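(* Let $q\in AM$, let $S=S(\varepsilon)$ be the operator in the Sobolev space $\mathring W^1_2[-1,1]$ associated with the Orr--Sommerfeld problem $$ (D^2-\alpha^2)^2y-i\alpha R\left[q(x)(D^2-\alpha^2)-q''(x)\right]y=-i\alpha R\lambda(D^2-\alpha^2)y,\qquad y(\pm1)=y'(\pm1)=0,\qquad \varepsilon=(\alpha R)^{-1/2}, $$ and let $\Omega$ be the domain bounded by the curves $\gamma_+$, $\gamma_-$ and the segment $[a,b]$. Then for every compact set $K\subset\Omega$ there are numbers $\tau>0$ and $\varepsilon_0>0$ such that $$\|(S-\lambda)^{-1}\|\ge e^{\tau/\varepsilon}\qquad\text{for all }\lambda\in K\text{ and }0<\varepsilon<\varepsilon_0,$$ the norm being the operator norm in $\mathring W^1_2[-1,1]$. In particular, the Riesz constant $C(\varepsilon)$ of the system of normed eigenfunctions of $S(\varepsilon)$ in $\mathring W^1_2[-1,1]$ grows exponentially: there is a number $\eta>0$ such that $C(\varepsilon)\ge e^{\eta/\varepsilon}$ (for all sufficiently small $\varepsilon$).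
   Context: Here $D=d/dx$ in the Orr--Sommerfeld equation, $x\in[-1,1]$, $\alpha$ is a fixed wave number and $R$ the Reynolds number with $\alpha R>0$, $\varepsilon>0$, and $\lambda$ is the spectral parameter. Class $AM$: a real-valued function $q$ on $[-1,1]$ belongs to $AM$ if $q$ is analytic on $[-1,1]$ and admits an analytic continuation to a domain $G\subset\mathbb C$ (containing $[-1,1]$) such that $q(G)$ contains the semistrip $\Pi=\{\lambda\in\mathbb C: a<\operatorname{Re}\lambda<b,\ \operatorname{Im}\lambda<0\}$, where $a=q(-1)$, $b=q(1)$; moreover, with $\mathcal D=q^{-1}(\Pi)\subset G$, $q$ is continuous on the closure $\overline{\mathcal D}$ and the map $q:\overline{\mathcal D}\to\overline\Pi$ is one-to-one (and onto). For $\lambda\in\overline\Pi$ let $\xi_\lambda\in\overline{\mathcal D}$ be the root of $q(\xi)-\lambda=0$, and put $Q^\pm(\lambda)=\int_{\xi_\lambda}^{\pm1}\sqrt{i(q(\xi)-\lambda)}\,d\xi$, where for $\lambda\in\Pi$ the root with positive imaginary part is taken and the path lies in $\overline{\mathcal D}$ and meets $q^{-1}(\{\lambda-it:t\ge0\})$ only at $\xi_\lambda$; values on the boundary of $\Pi$ are obtained by continuity. $Q^\pm$ are analytic in $\Pi$ and continuous in $\overline\Pi$. For $q\in AM$ the curves $\tilde\gamma_\pm=\{\lambda\in\Pi:\operatorname{Re}Q^\pm(\lambda)=0\}$ have a unique intersection point $\lambda_0\in\Pi$; $\gamma_+$ is the part of $\tilde\gamma_+$ connecting $\lambda_0$ with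 $b$, and $\gamma_-$ is the part of $\tilde\gamma_-$ connecting $\lambda_0$ with $a$. The operator $S$: $\mathring W^1_2[-1,1]$ is the Sobolev space of functions in $W^1_2[-1,1]$ vanishing at $\pm1$, with its usual scalar product. $S$ has domain $\{y\in W_2^3[-1,1]: y(\pm1)=y'(\pm1)=0\}$ and $$Sy=(D^2-\alpha^2)^{-1}\left[i\varepsilon^2(D^2-\alpha^2)^2y+q(D^2-\alpha^2)y-q''y\right],$$ where $(D^2-\alpha^2)^{-1}:W_2^{-1}[-1,1]\to\mathring W_2^1[-1,1]$ is the inverse of $D^2-\alpha^2$ with Dirichlet conditions; thus $Sy=\lambda y$ is equivalent to the Orr--Sommerfeld problem. We set $\|(S-\lambda)^{-1}\|=\infty$ if $\lambda$ is in the spectrum. Riesz constant: let $y_k$, $k\ge1$, be the eigenfunctions of $S(\varepsilon)$ normed to have norm $1$ in $\mathring W_2^1[-1,1]$ (it is assumed for simplicity that there are no associated functions for the values of $\varepsilon$ considered, and that $\{y_k\}$ is a Riesz basis, so that the operator below is bounded and boundedly invertible). Let $T$ be the operator in $\ell_2$ generated by the Gram matrix $\{(y_k,y_j)\}_{k,j=1}^\infty$, the scalar product being that of $\mathring W^1_2[-1,1]$, and $C(\varepsilon)=\|T\|\cdot\|T^{-1}\|$. *)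

(* Defs.v *)
(* The complex numbers are [R[i]] over an arbitrary
   [R : realType]; [R[i]^o] is the same type seen as a normed module over
   itself, which is what carries its topology. *)
From HB Require Import structures.
From mathcomp Require Import all_boot all_order all_algebra.
From mathcomp Require Import all_classical all_reals all_analysis.
Import Order.TTheory GRing.Theory Num.Theory.
Import numFieldNormedType.Exports.
From mathcomp Require Import complex.

Set Implicit Arguments.
Unset Strict Implicit.
Unset Printing Implicit Defensive.

Local Open Scope classical_set_scope.
Local Open Scope ring_scope.

Definition cintegral (R : realType) (A : set R) (f : R -> R[i]) : R[i] :=
  Complex (\int[lebesgue_measure]_(x in A) Re (f x))
          (\int[lebesgue_measure]_(x in A) Im (f x)).

Definition iC (R : realType) : R[i] := Complex 0 1.

Section AM.
Variable R : realType.
Notation C := (R[i]^o).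
Implicit Types (q : R -> R) (G K : set C) (qC : C -> C) (s e lambda z : C).

Definition semistrip (a b : R) : set C :=
  [set z | a < Re z < b /\ Im z < 0].

Definition Pi_of q : set C := semistrip (q (-1)) (q 1).

Definition D_of q G qC : set C := G `&` qC @^-1` Pi_of q.

(* [qC] is the analytic continuation of [q] to [G]; at the points of the closure
   of [D_of q G qC] that lie outside [G], [qC] takes the values of its
   extension by continuity.  Its values elsewhere are irrelevant.
   A semistrip is nonempty, hence [AM_lt]. *)
Record AM_continuation q G qC : Prop := {
  AM_open : open G;
  AM_connected : connected G;
  AM_itv : forall x : R, -1 <= x <= 1 -> G (x%:C)%C;
  AM_holomorphic : forall z, G z -> derivable qC z 1;
  AM_extends : forall x : R, -1 <= x <= 1 -> qC (x%:C)%C = ((q x)%:C)%C;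
  AM_lt : q (-1) < q 1;
  AM_range : Pi_of q `<=` qC @` G;
  AM_continuous : {within closure (D_of q G qC), continuous qC};
  AM_bij : set_bij (closure (D_of q G qC)) (closure (Pi_of q)) qC
}.

(* [g] is a C^1 path on [0, 1] with derivative [g1]. *)
Definition C1_path (g g1 : R -> C) : Prop :=
  {within `[0, 1], continuous g1} /\
  forall t : R, 0 <= t <= 1 -> g t = g 0 + cintegral `[0, t] g1.

(* Paths from the root xi_lambda to [s] in the closure of [D_of q G qC] that
   meet the preimage of the half-line below [lambda] only at xi_lambda. *)
Definition Q_path q G qC s lambda (g g1 : R -> C) : Prop :=
  [/\ C1_path g g1,
      (forall t : R, 0 <= t <= 1 -> closure (D_of q G qC) (g t)),
      qC (g 0) = lambda,
      g 1 = s &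
      forall t r : R, 0 <= t <= 1 -> 0 <= r ->
        qC (g t) = lambda - iC R * (r%:C)%C -> g t = g 0].

(* [Qfun _ _ _ 1] and [Qfun _ _ _ (-1)] are Q^+ and Q^-.  [sqrtC] is the root
   with nonnegative imaginary part; on an admissible path minus its origin,
   i(q - lambda) avoids the nonnegative half-axis, so that the imaginary part is
   positive there.  The integral does not depend on the path, which [xget]
   selects. *)
Definition Qfun q G qC s lambda : C :=
  xget 0 [set v | exists g g1 : R -> C, Q_path q G qC s lambda g g1 /\
    v = cintegral `[0, 1] (fun t => sqrtC (iC R * (qC (g t) - lambda)) * g1 t)].

Definition gamma_tilde q G qC s : set C :=
  [set lambda | Pi_of q lambda /\ Re (Qfun q G qC s lambda) = 0].

(* The unique common point of the two curves. *)
Definition lambda0 q G qC : C :=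
  xget 0 (gamma_tilde q G qC 1 `&` gamma_tilde q G qC (-1)).

(* The part of [gamma_tilde q G qC s] connecting [lambda0] with the boundary
   point [e] of the semistrip; it contains both endpoints. *)
Definition gamma_arc q G qC s e : set C :=
  [set z | exists g : R -> C,
    [/\ {within `[0, 1], continuous g},
        {in `[0, 1] &, injective g},
        g 0 = lambda0 q G qC, g 1 = e &
        forall t : R, 0 <= t < 1 -> gamma_tilde q G qC s (g t)] /\
    exists2 t : R, 0 <= t <= 1 & z = g t].

Definition gamma_plus q G qC : set C := gamma_arc q G qC 1 ((q 1)%:C)%C.
Definition gamma_minus q G qC : set C := gamma_arc q G qC (-1) ((q (-1))%:C)%C.

Definition Omega_boundary q G qC : set C :=
  gamma_plus q G qC `|` gamma_minus q G qC `|`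
  [set (x%:C)%C | x in [set x : R | q (-1) <= x <= q 1]].

(* The domain bounded by a closed curve: the points of its complement whose
   connected component in the complement is bounded. *)
Definition Omega q G qC : set C :=
  [set z | (~` Omega_boundary q G qC) z /\
     bounded_set (connected_component (~` Omega_boundary q G qC) z)].

End AM.

(* A function on [-1, 1] is represented by any total function with the given
   values on [-1, 1]; nothing below depends on the values outside [-1, 1]. *)

Section OrrSommerfeld.
Variable R : realType.
Notation C := (R[i]^o).
Implicit Types (f g y w u phi : R -> C) (q : R -> R) (lambda : C)
  (alpha eps : R).

Definition eq_itv f g : Prop := forall x : R, -1 <= x <= 1 -> f x = g x.

Definition L2 f : Prop :=
  [/\ measurable_fun (`[-1, 1] : set R) (fun x => Re (f x)),
      measurable_fun (`[-1, 1] : set R) (fun x => Im (f x)) &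
      (\int[lebesgue_measure]_(x in `[(-1)%R, 1%R])
         ((Re (f x)) ^+ 2 + (Im (f x)) ^+ 2)%:E < +oo)%E].

(* [f] is absolutely continuous on [-1, 1] and [f' = g] a.e., with [g] in L^2. *)
Definition has_deriv f g : Prop :=
  L2 g /\ forall x : R, -1 <= x <= 1 -> f x = f (-1) + cintegral `[-1, x] g.

Definition W1 f : Prop := exists g, has_deriv f g.

Definition H10 f : Prop := [/\ W1 f, f (-1) = 0 & f 1 = 0].

(* A representative of the derivative, an element of L^2; to be used under
   integrals only. *)
Definition deriv_L2 f : R -> C := xget (fun=> 0) [set g | has_deriv f g].

Definition W1_inner f g : C :=
  cintegral `[-1, 1] (fun x => deriv_L2 f x * (deriv_L2 g x)^*%C)
  + cintegral `[-1, 1] (fun x => f x * (g x)^*%C).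

Definition W1_norm f : R := Num.sqrt (Re (W1_inner f f)).

(* For [u] in W^1_2, the value at [phi] of (D^2 - alpha^2) u, an element of
   W^{-1}_2, which is identified with the space of bounded linear functionals
   on H10: the pairing is (bilinear) integration, and D is moved to [phi]. *)
Definition helmholtz alpha u phi : C :=
  - cintegral `[-1, 1] (fun x => deriv_L2 u x * deriv_L2 phi x)
  - ((alpha ^+ 2)%:C)%C * cintegral `[-1, 1] (fun x => u x * phi x).

(* The graph of S.  [y1] and [y2] are the continuous representatives of y' and
   y''; y is in W^3_2 because y'' is in W^1_2; [u] is (D^2 - alpha^2) y.  The
   last condition reads
     (D^2 - alpha^2) w = i eps^2 (D^2 - alpha^2) u + q u - q'' y  in W^{-1}_2.
   The values of q'' at the points -1 and 1 do not matter under the integral. *)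
Definition OS_graph q alpha eps y w : Prop :=
  exists y1 y2 : R -> C,
    let u : R -> C := fun x => y2 x - ((alpha ^+ 2)%:C)%C * y x in
    [/\ has_deriv y y1, has_deriv y1 y2 & W1 y2] /\
    [/\ y (-1) = 0, y 1 = 0, y1 (-1) = 0 & y1 1 = 0] /\
    H10 w /\
    forall phi, H10 phi ->
      helmholtz alpha w phi
      = iC R * ((eps ^+ 2)%:C)%C * helmholtz alpha u phi
        + cintegral `[-1, 1] (fun x =>
            (((q x)%:C)%C * u x - ((derive1n 2 q x)%:C)%C * y x) * phi x).

Definition OS_shift q alpha eps lambda y f : Prop :=
  exists2 w, OS_graph q alpha eps y w & eq_itv f (fun x => w x - lambda * y x).

Definition OS_resolvent_set q alpha eps : set C :=
  [set lambda |
    [/\ forall f, H10 f -> exists y, OS_shift q alpha eps lambda y f,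
        forall y, OS_shift q alpha eps lambda y (fun=> 0) -> eq_itv y (fun=> 0) &
        exists M : R, forall y f, OS_shift q alpha eps lambda y f ->
          W1_norm y <= M * W1_norm f]].

(* The norm of a linear operator given by its graph [A]. *)
Definition graph_norm (X Y : Type) (nX : X -> R) (nY : Y -> R)
    (A : X -> Y -> Prop) : \bar R :=
  ereal_sup [set r | exists (a : X) (b : Y), [/\ A a b, nX a <= 1 & r = (nY b)%:E]].

Definition OS_resolvent_norm q alpha eps lambda : \bar R :=
  if `[< OS_resolvent_set q alpha eps lambda >] then
    graph_norm W1_norm W1_norm (fun f y => OS_shift q alpha eps lambda y f)
  else +oo%E.

Definition OS_eigenfunction q alpha eps lambda y : Prop :=
  OS_shift q alpha eps lambda y (fun=> 0) /\ ~ eq_itv y (fun=> 0).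

Definition OS_no_associated q alpha eps : Prop :=
  forall lambda y0 y1, OS_eigenfunction q alpha eps lambda y0 ->
    ~ OS_shift q alpha eps lambda y1 y0.

Implicit Types (Y : nat -> R -> C) (c d : nat -> C).

Definition normed_eigenfunctions q alpha eps Y : Prop :=
  forall k, (exists lambda, OS_eigenfunction q alpha eps lambda (Y k))
            /\ W1_norm (Y k) = 1.

Definition lin_comb Y (n : nat) c : R -> C := fun x => \sum_(k < n) c k * Y k x.

Definition sqmod (z : C) : R := (Re z) ^+ 2 + (Im z) ^+ 2.

Definition Riesz_basis Y : Prop :=
  [/\ forall k, H10 (Y k),
      forall f, H10 f -> forall e : R, 0 < e -> exists n c,
        W1_norm (fun x => f x - lin_comb Y n c x) < e &
      exists m M : R, 0 < m /\ forall n c,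
        m * (\sum_(k < n) sqmod (c k)) <= W1_norm (lin_comb Y n c) ^+ 2
          <= M * (\sum_(k < n) sqmod (c k))].

Definition l2_sqnorm c : \bar R := (\sum_(0 <= k <oo) (sqmod (c k))%:E)%E.

Definition l2 c : Prop := (l2_sqnorm c < +oo)%E.

Definition l2_norm c : R := Num.sqrt (fine (l2_sqnorm c)).

(* The graph of the operator in l_2 with matrix ((y_k, y_j))_{k, j}. *)
Definition gram_graph Y c d : Prop :=
  [/\ l2 c, l2 d &
      forall k, series (fun j => W1_inner (Y k) (Y j) * c j : C) @ \oo --> d k].

Definition Riesz_constant Y : \bar R :=
  (graph_norm l2_norm l2_norm (gram_graph Y)
   * graph_norm l2_norm l2_norm (fun d c => gram_graph Y c d))%E.

End OrrSommerfeld.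

(* Main.v *)
(* For lambda in the semistrip let x0 be the real point with q(x0) = Re lambda
   and q'(x0) > 0, and let s^2 = - Im lambda.  Near x0 the root of i(q - lambda)
   is close to i s + p (x - x0) with p > 0, so the equation for
   u = (D^2 - alpha^2) y has a solution behaving like
   exp(- (i s (x - x0) + p (x - x0)^2 / 2) / eps), which is exponentially small
   at a fixed distance from x0.  It is obtained as an exact holomorphic solution
   started at x0 - i h on the dominant branch: along the segments from there to
   the real axis u grows, and the small quantities eps u' + (i s + p (x - x0)) u,
   y and y' + eps u / (i s) stay in a cone around u.  Cut off, it is a quasimode
   for all lambda near a given point, whence the bound on the resolvent.

   If C(eps) were not exponentially large, expanding the quasimodes in
   eigenfunctions would put an eigenvalue exponentially close to every point of
   a fixed disc, hence exponentially many eigenvalues into a bounded set.  But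
   the energy identity bounds an eigenfunction expansion pointwise by a power
   of 1 / eps, so the number of these eigenvalues, each contributing one to the
   integrated Bessel inequality, is at most a power of 1 / eps times the norms
   of the Gram operator and its inverse. *)

Require Import Defs.
From mathcomp Require Import all_boot all_order all_algebra.
From mathcomp Require Import all_classical all_reals all_analysis.
Import Order.TTheory GRing.Theory Num.Theory.
Import numFieldNormedType.Exports.
From mathcomp Require Import complex.
From mathcomp Require Import zify ring lra measurable_realfun.
Import ComplexField.Normc.

Set Implicit Arguments.
Unset Strict Implicit.
Unset Printing Implicit Defensive.

Local Open Scope classical_set_scope.
Local Open Scope ring_scope.
Local Open Scope complex_scope.

(* [AM_continuation] hypotheses are section variables, which [lra] cannot
   reify once they are cleared. *)
Ltac flra :=
  repeat match goal with
  | H : ?T |- _ => lazymatch T with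
    | is_true (Order.le _ _) => fail | is_true (Order.lt _ _) => fail
    | _ = _ => fail | AM_continuation _ _ _ => fail
    | _ => lazymatch type of T with Prop => clear H end
    end
  | x := _ |- _ => clearbody x
  end; lra.

Arguments normc : simpl never.

(** Along the real axis the wanted solution decays on both sides of x0, so that an initial value
    problem started at x0 would be swamped by the growing solutions; this forces the detour below
    the axis and with it holomorphic coefficients. Since only complex differentiability is given,
    Goursat's theorem, Cauchy expansions and power series solutions are derived with explicit
    estimates. That q'(x0) > 0 comes from univalence: at a multiple root of q = Re lambda,
    neighbouring real values would be taken at several points of the closure of D. The error of the
    approximate root is of order h^2, the Gaussian slope of order h; this fixes a small h, and
    lambda may then vary by h^2. In the second part S is unbounded, so that approximating a
    quasimode y by eigenfunctions does not control S y; (S - iN) y is expanded instead, and the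
    resolvent at iN, bounded uniformly in eps, carries the error back to y. With P the product of
    the two Gram norms, the count becomes exp(tau/eps) <= const P^3 eps^-4: half of tau absorbs the
    powers of eps and the cube root leaves tau/6. *)

Section ComplexBasics.
Variable R : realType.
Implicit Types (z w : R[i]) (x y : R).

Lemma normc_ge0 z : 0 <= normc z.
Proof. by case: z => a b; exact: sqrtr_ge0. Qed.

Lemma normc_eq0 z : (normc z == 0) = (z == 0).
Proof. by apply/eqP/eqP => [/eq0_normc|->] //; exact: normc0. Qed.

Lemma normc_gt0 z : (0 < normc z) = (z != 0).
Proof. by rewrite lt_def normc_ge0 andbT normc_eq0. Qed.

Lemma normcr x : normc x%:C = `|x|.
Proof. by rewrite /normc /= expr0n addr0 sqrtr_sqr. Qed.

Lemma normc_normr z : `|z| = (normc z)%:C.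
Proof. by case: z. Qed.

Lemma normcB z w : normc (z - w) <= normc z + normc w.
Proof. by rewrite (le_trans (le_normcD _ _))// normcN. Qed.

Lemma normcBC z w : normc (z - w) = normc (w - z).
Proof. by rewrite -normcN opprB. Qed.

Lemma normcX z n : normc (z ^+ n) = normc z ^+ n.
Proof. by elim: n => [|n ih]; rewrite ?expr0 ?normc1// !exprS normcM ih. Qed.

Lemma normc_Re z : `|Re z| <= normc z.
Proof.
case: z => a b; rewrite /normc /= -sqrtr_sqr ler_sqrt ?addr_ge0 ?sqr_ge0//.
by rewrite lerDl sqr_ge0.
Qed.

Lemma normc_Im z : `|Im z| <= normc z.
Proof.
case: z => a b; rewrite /normc /= -sqrtr_sqr ler_sqrt ?addr_ge0 ?sqr_ge0//.
by rewrite lerDr sqr_ge0.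
Qed.

Lemma normc_conj z : normc z^* = normc z.
Proof. by case: z => a b; rewrite /normc /= sqrrN. Qed.

Lemma sqr_normcE z : normc z ^+ 2 = Re z ^+ 2 + Im z ^+ 2.
Proof. by case: z => a b; rewrite /normc sqr_sqrtr// addr_ge0 ?sqr_ge0. Qed.

Lemma sqmod_normc z : sqmod z = normc z ^+ 2.
Proof. by rewrite sqr_normcE. Qed.

Lemma mulc_conj z : z * z^* = (normc z ^+ 2)%:C.
Proof. by rewrite sqr_normcE; case: z => a b /=; simpc; congr Complex; ring. Qed.

Lemma ReD z w : Re (z + w) = Re z + Re w.
Proof. by case: z w => [a b] [c d]. Qed.
Lemma ImD z w : Im (z + w) = Im z + Im w.
Proof. by case: z w => [a b] [c d]. Qed.
Lemma ReN z : Re (- z) = - Re z. Proof. by case: z. Qed.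
Lemma ImN z : Im (- z) = - Im z. Proof. by case: z. Qed.
Lemma ReB z w : Re (z - w) = Re z - Re w. Proof. by rewrite ReD ReN. Qed.
Lemma ImB z w : Im (z - w) = Im z - Im w. Proof. by rewrite ImD ImN. Qed.
Lemma ReM z w : Re (z * w) = Re z * Re w - Im z * Im w.
Proof. by case: z w => [a b] [c d]. Qed.
Lemma ImM z w : Im (z * w) = Re z * Im w + Im z * Re w.
Proof. by case: z w => [a b] [c d]. Qed.
Lemma ReJ z : Re (z^*) = Re z. Proof. by case: z. Qed.
Lemma ImJ z : Im (z^*) = - Im z. Proof. by case: z. Qed.

Definition ReImE := (ReB, ImB, ReD, ImD, ReN, ImN, ReM, ImM, ReJ, ImJ).

Lemma normc_leReIm z : normc z <= `|Re z| + `|Im z|.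
Proof.
case: z => a b; have -> : Complex a b = a%:C + 'i * b%:C by simpc.
apply: (le_trans (le_normcD _ _)); rewrite normcM !normcr.
have -> : normc 'i = 1 :> R by rewrite /normc expr0n expr1n add0r sqrtr1.
by rewrite !ReImE /= !(mul1r, mulr0, mul0r, subr0, addr0, add0r).
Qed.

Lemma complexP z w : Re z = Re w -> Im z = Im w -> z = w.
Proof. by case: z w => [a b] [c d] /= -> ->. Qed.

Lemma Re_mul_le z w : Re (z * w) <= normc z * normc w.
Proof. by rewrite -normcM (le_trans (ler_norm _))// normc_Re. Qed.

Lemma normc_lin z w v : normc (z + w + v) <= normc z + normc w + normc v.
Proof. by rewrite (le_trans (le_normcD _ _))// lerD2r le_normcD. Qed.

End ComplexBasics.

Ltac pos := solve [repeat first [ assumption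
  | match goal with
    | |- is_true (0 < _ * _) => apply: mulr_gt0
    | |- is_true (0 < _^-1) => rewrite invr_gt0
    | |- is_true (0 < _ ^+ _) => apply: exprn_gt0
    | |- is_true (0 < expR _) => exact: expR_gt0
    | |- is_true (0 < 1) => exact: ltr01
    | |- is_true (0 < _ *+ _) => exact: ltr0n
    | |- is_true (0 < _ + _) =>
        first [solve [apply: ltr_wpDl; pos] | solve [apply: ltr_pwDl; pos]]
    | |- is_true (0 <= normc _) => exact: normc_ge0
    | |- is_true (0 <= `|_|) => exact: normr_ge0
    | |- is_true (0 <= _ * _) => apply: mulr_ge0
    | |- is_true (0 <= _^-1) => rewrite invr_ge0
    | |- is_true (0 <= _ ^+ 2) => exact: sqr_ge0
    | |- is_true (0 <= _ ^+ _) => apply: exprn_ge0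
    | |- is_true (0 <= expR _) => exact: expR_ge0
    | |- is_true (0 <= 1) => exact: ler01
    | |- is_true (0 <= _ *+ _) => exact: ler0n
    | |- is_true (0 <= _ + _) =>
        first [apply: ltW; assumption | apply: addr_ge0]
    | |- is_true (0 <= _) => apply: ltW
    end
  | done ]].

(* A common frame for complex derivatives ([iota] the identity) and for
   derivatives of complex-valued functions of a real variable ([iota] the
   inclusion of the reals). *)
Section Deriv.
Variables (R : realType) (X : zmodType) (iota : X -> R[i]).
Implicit Types (f g : X -> R[i]) (x : X) (l m : R[i]).

(** The remainder is compared with [normc (iota w)] instead of being divided by it: [w = 0] needs no
    exception, and the calculus rules are proved once for complex and for real arguments. *)
Definition hasD f x l := forall e : R, 0 < e -> exists2 d : R, 0 < d &
  forall w : X, normc (iota w) < d ->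
  normc (f (x + w) - f x - l * iota w) <= e * normc (iota w).

Lemma hasD_eq f x l m : hasD f x l -> l = m -> hasD f x m.
Proof. by move=> h <-. Qed.

Lemma hasD_near f g x l (d : R) : 0 < d -> f x = g x ->
  (forall w, normc (iota w) < d -> f (x + w) = g (x + w)) ->
  hasD f x l -> hasD g x l.
Proof.
move=> d0 fgx fg h e e0; have [d1 d10 h1] := h _ e0.
exists (Num.min d d1); first by rewrite lt_min d0.
by move=> w; rewrite lt_min => /andP[wd wd1]; rewrite -fg// -fgx h1.
Qed.

Lemma hasD_ext f g x l : f =1 g -> hasD f x l -> hasD g x l.
Proof. by move=> fg h; apply: (hasD_near (@ltr01 R) _ _ h) => // w _. Qed.

Lemma hasD_cst (c : R[i]) x : hasD (fun=> c) x 0.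
Proof.
move=> e e0; exists 1 => // w _.
by rewrite subrr sub0r mul0r oppr0 normc0 mulr_ge0 ?normc_ge0// ltW.
Qed.

Lemma hasDD f g x l m : hasD f x l -> hasD g x m ->
  hasD (fun y => f y + g y) x (l + m).
Proof.
move=> hf hg e e0; have e20 : 0 < e / 2 by rewrite divr_gt0.
have [d d0 {}hf] := hf _ e20; have [d' d'0 {}hg] := hg _ e20.
exists (Num.min d d'); first by rewrite lt_min d0.
move=> w; rewrite lt_min => /andP[/hf {}hf /hg {}hg].
have -> : f (x + w) + g (x + w) - (f x + g x) - (l + m) * iota w =
  (f (x + w) - f x - l * iota w) + (g (x + w) - g x - m * iota w) by ring.
by apply: (le_trans (le_normcD _ _)); rewrite [e]splitr mulrDl lerD.
Qed.

Lemma hasDZ (c : R[i]) f x l : hasD f x l -> hasD (fun y => c * f y) x (c * l).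
Proof.
move=> hf e e0; have c0 : 0 < normc c + 1 by rewrite ltr_wpDl ?normc_ge0.
have [d d0 {}hf] := hf _ (divr_gt0 e0 c0); exists d => // w /hf {}hf.
have -> : c * f (x + w) - c * f x - c * l * iota w =
  c * (f (x + w) - f x - l * iota w) by ring.
rewrite normcM; apply: (@le_trans _ _ (normc c * (e / (normc c + 1) * normc (iota w)))).
  by rewrite ler_wpM2l ?normc_ge0.
rewrite mulrA ler_wpM2r ?normc_ge0// mulrCA ger_pMr//.
by rewrite ler_pdivrMr// mul1r lerDl.
Qed.

Lemma hasDN f x l : hasD f x l -> hasD (fun y => - f y) x (- l).
Proof.
move=> /(hasDZ (-1)); rewrite mulN1r; apply: hasD_ext => y; exact: mulN1r.
Qed.

Lemma hasDB f g x l m : hasD f x l -> hasD g x m ->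
  hasD (fun y => f y - g y) x (l - m).
Proof. by move=> hf hg; apply: hasDD => //; exact: hasDN. Qed.

Lemma hasD_lip f x l : hasD f x l -> exists2 d : R, 0 < d &
  forall w : X, normc (iota w) < d ->
  normc (f (x + w) - f x) <= (normc l + 1) * normc (iota w).
Proof.
move=> /(_ 1 ltr01)[d d0 h]; exists d => // w /h {}h.
rewrite -[_ - _](subrK (l * iota w)) (le_trans (le_normcD _ _))//.
by rewrite normcM mulrDl addrC lerD2l.
Qed.

Lemma hasD_cont f x l : hasD f x l -> forall e : R, 0 < e ->
  exists2 d : R, 0 < d & forall w : X, normc (iota w) < d ->
  normc (f (x + w) - f x) < e.
Proof.
move=> /hasD_lip[d d0 h] e e0; have c0 : 0 < normc l + 1 by rewrite ltr_wpDl ?normc_ge0.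
exists (Num.min d (e / (normc l + 1))); first by rewrite lt_min d0 divr_gt0.
move=> w; rewrite lt_min => /andP[/h {}h]; rewrite ltr_pdivlMr// => we.
by rewrite (le_lt_trans h)// mulrC.
Qed.

Lemma hasDM f g x l m : hasD f x l -> hasD g x m ->
  hasD (fun y => f y * g y) x (l * g x + f x * m).
Proof.
move=> hf hg e e0.
set A := normc (g x) + 1; set B := normc (f x) + 1; set L := normc l + 1.
have A0 : 0 < A by rewrite ltr_wpDl ?normc_ge0.
have B0 : 0 < B by rewrite ltr_wpDl ?normc_ge0.
have L0 : 0 < L by rewrite ltr_wpDl ?normc_ge0.
have [d1 d10 h1] := hf _ (divr_gt0 e0 (mulr_gt0 (ltr0Sn R 2) A0)).
have [d2 d20 h2] := hg _ (divr_gt0 e0 (mulr_gt0 (ltr0Sn R 2) B0)).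
have [d3 d30 h3] := hasD_lip hf.
have [d4 d40 h4] := hasD_cont hg (divr_gt0 e0 (mulr_gt0 (ltr0Sn R 2) L0)).
exists (Num.min (Num.min d1 d2) (Num.min d3 d4)).
  by rewrite !lt_min d10 d20 d30.
move=> w; rewrite !lt_min => /andP[/andP[/h1 {}h1 /h2 {}h2] /andP[/h3 {}h3 /h4 {}h4]].
have -> : f (x + w) * g (x + w) - f x * g x - (l * g x + f x * m) * iota w =
  (f (x + w) - f x - l * iota w) * g x + f x * (g (x + w) - g x - m * iota w)
  + (f (x + w) - f x) * (g (x + w) - g x) by ring.
set W := normc (iota w) in h1 h2 h3 h4 *.
have W0 : 0 <= W by exact: normc_ge0.
apply: (le_trans (normc_lin _ _ _)); rewrite !normcM.
have -> : e * W = e / (3 * A) * W * A + B * (e / (3 * B) * W) + L * W * (e / (3 * L)).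
  by field; rewrite ?gt_eqF.
rewrite lerD ?lerD//.
- by rewrite ler_pM ?normc_ge0// lerDl.
- by rewrite ler_pM ?normc_ge0// lerDl.
- by rewrite ler_pM ?normc_ge0// ltW.
Qed.

End Deriv.

Notation cD := (@hasD _ _ (@id _)).
Notation rD := (@hasD _ _ (fun x => x%:C)).

Section DerivChain.
Variable R : realType.
Implicit Types (f g : R[i] -> R[i]) (h k : R -> R[i]) (z : R[i]) (t : R).

Lemma cD_id z : cD (fun y => y) z 1.
Proof.
move=> e e0; exists 1 => // w _.
have -> : z + w - z - 1 * w = 0 by ring.
by rewrite normc0 mulr_ge0 ?normc_ge0// ltW.
Qed.

Lemma rD_id t : rD (fun y => y%:C) t 1.
Proof.
move=> e e0; exists 1 => // w _; rewrite mul1r -!rmorphB /=.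
have -> : t + w - t - w = 0 by ring.
by rewrite normc0 mulr_ge0 ?normc_ge0// ltW.
Qed.

Lemma cDX n z : cD (fun y => y ^+ n) z (n%:R * z ^+ n.-1).
Proof.
elim: n => [|n ih]; first by rewrite mul0r; exact: hasD_cst.
apply: (@hasD_ext _ _ _ (fun y => y * y ^+ n)); first by move=> y; rewrite exprS.
apply: (hasD_eq (hasDM (cD_id z) ih)) => /=.
by case: n ih => [|n] _ /=; rewrite ?expr0 ?exprS -?natr1; ring.
Qed.

(** The outer function is always complex differentiable; with [iota] the inclusion of the reals this
    differentiates a holomorphic function along a curve. *)
Lemma hasD_comp (X : zmodType) (iota : X -> R[i]) f (h : X -> R[i]) (t : X) l m :
  hasD iota h t m -> cD f (h t) l ->
  hasD iota (fun y => f (h y)) t (l * m).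
Proof.
move=> hh hf e e0.
set L := normc l + 1; set M := normc m + 1.
have L0 : 0 < L by rewrite ltr_wpDl ?normc_ge0.
have M0 : 0 < M by rewrite ltr_wpDl ?normc_ge0.
have [d1 d10 h1] := hf _ (divr_gt0 e0 (mulr_gt0 (ltr0Sn R 1) M0)).
have [d2 d20 h2] := hh _ (divr_gt0 e0 (mulr_gt0 (ltr0Sn R 1) L0)).
have [d3 d30 h3] := hasD_lip hh.
have [d4 d40 h4] := hasD_cont hh d10.
exists (Num.min d2 (Num.min d3 d4)); first by rewrite !lt_min d20 d30.
move=> w; rewrite !lt_min => /andP[/h2 {}h2 /andP[/h3 {}h3 /h4 /h1]].
rewrite (addrC (h t)) subrK => {}h1.
have -> : f (h (t + w)) - f (h t) - l * m * iota w =
  (f (h (t + w)) - f (h t) - l * (h (t + w) - h t)) +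
  l * (h (t + w) - h t - m * iota w) by ring.
set W := normc (iota w) in h1 h2 h3 *.
have W0 : 0 <= W by exact: normc_ge0.
apply: (le_trans (le_normcD _ _)); rewrite normcM.
have -> : e * W = e / (2 * M) * (M * W) + L * (e / (2 * L) * W).
  by field; rewrite ?gt_eqF.
rewrite lerD//.
- rewrite (le_trans h1)// ler_wpM2l//; first by rewrite divr_ge0 ?mulr_ge0 ?ltW.
- by rewrite ler_pM ?normc_ge0// lerDl.
Qed.

Lemma rD_line (a b : R[i]) t : rD (fun s => a + s%:C * b) t b.
Proof.
have := hasDD (hasD_cst (fun x : R => x%:C) a t) (hasDZ b (rD_id t)).
rewrite add0r mulr1; apply: hasD_ext => y; by rewrite mulrC.
Qed.

Lemma rD_re h t l : rD h t l -> is_derive t 1 (fun x => Re (h x)) (Re l).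
Proof.
move=> hh.
have key : (fun s : R => s^-1 *: (((fun x => Re (h x)) \o shift t) (s *: 1) - Re (h t)))
    @ 0^' --> Re l.
  apply/cvgrPdist_le => e e0; have [d d0 {}hh] := hh _ e0.
  exists d => //= s; rewrite /ball_ /= sub0r normrN => sd s0.
  have := hh s; rewrite normcr => /(_ sd).
  move=> /(le_trans (normc_Re _)); rewrite !ReImE /= mulr0 subr0 => {}hh.
  rewrite -(ler_pM2r (_ : 0 < `|s|)) ?normr_gt0//; apply: le_trans hh.
  rewrite -normrM -normrN le_eqVlt; apply/orP; left; apply/eqP; congr `|_|.
  rewrite [s *: 1]mulr1 [t + s]addrC /GRing.scale /=.
  by field.
by split; [apply/cvg_ex; exists (Re l)|apply: cvg_lim key].
Qed.

Lemma rD_i h t l : rD h t l -> rD (fun x => - 'i * h x) t (- 'i * l).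
Proof. exact: hasDZ. Qed.

Lemma rD_im h t l : rD h t l -> is_derive t 1 (fun x => Im (h x)) (Im l).
Proof.
move=> /rD_i/rD_re; have E z : Re (- 'i * z) = Im z by case: z => a b; simpc.
by under eq_fun do rewrite E; rewrite E.
Qed.

Lemma rD_pair (u v : R -> R) t du dv : is_derive t 1 u du -> is_derive t 1 v dv ->
  rD (fun x => Complex (u x) (v x)) t (Complex du dv).
Proof.
have key (f : R -> R) df : is_derive t 1 f df -> forall e : R, 0 < e ->
   exists2 d : R, 0 < d & forall s : R, `|s| < d -> `|f (t + s) - f t - df * s| <= e * `|s|.
  move=> [df1 <-] e e0; have := df1; rewrite /derivable => /cvgrPdist_le/(_ _ e0)[d /= d0 hd].
  exists d => // s sd; have [->|s0] := eqVneq s 0.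
    by rewrite addr0 subrr mulr0 subrr normr0 mulr0.
  have /= := hd s; rewrite /ball_ /= sub0r normrN => /(_ sd s0).
  rewrite -(ler_pM2r (_ : 0 < `|s|)) ?normr_gt0// -normrM; apply: le_trans.
  rewrite -normrN le_eqVlt; apply/orP; left; apply/eqP; congr `|_|.
  rewrite [s *: 1]mulr1 [t + s]addrC /GRing.scale /= /derive.
  by field.
move=> /key hu /key hv e e0; have e20 : 0 < e / 2 by rewrite divr_gt0.
have [d d0 {}hu] := hu _ e20; have [d' d'0 {}hv] := hv _ e20.
exists (Num.min d d'); first by rewrite lt_min d0.
move=> w; rewrite normcr lt_min => /andP[/hu {}hu /hv {}hv].
apply: (le_trans (normc_leReIm _)); rewrite !ReImE /= !mulr0 subr0 add0r.
by rewrite [e]splitr mulrDl lerD.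
Qed.

End DerivChain.

(** * Mean value inequalities and primitives of continuous curves *)

Section MeanValue.
Variable R : realType.
Implicit Types (a b t : R) (g : R -> R[i]).

Lemma is_derive_cont (f : R -> R) (x df : R) : is_derive x 1 f df -> {for x, continuous f}.
Proof. by move=> [h _]; apply/differentiable_continuous/derivable1_diffP. Qed.

Lemma mean_value (f df : R -> R) a b : a <= b ->
  (forall t, a <= t <= b -> is_derive t 1 f (df t)) ->
  exists2 c, a <= c <= b & f b - f a = df c * (b - a).
Proof.
move=> ab h; have [->|ne] := eqVneq a b.
  by exists b; rewrite ?lexx// !subrr mulr0.
have lab : a < b by rewrite lt_def eq_sym ne.
have [| |c] := @MVT _ f df a b lab.
- by move=> x /[!in_itv]/= /andP[/ltW ax /ltW xb]; apply: h; rewrite ax.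
- apply: derivable_within_continuous => x /[!in_itv]/= axb.
  by have [] := h _ axb.
- by rewrite in_itv/= => /andP[/ltW ac /ltW cb] ->; exists c; rewrite ?ac.
Qed.

Lemma mean_value_le (f df : R -> R) a b (M : R) : a <= b ->
  (forall t, a <= t <= b -> is_derive t 1 f (df t)) ->
  (forall t, a <= t <= b -> df t <= M) -> f b - f a <= M * (b - a).
Proof.
move=> ab /(mean_value ab)[c acb ->] h.
by rewrite ler_wpM2r ?subr_ge0// h.
Qed.

(** The mean value equality fails for complex values. With [D] the total increment, it is applied to
    the real function [Re (D^* * g t)], whose increment is [normc D ^+ 2]. *)
Lemma rD_mean_value g dg a b (M : R) : a <= b ->
  (forall t, a <= t <= b -> rD g t (dg t)) ->
  (forall t, a <= t <= b -> normc (dg t) <= M) ->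
  normc (g b - g a) <= M * (b - a).
Proof.
move=> ab hg hM; set D := g b - g a.
have M0 : 0 <= M by apply: le_trans (normc_ge0 _) (hM a _); rewrite lexx.
have [D0|D0] := eqVneq D 0; first by rewrite D0 normc0 mulr_ge0 ?subr_ge0.
have : Re (D^* * g b) - Re (D^* * g a) <= (normc D * M) * (b - a).
  apply: (@mean_value_le (fun t => Re (D^* * g t)) (fun t => Re (D^* * dg t))) => //.
    by move=> t /hg/(hasDZ D^*)/rD_re.
  move=> t /hM {}hM; apply: le_trans (Re_mul_le _ _) _.
  by rewrite normc_conj ler_wpM2l ?normc_ge0.
rewrite -ReB -mulrBr mulrC mulc_conj /= expr2 -mulrA ler_pM2l//.
by rewrite normc_gt0.
Qed.

Lemma rD_const g a b : a <= b -> (forall t, a <= t <= b -> rD g t 0) -> g b = g a.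
Proof.
move=> ab h; apply/eqP; rewrite -subr_eq0 -normc_eq0 eq_le normc_ge0 andbT.
rewrite -[leRHS](mul0r (b - a)).
by apply: (rD_mean_value ab h) => t _; rewrite normc0.
Qed.

Definition rcont g := forall t (e : R), 0 < e ->
  exists2 d, 0 < d & forall s, `|s| < d -> normc (g (t + s) - g t) < e.

Lemma rcont_re g : rcont g -> continuous (fun x => Re (g x)).
Proof.
move=> h t; apply/cvgrPdist_lt => e /h -/(_ t)[d d0 hd].
exists d => // s; rewrite /ball_/= -normrN opprB => ts.
rewrite -normrN opprB -ReB (le_lt_trans (normc_Re _))//.
by have := hd _ ts; rewrite (addrC t) subrK.
Qed.

Lemma rcont_im g : rcont g -> continuous (fun x => Im (g x)).
Proof.
move=> h t; apply/cvgrPdist_lt => e /h -/(_ t)[d d0 hd].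
exists d => // s; rewrite /ball_/= -normrN opprB => ts.
rewrite -normrN opprB -ImB (le_lt_trans (normc_Im _))//.
by have := hd _ ts; rewrite (addrC t) subrK.
Qed.

Lemma real_primitive (f : R -> R) a b : continuous f ->
  exists F : R -> R, forall t, a <= t <= b -> is_derive t 1 F (f t).
Proof.
(* Starting at [a - 1], and working up to [b + 1], makes [a] and [b] interior points, where the
   derivative is two-sided. *)
move=> cf; exists (fun x => \int[lebesgue_measure]_(t in `[a - 1, x]) f t).
move=> t /andP[at_ tb].
have [| | | |H1 H2] := @continuous_FTC1_closed R f (a - 1) t (b + 1).
- by rewrite ltr_pwDr// ltr01.
- apply: continuous_compact_integrable; first exact: segment_compact.
  exact: continuous_subspaceT.
- by rewrite ltrBlDr ltr_pwDr// ltr01.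
- exact: cf.
- move: H1 H2; move: (fun x => \int[_]_(_ in _) _) => F dF; rewrite derive1E => FE.
  exact: DeriveDef.
Qed.

Lemma curve_primitive g a b : rcont g ->
  exists G : R -> R[i], forall t, a <= t <= b -> rD G t (g t).
Proof.
move=> cg; have [F hF] := real_primitive a b (rcont_re cg).
have [H hH] := real_primitive a b (rcont_im cg).
exists (fun x => Complex (F x) (H x)) => t tab.
by apply: hasD_eq (rD_pair (hF _ tab) (hH _ tab)) _; case: (g t).
Qed.

End MeanValue.

(** * Integrals of complex functions along segments *)

Section SegmentIntegral.
Variable R : realType.
Implicit Types (a b c z : R[i]) (f : R[i] -> R[i]).

Definition seg a b (t : R) := a + t%:C * (b - a).

Definition ccont_on (D : set R[i]) f := forall z, D z -> forall e : R, 0 < e ->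
  exists2 d : R, 0 < d & forall w, normc w < d -> D (z + w) -> normc (f (z + w) - f z) < e.

Definition segprim f a b (G : R -> R[i]) :=
  forall t, 0 <= t <= 1 -> rD G t (f (seg a b t) * (b - a)).

(** The line integral, encoded as the increment of any primitive of the pulled-back integrand. Two
    primitives differ by a constant, so that the rules for line integrals become rules for
    derivatives. *)
Definition segint f a b : R[i] :=
  xget 0 [set v | exists G, segprim f a b G /\ v = G 1 - G 0].

Lemma segintE f a b G : segprim f a b G -> segint f a b = G 1 - G 0.
Proof.
move=> hG; rewrite /segint; case: xgetP => [v _ [H [hH ->]]|]; last first.
  by move=> /(_ (G 1 - G 0)) []; exists G.
apply/eqP; rewrite -subr_eq0; apply/eqP.
have /= E : H 1 - G 1 = H 0 - G 0.
  apply: (@rD_const _ (fun t => H t - G t)) => // t t01.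
  by have := hasDB (hH _ t01) (hG _ t01); rewrite subrr.
by transitivity ((H 1 - G 1) - (H 0 - G 0)); [ring|rewrite E subrr].
Qed.

(** The 1-Lipschitz projection onto [[0, 1]] extends an integrand known only on the segment to a
    continuous function on the whole line, as [curve_primitive] requires. *)
Definition clamp (t : R) := Num.max 0 (Num.min t 1).

Lemma clamp01 t : 0 <= clamp t <= 1.
Proof. by rewrite /clamp le_max lexx/= ge_max ler01/= ge_min lexx orbT. Qed.

Lemma clampE t : 0 <= t <= 1 -> clamp t = t.
Proof.
by move=> /andP[t0 t1]; rewrite /clamp min_l// max_r.
Qed.

Lemma clamp_lip t s : `|clamp (t + s) - clamp t| <= `|s|.
Proof.
have hmax (x y : R) : `|Num.max 0 x - Num.max 0 y| <= `|x - y|.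
  by rewrite ler_norml; have := ler_norm (x - y); have := ler_norm (y - x);
    rewrite distrC; case: (ltP 0 x); case: (ltP 0 y) => ? ? ? ?;
    apply/andP; split; flra.
have hmin (x y : R) : `|Num.min x 1 - Num.min y 1| <= `|x - y|.
  by rewrite ler_norml; have := ler_norm (x - y); have := ler_norm (y - x);
    rewrite distrC; case: (ltP x 1); case: (ltP y 1) => ? ? ? ?;
    apply/andP; split; flra.
by rewrite (le_trans (hmax _ _))// (le_trans (hmin _ _))// addrAC subrr add0r.
Qed.

Lemma segprim_ex f a b (D : set R[i]) : ccont_on D f ->
  (forall t, 0 <= t <= 1 -> D (seg a b t)) -> exists G, segprim f a b G.
Proof.
move=> cf Dab.
have rc : rcont (fun t => f (seg a b (clamp t)) * (b - a)).
  move=> t e e0; have L0 : 0 < normc (b - a) + 1 by rewrite ltr_wpDl ?normc_ge0.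
  have [d d0 hd] := cf _ (Dab _ (clamp01 t)) _ (divr_gt0 e0 L0).
  exists (d / (normc (b - a) + 1)); first exact: divr_gt0.
  move=> s; rewrite ltr_pdivlMr// => sd.
  have E : seg a b (clamp (t + s)) =
    seg a b (clamp t) + (clamp (t + s) - clamp t)%:C * (b - a).
    by rewrite /seg rmorphB/=; ring.
  rewrite -mulrBl normcM E.
  have := hd ((clamp (t + s) - clamp t)%:C * (b - a)).
  rewrite -E normcM normcr => /(_ _ (Dab _ (clamp01 _))) H.
  have {}H : normc (f (seg a b (clamp (t + s))) - f (seg a b (clamp t))) < e / (normc (b - a) + 1).
    apply: H; apply: le_lt_trans sd; apply: ler_pM; rewrite ?normr_ge0 ?normc_ge0//.
      exact: clamp_lip.
    by rewrite lerDl.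
  apply: (@le_lt_trans _ _ (e / (normc (b - a) + 1) * normc (b - a))).
    by rewrite ler_wpM2r ?normc_ge0// ltW.
  by rewrite mulrAC ltr_pdivrMr// ltr_pM2l// ltrDl.
have [G hG] := curve_primitive 0 1 rc.
by exists G => t t01; have := hG _ t01; rewrite clampE.
Qed.

Lemma segint_le f a b G (M : R) : segprim f a b G ->
  (forall t, 0 <= t <= 1 -> normc (f (seg a b t)) <= M) ->
  normc (segint f a b) <= M * normc (b - a).
Proof.
move=> hG hM; rewrite (segintE hG).
have := @rD_mean_value R G _ 0 1 (M * normc (b - a)) ler01 hG.
rewrite subr0 mulr1; apply => t /hM {}hM.
by rewrite normcM ler_wpM2r ?normc_ge0.
Qed.

Lemma rD_affine (G : R -> R[i]) (c k t : R) l : rD G (c + t * k) l ->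
  rD (fun s => G (c + s * k)) t (l * k%:C).
Proof.
move=> hG e e0; have L0 : 0 < `|k| + 1 by rewrite ltr_wpDl ?normr_ge0.
have [d d0 hd] := hG _ (divr_gt0 e0 L0).
exists (d / (`|k| + 1)); first exact: divr_gt0.
move=> s; rewrite normcr ltr_pdivlMr// => sd.
have := hd (s * k); rewrite normcr => H.
have -> : c + (t + s) * k = c + t * k + s * k by ring.
apply: (le_trans (_ : _ <= e / (`|k| + 1) * `|s * k|)).
  apply: le_trans (H _).
    rewrite le_eqVlt; apply/orP; left; apply/eqP; congr normc.
    by rewrite rmorphM/=; ring.
  by rewrite normrM; apply: le_lt_trans sd; rewrite ler_wpM2l ?normr_ge0// lerDl.
rewrite normrM mulrACA ler_piMr//; first by apply: mulr_ge0; [exact: ltW|exact: normr_ge0].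
by rewrite mulrC ler_pdivrMr// mul1r lerDl.
Qed.

Lemma segprimN f a b G : segprim f a b G -> segprim f b a (fun t => G (1 + t * -1)).
Proof.
move=> hG t t01.
have t01' : 0 <= 1 + t * -1 <= 1 by case/andP: t01 => ? ?; apply/andP; split; lra.
apply: hasD_eq (rD_affine (hG _ t01')) _.
have -> : seg b a t = seg a b (1 + t * -1).
  by rewrite /seg rmorphD rmorphM rmorphN rmorph1/=; ring.
by rewrite rmorphN rmorph1; ring.
Qed.

Lemma segintN f a b G : segprim f a b G -> segint f b a = - segint f a b.
Proof.
move=> hG; rewrite (segintE hG) (segintE (segprimN hG)).
by rewrite mul0r addr0 mul1r subrr opprB.
Qed.

Lemma segprim_sub f a b G (u v : R) : segprim f a b G -> 0 <= u <= 1 -> 0 <= v <= 1 ->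
  segprim f (seg a b u) (seg a b v) (fun t => G (u + t * (v - u))).
Proof.
move=> hG /andP[u0 u1] /andP[v0 v1] t /andP[t0 t1].
have t01' : 0 <= u + t * (v - u) <= 1 by apply/andP; split; nra.
have E : seg (seg a b u) (seg a b v) t = seg a b (u + t * (v - u)).
  by rewrite /seg rmorphD rmorphM rmorphB/=; ring.
have E2 : seg a b v - seg a b u = (v - u)%:C * (b - a).
  by rewrite /seg rmorphB/=; ring.
rewrite E E2; apply: hasD_eq (rD_affine (hG _ t01')) _; ring.
Qed.

Lemma segint_split f a b (u : R) G : segprim f a b G -> 0 <= u <= 1 ->
  segint f a b = segint f a (seg a b u) + segint f (seg a b u) b.
Proof.
move=> hG u01.
have h0 : 0 <= (0 : R) <= 1 by rewrite lexx ler01.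
have h1 : 0 <= (1 : R) <= 1 by rewrite lexx ler01.
have E0 : seg a b 0 = a by rewrite /seg mul0r addr0.
have E1 : seg a b 1 = b by rewrite /seg mul1r addrC subrK.
have := segprim_sub hG h0 u01; rewrite E0 => /segintE ->.
have := segprim_sub hG u01 h1; rewrite E1 => /segintE ->.
rewrite (segintE hG) !(mul0r, mul1r, subr0, add0r, addr0) (addrC u) subrK.
by ring.
Qed.

End SegmentIntegral.

(** * Geometric limits, Goursat's theorem and primitives in discs *)

Section Limits.
Variable R : realType.
Implicit Types (th M e : R).

Lemma expr_lt_eps th e : 0 <= th < 1 -> 0 < e -> exists n, th ^+ n < e.
Proof.
move=> /andP[th0 th1] e0; have : (fun n => th ^+ n) @ \oo --> 0.
  by apply: cvg_expr; rewrite ger0_norm.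
move=> /cvgrPdist_lt/(_ _ e0)[n _ /(_ n (leqnn n))].
by rewrite sub0r normrN ger0_norm ?exprn_ge0// => ?; exists n.
Qed.

Lemma le0_geom x M th : 0 <= th < 1 -> (forall n : nat, x <= M * th ^+ n) -> x <= 0.
Proof.
move=> th01 h; rewrite leNgt; apply/negP => x0.
have M0 : 0 < M by have := h 0%N; rewrite expr0 mulr1; apply: lt_le_trans.
have [n] := expr_lt_eps th01 (divr_gt0 x0 M0).
by rewrite ltr_pdivlMr// mulrC ltNge h.
Qed.

Lemma real_geom_limit (u : nat -> R) M th : 0 <= th < 1 ->
  (forall n, `|u n.+1 - u n| <= M * th ^+ n) -> exists l : R, (u : nat -> R^o) @ \oo --> l.
Proof.
move=> th01 h; have /andP[th0 th1] := th01.
have M0 : 0 <= M by have := h 0%N; rewrite expr0 mulr1; apply: le_trans.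
have : cvgn (series (fun n => u n.+1 - u n)).
  apply: normed_cvg; apply: (@series_le_cvg _ _ (geometric M th)) => //.
  - by move=> n; rewrite /=.
  - by move=> n; rewrite /geometric /= mulr_ge0// exprn_ge0.
  - by apply: is_cvg_geometric_series; rewrite ger0_norm.
move=> /cvg_ex[l hl]; exists (u 0%N + l).
suff : (fun n => u 0%N + series (fun n => u n.+1 - u n) n : R^o) @ \oo --> u 0%N + l.
  rewrite (_ : (fun n => _) = u)//.
  by apply/funext => n; rewrite /series/= telescope_sumr// addrC subrK.
by apply: cvgD => //; exact: cvg_cst.
Qed.

(** Completeness with a rate; the factor 2 adds the errors of the real and the imaginary part. *)
Lemma geom_limit (u : nat -> R[i]) M th : 0 <= th < 1 ->
  (forall n, normc (u n.+1 - u n) <= M * th ^+ n) ->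
  exists p, forall n, normc (p - u n) <= 2 * (M / (1 - th)) * th ^+ n.
Proof.
move=> th01 h; have /andP[th0 th1] := th01.
have M0 : 0 <= M by have := h 0%N; rewrite expr0 mulr1; apply: le_trans; exact: normc_ge0.
have key (g : R[i] -> R) : (forall x y, g x - g y = g (x - y)) -> (forall z, `|g z| <= normc z) ->
    exists l, forall n, `|l - g (u n)| <= (M / (1 - th)) * th ^+ n.
  move=> gB gn; have [|l hl] := @real_geom_limit (g \o u) M th th01.
    by move=> n; rewrite /= gB (le_trans (gn _)).
  exists l => n.
  have hm m : `|g (u (n + m)%N) - g (u n)| <= M / (1 - th) * th ^+ n.
    suff : `|g (u (n + m)%N) - g (u n)| <= M / (1 - th) * th ^+ n * (1 - th ^+ m).
      move/le_trans; apply; rewrite ler_piMr ?gerBl ?exprn_ge0//.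
      by rewrite mulr_ge0 ?exprn_ge0// divr_ge0// subr_ge0 ltW.
    elim: m => [|m ih]; first by rewrite addn0 subrr normr0 expr0 subrr mulr0.
    rewrite addnS -(subrK (g (u (n + m)%N)) (g (u (n + m).+1))) -addrA.
    apply: (le_trans (ler_normD _ _)); rewrite gB.
    apply: (le_trans (lerD (le_trans (gn _) (h _)) ih)).
    rewrite exprS exprD le_eqVlt; apply/orP; left; apply/eqP; field.
    by rewrite subr_eq0 eq_sym lt_eqF.
  have : (fun m => `|g (u (n + m)%N) - g (u n)|) @ \oo --> `|l - g (u n)|.
    apply: cvg_norm; apply: cvgB; last exact: cvg_cst.
    have -> : (fun m => g (u (n + m)%N)) = [sequence (g \o u) (k + n)%N]_k.
      by apply/funext => k; rewrite /= addnC.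
    by rewrite cvg_shiftn.
  move=> hc; rewrite -(cvg_lim (@norm_hausdorff _ R^o) hc).
  by apply: limr_le; [apply/cvg_ex; eexists; exact: hc|exact: nearW].
have [| |r hr] := key (@Re R); first by move=> ? ?; rewrite ReB.
  exact: normc_Re.
have [| |i hi] := key (@Im R); first by move=> ? ?; rewrite ImB.
  exact: normc_Im.
exists (Complex r i) => n; rewrite (le_trans (normc_leReIm _))// !ReImE/=.
by rewrite mulr_natl mulr2n !mulrDl lerD.
Qed.

End Limits.

Section Goursat.
Variable R : realType.
Implicit Types (a b c z p : R[i]) (f F : R[i] -> R[i]) (D : set R[i]).

Definition cconvex D := forall a b t, D a -> D b -> 0 <= t <= 1 -> D (seg a b t).

Lemma segint_FTC f F a b : (forall t, 0 <= t <= 1 -> cD F (seg a b t) (f (seg a b t))) ->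
  segprim f a b (fun t => F (seg a b t)).
Proof. by move=> h t /h; apply: hasD_comp; exact: rD_line. Qed.

Lemma segint_FTCE f F a b : (forall t, 0 <= t <= 1 -> cD F (seg a b t) (f (seg a b t))) ->
  segint f a b = F b - F a.
Proof.
move=> /segint_FTC/segintE ->; rewrite /seg mul1r mul0r addr0.
by rewrite (addrC a) subrK.
Qed.

Lemma segintB f g a b G H : segprim f a b G -> segprim g a b H ->
  segint (fun z => f z - g z) a b = segint f a b - segint g a b.
Proof.
move=> hG hH; rewrite (segintE hG) (segintE hH).
rewrite (@segintE _ _ _ _ (fun t => G t - H t)); first by ring.
by move=> t t01; apply: hasD_eq (hasDB (hG _ t01) (hH _ t01)) _; ring.
Qed.

Lemma segprimB f g a b G H : segprim f a b G -> segprim g a b H ->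
  segprim (fun z => f z - g z) a b (fun t => G t - H t).
Proof.
by move=> hG hH t t01; apply: hasD_eq (hasDB (hG _ t01) (hH _ t01)) _; ring.
Qed.

Definition tri f a b c := segint f a b + segint f b c + segint f c a.

Definition mid a b := seg a b (2^-1).

Lemma tri_split D f a b c : cconvex D -> ccont_on D f -> D a -> D b -> D c ->
  tri f a b c = tri f a (mid a b) (mid c a) + tri f (mid a b) b (mid b c) +
    tri f (mid b c) c (mid c a) + tri f (mid a b) (mid b c) (mid c a).
Proof.
move=> cvxD cf Da Db Dc.
have h01 : 0 <= (2^-1 : R) <= 1 by apply/andP; split; lra.
have sp x y : D x -> D y -> segint f x y = segint f x (mid x y) + segint f (mid x y) y.
  move=> Dx Dy; have [|G hG] := @segprim_ex _ f x y D cf; last exact: segint_split hG h01.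
  by move=> t; exact: cvxD.
have sn x y : D x -> D y -> segint f y x = - segint f x y.
  move=> Dx Dy; have [|G hG] := @segprim_ex _ f x y D cf; last exact: segintN hG.
  by move=> t; exact: cvxD.
have Dm x y : D x -> D y -> D (mid x y) by move=> Dx Dy; exact: cvxD.
rewrite /tri (sp a b)// (sp b c)// (sp c a)//.
rewrite (sn _ _ (Dm _ _ Da Db) (Dm _ _ Dc Da)) (sn _ _ (Dm _ _ Db Dc) (Dm _ _ Da Db)).
rewrite (sn _ _ (Dm _ _ Dc Da) (Dm _ _ Db Dc)); ring.
Qed.

(** Quartering: one of the four triangles carries at least a fourth of the integral, and the nested
    triangles converge to a point [p] of [D], which is closed under limits. Near [p] the function is
    affine up to [e * normc (w - p)]. The affine part has a primitive, so that the n-th integral is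
    at most a constant times [e * 4 ^- n], too small for small [e]. *)
Lemma goursat D f a b c : cconvex D ->
  (forall (u : nat -> R[i]) p, (forall n, D (u n)) ->
     (forall e : R, 0 < e -> exists n, normc (p - u n) < e) -> D p) ->
  (forall z, D z -> exists l, cD f z l) ->
  D a -> D b -> D c -> tri f a b c = 0.
Proof.
move=> cvxD clD hf Da Db Dc.
have cf : ccont_on D f.
  move=> z /hf[l hl] e e0; have [d d0 hd] := hasD_cont hl e0.
  by exists d => // w /hd.
pose P (T : R[i] * R[i] * R[i]) (d : R) := [/\ D T.1.1, D T.1.2 & D T.2] /\
  [/\ normc (T.1.1 - T.1.2) <= d, normc (T.1.2 - T.2) <= d & normc (T.2 - T.1.1) <= d].
pose tr (T : R[i] * R[i] * R[i]) := normc (tri f T.1.1 T.1.2 T.2).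
have h2 : (2^-1%:C : R[i]) = 2^-1 by rewrite fmorphV/= -[2]/(2%:R) rmorph_nat.
have n2 : normc (2^-1 : R[i]) = 2^-1 by rewrite -h2 normcr ger0_norm.
have step T d : P T d -> exists T', [/\ P T' (d / 2), normc (T'.1.1 - T.1.1) <= d & tr T <= 4 * tr T'].
  case: T => [[x y] z] [/= [Dx Dy Dz] [xy yz zx]].
  have d0 : 0 <= d by apply: le_trans xy; exact: normc_ge0.
  have Dm u v : D u -> D v -> D (mid u v).
    by move=> Du Dv; apply: cvxD => //; apply/andP; split; flra.
  have half u v w : u - v = 2^-1 * w -> normc w <= d -> normc (u - v) <= d / 2.
    by move=> -> wd; rewrite normcM n2 mulrC ler_wpM2r// invr_ge0.
  have E x' y' : mid x' y' = (x' + y') / 2 by rewrite /mid /seg h2; field.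
  have hd : d / 2 <= d by flra.
  have N u v : normc (u - v) <= d -> normc (v - u) <= d by rewrite normcBC.
  have xy' := N _ _ xy; have yz' := N _ _ yz; have zx' := N _ _ zx.
  have mxy : normc (mid x y - x) <= d.
    by apply: le_trans hd; apply: (half _ _ (y - x)); rewrite // E; field.
  have myzx : normc (mid y z - x) <= d.
    have -> : mid y z - x = (y - x + (z - x)) / 2 by rewrite E; field.
    rewrite normcM n2; have := le_normcD (y - x) (z - x); flra.
  have T1 : P (x, mid x y, mid z x) (d / 2).
    split; split; rewrite //=; try exact: Dm.
    - by apply: (half _ _ (x - y)); rewrite // E; field.
    - by apply: (half _ _ (y - z)); rewrite // !E; field.
    - by apply: (half _ _ (z - x)); rewrite // E; field.
  have T2 : P (mid x y, y, mid y z) (d / 2).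
    split; split; rewrite //=; try exact: Dm.
    - by apply: (half _ _ (x - y)); rewrite // E; field.
    - by apply: (half _ _ (y - z)); rewrite // !E; field.
    - by apply: (half _ _ (z - x)); rewrite // !E; field.
  have T3 : P (mid y z, z, mid z x) (d / 2).
    split; split; rewrite //=; try exact: Dm.
    - by apply: (half _ _ (y - z)); rewrite // !E; field.
    - by apply: (half _ _ (z - x)); rewrite // E; field.
    - by apply: (half _ _ (x - y)); rewrite // !E; field.
  have T4 : P (mid x y, mid y z, mid z x) (d / 2).
    split; split; rewrite //=; try exact: Dm.
    - by apply: (half _ _ (x - z)); rewrite // !E; field.
    - by apply: (half _ _ (y - x)); rewrite // !E; field.
    - by apply: (half _ _ (z - y)); rewrite // !E; field.
  have S : tr (x, y, z) <= tr (x, mid x y, mid z x) + tr (mid x y, y, mid y z) +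
     tr (mid y z, z, mid z x) + tr (mid x y, mid y z, mid z x).
    rewrite /tr /= (tri_split cvxD cf Dx Dy Dz).
    apply: (le_trans (le_normcD _ _)); rewrite lerD2r.
    by apply: (le_trans (le_normcD _ _)); rewrite lerD2r le_normcD.
  have [S1|S1] := leP (tr (x, y, z)) (4 * tr (x, mid x y, mid z x)).
    by exists (x, mid x y, mid z x); split => //=; rewrite subrr normc0.
  have [S2|S2] := leP (tr (x, y, z)) (4 * tr (mid x y, y, mid y z)).
    by exists (mid x y, y, mid y z).
  have [S3|S3] := leP (tr (x, y, z)) (4 * tr (mid y z, z, mid z x)).
    by exists (mid y z, z, mid z x).
  exists (mid x y, mid y z, mid z x); split => //; clear - S S1 S2 S3; flra.
pose d := normc (a - b) + normc (b - c) + normc (c - a).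
have hab := normc_ge0 (a - b); have hbc := normc_ge0 (b - c); have hca := normc_ge0 (c - a).
have P0 : P (a, b, c) d by split; split; rewrite //= /d; flra.
pose stp (Td : R[i] * R[i] * R[i] * R) : R[i] * R[i] * R[i] * R :=
  (xget Td.1 [set T' | [/\ P T' (Td.2 / 2), normc (T'.1.1 - Td.1.1.1) <= Td.2 & tr Td.1 <= 4 * tr T']],
   Td.2 / 2).
have stpP Td : P Td.1 Td.2 -> [/\ P (stp Td).1 (stp Td).2,
    normc ((stp Td).1.1.1 - Td.1.1.1) <= Td.2 & tr Td.1 <= 4 * tr (stp Td).1].
  move=> /step[T' hT']; rewrite /stp /=; case: xgetP => //=.
  by move=> /(_ T')/(_ hT').
pose s n := iter n stp ((a, b, c), d).
have sP n : P (s n).1 (s n).2 /\ (s n).2 = d * 2^-1 ^+ n.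
  elim: n => [|n [ih1 ih2]]; first by rewrite /= expr0 mulr1.
  have [h _ _] := stpP _ ih1; split; first exact: h.
  by rewrite /= -/(s n) ih2 exprSr mulrA.
have trn n : tr (a, b, c) <= 4 ^+ n * tr (s n).1.
  elim: n => [|n ih]; first by rewrite expr0 mul1r.
  have [_ _ h] := stpP _ (sP n).1; apply: (le_trans ih).
  by rewrite exprSr -mulrA ler_wpM2l// exprn_ge0.
have th : 0 <= (2^-1 : R) < 1 by apply/andP; split; flra.
have th0 : 0 <= (2^-1 : R) by flra.
have [|p hp] := @geom_limit R (fun n => (s n).1.1.1) d 2^-1 th.
  by move=> n; have [_ h _] := stpP _ (sP n).1; rewrite -(sP n).2.
have d0 : 0 <= d by rewrite /d; flra.
have hp' n : normc ((s n).1.1.1 - p) <= 4 * d * 2^-1 ^+ n.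
  by rewrite normcBC; have := hp n; rewrite (_ : 2 * (d / (1 - 2^-1)) = 4 * d)//; field.
have Dp : D p.
  apply: (clD (fun n => (s n).1.1.1)) => [n|e e0]; first by have [[[]]] := sP n.
  have e1 : 0 < e / (4 * d + 1) by rewrite divr_gt0// ltr_wpDl// mulr_ge0.
  have [n hn] := expr_lt_eps th e1; exists n; rewrite normcBC (le_lt_trans (hp' n))//.
  move: hn; rewrite ltr_pdivlMr ?ltr_wpDl ?mulr_ge0// mulrC; apply: le_lt_trans.
  by rewrite ler_wpM2r ?exprn_ge0// lerDl.
have [l hl] := hf _ Dp.
apply/eqP; rewrite -normc_eq0 eq_le normc_ge0 andbT leNgt; apply/negP => t0.
(* Each of the three sides will have length at most [D2 = d * 2^-1 ^+ n] and stay within [6 * D2] of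
   [p], a total error of [18 * e * D2 ^+ 2]. After the factor [4 ^+ n] this is [18 * e * d ^+ 2], at
   most half of the integral for this [e]. *)
have e0 : 0 < normc (tri f a b c) / (18 * d ^+ 2 + 1) / 2.
  by rewrite !divr_gt0// ltr_wpDl// mulr_ge0 ?sqr_ge0.
set e := _ / _ / 2 in e0.
have [r r0 hr] := hl _ e0.
have d1 : 0 < 6 * d + 1 by rewrite ltr_wpDl// mulr_ge0.
have [n hn] := expr_lt_eps th (divr_gt0 r0 d1).
move: hn; rewrite ltr_pdivlMr ?ltr_wpDl ?mulr_ge0// => hn.
have [[[Dx Dy Dz] [xy yz zx]] dn] := sP n.
have := trn n; rewrite /tr /=.
move: (hp' n); rewrite dn in xy yz zx.
set x := (s n).1.1.1 in Dx xy zx *; set y := (s n).1.1.2 in Dy xy yz *.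
set z := (s n).1.2 in Dz yz zx *; set D2 := d * 2^-1 ^+ n in xy yz zx *.
have -> : 4 * d * 2^-1 ^+ n = 4 * D2 by rewrite /D2; ring.
move=> xp.
have D20 : 0 <= D2 by rewrite mulr_ge0// exprn_ge0.
have D2r : 6 * D2 < r.
  apply: le_lt_trans hn; have := exprn_ge0 n th0; rewrite /D2; flra.
(* The affine approximation of [f] at [p]; the increments of its primitive [Gp] cancel around the
   triangle. *)
pose g w := f p + l * (w - p).
pose Gp w := f p * w + l * 2^-1 * (w - p) ^+ 2.
have gG w : cD Gp w (g w).
  have h1 := hasDD (cD_id w) (hasD_cst id (- p) w).
  have := hasDD (hasDZ (f p) (cD_id w)) (hasDZ (l * 2^-1) (hasDM h1 h1)).
  move=> H; apply: (hasD_ext _ (hasD_eq H _)); last by rewrite /g; field.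
  by move=> v; rewrite /Gp expr2.
have spf u v : D u -> D v -> exists G, segprim f u v G.
  by move=> Du Dv; apply: (@segprim_ex _ f u v D cf) => t; exact: cvxD.
have spg u v : segprim g u v (fun t => Gp (seg u v t)).
  by apply: segint_FTC => t _; exact: gG.
have ig u v : segint g u v = Gp v - Gp u by apply: segint_FTCE => t _; exact: gG.
have bnd u v : D u -> D v -> normc (u - p) <= 5 * D2 -> normc (v - u) <= D2 ->
    normc (segint f u v - (Gp v - Gp u)) <= e * (6 * D2) * D2.
  move=> Du Dv up vu; have [G hG] := spf _ _ Du Dv.
  rewrite -ig -(segintB hG (spg u v)).
  apply: (le_trans (segint_le (M := e * (6 * D2)) (segprimB hG (spg u v)) _)).
    move=> t /andP[t0' t1']; have ts : normc (seg u v t - p) <= 6 * D2.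
      have -> : seg u v t - p = (u - p) + t%:C * (v - u) by rewrite /seg; ring.
      apply: (le_trans (le_normcD _ _)); rewrite normcM normcr ger0_norm//.
      have tv : t * normc (v - u) <= 1 * D2 by rewrite ler_pM ?normc_ge0.
      clear - tv up; lra.
    have := hr (seg u v t - p); rewrite (addrC p) subrK => /(_ (le_lt_trans ts D2r)).
    rewrite /g opprD addrA => /le_trans; apply.
    by rewrite ler_wpM2l// ltW.
  by rewrite ler_wpM2l//; apply: mulr_ge0; [exact: ltW|exact: mulr_ge0].
have yp : normc (y - p) <= 5 * D2.
  have -> : y - p = (y - x) + (x - p) by ring.
  by apply: (le_trans (le_normcD _ _)); rewrite (normcBC y); clear - xy xp; flra.
have zp : normc (z - p) <= 5 * D2.
  have -> : z - p = (z - x) + (x - p) by ring.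
  by apply: (le_trans (le_normcD _ _)); clear - zx xp; flra.
have b1 := bnd x y Dx Dy _ _; rewrite normcBC in xy; have {}b1 := b1 (_ : _ <= _) xy.
have b2 := bnd y z Dy Dz yp; rewrite normcBC in yz; have {}b2 := b2 yz.
have b3 := bnd z x Dz Dx zp; rewrite normcBC in zx; have {}b3 := b3 zx.
have {}b1 : normc (segint f x y - (Gp y - Gp x)) <= e * (6 * D2) * D2 by apply: b1; clear - xp D20; flra.
have E : tri f x y z = (segint f x y - (Gp y - Gp x)) + (segint f y z - (Gp z - Gp y)) +
  (segint f z x - (Gp x - Gp z)) by rewrite /tri; ring.
have hS : normc (tri f x y z) <= 18 * e * D2 ^+ 2.
  by rewrite E (le_trans (normc_lin _ _ _))//; clear - b1 b2 b3; flra.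
move=> hT.
have E4 : 4 ^+ n * (18 * e * D2 ^+ 2) = 18 * e * d ^+ 2.
  have -> : D2 ^+ 2 = d ^+ 2 * (4 ^+ n)^-1.
    have h4 : (2^-1 : R) ^+ 2 = 4^-1 by field.
    by rewrite /D2 exprMn -exprM mulnC exprM h4 exprVn.
  by rewrite mulrCA [4 ^+ n * _]mulrCA mulfV ?mulr1// expf_neq0.
have {}hT : normc (tri f a b c) <= 18 * e * d ^+ 2.
  by apply: (le_trans hT); rewrite -E4 ler_wpM2l// exprn_ge0.
have : 18 * e * d ^+ 2 <= normc (tri f a b c) / 2.
  have Q : 0 < 18 * d ^+ 2 + 1 by rewrite ltr_wpDl// mulr_ge0 ?sqr_ge0.
  rewrite (_ : 18 * e * d ^+ 2 = (18 * d ^+ 2 / (18 * d ^+ 2 + 1)) * (normc (tri f a b c) / 2)); last first.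
    by rewrite /e; field; rewrite gt_eqF.
  rewrite ler_piMl ?divr_ge0 ?normc_ge0//.
  by rewrite ler_pdivrMr// mul1r lerDl.
clear - t0 hT; lra.
Qed.

Definition disc z (r : R) : set R[i] := [set w | normc (w - z) < r].

Lemma disc_seg z r a b t : disc z r a -> disc z r b -> 0 <= t <= 1 -> disc z r (seg a b t).
Proof.
rewrite /disc /= => ha hb /andP[t0 t1].
have -> : seg a b t - z = (1 - t)%:C * (a - z) + t%:C * (b - z).
  by rewrite /seg rmorphB rmorph1; ring.
apply: (le_lt_trans (le_normcD _ _)); rewrite !normcM !normcr (ger0_norm t0) ger0_norm ?subr_ge0//.
have [->|t0'] := eqVneq t 0; first by rewrite subr0 mul1r mul0r addr0.
have : t * normc (b - z) < t * r by rewrite ltr_pM2l// lt_def t0'.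
have : (1 - t) * normc (a - z) <= (1 - t) * r by rewrite ler_wpM2l ?subr_ge0// ltW.
lra.
Qed.

Lemma disc_near z r a : disc z r a -> exists2 d, 0 < d & forall w, normc w < d -> disc z r (a + w).
Proof.
rewrite /disc /= => ha; exists (r - normc (a - z)); first by rewrite subr_gt0.
move=> w hw; have -> : a + w - z = (a - z) + w by ring.
by apply: (le_lt_trans (le_normcD _ _)); lra.
Qed.

Lemma disc_primitive f z r : (forall w, disc z r w -> exists l, cD f w l) ->
  exists F, forall w, disc z r w -> cD F w (f w).
Proof.
move=> hf; have cf : ccont_on (disc z r) f.
  move=> w /hf[l hl] e e0; have [d d0 hd] := hasD_cont hl e0.
  by exists d => // v /hd.
exists (fun w => segint f z w) => w Dw e e0.
have Dz : disc z r z by rewrite /disc /= subrr normc0; apply: le_lt_trans Dw; exact: normc_ge0.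
have spx u v : disc z r u -> disc z r v -> exists G, segprim f u v G.
  by move=> Du Dv; apply: (@segprim_ex _ f u v _ cf) => t; exact: disc_seg.
have [d1 d10 h1] := cf _ Dw _ e0.
have [d2 d20 h2] := disc_near Dw.
exists (Num.min d1 d2); first by rewrite lt_min d10.
move=> v; rewrite lt_min => /andP[vd1 vd2].
have Dwv := h2 _ vd2.
have T : tri f z w (w + v) = 0.
  (* [goursat] asks for a set closed under limits, hence the closed disc through the farther of the
     two points, which still lies inside the open one. *)
  set r' := Num.max (normc (w - z)) (normc (w + v - z)).
  have r'r : r' < r by rewrite gt_max; apply/andP.
  apply: (@goursat [set u | normc (u - z) <= r']) => /=.
  - move=> a b t /= ha hb /andP[t0 t1].
    have -> : seg a b t - z = (1 - t)%:C * (a - z) + t%:C * (b - z).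
      by rewrite /seg rmorphB rmorph1; ring.
    apply: (le_trans (le_normcD _ _)); rewrite !normcM !normcr (ger0_norm t0) ger0_norm ?subr_ge0//.
    have : t * normc (b - z) <= t * r' by rewrite ler_wpM2l.
    have : (1 - t) * normc (a - z) <= (1 - t) * r' by rewrite ler_wpM2l ?subr_ge0.
    flra.
  - move=> u p hu hp; rewrite leNgt; apply/negP => hlt.
    rewrite -subr_gt0 in hlt; have [n hn] := hp _ hlt.
    have := hu n; have := le_normcD (p - u n) (u n - z).
    by rewrite addrA subrK => ? ?; flra.
  - by move=> u hu; apply: hf; rewrite /disc /=; apply: le_lt_trans r'r.
  - by rewrite subrr normc0 le_max normc_ge0.
  - by rewrite le_max lexx.
  - by rewrite le_max lexx orbT.
have [G1 hG1] := spx _ _ Dwv Dz; have [G2 hG2] := spx _ _ Dw Dwv.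
have [G3 hG3] := spx _ _ Dz Dwv.
move: T; rewrite /tri (segintN hG3) => T.
have -> : segint f z (w + v) - segint f z w = segint f w (w + v).
  apply/eqP; rewrite eq_sym -subr_eq0; apply/eqP; rewrite -T; ring.
have hc : segprim (fun=> f w) w (w + v) (fun t => f w * seg w (w + v) t).
  by apply: segint_FTC => t _; apply: hasD_eq (hasDZ (f w) (cD_id _)) _; rewrite mulr1.
have -> : segint f w (w + v) - f w * v = segint (fun x => f x - f w) w (w + v).
  rewrite (segintB hG2 hc) (segintE hc); congr (_ - _).
  by rewrite /seg mul1r mul0r; ring.
have vE : w + v - w = v by ring.
rewrite -{2}vE; apply: (segint_le (segprimB hG2 hc)) => t /andP[t0 t1].
rewrite ltW// {1}/seg vE; apply: h1.
  rewrite normcM normcr ger0_norm//; apply: le_lt_trans vd1.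
  by rewrite ler_piMl ?normc_ge0.
by have := disc_seg Dw Dwv (_ : 0 <= t <= 1); rewrite /seg vE t0 t1; apply.
Qed.

End Goursat.

(** * Geometrically convergent series and power series *)

Section GeometricSums.
Variable R : realType.
Implicit Types (t : nat -> R[i]) (S : R[i]) (M th : R) (a b : R).

(** Convergence with a geometric rate. A power series has it at every point strictly inside its
    disc, and it turns uniqueness, linearity and Cauchy products into estimates of partial sums. *)
Definition gsum t S := exists M th : R, 0 <= th < 1 /\
  forall n, normc (S - \sum_(k < n) t k) <= M * th ^+ n.

Lemma gsum_ex t M th : 0 <= th < 1 -> (forall k, normc (t k) <= M * th ^+ k) ->
  exists S, gsum t S.
Proof.
move=> th01 h; have [|S hS] := @geom_limit R (fun n => \sum_(k < n) t k) M th th01.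
  by move=> n; rewrite big_ord_recr/= addrC addrK.
by exists S, (2 * (M / (1 - th))), th; split.
Qed.

Lemma geom_rate2 M1 th1 M2 th2 : 0 <= th1 < 1 -> 0 <= th2 < 1 -> 0 <= M1 -> 0 <= M2 ->
  exists M th, 0 <= th < 1 /\ forall n, M1 * th1 ^+ n + M2 * th2 ^+ n <= M * th ^+ n.
Proof.
move=> /andP[a0 a1] /andP[b0 b1] m1 m2; exists (M1 + M2), (Num.max th1 th2).
split; first by rewrite le_max a0/= gt_max a1.
move=> n; rewrite mulrDl lerD// ler_wpM2l// lerXn2r// ?nnegrE ?le_max ?a0 ?b0 ?lexx ?orbT//.
Qed.

Lemma gsum_rate t S M th : (forall n : nat, normc (S - \sum_(k < n) t k) <= M * th ^+ n) -> 0 <= M.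
Proof. by move=> /(_ 0%N); rewrite expr0 mulr1; apply: le_trans; exact: normc_ge0. Qed.

Lemma gsumD t S t' S' : gsum t S -> gsum t' S' -> gsum (fun k => t k + t' k) (S + S').
Proof.
move=> [M1 [th1 [h1 H1]]] [M2 [th2 [h2 H2]]].
have [M [th [h H]]] := geom_rate2 h1 h2 (gsum_rate H1) (gsum_rate H2).
exists M, th; split=> // n; rewrite big_split/= opprD addrACA.
by apply: (le_trans (le_normcD _ _)); apply: le_trans (H n);
  exact: lerD (H1 n) (H2 n).
Qed.

Lemma gsumZ c t S : gsum t S -> gsum (fun k => c * t k) (c * S).
Proof.
move=> [M [th [h H]]]; exists (normc c * M), th; split => // n.
by rewrite -mulr_sumr -mulrBr normcM -mulrA ler_wpM2l// normc_ge0.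
Qed.

Lemma gsum_ext t t' S : t =1 t' -> gsum t S -> gsum t' S.
Proof. by move=> /funext ->. Qed.

Lemma gsumB t S t' S' : gsum t S -> gsum t' S' -> gsum (fun k => t k - t' k) (S - S').
Proof.
move=> h /(gsumZ (-1)) h'; have := gsumD h h'; rewrite mulN1r.
by apply: gsum_ext => k; rewrite mulN1r.
Qed.

Lemma gsum_bound t S (B : R) : gsum t S -> (forall n, normc (\sum_(k < n) t k) <= B) ->
  normc S <= B.
Proof.
move=> [M [th [h H]]] hB; rewrite -subr_le0; apply: (le0_geom h (M := M)) => n.
rewrite lerBlDr (le_trans _ (lerD (H n) (hB n)))// -{1}(subrK (\sum_(k < n) t k) S).
exact: le_normcD.
Qed.

Lemma gsum_uniq t S S' : gsum t S -> gsum t S' -> S = S'.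
Proof.
move=> h h'; have := gsumB h h' => H; apply/eqP; rewrite -subr_eq0 -normc_eq0 eq_le normc_ge0 andbT.
by apply: (gsum_bound H) => n; rewrite big1 ?normc0// => i _; rewrite subrr.
Qed.

Lemma gsum_shift t S : gsum (fun k => t k.+1) S -> gsum t (t 0%N + S).
Proof.
move=> [M [th [h H]]]; have /andP[th0 th1] := h.
have M0 : 0 <= M := @gsum_rate (fun k => t k.+1) _ _ _ H.
set th' := Num.max th 2^-1.
have hm0 : 2^-1 <= th' by rewrite le_max lexx orbT.
have hm1 : th' < 1 by rewrite gt_max th1/= invf_lt1 ?ltr1n.
have tt : th <= th' by rewrite le_max lexx.
exists (2 * M + normc (t 0%N) + normc S), th'; split; first by rewrite hm1 andbT; lra.
case=> [|n].
  rewrite big_ord0 subr0 expr0 mulr1 (le_trans (le_normcD _ _))//.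
  have := normc_ge0 (t 0%N); have := normc_ge0 S; lra.
rewrite big_ord_recl /= opprD addrACA subrr add0r (le_trans (H n))//.
have e0 : 0 <= th' ^+ n by rewrite exprn_ge0//; lra.
have : M * th ^+ n <= M * th' ^+ n by rewrite ler_wpM2l// lerXn2r// nnegrE; flra.
move/le_trans; apply; rewrite exprS mulrA ler_wpM2r//.
have := normc_ge0 (t 0%N); have := normc_ge0 S; nra.
Qed.

Lemma geom_sum_le th n : 0 <= th < 1 -> \sum_(k < n) th ^+ k <= (1 - th)^-1.
Proof.
move=> /andP[th0 th1]; have p : 0 < 1 - th by rewrite subr_gt0.
rewrite -(ler_pM2l p) mulfV ?gt_eqF//.
have -> : (1 - th) * \sum_(k < n) th ^+ k = 1 - th ^+ n.
  by rewrite -opprB mulNr -subrX1 opprB.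
by rewrite gerBl exprn_ge0.
Qed.

Lemma gsum_le t S M th : 0 <= th < 1 -> (forall k, normc (t k) <= M * th ^+ k) ->
  gsum t S -> normc S <= M / (1 - th).
Proof.
move=> th01 h /gsum_bound; apply => n.
have M0 : 0 <= M by have := h 0%N; rewrite expr0 mulr1; apply: le_trans; exact: normc_ge0.
apply: (@le_trans _ _ (\sum_(k < n) M * th ^+ k)).
  elim: n => [|n ih]; first by rewrite !big_ord0 normc0.
  by rewrite !big_ord_recr/= (le_trans (le_normcD _ _))// lerD.
by rewrite -mulr_sumr ler_wpM2l// geom_sum_le.
Qed.

(** Bernoulli's inequality for [b / a]: a factor [k], as produced by differentiation, costs only an
    arbitrarily small enlargement of the ratio. *)
Lemma natmul_geom a b : 0 <= a -> a < b -> exists2 c, 0 < c & forall k, k%:R * a ^+ k <= c * b ^+ k.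
Proof.
move=> a0 ab; have b0 : 0 < b by apply: le_lt_trans ab.
have p : 0 < b - a by rewrite subr_gt0.
exists (b / (b - a)); first exact: divr_gt0.
move=> k; have [->|a0'] := eqVneq a 0.
  have h0 : 0 <= b / (b - 0) * b ^+ k.
    by rewrite subr0 mulr_ge0 ?exprn_ge0 ?divr_ge0 ?ltW.
  by case: k h0 => [|k] h0; rewrite ?mul0r// expr0n mulr0.
have {}a0 : 0 < a by rewrite lt_def a0'.
have E : (b - a) / a = b / a - 1 by field.
have : k%:R * ((b - a) / a) <= (b / a) ^+ k.
  elim: k => [|k ih]; first by rewrite mul0r expr0 ler01.
  have h1 : 1 <= b / a by rewrite ler_pdivlMr// mul1r ltW.
  have h2 : 1 <= (b / a) ^+ k by exact: exprn_ege1.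
  rewrite E in ih *; rewrite exprS -natr1; nra.
rewrite expr_div_n ler_pdivlMr ?exprn_gt0// => h.
rewrite mulrAC ler_pdivlMr//.
have -> : k%:R * a ^+ k * (b - a) = a * (k%:R * ((b - a) / a) * a ^+ k) by field.
apply: (le_trans (ler_wpM2l (ltW a0) h)).
by apply: ler_wpM2r; [pos|exact: ltW].
Qed.

End GeometricSums.

Section PowerSeries.
Variable R : realType.
Implicit Types (c : nat -> R[i]) (f : R[i] -> R[i]) (z w v : R[i]) (r s M : R).

Definition hasps f z r c := forall w, normc w < r -> gsum (fun k => c k * w ^+ k) (f (z + w)).

Definition psbound c M r := forall k, normc (c k) * r ^+ k <= M.

Definition psdiff c : nat -> R[i] := fun k => k.+1%:R * c k.+1.

Lemma normc_nat n : normc (n%:R : R[i]) = n%:R.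
Proof. by rewrite -(rmorph_nat (real_complex R)) normcr ger0_norm. Qed.

Lemma psterm_le c M r w : 0 < r -> psbound c M r -> forall k,
  normc (c k * w ^+ k) <= M * (normc w / r) ^+ k.
Proof.
move=> r0 h k; rewrite normcM normcX expr_div_n mulrA mulrAC.
by rewrite ler_wpM2r ?exprn_ge0 ?normc_ge0// ler_pdivlMr ?exprn_gt0.
Qed.

Lemma ratio01 r w : normc w < r -> 0 <= normc w / r < 1.
Proof.
move=> wr; have r0 : 0 < r by apply: le_lt_trans wr; exact: normc_ge0.
by rewrite divr_ge0 ?normc_ge0 ?ltW//= ltr_pdivrMr// mul1r.
Qed.

Lemma psbound_diff c M r s : 0 < s -> s < r -> psbound c M r ->
  exists2 M', 0 <= M' & psbound (psdiff c) M' s.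
Proof.
move=> s0 sr h; have r0 : 0 < r by apply: lt_trans sr.
have M0 : 0 <= M by have := h 0%N; apply: le_trans; rewrite mulr_ge0 ?normc_ge0.
have [C C0 hC] := natmul_geom (ltW s0) sr.
exists (M * C / s); first by pos.
move=> k; rewrite /psdiff normcM normc_nat ler_pdivlMr//.
have -> : k.+1%:R * normc (c k.+1) * s ^+ k * s = k.+1%:R * s ^+ k.+1 * normc (c k.+1).
  by rewrite [s ^+ k.+1]exprS; ring.
apply: (le_trans (ler_wpM2r (normc_ge0 _) (hC k.+1))).
by rewrite -mulrA [leLHS]mulrC; apply: ler_wpM2r; [exact: ltW|rewrite mulrC; exact: h].
Qed.

(** The second-order Taylor remainder of the k-th power on the disc of radius [s]. The factor
    [s ^+ 2] on the left avoids the exponent [k - 2], which is truncated for small [k]. *)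
Lemma binom2 w v s k : normc w <= s -> normc (w + v) <= s ->
  s ^+ 2 * normc ((w + v) ^+ k - w ^+ k - k%:R * w ^+ k.-1 * v) <= k%:R ^+ 2 * s ^+ k * normc v ^+ 2.
Proof.
move=> ws wvs; have s0 : 0 <= s by apply: le_trans ws; exact: normc_ge0.
elim: k => [|k ih].
  by rewrite !expr0 subrr mul0r mul0r subr0 normc0 mulr0 expr0n !mul0r.
have -> : (w + v) ^+ k.+1 - w ^+ k.+1 - k.+1%:R * w ^+ k.+1.-1 * v =
  (w + v) * ((w + v) ^+ k - w ^+ k - k%:R * w ^+ k.-1 * v) + k%:R * w ^+ k.-1 * v ^+ 2.
  by case: k ih => [|k] _ /=; rewrite !exprS -?natr1; ring.
apply: (@le_trans _ _ (s * (k%:R ^+ 2 * s ^+ k * normc v ^+ 2) + k%:R * s ^+ k.+1 * normc v ^+ 2)).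
  apply: (@le_trans _ _ (s ^+ 2 * (normc ((w + v) * ((w + v) ^+ k - w ^+ k - k%:R * w ^+ k.-1 * v)) +
    normc (k%:R * w ^+ k.-1 * v ^+ 2)))).
    by rewrite ler_wpM2l ?exprn_ge0// le_normcD.
  rewrite mulrDr !normcM lerD//.
    rewrite mulrCA ler_pM// ?mulr_ge0 ?normc_ge0 ?exprn_ge0//.
  rewrite normc_nat !normcX; case: k ih => [|k] ih; first by rewrite !mul0r mulr0.
  have hk : normc w ^+ k <= s ^+ k by rewrite lerXn2r ?nnegrE ?normc_ge0.
  have -> : k.+1%:R * s ^+ k.+2 * normc v ^+ 2 = (s ^+ 2 * k.+1%:R * normc v ^+ 2) * s ^+ k.
    by rewrite !exprS; ring.
  have -> : s ^+ 2 * (k.+1%:R * normc w ^+ k * (normc v * normc v)) =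
     (s ^+ 2 * k.+1%:R * normc v ^+ 2) * normc w ^+ k by ring.
  by apply: ler_wpM2l hk; pos.
rewrite [s ^+ k.+1]exprS -natr1.
have := exprn_ge0 k s0; have := sqr_ge0 (normc v); have := ler0n R k.
set x := s ^+ k; set y := normc v ^+ 2; set m := k%:R => m0 y0 x0.
have : 0 <= s * x * y by pos.
have : 0 <= s * x * y * m by pos.
flra.
Qed.

(** Termwise differentiation: by [binom2] the remainders of the terms add up to at most
    [K * normc v ^+ 2]. The factor [k%:R ^+ 2] in them is absorbed by two enlargements of the
    radius, [s < s' < s'' < r]. *)
Lemma ps_deriv f z r c M : 0 < r -> psbound c M r -> hasps f z r c ->
  exists g, (forall w, normc w < r -> cD f (z + w) (g (z + w))) /\ hasps g z r (psdiff c).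
Proof.
move=> r0 hb hf.
have M0 : 0 <= M by have := hb 0%N; apply: le_trans; rewrite mulr_ge0 ?normc_ge0.
have hmid x : x < r -> x < (x + r) / 2 /\ (x + r) / 2 < r by split; lra.
have ex w : normc w < r -> exists S, gsum (fun k => psdiff c k * w ^+ k) S.
  move=> wr; have [a b] := hmid _ wr; have w0 := normc_ge0 w.
  have s0 : 0 < (normc w + r) / 2 by apply: le_lt_trans a.
  have [M' M'0 hM'] := psbound_diff s0 b hb.
  exact: gsum_ex (ratio01 a) (psterm_le w s0 hM').
exists (fun u => xget 0 [set S | gsum (fun k => psdiff c k * (u - z) ^+ k) S]).
have gP w : normc w < r -> gsum (fun k => psdiff c k * w ^+ k)
    (xget 0 [set S | gsum (fun k => psdiff c k * (z + w - z) ^+ k) S]).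
  have -> : z + w - z = w by ring.
  by move=> /ex[S hS]; case: xgetP => // /(_ S).
split; last exact: gP.
move=> w wr; set l := xget _ _; have hl := gP _ wr; rewrite -/l in hl.
have [a b] := hmid _ wr; have [_ b'] := hmid _ b; have [a' _] := hmid _ b.
set s := (normc w + r) / 2 in a b a' b'; have w0 := normc_ge0 w.
have s0 : 0 < s by apply: le_lt_trans a.
set s' := (s + r) / 2 in a' b'; set s'' := (s' + r) / 2.
have b'' : s'' < r by rewrite /s''; flra.
have a'' : s' < s'' by rewrite /s''; flra.
have [C1 C10 hC1] := natmul_geom (ltW s0) a'.
have s'0 : 0 < s' by apply: lt_trans a'.
have [C2 C20 hC2] := natmul_geom (ltW s'0) a''.
have s''0 : 0 < s'' by apply: lt_trans a''.
have th : 0 <= s'' / r < 1 by rewrite divr_ge0 ?ltW//= ltr_pdivrMr// mul1r.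
set K := M * C1 * C2 / (1 - s'' / r) / s ^+ 2.
have th1 : 0 <= 1 - s'' / r by case/andP: th => _; rewrite subr_ge0 => /ltW.
have K0 : 0 <= K by rewrite /K; pos.
move=> e e0; exists (Num.min (s - normc w) (e / (K + 1))).
  by rewrite lt_min subr_gt0 a divr_gt0// ltr_wpDl.
move=> v; rewrite lt_min => /andP[vs ve].
have wvs : normc (w + v) < s by apply: (le_lt_trans (le_normcD _ _)); flra.
have wvr : normc (w + v) < r by apply: lt_trans b.
suff H : normc (f (z + w + v) - f (z + w) - l * v) <= K * normc v ^+ 2.
  apply: (le_trans H); rewrite expr2 mulrA ler_wpM2r ?normc_ge0//.
  move: ve; rewrite ltr_pdivlMr ?ltr_wpDl// => ve; apply/ltW; apply: le_lt_trans ve.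
  by rewrite mulrC ler_wpM2l ?normc_ge0// lerDl.
have G : gsum (fun k => c k * ((w + v) ^+ k - w ^+ k - k%:R * w ^+ k.-1 * v))
   (f (z + w + v) - f (z + w) - l * v).
  have h1 := hf _ wvr; have h2 := hf _ wr; rewrite addrA in h1.
  have h3 : gsum (fun k => v * (k%:R * c k * w ^+ k.-1)) (v * l).
    apply: gsumZ; have := @gsum_shift R (fun k => k%:R * c k * w ^+ k.-1) l hl.
    by rewrite !mul0r add0r.
  have := gsumB (gsumB h1 h2) h3; rewrite [v * l]mulrC.
  by apply: gsum_ext => k; ring.
have -> : K * normc v ^+ 2 = (M * C1 * C2 / s ^+ 2 * normc v ^+ 2) / (1 - s'' / r).
  rewrite /K; set x := (1 - _)^-1; field; rewrite gt_eqF//.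
apply: (gsum_le th _ G) => k.
rewrite normcM -(ler_pM2l (exprn_gt0 2 s0)) mulrCA.
apply: (le_trans (ler_wpM2l (normc_ge0 _) (binom2 k (ltW a) (ltW wvs)))).
have -> : s ^+ 2 * (M * C1 * C2 / s ^+ 2 * normc v ^+ 2 * (s'' / r) ^+ k) =
   M * (C1 * C2 * s'' ^+ k) / r ^+ k * normc v ^+ 2.
  rewrite (expr_div_n s'' r k); move: (s'' ^+ k) (r ^+ k) (exprn_gt0 k r0) => X Y Y0.
  by field; rewrite !gt_eqF.
rewrite mulrA ler_wpM2r ?exprn_ge0 ?normc_ge0// ler_pdivlMr ?exprn_gt0//.
rewrite mulrAC; apply: ler_pM; [pos|pos|exact: hb|].
rewrite expr2 -mulrA; apply: (le_trans (ler_wpM2l (ler0n _ _) (hC1 k))).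
by rewrite mulrCA -[in leRHS]mulrA ler_wpM2l// ltW.
Qed.

End PowerSeries.

(** * Power series expansion of holomorphic functions *)

Section Cauchy.
Variable R : realType.
Implicit Types (f F g : R[i] -> R[i]) (z w v : R[i]) (r s M : R).

Lemma cD_uniq f z l m : cD f z l -> cD f z m -> l = m.
Proof.
move=> hl hm; have h := hasDB hl hm; apply/eqP; rewrite -subr_eq0 -normc_eq0.
rewrite eq_le normc_ge0 andbT; apply/ler_addgt0Pl => e e0; rewrite addr0.
have [d d0 hd] := h _ e0; have d2 : 0 < d / 2 by pos.
have := hd (d / 2)%:C; rewrite normcr gtr0_norm// => /(_ _)H.
have {}H := H (_ : d / 2 < d); rewrite !subrr sub0r normcN normcM normcr gtr0_norm// in H.
by rewrite ler_pM2r// in H; apply: H; lra.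
Qed.

Lemma cDV w : w != 0 -> cD (fun y => y^-1) w (- w ^- 2).
Proof.
move=> w0 e e0; have nw : 0 < normc w by rewrite normc_gt0.
exists (Num.min (normc w / 2) (e * normc w ^+ 3 / 2)).
  by rewrite lt_min; apply/andP; split; pos.
move=> v; rewrite lt_min => /andP[v1 v2].
have wv : normc w / 2 <= normc (w + v).
  have := normcB (w + v) v; rewrite addrK; lra.
have wv0 : w + v != 0 by rewrite -normc_gt0; apply: lt_le_trans wv; pos.
have -> : (w + v)^-1 - w^-1 - - w ^- 2 * v = v ^+ 2 / (w ^+ 2 * (w + v)).
  by field; rewrite wv0.
have D0 : 0 < normc w ^+ 2 * normc (w + v).
  by apply: mulr_gt0; [pos|apply: lt_le_trans wv; pos].
rewrite normcM normcV (normcM (w ^+ 2)) !normcX ler_pdivrMr// expr2 mulrAC ler_wpM2r ?normc_ge0//.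
apply: (le_trans (ltW v2)); rewrite -[e * _ / 2]mulrA.
have -> : normc w ^+ 3 / 2 = normc w ^+ 2 * (normc w / 2) by field.
by rewrite ler_pM2l// ler_wpM2l// sqr_ge0.
Qed.

(** The mean value inequality for [F] minus its quadratic polynomial on the segment from [z] to
    [z + v]. It makes a difference quotient of [F] differentiable at its singular point. *)
Lemma cD_taylor2 F f z r l : 0 < r -> (forall w, normc w < r -> cD F (z + w) (f (z + w))) ->
  cD f z l -> forall e, 0 < e -> exists2 d, 0 < d & forall v, normc v < d ->
  normc (F (z + v) - F z - f z * v - l / 2 * v ^+ 2) <= e * normc v ^+ 2.
Proof.
move=> r0 hF hl e e0; have [d d0 hd] := hl _ e0.
exists (Num.min r d); first by rewrite lt_min r0.
move=> v; rewrite lt_min => /andP[vr vd].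
pose G (t : R) := F (z + t%:C * v) - f z * (t%:C * v) - l / 2 * (t%:C * v) ^+ 2.
have tv (t : R) : 0 <= t <= 1 -> normc (t%:C * v) <= normc v.
  by move=> /andP[t0 t1]; rewrite normcM normcr ger0_norm// ler_piMl ?normc_ge0.
have : normc (G 1 - G 0) <= e * normc v ^+ 2 * (1 - 0).
  apply: (@rD_mean_value R G (fun t => (f (z + t%:C * v) - f z - l * (t%:C * v)) * v) 0 1) => //.
    move=> t t01; have h1 := hasD_comp (rD_line z v t) (hF _ (le_lt_trans (tv _ t01) vr)).
    have h2 : rD (fun s => s%:C * v) t v.
      by apply: hasD_ext (rD_line 0 v t) => s; rewrite add0r.
    have h3 := hasD_comp h2 (cDX 2 (t%:C * v)).
    apply: hasD_eq (hasDB (hasDB h1 (hasDZ (f z) h2)) (hasDZ (l / 2) h3)) _.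
    by rewrite /= expr1; field.
  move=> t t01; have tvv := tv _ t01; have -> : e * normc v ^+ 2 = (e * normc v) * normc v by ring.
  rewrite normcM; apply: ler_wpM2r; first exact: normc_ge0.
  apply: (le_trans (hd _ (le_lt_trans tvv vd))); by rewrite ler_wpM2l// ltW.
by rewrite subr0 mulr1 /G !mul1r !mul0r addr0 mulr0 expr0n mulr0 !subr0 => H;
  apply: le_trans H; rewrite le_eqVlt; apply/orP; left; apply/eqP; congr normc; ring.
Qed.

Lemma normc_bounded (g : R -> R[i]) a b : a <= b -> rcont g ->
  exists2 M, 0 <= M & forall t, a <= t <= b -> normc (g t) <= M.
Proof.
move=> ab cg; have cn : {within `[a, b], continuous (fun t => normc (g t))}.
  apply: continuous_subspaceT => t; apply/cvgrPdist_lt => e e0.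
  have [d d0 hd] := cg t _ e0; exists d => // s; rewrite /ball_/= distrC => ts.
  have := hd _ ts; rewrite (addrC t) subrK => H.
  have H1 := normcB (g s) (g s - g t); have H2 := le_normcD (g s - g t) (g t).
  rewrite ltr_norml; apply/andP; split.
    by move: H2; rewrite subrK; flra.
  by move: H1; rewrite opprB addrC subrK; flra.
have [c _ hc] := EVT_max ab cn; exists (normc (g c)); first exact: normc_ge0.
by move=> t tab; apply: hc; rewrite in_itv.
Qed.

Lemma hasD_rcont (g dg : R -> R[i]) : (forall t, rD g t (dg t)) -> rcont g.
Proof.
move=> h t e e0; have [d d0 hd] := hasD_cont (h t) e0.
by exists d => // s; rewrite -normcr => /hd.
Qed.

(** This is exp(-it), with the minus sign: its conjugate runs counterclockwise around the circle,
    and it is itself the reciprocal. *)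
Definition cis (t : R) : R[i] := Complex (cos t) (- sin t).

Lemma normc_cis t : normc (cis t) = 1.
Proof. by rewrite /normc /cis sqrrN cos2Dsin2 sqrtr1. Qed.

Lemma cis_deriv t : rD cis t (- 'i * cis t).
Proof.
have := rD_pair (is_derive_cos t) (@is_deriveN _ _ _ _ _ _ _ (is_derive_sin t)).
move=> h; apply: (@hasD_ext _ _ _ (fun x => Complex (cos x) ((- sin)%R x))) => //.
by apply: hasD_eq h _; rewrite /cis; simpc.
Qed.

Lemma cis_mul_conj t : cis t * (cis t)^* = 1.
Proof. by rewrite mulc_conj normc_cis expr1n. Qed.

Lemma cis_conj_deriv t : rD (fun s => (cis s)^*) t ('i * (cis t)^*).
Proof.
have := rD_pair (is_derive_cos t) (is_derive_sin t).
move=> h; apply: (@hasD_ext _ _ _ (fun x => Complex (cos x) (sin x))).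
  by move=> y; rewrite /cis; simpc.
by apply: hasD_eq h _; rewrite /cis; simpc.
Qed.

(** The n-th coefficient is the mean over the circle of [F] times [om ^+ n], the reciprocal power of
    [cc]. The partial sums are compared directly with the value at [z + w]: the difference quotient
    of [F] at this point is holomorphic in the disc, hence has a primitive and contributes nothing
    over a full turn. That it is differentiable at the point itself uses the derivative of [f],
    which is why the expansion is first proved for a function with holomorphic derivative. *)
Lemma cauchy_ps_prim F f z r rho : 0 < rho -> rho < r ->
  (forall w, disc z r w -> cD F w (f w)) -> (forall w, disc z r w -> exists l, cD f w l) ->
  exists c M, psbound c M rho /\ hasps F z rho c.
Proof.
move=> rho0 rhor hF hf.
pose cc (t : R) := rho%:C * (cis t)^*.
have ncc t : normc (cc t) = rho by rewrite normcM normc_conj normc_cis normcr mulr1 gtr0_norm.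
have dcc t : rD cc t ('i * cc t).
  by apply: hasD_eq (hasDZ _ (cis_conj_deriv t)) _; rewrite /cc; ring.
have Dcc t : disc z r (z + cc t) by rewrite /disc/= addrAC subrr add0r ncc.
pose phi t := F (z + cc t).
have dphi t : rD phi t (f (z + cc t) * ('i * cc t)).
  have := hasD_comp (hasDD (hasD_cst (fun x : R => x%:C) z t) (dcc t)) (hF _ (Dcc t)).
  by rewrite add0r.
have rhoC : rho%:C != 0 by rewrite eq_complex /= gt_eqF.
pose om t := (rho%:C)^-1 * cis t.
have ccom t : cc t * om t = 1.
  by rewrite /cc /om -[RHS](cis_mul_conj t); field.
have nom t : normc (om t) = rho^-1.
  by rewrite normcM normcV normc_cis mulr1 normcr gtr0_norm.
have dom t : rD om t (- 'i * om t).
  by apply: hasD_eq (hasDZ _ (cis_deriv t)) _; rewrite /om; ring.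
have domn n t : rD (fun s => om s ^+ n) t (- 'i * n%:R * om t ^+ n).
  apply: hasD_eq (hasD_comp (dom t) (cDX n _)) _.
  by case: n => [|n] /=; rewrite ?exprS; ring.
have twopi : 0 <= 2 * pi :> R by rewrite mulr_ge0// pi_ge0.
have [M M0 hM] := normc_bounded twopi (hasD_rcont dphi).
have [G hG] : exists G : nat -> R -> R[i], forall n t, 0 <= t <= 2 * pi -> rD (G n) t (phi t * om t ^+ n).
  have : forall n, exists G : R -> R[i], forall t, 0 <= t <= 2 * pi -> rD G t (phi t * om t ^+ n).
    move=> n; apply: curve_primitive.
    exact: hasD_rcont (fun t => hasDM (dphi t) (domn n t)).
  by move=> /choice[G hG]; exists G.
have pi0 : 0 < 2 * pi :> R by rewrite mulr_gt0// pi_gt0.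
have piC : (2 * pi)%:C != 0 :> R[i] by rewrite eq_complex /= gt_eqF.
exists (fun n => ((2 * pi)%:C)^-1 * (G n (2 * pi) - G n 0)), M; split.
  move=> n; rewrite normcM normcV normcr gtr0_norm// -mulrA ler_pdivrMl//.
  have : normc (G n (2 * pi) - G n 0) <= M * rho ^- n * (2 * pi - 0).
    apply: (rD_mean_value twopi (hG n)) => t /hM {}hM.
    by rewrite normcM normcX nom exprVn ler_wpM2r// invr_ge0 exprn_ge0// ltW.
  rewrite subr0 => H; have rn : 0 < rho ^+ n by pos.
  rewrite -ler_pdivlMr//; apply: (le_trans H).
  by rewrite le_eqVlt; apply/orP; left; apply/eqP; rewrite mulrC mulrA.
move=> w wr; set zz := z + w.
have Dzz : disc z r zz by rewrite /disc/= /zz addrAC subrr add0r (lt_trans wr).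
pose g v := if v == zz then f zz else (F v - F zz) / (v - zz).
have hg v : disc z r v -> exists l, cD g v l.
  move=> Dv; have [->|nv] := eqVneq v zz.
    have [l hl] := hf _ Dzz; exists (l / 2) => e e0.
    have [d1 d10 h1] := disc_near Dzz.
    have [d d0 hd] := cD_taylor2 d10 (fun w hw => hF _ (h1 w hw)) hl e0.
    exists d => // x xd; have [->|x0] := eqVneq x 0.
      by rewrite addr0 subrr mulr0 subrr normc0 mulr0.
    have E1 : zz + x - zz = x by ring.
    rewrite /g eqxx -subr_eq0 E1 (negbTE x0).
    have nx : 0 < normc x by rewrite normc_gt0.
    rewrite -(ler_pM2r nx) -normcM; have -> : e * normc x * normc x = e * normc x ^+ 2 by ring.
    apply: le_trans (hd _ xd); rewrite le_eqVlt; apply/orP; left; apply/eqP.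
    by congr normc; field.
  have [d1 d10 h1] : exists2 d : R, 0 < d & forall x, normc x < d -> v + x != zz.
    exists (normc (v - zz)); first by rewrite normc_gt0 subr_eq0.
    move=> x xd; apply: contraTneq xd => <-.
    by rewrite opprD addrA subrr add0r normcN ltxx.
  have nv0 : v - zz != 0 by rewrite subr_eq0.
  have hh := hasDB (cD_id v) (hasD_cst id zz v).
  have := hasDM (hasDB (hF _ Dv) (hasD_cst id (F zz) v)) (hasD_comp hh (cDV nv0)).
  move=> H; eexists; apply: (hasD_near d10 _ _ H); rewrite /g ?(negbTE nv)//.
  by move=> x /h1/negbTE ->.
have [Ga hGa] := disc_primitive hg.
set th := normc w / rho.
have th01 : 0 <= th < 1 := ratio01 wr.
have [th0 th1] := andP th01.
set A := M + normc (F zz).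
exists (A / (1 - th)), th; split => // N.
pose u t := w * om t.
have nu t : normc (u t) = th by rewrite normcM nom.
have u1 t : 1 - u t != 0.
  rewrite -normc_gt0; have := normcB 1 (1 - u t); have := le_normcD (1 - u t) (u t).
  by rewrite subrK nu normc1; flra.
(* Primitives of the powers of [w * om t]. Only the one for [n = 0] is not periodic, and it produces
   the value [F zz]. *)
pose P (n : nat) (t : R) : R[i] := if n is 0%N then t%:C else w ^+ n * ('i / n%:R) * om t ^+ n.
have dP n t : rD (P n) t (w ^+ n * om t ^+ n).
  case: n => [|n]; first by rewrite !expr0 mulr1; exact: rD_id.
  apply: hasD_eq (hasDZ _ (domn n.+1 t)) _.
  have -> : w ^+ n.+1 * ('i / n.+1%:R) * (- 'i * n.+1%:R * om t ^+ n.+1) =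
    - ('i ^+ 2) * (n.+1%:R / n.+1%:R) * (w ^+ n.+1 * om t ^+ n.+1) by ring.
  by rewrite sqr_i opprK mulfV ?mulr1 ?mul1r// pnatr_eq0.
(* Its derivative is [F zz - phi t] times the tail of a geometric series, of size [th ^+ N]. Its
   increment over a period is [2 * pi] times the partial sum minus [F zz] (for [N > 0]), because
   [Ga] returns to its initial value. *)
pose H t := \sum_(n < N) (w ^+ n * G n t - F zz * P n t) - (- 'i) * Ga (z + cc t).
have dsum (I : nat) (h : nat -> R -> R[i]) (dh : nat -> R[i]) t :
   (forall n, rD (h n) t (dh n)) -> rD (fun t => \sum_(n < I) h n t) t (\sum_(n < I) dh n).
  move=> hh; elim: I => [|I ih].
    rewrite big_ord0; apply: (hasD_ext _ (hasD_cst _ 0 t)) => y; by rewrite big_ord0.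
  rewrite big_ord_recr /=; apply: (hasD_ext _ (hasDD ih (hh I))) => y.
  by rewrite big_ord_recr.
have dH t : 0 <= t <= 2 * pi -> rD H t (- ((phi t - F zz) * u t ^+ N / (1 - u t))).
  move=> t02; have h1 := dsum N (fun n t => w ^+ n * G n t - F zz * P n t) _ t
     (fun n => hasDB (hasDZ (w ^+ n) (hG n t t02)) (hasDZ (F zz) (dP n t))).
  have h2 := hasD_comp (hasDD (hasD_cst (fun x : R => x%:C) z t) (dcc t)) (hGa _ (Dcc t)).
  apply: hasD_eq (hasDB h1 (hasDZ (- 'i) h2)) _.
  have -> : \sum_(n < N) (w ^+ n * (phi t * om t ^+ n) - F zz * (w ^+ n * om t ^+ n)) =
     (phi t - F zz) * \sum_(n < N) u t ^+ n.
    by rewrite mulr_sumr; apply: eq_bigr => n _; rewrite /u (exprMn n w (om t));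
      move: (w ^+ n) ((om t) ^+ n) (phi t) (F zz) => *; ring.
  have -> : \sum_(n < N) u t ^+ n = (1 - u t ^+ N) / (1 - u t).
    by apply: (mulIf (u1 t)); rewrite divfK// mulrC -opprB mulNr -subrX1 opprB.
  have ne : z + cc t != zz.
    rewrite /zz (inj_eq (addrI _)); apply: contraTneq wr => <-.
    by rewrite ncc ltxx.
  rewrite add0r /g (negbTE ne).
  have cw : cc t - w != 0 by rewrite subr_eq0 -(inj_eq (addrI z)).
  have E : z + cc t - zz = cc t * (1 - u t).
    rewrite mulrBr mulr1 /u mulrCA ccom mulr1 /zz; move: (cc t) => *; ring.
  have c0 : cc t != 0 by rewrite -normc_gt0 ncc.
  rewrite E -/(phi t).
  have -> : - 'i * ((phi t - F zz) / (cc t * (1 - u t)) * ('i * cc t)) =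
    - ('i ^+ 2) * ((phi t - F zz) / (1 - u t)).
    by move: (cc t) (u t) (phi t) (F zz) c0 (u1 t) => c' u' p' f' c0' u0'; field; rewrite ?c0' ?u0'.
  rewrite sqr_i; move: (u t) (phi t) (F zz) (u1 t) => u' p' f' u0'.
  by rewrite opprK mul1r; field.
have cc2 : cc (2 * pi) = cc 0.
  by rewrite /cc /cis mulr_natl mulr2n -(add0r (pi + pi)) addrA !cosDpi !sinDpi !opprK.
have om2 : om (2 * pi) = om 0.
  by rewrite /om /cis mulr_natl mulr2n -(add0r (pi + pi)) addrA !cosDpi !sinDpi !opprK.
have : normc (H (2 * pi) - H 0) <= A * th ^+ N / (1 - th) * (2 * pi - 0).
  apply: (rD_mean_value twopi dH) => t t02.
  rewrite normcN normcM normcV normcM normcX nu.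
  have p1 : 0 < 1 - th by flra.
  have q1 : 1 - th <= normc (1 - u t).
    have := le_normcD (1 - u t) (u t); rewrite subrK nu normc1; flra.
  apply: ler_pM; [pos|by rewrite invr_ge0 normc_ge0| |by rewrite lef_pV2 ?posrE// (lt_le_trans p1)].
  rewrite ler_wpM2r ?exprn_ge0//; apply: (le_trans (normcB _ _)).
  by rewrite lerD2r; exact: hM.
rewrite subr0 /H cc2 => K.
have E : \sum_(n < N) (w ^+ n * G n (2 * pi) - F zz * P n (2 * pi)) - - 'i * Ga (z + cc 0) -
  (\sum_(n < N) (w ^+ n * G n 0 - F zz * P n 0) - - 'i * Ga (z + cc 0)) =
  (2 * pi)%:C * (\sum_(n < N) ((2 * pi)%:C^-1 * (G n (2 * pi) - G n 0) * w ^+ n)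
     - F zz * (0 < N)%N%:R).
  have cancel (x y a : R[i]) : x - a - (y - a) = x - y by ring.
  rewrite cancel -sumrB mulrBr mulr_sumr.
  have -> : (2 * pi)%:C * (F zz * (0 < N)%N%:R) = \sum_(n < N) F zz * (P n (2 * pi) - P n 0).
    case: N {H dH K} => [|N]; first by rewrite big_ord0 !mulr0.
    rewrite big_ord_recl big1 /= => [|i _]; last by rewrite om2 subrr mulr0.
    by rewrite addr0 mulr1 subr0 mulrC.
  rewrite -sumrB; apply: eq_bigr => n _.
  move: (2 * pi)%:C piC (P n (2 * pi)) (P n 0) (G n (2 * pi)) (G n 0) => *; field.
  by [].
move: K; rewrite E normcM normcr gtr0_norm// mulrC ler_pM2r//.
(* For [N = 0] the identity lacks the term [F zz]; the claim is then only the bound of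
   [normc (F zz)] by [A / (1 - th)]. *)
case: N {H dH E} => [|N] K; last first.
  by rewrite mulrAC -normcN opprB -[F zz]mulr1.
rewrite big_ord0 subr0 expr0 mulr1 /A ler_pdivlMr ?subr_gt0//.
have := normc_ge0 (F zz); nra.
Qed.

(** [f] is the derivative of a primitive, to which the previous expansion applies; the midpoint
    radius leaves room for the termwise differentiation. *)
Lemma cauchy_ps f z r rho : 0 < rho -> rho < r ->
  (forall w, disc z r w -> exists l, cD f w l) ->
  exists c M, psbound c M rho /\ hasps f z rho c.
Proof.
move=> rho0 rhor hf; have [F hF] := disc_primitive hf.
have r1 : (rho + r) / 2 < r by lra.
have r2 : rho < (rho + r) / 2 by lra.
have r3 : 0 < (rho + r) / 2 by lra.
have [c [M [hM hc]]] := cauchy_ps_prim r3 r1 hF hf.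
have [g [hg1 hg2]] := ps_deriv r3 hM hc.
have [M' _ hM'] := psbound_diff rho0 r2 hM.
exists (psdiff c), M'; split => // w wr.
have wr' := lt_trans wr r2.
suff -> : f (z + w) = g (z + w) by exact: hg2.
have Dw : disc z r (z + w) by rewrite /disc/= addrAC subrr add0r (lt_trans wr').
exact: cD_uniq (hF _ Dw) (hg1 _ wr').
Qed.

End Cauchy.

(** * Cauchy products and power series solutions of a linear equation of order four *)

Section CauchyProduct.
Variable R : realType.
Implicit Types (t : nat -> R[i]) (S : R[i]) (M th : R).

Lemma tri_sum t t' N : \sum_(n < N) \sum_(k < n.+1) t k * t' (n - k)%N =
  \sum_(k < N) t k * \sum_(j < N - k) t' j.
Proof.
elim: N => [|N ih]; first by rewrite !big_ord0.
rewrite big_ord_recr/= ih.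
have -> : \sum_(k < N.+1) t k * \sum_(j < N.+1 - k) t' j =
  \sum_(k < N.+1) t k * \sum_(j < N - k) t' j + \sum_(k < N.+1) t k * t' (N - k)%N.
  rewrite -big_split; apply: eq_bigr => k _ /=; rewrite -mulrDr subSn; last by rewrite -ltnS.
  by rewrite big_ord_recr.
congr (_ + _); rewrite [RHS]big_ord_recr/= subnn.
by rewrite [X in _ + _ * X]big_ord0 mulr0 addr0.
Qed.

Lemma normc_sum (I : nat) (u : nat -> R[i]) : normc (\sum_(k < I) u k) <= \sum_(k < I) normc (u k).
Proof.
elim: I => [|I ih]; first by rewrite !big_ord0 normc0.
by rewrite !big_ord_recr/= (le_trans (le_normcD _ _))// lerD.
Qed.

(** Mertens' argument with rates: [tri_sum] writes the partial sum through partial sums of the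
    second series. This leaves [N] errors of order [s ^+ N], and the factor [N] is absorbed by a
    larger ratio [r]. *)
Lemma gsum_prod t S t' S' M th : 0 <= th < 1 -> (forall k, normc (t k) <= M * th ^+ k) ->
  gsum t S -> gsum t' S' ->
  gsum (fun n => \sum_(k < n.+1) t k * t' (n - k)%N) (S * S').
Proof.
move=> th01 ht [M1 [th1 [h1 H1]]] [M2 [th2 [h2 H2]]].
have /andP[th0 thl] := th01; have /andP[th10 th1l] := h1; have /andP[th20 th2l] := h2.
have M10 := gsum_rate H1; have M20 := gsum_rate H2.
have M0 : 0 <= M by have := ht 0%N; rewrite expr0 mulr1; apply: le_trans; exact: normc_ge0.
set s := Num.max th (Num.max th1 th2).
have s1 : th <= s by rewrite le_max lexx.
have s2 : th1 <= s by rewrite !le_max lexx orbT.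
have s3 : th2 <= s by rewrite !le_max lexx !orbT.
have s0 : 0 <= s by apply: le_trans s1.
have sl : s < 1 by rewrite !gt_max thl th1l.
have pw x n : 0 <= x -> x <= s -> x ^+ n <= s ^+ n.
  by move=> x0 xs; rewrite lerXn2r ?nnegrE.
have [r [sr rl]] : exists r, s < r /\ r < 1 by exists ((s + 1) / 2); split; flra.
have r0 : 0 <= r by apply: le_trans (ltW sr).
have [C C0 hC] := natmul_geom s0 sr.
exists (M * M2 * C + M1 * normc S'), r; split; first by rewrite r0.
move=> N; rewrite tri_sum.
have -> : S * S' - \sum_(k < N) t k * \sum_(j < N - k) t' j =
  \sum_(k < N) t k * (S' - \sum_(j < N - k) t' j) + (S - \sum_(k < N) t k) * S'.
  under [X in _ = X + _]eq_bigr do rewrite mulrBr.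
  rewrite sumrB -mulr_suml mulrBl; ring.
apply: (le_trans (le_normcD _ _)); rewrite [leRHS]mulrDl; apply: lerD.
  apply: (le_trans (normc_sum _ (fun k => t k * (S' - \sum_(j < N - k) t' j)))).
  apply: (@le_trans _ _ (\sum_(k < N) M * M2 * s ^+ N)).
    apply: ler_sum => k _; rewrite normcM.
    have -> : M * M2 * s ^+ N = (M * s ^+ k) * (M2 * s ^+ (N - k)).
      by rewrite -{1}(subnKC (ltnW (ltn_ord k))) exprD; ring.
    apply: ler_pM; [pos|pos| |].
      by apply: (le_trans (ht k)); rewrite ler_wpM2l// pw.
    by apply: (le_trans (H2 _)); rewrite ler_wpM2l// pw.
  rewrite sumr_const card_ord -mulr_natl -mulrA.
  have -> : N%:R * (M * (M2 * s ^+ N)) = M * M2 * (N%:R * s ^+ N) by ring.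
  by rewrite -[leRHS]mulrA; apply: ler_wpM2l; [pos|].
rewrite normcM mulrAC ler_wpM2r ?normc_ge0//.
apply: (le_trans (H1 N)); rewrite ler_wpM2l//.
by apply: (le_trans (pw _ _ th10 s2)); rewrite lerXn2r ?nnegrE// ltW.
Qed.

End CauchyProduct.

Section LinearODE.
Variable R : realType.
Implicit Types (a b : nat -> R[i]) (y : nat -> R[i]) (r s M : R).

(** Course-of-values recursion: [F n] is a table whose first [n] entries are final. *)
Lemma strong_rec (T : Type) (x0 : T) (Psi : nat -> (nat -> T) -> T) :
  (forall n u v, (forall k, (k < n)%N -> u k = v k) -> Psi n u = Psi n v) ->
  exists y : nat -> T, forall n, y n = Psi n y.
Proof.
move=> ext; pose F := fix F n := if n is n'.+1 then
  (fun k => if k == n' then Psi n' (F n') else F n' k) else (fun=> x0).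
have FE n k : (k < n)%N -> F n k = F k.+1 k.
  elim: n => // n ih; rewrite ltnS leq_eqVlt => /orP[/eqP ->//|kn].
  by rewrite {1}/F -/F ltn_eqF// ih.
exists (fun n => F n.+1 n) => n; rewrite {1}/F -/F eqxx; apply: ext => k kn.
exact: FE.
Qed.

(** The recurrence for the Taylor coefficients of a solution of [Y'''' = a Y'' + b Y], with both
    products expanded as Cauchy products. *)
Definition odestep a b (n : nat) (u : nat -> R[i]) : R[i] :=
  (\sum_(k < n.+1) a k * ((n - k).+1%:R * ((n - k).+2%:R * u (n - k).+2))
   + \sum_(k < n.+1) b k * u (n - k)%N)
  / (n.+1%:R * (n.+2%:R * (n.+3%:R * n.+4%:R))).

Lemma ode_coef a b (y0 y1 y2 y3 : R[i]) : exists y,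
  [/\ y 0%N = y0, y 1%N = y1, y 2%N = y2, y 3%N = y3 & forall n, y n.+4 = odestep a b n y].
Proof.
have [|y hy] := @strong_rec _ (0 : R[i]) (fun n u => match n with
  | 0 => y0 | 1 => y1 | 2 => y2 | 3 => y3 | n.+4 => odestep a b n u end).
  move=> [|[|[|[|n]]]] u v h //; rewrite /odestep; congr ((_ + _) / _).
    apply: eq_bigr => k _; rewrite h//.
    by rewrite !ltnS (leq_trans (leq_subr _ _))// ltnW.
  apply: eq_bigr => k _; rewrite h//.
  by rewrite (leq_ltn_trans (leq_subr _ _))// -addn4 -[X in (X < _)%N]addn0 ltn_add2l.
by exists y; split => [||||n]; rewrite hy.
Qed.

Lemma pow_split s n k j : (k <= n)%N -> (j <= 4)%N ->
  s ^+ n.+4 = s ^+ (4 - j) * s ^+ k * s ^+ ((n - k) + j)%N.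
Proof. by move=> kn j4; rewrite -!exprD; congr GRing.exp; lia. Qed.

(** If the earlier coefficients satisfy the bound with constant [C], the recurrence gives the next
    one with constant [C * K / (n.+3%:R * n.+4%:R)], hence with [C] again once [n >= n0]. [C] is the
    sum that covers the first [n0.+4] coefficients. *)
Lemma ode_bound a b y M r s : 0 < s -> s < r -> psbound a M r -> psbound b M r ->
  (forall n, y n.+4 = odestep a b n y) -> exists C, psbound y C s.
Proof.
move=> s0 sr ha hb hy; have r0 : 0 < r by apply: lt_trans sr.
have M0 : 0 <= M by have := ha 0%N; apply: le_trans; rewrite mulr_ge0 ?normc_ge0.
set th := s / r; have th01 : 0 <= th < 1.
  by rewrite /th divr_ge0 ?ltW//= ltr_pdivrMr// mul1r.
have th1 : 0 < 1 - th by rewrite subr_gt0; case/andP: th01.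
have th0 : 0 <= th by case/andP: th01.
have coefs c : psbound c M r -> forall k, normc (c k) * s ^+ k <= M * th ^+ k.
  move=> hc k; have rk : 0 < r ^+ k by pos.
  have -> : M * th ^+ k = M * s ^+ k / r ^+ k by rewrite /th expr_div_n mulrA.
  rewrite ler_pdivlMr// mulrAC; apply: ler_wpM2r; [pos|exact: hc].
set K := M * (s ^+ 2 + s ^+ 4) / (1 - th).
have K0 : 0 <= K by rewrite /K; pos.
pose n0 := (Num.truncn K).+1.
have n0K : K <= n0%:R by rewrite ltW// truncnS_gt.
pose C := \sum_(m < n0.+4) normc (y m) * s ^+ m.
have C0 : 0 <= C by apply: sumr_ge0 => i _; pos.
exists C => n; elim/ltn_ind: n => n ih.
have [nn|nn] := ltnP n n0.+4.
  by rewrite /C (bigD1 (Ordinal nn))//= lerDl sumr_ge0// => i _; pos.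
case: n ih nn => [|[|[|[|n]]]]// ih; rewrite !ltnS => nn.
have c0 (m : nat) : 0 < m.+1%:R :> R by rewrite ltr0n.
have D0 : 0 < n.+1%:R * (n.+2%:R * (n.+3%:R * n.+4%:R)) :> R by pos.
rewrite hy /odestep normcM normcV !normcM !normc_nat mulrAC ler_pdivrMr//.
apply: (@le_trans _ _ (C * (n.+1%:R * n.+2%:R) * K)); last first.
  have -> : C * (n.+1%:R * (n.+2%:R * (n.+3%:R * n.+4%:R))) =
     C * (n.+1%:R * n.+2%:R) * (n.+3%:R * n.+4%:R) :> R by ring.
  apply: ler_wpM2l; first by pos.
  apply: (le_trans n0K); rewrite -natrM ler_nat (leq_trans nn)//.
  by rewrite (leq_trans _ (leq_pmulr _ _))// -addn3 leq_addr.
have E (u : nat -> R) : (forall k : 'I_n.+1, u k <= M * th ^+ k) ->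
   \sum_(k < n.+1) u k <= M / (1 - th).
  move=> hu; apply: (@le_trans _ _ (\sum_(k < n.+1) M * th ^+ k)); first exact: ler_sum.
  by rewrite -mulr_sumr ler_wpM2l// geom_sum_le.
have m12 : 1 <= n.+1%:R * n.+2%:R :> R by rewrite -natrM ler1n.
have p12 : 0 < n.+1%:R * n.+2%:R :> R by pos.
apply: (@le_trans _ _ (\sum_(k < n.+1) normc (a k * ((n - k).+1%:R * ((n - k).+2%:R * y (n - k).+2))) * s ^+ n.+4
   + \sum_(k < n.+1) normc (b k * y (n - k)%N) * s ^+ n.+4)).
  rewrite -[X in _ <= X + _]mulr_suml -[X in _ <= _ + X]mulr_suml -mulrDl.
  apply: ler_wpM2r; first by pos.
  apply: (le_trans (le_normcD _ _)); apply: lerD.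
    exact: (normc_sum _ (fun k => a k * ((n - k).+1%:R * ((n - k).+2%:R * y (n - k).+2)))).
  exact: (normc_sum _ (fun k => b k * y (n - k)%N)).
have -> : C * (n.+1%:R * n.+2%:R) * K = C * (n.+1%:R * n.+2%:R) * s ^+ 2 * (M / (1 - th)) +
  C * (n.+1%:R * n.+2%:R) * s ^+ 4 * (M / (1 - th)).
  by rewrite /K; move: (1 - th)^-1 => x; ring.
apply: lerD.
  apply: (@le_trans _ _ (\sum_(k < n.+1) C * (n.+1%:R * n.+2%:R) * s ^+ 2 * (normc (a k) * s ^+ k))).
    apply: ler_sum => k _; have kn : (k <= n)%N by rewrite -ltnS.
    have -> : s ^+ n.+4 = s ^+ 2 * s ^+ k * s ^+ (n - k).+2.
      by rewrite (@pow_split s n k 2 kn isT) addn2.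
    rewrite !normcM !normc_nat.
    have h1 := ih (n - k).+2 _; have {}h1 : normc (y (n - k).+2) * s ^+ (n - k).+2 <= C.
      by apply: h1; rewrite !ltnS (leq_trans (leq_subr _ _))// leqW.
    have h2 : (n - k).+1%:R * (n - k).+2%:R <= n.+1%:R * n.+2%:R :> R.
      by rewrite -!natrM ler_nat leq_mul// !ltnS leq_subr.
    have -> : normc (a k) * ((n - k).+1%:R * ((n - k).+2%:R * normc (y (n - k).+2))) *
      (s ^+ 2 * s ^+ k * s ^+ (n - k).+2) =
      ((normc (y (n - k).+2) * s ^+ (n - k).+2) * ((n - k).+1%:R * (n - k).+2%:R)) *
      (s ^+ 2 * (normc (a k) * s ^+ k)) by ring.
    rewrite -[leRHS]mulrA; apply: ler_wpM2r; first by pos.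
    by apply: ler_pM => //; pos.
  rewrite -mulr_sumr; apply: ler_wpM2l; first by pos.
  by apply: (E (fun k => normc (a k) * s ^+ k)) => k; exact: coefs.
apply: (@le_trans _ _ (\sum_(k < n.+1) C * (n.+1%:R * n.+2%:R) * s ^+ 4 * (normc (b k) * s ^+ k))).
  apply: ler_sum => k _; have kn : (k <= n)%N by rewrite -ltnS.
  have -> : s ^+ n.+4 = s ^+ 4 * s ^+ k * s ^+ (n - k).
    by rewrite (@pow_split s n k 0 kn isT) addn0.
  rewrite !normcM.
  have h1 := ih (n - k)%N _; have {}h1 : normc (y (n - k)%N) * s ^+ (n - k) <= C.
    by apply: h1; rewrite ltnS (leq_trans (leq_subr _ _))// -addn3 leq_addr.
  have -> : normc (b k) * normc (y (n - k)%N) * (s ^+ 4 * s ^+ k * s ^+ (n - k)) =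
    (normc (y (n - k)%N) * s ^+ (n - k) * 1) * (s ^+ 4 * (normc (b k) * s ^+ k)) by ring.
  rewrite -[leRHS]mulrA; apply: ler_wpM2r; first by pos.
  by apply: ler_pM => //; pos.
rewrite -mulr_sumr; apply: ler_wpM2l; first by pos.
by apply: (E (fun k => normc (b k) * s ^+ k)) => k; exact: coefs.
Qed.

Lemma gsum0 (t : nat -> R[i]) (S : R[i]) : gsum t S -> (forall k, t k.+1 = 0) -> S = t 0%N.
Proof.
move=> h h0; apply: (gsum_uniq h); exists (normc (t 0%N)), 0; split; first by rewrite lexx ltr01.
case=> [|n]; first by rewrite big_ord0 subr0 expr0 mulr1.
by rewrite big_ord_recl big1 ?addr0 ?subrr ?normc0 ?expr0n ?mulr0// => i _; exact: h0.
Qed.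

Lemma hasps0 f z r c : 0 < r -> hasps f z r c -> f z = c 0%N.
Proof.
move=> r0 h; have := h 0; rewrite normc0 => /(_ r0); rewrite addr0 => /gsum0 ->.
  by rewrite expr0 mulr1.
by move=> k; rewrite expr0n mulr0.
Qed.

Lemma ode_solution (fa fb : R[i] -> R[i]) z a b M r s (y0 y1 y2 y3 : R[i]) :
  0 < s -> s < r -> psbound a M r -> psbound b M r -> hasps fa z r a -> hasps fb z r b ->
  exists Y Y1 Y2 Y3 Y4 : R[i] -> R[i],
  [/\ Y z = y0, Y1 z = y1, Y2 z = y2 & Y3 z = y3] /\
  forall w, normc w < s -> [/\ cD Y (z + w) (Y1 (z + w)), cD Y1 (z + w) (Y2 (z + w)),
    cD Y2 (z + w) (Y3 (z + w)), cD Y3 (z + w) (Y4 (z + w)) &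
    Y4 (z + w) = fa (z + w) * Y2 (z + w) + fb (z + w) * Y (z + w)].
Proof.
move=> s0 sr ha hb hfa hfb.
have [y [E0 E1 E2 E3 hy]] := ode_coef a b y0 y1 (y2 / 2) (y3 / 6).
(* Each of the four differentiations costs some radius; the radii [sq 4 > ... > sq 1 > s] leave the
   disc of radius [s] to all derivatives. *)
pose sq k : R := s + (r - s) * (k%:R / 5).
have sqs k : sq k < sq k.+1 by rewrite /sq ltrD2l ltr_pM2l ?subr_gt0// ltr_pM2r ?ltr_nat.
have sq0 k : 0 < sq k by rewrite /sq; apply: ltr_pwDl => //; rewrite mulr_ge0 ?subr_ge0 ?(ltW sr).
have sq5 : sq 4 < r by rewrite /sq; lra.
have s4 : s < sq 4 by rewrite /sq; lra.
have [C0 hC0] := ode_bound (sq0 4) sq5 ha hb hy.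
have [C1 _ hC1] := psbound_diff (sq0 3) (sqs 3) hC0.
have [C2 _ hC2] := psbound_diff (sq0 2) (sqs 2) hC1.
have [C3 _ hC3] := psbound_diff (sq0 1) (sqs 1) hC2.
have [Y hY] : exists Y, hasps Y z (sq 4) y.
  exists (fun u => xget 0 [set S | gsum (fun k => y k * (u - z) ^+ k) S]) => w wr.
  have -> : z + w - z = w by ring.
  have [S hS] := gsum_ex (ratio01 wr) (psterm_le w (sq0 4) hC0).
  by case: xgetP => // /(_ S).
have mono f k c : hasps f z (sq k.+1) c -> hasps f z (sq k) c.
  by move=> h w wr; apply: h; apply: lt_trans (sqs k).
have [Y1 [d0 p1]] := ps_deriv (sq0 4) hC0 hY.
have [Y2 [d1 p2]] := ps_deriv (sq0 3) hC1 (mono _ _ _ p1).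
have [Y3 [d2 p3]] := ps_deriv (sq0 2) hC2 (mono _ _ _ p2).
have [Y4 [d3 p4]] := ps_deriv (sq0 1) hC3 (mono _ _ _ p3).
exists Y, Y1, Y2, Y3, Y4; split.
  rewrite (hasps0 (sq0 4) hY) (hasps0 (sq0 4) p1) (hasps0 (sq0 3) p2) (hasps0 (sq0 2) p3).
  rewrite /psdiff E0 E1 E2 E3; split => //; by field.
move=> w ws.
have l1 : normc w < sq 1 by apply: (lt_trans ws); rewrite /sq; flra.
have l2 := lt_trans l1 (sqs 1); have l3 := lt_trans l2 (sqs 2); have l4 := lt_trans l3 (sqs 3).
split; [exact: d0|exact: d1|exact: d2|exact: d3|].
have wr : normc w < r by apply: lt_trans sq5.
have r0 : 0 < r by apply: lt_trans sr.
have G1 := gsum_prod (ratio01 wr) (psterm_le w r0 ha) (hfa _ wr) (p2 _ l3).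
have G2 := gsum_prod (ratio01 wr) (psterm_le w r0 hb) (hfb _ wr) (hY _ l4).
apply: (gsum_uniq (p4 _ l1)); apply: gsum_ext (gsumD G1 G2) => n.
rewrite /psdiff hy /odestep.
have nz (m : nat) : m.+1%:R != 0 :> R[i] by rewrite pnatr_eq0.
have -> (x : R[i]) : n.+1%:R * (n.+2%:R * (n.+3%:R * (n.+4%:R *
   (x / (n.+1%:R * (n.+2%:R * (n.+3%:R * n.+4%:R))))))) = x.
  have := nz n; have := nz n.+1; have := nz n.+2; have := nz n.+3.
  move: (n.+1%:R) (n.+2%:R) (n.+3%:R) (n.+4%:R) => A1 A2 A3 A4 *; field.
  by do !(apply/andP; split).
rewrite mulrDl !mulr_suml; congr (_ + _); apply: eq_bigr => k _.
  have kn : (k <= n)%N by rewrite -ltnS.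
  by have -> : w ^+ n = w ^+ k * w ^+ (n - k); [rewrite -exprD subnKC|
    move: (w ^+ k) (w ^+ (n - k)) => *; ring].
have kn : (k <= n)%N by rewrite -ltnS.
by have -> : w ^+ n = w ^+ k * w ^+ (n - k); [rewrite -exprD subnKC|
  move: (w ^+ k) (w ^+ (n - k)) => *; ring].
Qed.

End LinearODE.

(** * Topology of the complex plane and holomorphic functions on an open set *)

Section Topology.
Variable R : realType.
Implicit Types (f : R[i] -> R[i]) (z w : R[i]) (r : R).

(** The norm of [R[i]] takes its values in [R[i]]; a positive radius there has imaginary part zero,
    which brings back real radii. *)
Lemma nbhs_disc z (A : set R[i]) : nbhs (z : R[i]^o) A <-> exists2 r, 0 < r & disc z r `<=` A.
Proof.
split.
  move=> /nbhs_ballP[[er ei]]; rewrite /= ltcE /= => /andP[/eqP e0 er0] h.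
  exists er => // w wr; apply: h; rewrite -ball_normE /ball_ /=.
  by rewrite normc_normr e0 ltcR normcBC.
move=> [r r0 h]; apply/nbhs_ballP; exists r%:C; rewrite /= ?ltcR// => w.
rewrite -ball_normE /ball_ /= normc_normr ltcR => hw; apply: h.
by rewrite /disc/= normcBC.
Qed.

Lemma open_disc (A : set R[i]^o) z : open A -> A z -> exists2 r, 0 < r & disc z r `<=` A.
Proof. by rewrite openE => h /h /nbhs_disc. Qed.

Lemma closure_disc (A : set R[i]^o) z : (forall r, 0 < r -> exists2 w, A w & disc z r w) -> closure A z.
Proof. by move=> h B /nbhs_disc[r /h[w Aw zw] hB]; exists w; split => //; exact: hB. Qed.

Lemma derivable_cD (f : R[i]^o -> R[i]^o) (z : R[i]^o) : derivable f z 1 -> exists l, cD f z l.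
Proof.
rewrite /derivable => /cvg_ex[/= l hl]; exists l => e e0.
have eC : 0 < e%:C by rewrite ltcR.
move: hl => /cvgrPdist_le/(_ _ eC); rewrite /dnbhs /within /=.
move=> /nbhs_disc[d d0 hd]; exists d => // w wd.
have [->|w0] := eqVneq w 0; first by rewrite addr0 subrr mulr0 subrr normc0 mulr0.
have := hd w; rewrite /disc /= subr0 => /(_ wd w0).
rewrite normc_normr lecR => H; have nw : 0 < normc w by rewrite normc_gt0.
rewrite -(ler_pM2r nw) -normcM -normcN in H; apply: le_trans H.
rewrite le_eqVlt; apply/orP; left; apply/eqP; congr normc.
rewrite /GRing.scale /= mulr1 (addrC w z).
by move: (f (z + w)) (f z) => *; field.
Qed.

Lemma continuous_complex_pair (g : R -> R[i]^o) :
  (forall t e, 0 < e -> exists2 d, 0 < d & forall s, `|s| < d -> normc (g (t + s) - g t) < e) ->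
  continuous g.
Proof.
move=> h t B /nbhs_disc[e e0 hB]; have [d d0 hd] := h t e e0.
apply/nbhs_ballP; exists d => // s; rewrite -ball_normE /ball_ /= distrC => ts.
by apply: hB; rewrite /disc /=; have := hd _ ts; rewrite (addrC t) subrK.
Qed.

End Topology.

Section Holomorphic.
Variable R : realType.
Variable G : set R[i].
Hypothesis oG : forall z, G z -> exists2 r, 0 < r & disc z r `<=` G.
Implicit Types (f : R[i] -> R[i]) (z w : R[i]) (r M : R).

Definition hol f := forall z, G z -> exists l, cD f z l.
Definition dC f z : R[i] := xget 0 [set l | cD f z l].

Lemma dCP f z : hol f -> G z -> cD f z (dC f z).
Proof. by move=> h /h[l hl]; rewrite /dC; case: xgetP => // /(_ l). Qed.

Lemma hol_ps f z r rho : hol f -> disc z r `<=` G -> 0 < rho -> rho < r ->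
  exists c M, [/\ 0 <= M, psbound c M rho, hasps f z rho c &
    hasps (dC f) z rho (psdiff c)].
Proof.
move=> hf hD rho0 rhor; have [c [M [hM hc]]] := cauchy_ps rho0 rhor (fun w hw => hf w (hD w hw)).
have M0 : 0 <= M by have := hM 0%N; apply: le_trans; rewrite mulr_ge0 ?normc_ge0.
exists c, M; split => //; have [g [hg1 hg2]] := ps_deriv rho0 hM hc.
move=> w wr; have := hg2 _ wr; suff -> : dC f (z + w) = g (z + w) by [].
apply: cD_uniq (hg1 _ wr); apply: dCP => //; apply: hD.
by rewrite /disc/= addrAC subrr add0r (lt_trans wr).
Qed.

Lemma hol_dC f : hol f -> hol (dC f).
Proof.
move=> hf z Gz; have [r r0 hr] := oG Gz.
have r2 : 0 < r / 2 by lra.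
have r2r : r / 2 < r by lra.
have r4 : 0 < r / 4 by lra.
have r42 : r / 4 < r / 2 by lra.
have [c [M [M0 hM hc hd]]] := hol_ps hf hr r2 r2r.
have [M' _ hM'] := psbound_diff r4 r42 hM.
have hd' : hasps (dC f) z (r / 4) (psdiff c) by move=> w wr; apply: hd; apply: lt_trans r42.
have [g [hg _]] := ps_deriv r4 hM' hd'.
by have := hg 0; rewrite normc0 => /(_ r4); rewrite addr0 => ?; exists (g z).
Qed.

Lemma hol_lin f (a b : R[i]) : hol f -> hol (fun z => a * f z + b).
Proof.
by move=> hf z /hf[l hl]; exists (a * l + 0); apply: hasDD; [exact: hasDZ|exact: hasD_cst].
Qed.

Lemma hol_add f g : hol f -> hol g -> hol (fun z => f z + g z).
Proof. by move=> hf hg z Gz; have [l hl] := hf _ Gz; have [m hm] := hg _ Gz; exists (l + m); exact: hasDD. Qed.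

End Holomorphic.

(** * Local solvability and Taylor remainders *)

Section Newton.
Variable R : realType.
Implicit Types (f df : R[i] -> R[i]) (z w v : R[i]) (r M : R).

Lemma cD_mean_value f df z r (M : R) : (forall w, disc z r w -> cD f w (df w)) ->
  (forall w, disc z r w -> normc (df w) <= M) ->
  forall a b, disc z r a -> disc z r b -> normc (f b - f a) <= M * normc (b - a).
Proof.
move=> hf hM a b Da Db.
have h : segprim df a b (fun t => f (seg a b t)).
  by apply: segint_FTC => t t01; apply: hf; exact: disc_seg.
rewrite -(@segint_FTCE _ df) => [|t t01]; last by apply: hf; exact: disc_seg.
by apply: segint_le h _ => t t01; apply: hM; exact: disc_seg.
Qed.

(** The simplified Newton map with constant slope [l] contracts by 1/2 on the disc, and its first
    step is shorter than [r / 4], so that the iterates and their limit stay inside. *)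
Lemma newton_root f df z r (l v : R[i]) : l != 0 -> 0 < r ->
  (forall w, disc z r w -> cD f w (df w)) ->
  (forall w, disc z r w -> normc (df w - l) <= normc l / 2) ->
  normc (f z - v) < normc l * r / 4 -> exists2 p, disc z r p & f p = v.
Proof.
move=> l0 r0 hf hl hv; have nl : 0 < normc l by rewrite normc_gt0.
pose phi w := w - l^-1 * (f w - v).
have dphi w : disc z r w -> cD phi w (1 - l^-1 * (df w - 0)).
  by move=> /hf h; apply: hasDB (cD_id w) (hasDZ _ (hasDB h (hasD_cst _ _ _))).
have lip a b : disc z r a -> disc z r b -> normc (phi b - phi a) <= 2^-1 * normc (b - a).
  apply: (cD_mean_value dphi) => w Dw; rewrite subr0.
  have -> : 1 - l^-1 * df w = - (l^-1 * (df w - l)) by field.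
  rewrite normcN normcM normcV ler_pdivrMl// mulrC; have := hl _ Dw; lra.
pose d := normc (phi z - z).
have dr : d < r / 4.
  have -> : d = (normc l)^-1 * normc (f z - v).
    rewrite /d /phi -normcV -normcM -normcN; congr normc; ring.
  by rewrite ltr_pdivrMl// mulrA.
have d0 : 0 <= d by exact: normc_ge0.
pose u n := iter n phi z.
have uP n : disc z r (u n) /\ normc (u n.+1 - u n) <= d * 2^-1 ^+ n /\ normc (u n - z) <= 2 * d * (1 - 2^-1 ^+ n).
  elim: n => [|n [ih1 [ih2 ih3]]].
    split; first by rewrite /disc /u /= subrr normc0.
    split; first by rewrite expr0 mulr1.
    by rewrite /u /= subrr normc0 expr0 subrr mulr0.
  have p0 : 0 <= (2^-1 : R) ^+ n by apply: exprn_ge0; flra.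
  have h3 : normc (u n.+1 - z) <= 2 * d * (1 - 2^-1 ^+ n.+1).
    have -> : u n.+1 - z = (u n.+1 - u n) + (u n - z) by ring.
    apply: (le_trans (le_normcD _ _)); rewrite exprS; flra.
  have h1 : disc z r (u n.+1).
    rewrite /disc /=; apply: (le_lt_trans h3).
    have : 0 <= d * 2^-1 ^+ n by exact: mulr_ge0.
    rewrite exprS; flra.
  split=> //; split=> //; rewrite exprS.
  have -> : u n.+2 - u n.+1 = phi (u n.+1) - phi (u n) by [].
  apply: (le_trans (lip _ _ ih1 h1)); flra.
have th : 0 <= (2^-1 : R) < 1 by apply/andP; split; flra.
have [|p hp] := @geom_limit R u d 2^-1 th; first by move=> n; have [_ []] := uP n.
have hp' n : normc (p - u n) <= 4 * d * 2^-1 ^+ n.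
  by apply: (le_trans (hp n)); rewrite le_eqVlt; apply/orP; left; apply/eqP; field.
have Dp : disc z r p.
  by have := hp' 0%N; rewrite /disc /= expr0 /u /=; flra.
exists p => //; have : normc (phi p - p) <= 0.
  apply: (@le0_geom R _ (4 * d) 2^-1 th) => n.
  have -> : phi p - p = (phi p - phi (u n)) - (p - u n.+1) by rewrite /u /=; ring.
  apply: (le_trans (normcB _ _)); have h1 := lip _ _ (uP n).1 Dp.
  have := hp' n; have := hp' n.+1; rewrite exprS; flra.
rewrite le_eqVlt ltNge normc_ge0 orbF normc_eq0 subr_eq0 => /eqP.
rewrite /phi => H; have : l^-1 * (f p - v) = 0.
  have -> : l^-1 * (f p - v) = p - (p - l^-1 * (f p - v)) by ring.
  by rewrite H subrr.
by move/eqP; rewrite mulf_eq0 invr_eq0 (negbTE l0)/= subr_eq0 => /eqP.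
Qed.

(** On half the radius the bounds of the terms after the first [n] decrease at least like powers of
    1/2, whose sum is at most 2. *)
Lemma ps_tail f z r c M n w : 0 < r -> psbound c M r -> hasps f z r c -> normc w <= r / 2 ->
  normc (f (z + w) - \sum_(k < n) c k * w ^+ k) <= 2 * M * 2 ^+ n / r ^+ n * normc w ^+ n.
Proof.
move=> r0 hb hf wr; have wlt : normc w < r by lra.
have M0 : 0 <= M by have := hb 0%N; apply: le_trans; rewrite mulr_ge0 ?normc_ge0.
pose t k := c k * w ^+ k; pose t' k := if (k < n)%N then 0 else t k.
have sumE N : \sum_(k < n + N) t' k = \sum_(k < n + N) t k - \sum_(k < n) t k.
  elim: N => [|N ih].
    by rewrite addn0 subrr big1// => i _; rewrite /t' ltn_ord.
  by rewrite addnS !big_ord_recr /= ih /t' ltnNge leq_addr /=; ring.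
have [M1 [th1 [h1 H1]]] := hf _ wlt; have /andP[th10 th11] := h1.
have G : forall N, normc (\sum_(k < n + N) t k - \sum_(k < n) t k) <= 2 * M * 2 ^+ n / r ^+ n * normc w ^+ n.
  move=> N; have -> : \sum_(k < n + N) t k - \sum_(k < n) t k = \sum_(j < N) t (n + j)%N.
    by rewrite big_split_ord /= addrAC subrr add0r.
  apply: (le_trans (normc_sum _ (fun j => t (n + j)%N))).
  apply: (@le_trans _ _ (\sum_(j < N) M * (normc w / r) ^+ n * 2^-1 ^+ j)).
    apply: ler_sum => j _; apply: (le_trans (psterm_le w r0 hb _)).
    rewrite exprD mulrA ler_wpM2l//; first by pos.
    have hr1 : 0 <= normc w / r by pos.
    have hr2 : normc w / r <= 2^-1 by rewrite ler_pdivrMr//; flra.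
    by rewrite lerXn2r// nnegrE; flra.
  rewrite -mulr_sumr; have h2 : \sum_(j < N) (2^-1 : R) ^+ j <= 2.
    have h2 : 0 <= (2^-1 : R) < 1 by apply/andP; split; flra.
    by apply: (le_trans (geom_sum_le N h2)); rewrite (_ : (1 - 2^-1)^-1 = 2)//; field.
  have P : 0 <= M * (normc w / r) ^+ n by pos.
  apply: (le_trans (ler_wpM2l P h2)).
  have e2 : 1 <= 2 ^+ n :> R by apply: exprn_ege1; flra.
  rewrite expr_div_n; have q0 : 0 <= M * (normc w ^+ n / r ^+ n) by pos.
  have -> : 2 * M * 2 ^+ n / r ^+ n * normc w ^+ n = M * (normc w ^+ n / r ^+ n) * 2 * 2 ^+ n.
    by move: (2 ^+ n) (r ^+ n)^-1 (normc w ^+ n) => *; ring.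
  by rewrite ler_peMr// mulr_ge0.
rewrite -subr_le0; apply: (le0_geom h1 (M := M1)) => N.
rewrite lerBlDr [leRHS]addrC.
have -> : f (z + w) - \sum_(k < n) c k * w ^+ k =
  (\sum_(k < n + N) t k - \sum_(k < n) t k) + (f (z + w) - \sum_(k < n + N) t k) by rewrite /t; ring.
apply: (le_trans (le_normcD _ _)); apply: lerD; first exact: G.
apply: (le_trans (H1 _)); apply: ler_wpM2l; first exact: (@gsum_rate R t _ _ _ H1).
by rewrite exprD ler_piMl ?exprn_ge0// exprn_ile1// ltW.
Qed.

End Newton.

(** * Points where the profile crosses a level with positive slope *)

Section Crossing.
Variables (R : realType) (q : R -> R) (G : set R[i]^o) (qC : R[i]^o -> R[i]^o).
Hypothesis AM : AM_continuation q G qC.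
Implicit Types (z w u : R[i]) (x c s r : R).

Lemma AM_oG : forall z, G z -> exists2 r, 0 < r & disc z r `<=` (G : set R[i]).
Proof. by move=> z; apply: open_disc; exact: AM_open AM. Qed.

Lemma AM_hol : hol (G : set R[i]) qC.
Proof. by move=> z /(AM_holomorphic AM)/derivable_cD. Qed.

Definition q1C := dC qC.
Definition q2C := dC q1C.

Lemma q1C_hol : hol (G : set R[i]) q1C. Proof. exact: (hol_dC AM_oG AM_hol). Qed.
Lemma q2C_hol : hol (G : set R[i]) q2C. Proof. exact: (hol_dC AM_oG q1C_hol). Qed.

Lemma itv_G x : -1 <= x <= 1 -> (G : set R[i]) x%:C. Proof. exact: AM_itv AM x. Qed.
Lemma qCE x : -1 <= x <= 1 -> qC x%:C = (q x)%:C. Proof. exact: AM_extends AM x. Qed.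

Lemma q_cont x e : -1 <= x <= 1 -> 0 < e -> exists2 d, 0 < d &
  forall s, `|s| < d -> -1 <= x + s <= 1 -> `|q (x + s) - q x| < e.
Proof.
move=> hx e0; have [d d0 hd] := hasD_cont (dCP AM_hol (itv_G hx)) e0.
exists d => // s sd hs; have := hd s%:C; rewrite normcr -rmorphD/= qCE// qCE//.
by rewrite -rmorphB normcr => /(_ sd).
Qed.

(** As the derivative [l] is nonzero, the step [w] with [l * w = - 'i * sg] moves the value of [qC]
    from the real number [v] down into the semistrip, at an arbitrarily small distance from [z]. *)
Lemma closure_D z (v : R) : (G : set R[i]) z -> qC z = v%:C -> q (-1) < v < q 1 ->
  q1C z != 0 -> closure (D_of q G qC) z.
Proof.
move=> Gz hv /andP[av vb] l0; apply: closure_disc => r r0.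
have [r1 r10 hr1] := AM_oG Gz.
have nl : 0 < normc (q1C z) by rewrite normc_gt0.
have e0 : 0 < normc (q1C z) / 2 by pos.
have [d d0 hd] := dCP AM_hol Gz e0; rewrite -/q1C in hd.
set l := q1C z in l0 nl e0 hd.
pose m := Num.min (Num.min r r1) d.
have m0 : 0 < m by rewrite !lt_min r0 r10.
pose sg := Num.min (m * normc l / 2) (Num.min (v - q (-1)) (q 1 - v)).
have s0 : 0 < sg by rewrite !lt_min !subr_gt0 av vb !andbT; pos.
have sm : sg <= m * normc l / 2 by rewrite ge_min lexx.
have sa : sg <= v - q (-1) by rewrite !ge_min lexx orbT.
have sb : sg <= q 1 - v by rewrite !ge_min lexx !orbT.
pose w : R[i] := - 'i * sg%:C / l.
have ni : normc ('i : R[i]) = 1 by rewrite /normc expr0n expr1n add0r sqrtr1.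
have nw : normc w = sg / normc l.
  by rewrite /w normcM normcV normcM normcN ni mul1r normcr gtr0_norm.
have wm : normc w < m.
  rewrite nw ltr_pdivrMr//; apply: (le_lt_trans sm).
  have : 0 < m * normc l by pos.
  flra.
move: (wm); rewrite !lt_min => /andP[/andP[wr wr1] wd].
have := hd _ wd; rewrite hv.
have -> : l * w = - 'i * sg%:C by rewrite /w; field.
rewrite nw => H; exists (z + w); last by rewrite /disc/= addrAC subrr add0r.
split; first by apply: hr1; rewrite /disc/= addrAC subrr add0r.
have {}H : normc (qC (z + w) - v%:C - - 'i * sg%:C) <= sg / 2.
  by apply: (le_trans H); rewrite le_eqVlt; apply/orP; left; apply/eqP; field; rewrite gt_eqF.
have /(le_trans (normc_Re _)) := H; have /(le_trans (normc_Im _)) := H.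
rewrite !ReImE /= !(mul0r, mulr0, subr0, addr0, add0r, mulN1r, oppr0, mulNr, opprK, sub0r, mul1r).
rewrite !ler_norml => /andP[i1 i2] /andP[h1 h2].
clear - AM i1 i2 h1 h2 s0 sa sb; clearbody sg.
by split; [apply/andP; split|]; lra.
Qed.

(** [x0] is the last point where [q] is at most [c]. Taking the last one makes [q] exceed [c] on the
    right, which later gives the sign of the leading Taylor coefficient. *)
Lemma level_point c : q (-1) < c < q 1 -> exists x0, [/\ -1 < x0 < 1, q x0 = c &
  forall x, x0 < x <= 1 -> c < q x].
Proof.
move=> /andP[ac cb]; pose E : set R := [set x | -1 <= x <= 1 /\ q x <= c].
have hE : has_sup E.
  split; first by exists (-1); split; [rewrite lexx/=; lra|exact: ltW].
  by exists 1 => x [/andP[]].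
set x0 := sup E; have ub x : E x -> x <= x0 by exact: sup_upper_bound.
have x01 : x0 <= 1 by apply: ge_sup; [case: hE|move=> x [/andP[]]].
have x0N : -1 <= x0 by apply: ub; split; [rewrite lexx/=; lra|exact: ltW].
have x0i : -1 <= x0 <= 1 by rewrite x0N.
have right x : x0 < x <= 1 -> c < q x.
  move=> /andP[x0x x1]; rewrite ltNge; apply/negP => qx.
  have /ub : E x by split => //; apply/andP; split => //; flra.
  lra.
have q0c : q x0 <= c.
  rewrite leNgt; apply/negP => h.
  have p : 0 < q x0 - c by lra.
  have [d d0 hd] := q_cont x0i p.
  have [x [Ex qx] hx] := @sup_adherent R E d d0 hE; rewrite -/x0 in hx.
  have xx0 : x <= x0 by apply: ub.
  have := hd (x - x0); rewrite (addrC x0) subrK => /(_ _ Ex).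
  have hh : `|x - x0| < d by rewrite ler0_norm; flra.
  by move=> /(_ hh); rewrite ltr_norml => /andP[]; flra.
have c0q : c <= q x0.
  rewrite leNgt; apply/negP => h.
  have x0l : x0 < 1 by rewrite lt_def x01 andbT; apply: contraTneq h => <-; flra.
  have p : 0 < c - q x0 by flra.
  have [d d0 hd] := q_cont x0i p.
  pose s := Num.min (d / 2) (1 - x0).
  have s0 : 0 < s by rewrite lt_min subr_gt0 x0l andbT; flra.
  have sd : s < d by rewrite gt_min; apply/orP; left; flra.
  have s1 : s <= 1 - x0 by rewrite ge_min lexx orbT.
  have si : -1 <= x0 + s <= 1 by apply/andP; split; flra.
  have := hd s; rewrite gtr0_norm// => /(_ sd si); rewrite ltr_norml => /andP[_ H].
  have := right (x0 + s); rewrite (_ : x0 < x0 + s <= 1); last by apply/andP; split; flra.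
  move=> /(_ isT); flra.
have E0 : q x0 = c by apply/eqP; rewrite eq_le q0c.
exists x0; split=> //; apply/andP; split.
  by rewrite lt_def x0N andbT; apply: contraTneq ac => h; rewrite -E0 h ltxx.
by rewrite lt_def x01 andbT; apply: contraTneq cb => h; rewrite -E0 -h ltxx.
Qed.

(** A root of 1 + X + ... + X^(m-1), a polynomial of positive degree with value [m] at 1. *)
Lemma root_of_unity (m : nat) : (1 < m)%N -> exists2 u : R[i], u ^+ m = 1 & u != 1.
Proof.
move=> m1; pose p : {poly R[i]} := \poly_(i < m) 1.
have szp : size p = m by rewrite size_poly_eq// oner_eq0.
have : size p != 1%N by rewrite szp gtn_eqF.
move=> /closed_rootP[u]; rewrite /root horner_poly => /eqP hu.
have hu' : \sum_(i < m) u ^+ i = 0 by rewrite -[RHS]hu; apply: eq_bigr => i _; rewrite mul1r.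
exists u; first by apply/eqP; rewrite -subr_eq0 subrX1 hu' mulr0.
apply/eqP => u1; move: hu'; rewrite u1; under eq_bigr do rewrite expr1n.
by rewrite sumr_const card_ord => /eqP; rewrite pnatr_eq0; case: (m) m1.
Qed.

Lemma expr_diff_le (x y : R[i]) (B : R) k : normc x <= B -> normc y <= B ->
  B * normc (x ^+ k - y ^+ k) <= k%:R * normc (x - y) * B ^+ k.
Proof.
move=> xB yB; have B0 : 0 <= B by apply: le_trans xB; exact: normc_ge0.
elim: k => [|k ih]; first by rewrite !expr0 subrr normc0 mulr0 !mul0r.
have -> : x ^+ k.+1 - y ^+ k.+1 = x * (x ^+ k - y ^+ k) + (x - y) * y ^+ k.
  by rewrite !exprS; ring.
apply: (@le_trans _ _ (B * (normc x * normc (x ^+ k - y ^+ k) + normc (x - y) * normc y ^+ k))).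
  by rewrite ler_wpM2l// (le_trans (le_normcD _ _))// !normcM normcX.
have h1 : normc x * (B * normc (x ^+ k - y ^+ k)) <= B * (k%:R * normc (x - y) * B ^+ k).
  by apply: ler_pM => //; pos.
have h2 : normc y ^+ k <= B ^+ k by rewrite lerXn2r ?nnegrE ?normc_ge0.
have h3 : B * normc (x - y) * normc y ^+ k <= B * normc (x - y) * B ^+ k.
  by apply: ler_wpM2l => //; pos.
rewrite exprS -natr1; lra.
Qed.

(** Let [m] be the order of the zero of [qC - c] at [x0] and [A] its leading coefficient, which is
    positive since [q > c] on the right. If [m > 1], a real value [v] slightly above [c] is taken
    near [x0 + rho * u] for every m-th root of unity [u]. By [closure_D] these points lie in the
    closure of [D_of q G qC], and two of them contradict the injectivity in [AM_bij]. *)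
Lemma simple_crossing c : q (-1) < c < q 1 -> exists x0 d,
  [/\ -1 < x0 < 1, q x0 = c, 0 < d & q1C x0%:C = d%:C].
Proof.
move=> hc; have [x0 [x0i q0 right]] := level_point hc; exists x0.
have x0i' : -1 <= x0 <= 1 by case/andP: x0i => /ltW -> /ltW ->.
have [r0 r00 hr0] := AM_oG (itv_G x0i').
have [r r_0 rr0] : exists2 r, 0 < r & r < r0 by exists (r0 / 2); flra.
have [cc [M [M0 hM hq hq1]]] := hol_ps AM_hol hr0 r_0 rr0.
have [r' [r'0 r'r r'E]] : exists r', [/\ 0 < r', r' < r & r' = r / 2] by exists (r / 2); split; flra.
have [M' M'0 hM'] := psbound_diff r'0 r'r hM.
have hq1' : hasps q1C x0%:C r' (psdiff cc) by move=> w wr; apply: hq1; apply: lt_trans r'r.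
have c0E : cc 0%N = c%:C by rewrite -(hasps0 r_0 hq) qCE// q0.
have x01 : 0 < 1 - x0 by case/andP: x0i => *; flra.
have qright s : 0 < s -> s < r -> s <= 1 - x0 -> c < q (x0 + s) /\ qC (x0%:C + s%:C) = (q (x0 + s))%:C.
  move=> s0 sr s1; case/andP: x0i => *; split; first by apply: right; apply/andP; split; flra.
  by rewrite -rmorphD/= qCE//; apply/andP; split; flra.
(* Otherwise [q] would be equal to [c] just to the right of [x0]. *)
have nzP : exists n, (0 < n)%N && (cc n != 0).
  apply: contrapT => h; have h0 n : cc n.+1 = 0.
    by apply/eqP; apply: contra_notT h => h; exists n.+1.
  pose s := Num.min (r / 2) (1 - x0).
  have s0 : 0 < s by rewrite lt_min x01 andbT; flra.
  have sr : s < r by rewrite gt_min; apply/orP; left; flra.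
  have s1 : s <= 1 - x0 by rewrite ge_min lexx orbT.
  have [h1 h2] := qright s s0 sr s1.
  have := hq s%:C; rewrite normcr gtr0_norm// => /(_ sr)/gsum0.
  rewrite h2 expr0 mulr1 c0E => /(_ (fun k => _)) H.
  have : (q (x0 + s))%:C = c%:C :> R[i] by apply: H => k; rewrite h0 mul0r.
  by move=> [E]; move: h1; rewrite E ltxx.
have [m [m0 A0 mmin]] : exists m, [/\ (0 < m)%N, cc m != 0 & forall n, (0 < n)%N -> (n < m)%N -> cc n = 0].
  case: (ex_minnP nzP) => n /andP[n0 hn] hmin; exists n; split => // k k0 kn.
  by apply/eqP; apply: contraTT kn => hk; rewrite -leqNgt hmin// k0.
have [A Am] : exists A, A = cc m by exists (cc m).
rewrite -Am in A0.
have [L [L0 hL hL1]] : exists L, [/\ 0 < L, forall w, normc w <= r' / 2 ->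
     normc (qC (x0%:C + w) - c%:C - A * w ^+ m) <= L * normc w ^+ m.+1 &
     forall w, normc w <= r' / 2 -> normc (q1C (x0%:C + w) - m%:R * A * w ^+ m.-1) <= L * normc w ^+ m].
  exists (2 * M * 2 ^+ m.+1 / r ^+ m.+1 + 2 * M' * 2 ^+ m / r' ^+ m + 1); split.
  - by pos.
  - move=> w wr; have wr' : normc w <= r / 2 by clear - AM wr r'E r_0; lra.
    have := ps_tail m.+1 r_0 hM hq wr'.
    have -> : \sum_(k < m.+1) cc k * w ^+ k = c%:C + A * w ^+ m.
      rewrite big_ord_recr /= -Am; congr (_ + _).
      case: (m) m0 mmin => // n _ mmin; rewrite big_ord_recl expr0 mulr1 c0E big1 ?addr0// => i _.
      by rewrite mmin ?mul0r// /bump/= add1n ltnS.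
    rewrite opprD addrA => /le_trans; apply; apply: ler_wpM2r; first by pos.
    have : 0 <= 2 * M' * 2 ^+ m / r' ^+ m by pos.
    flra.
  - move=> w wr; have := ps_tail m r'0 hM' hq1' wr.
    have -> : \sum_(k < m) psdiff cc k * w ^+ k = m%:R * A * w ^+ m.-1.
      rewrite Am; case: (m) m0 mmin => // n _ mmin; rewrite big_ord_recr /= big1 ?add0r// => i _.
      by rewrite /psdiff mmin ?mulr0 ?mul0r// ltnS.
    move=> /le_trans; apply; apply: ler_wpM2r; first by pos.
    have : 0 <= 2 * M * 2 ^+ m.+1 / r ^+ m.+1 by pos.
    flra.
have [AR0 AI0] : 0 <= Re A /\ Im A = 0.
  have key s : 0 < s -> s <= r' / 2 -> s <= 1 - x0 -> - (L * s) <= Re A /\ `|Im A| <= L * s.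
    move=> s0 sr s1; have sr' : s < r by clear - AM sr r'r s0; lra.
    have [h1 h2] := qright s s0 sr' s1.
    have := hL s%:C; rewrite normcr gtr0_norm// => /(_ sr); rewrite h2.
    have sm : 0 < s ^+ m by pos.
    rewrite -(rmorphXn (real_complex R))/= => H.
    have /(le_trans (normc_Re _)) := H; have /(le_trans (normc_Im _)) := H.
    rewrite !ReImE /= !(mul0r, mulr0, subr0, addr0, add0r, oppr0, subrr, sub0r).
    rewrite normrN normrM (gtr0_norm sm) exprS mulrA ler_pM2r// => HI.
    rewrite ler_norml => /andP[_ HR]; split=> //.
    by rewrite -(ler_pM2r sm); flra.
  have x1 : 0 < Num.min (r' / 2) (1 - x0) by rewrite lt_min x01 andbT; flra.
  split; first rewrite -oppr_le0; last (apply/eqP; rewrite -normr_le0).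
    apply/ler_addgt0Pl => e e0; rewrite addr0.
    pose s := Num.min (e / L) (Num.min (r' / 2) (1 - x0)).
    have s0 : 0 < s by rewrite lt_min x1 andbT; pos.
    have [||h _] := key s s0; rewrite ?ge_min ?lexx ?orbT//.
    have : L * s <= e by rewrite mulrC -ler_pdivlMr// ge_min lexx.
    flra.
  apply/ler_addgt0Pl => e e0; rewrite addr0.
  pose s := Num.min (e / L) (Num.min (r' / 2) (1 - x0)).
  have s0 : 0 < s by rewrite lt_min x1 andbT; pos.
  have [||_ h] := key s s0; rewrite ?ge_min ?lexx ?orbT//.
  by apply: (le_trans h); rewrite mulrC -ler_pdivlMr// ge_min lexx.
have AE : A = (Re A)%:C by apply: complexP => //=.
have ARp : 0 < Re A.
  by rewrite lt_def AR0 andbT; apply: contraNneq A0 => h; rewrite AE h.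
exists (Re A).
have m1 : m = 1%N.
  apply/eqP; rewrite eqn_leq m0 andbT leqNgt; apply/negP => m1.
  have [u u1 un1] := root_of_unity m1.
  have nu_ (y : R[i]) : y ^+ m = 1 -> normc y = 1.
    move=> h; apply/eqP; rewrite -(@pexpr_eq1 _ _ m)// ?normc_ge0//.
    by rewrite -normcX h normc1.
  have du0 : 0 < normc (u - 1) by rewrite normc_gt0 subr_eq0.
  set a0 := Re A in AE ARp *; clearbody a0; have [du duE] : exists du, du = normc (u - 1) by exists (normc (u - 1)).
  rewrite -duE in du0.
  have pow2 j : 0 < 2 ^+ j :> R by pos.
  have mR : 0 < m%:R :> R by rewrite ltr0n.
  (* [kap * rho] is the radius of the Newton discs: small against the distance [rho * du] of their
     centres, and so small that the leading term of the derivative hardly varies on each disc. *)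
  have [kap [kap0 kap1 kap2 kap3]] : exists kap,
      [/\ 0 < kap, kap <= du / 4, kap <= 2^-1 & kap <= (8 * m%:R * 2 ^+ m)^-1].
    exists (Num.min (Num.min (du / 4) 2^-1) (8 * m%:R * 2 ^+ m)^-1).
    rewrite !lt_min !ge_min !lexx ?orbT -andbA; split=> //; clear - AM du0 mR pow2.
    by apply/and3P; split; pos.
  have [T TE] : exists T, T = L * (2 ^+ m + 1) by exists (L * (2 ^+ m + 1)).
  have T0 : 0 < T by rewrite TE; clear - AM L0; pos.
  have qc0 : 0 < q 1 - c by case/andP: hc => *; rewrite subr_gt0.
  (* In order: the points stay where the expansions hold; [rho ^+ m <= rho]; the remainder of the
     derivative is small; the value at the centre is close enough to [v] for [newton_root]; and
     [v < q 1]. *)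
  pose rho := Num.min (Num.min (r' / 4) 1) (Num.min (a0 / (8 * T)) (Num.min (a0 * kap / (16 * L)) ((q 1 - c) / (2 * a0)))).
  have rho0 : 0 < rho.
    by rewrite !lt_min -!andbA; clear - AM r'0 ARp T0 kap0 L0 qc0; apply/and5P; split; pos.
  have rh1 : rho <= r' / 4 by rewrite !ge_min lexx.
  have rh2 : rho <= 1 by rewrite !ge_min lexx !orbT.
  have rh3 : rho * (8 * T) <= a0 by rewrite -ler_pdivlMr ?mulr_gt0// !ge_min lexx !orbT.
  have rh4 : rho * (16 * L) <= a0 * kap by rewrite -ler_pdivlMr ?mulr_gt0// !ge_min lexx !orbT.
  have rh5 : rho * (2 * a0) <= q 1 - c by rewrite -ler_pdivlMr ?mulr_gt0// !ge_min lexx !orbT.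
  clearbody rho; have [v vE] : exists v, v = c + a0 * rho ^+ m by exists (c + a0 * rho ^+ m).
  have rm0 : 0 < rho ^+ m by pos.
  have rm1 : rho ^+ m <= rho by rewrite -[leRHS]expr1 ler_wiXn2l// ltW.
  have vab : q (-1) < v < q 1.
    have : 0 < a0 * rho ^+ m by pos.
    have : a0 * rho ^+ m <= a0 * rho by rewrite ler_pM2l.
    case/andP: hc => h1 h2 h3 h4; rewrite vE; clear - AM h1 h2 h3 h4 rh5 ARp rho0 qc0.
    by apply/andP; split; flra.
  have nA : normc A = a0 by rewrite AE normcr gtr0_norm.
  have sol (y : R[i]) : y ^+ m = 1 -> exists p,
      [/\ normc (p - (x0%:C + rho%:C * y)) < kap * rho, closure (D_of q G qC) p & qC p = v%:C].
    move=> y1; have ny := nu_ _ y1.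
    have nry : normc (rho%:C * y) = rho by rewrite normcM ny mulr1 normcr gtr0_norm.
    pose z1 := x0%:C + rho%:C * y.
    have wB (s : R[i]) : normc s < kap * rho -> normc (rho%:C * y + s) <= 2 * rho.
      move=> hs; apply: (le_trans (le_normcD _ _)); rewrite nry.
      have kr : kap * rho <= 2^-1 * rho by rewrite ler_pM2r.
      clear - AM kr hs rho0; lra.
    have hr2 : 2 * rho <= r' / 2 by clear - AM rh1; lra.
    have inG p : disc z1 (kap * rho) p -> (G : set R[i]) p.
      move=> hp; apply: hr0; rewrite /disc /=.
      have -> : p - x0%:C = rho%:C * y + (p - z1) by rewrite /z1; ring.
      by apply: (le_lt_trans (wB _ hp)); clear - AM hr2 r'r rr0 r'0; lra.
    have [l lE] : exists l, l = q1C z1 by exists (q1C z1).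
    have rk : 0 < rho ^+ m.-1 by pos.
    have mE : rho ^+ m = rho * rho ^+ m.-1 by rewrite -exprS prednK.
    have l1 : normc (l - m%:R * A * (rho%:C * y) ^+ m.-1) <= L * rho ^+ m.
      by rewrite lE; have := hL1 (rho%:C * y); rewrite nry; apply; clear - AM hr2 rho0; lra.
    have nl1 : normc (m%:R * A * (rho%:C * y) ^+ m.-1) = m%:R * a0 * rho ^+ m.-1.
      by rewrite !normcM normc_nat nA normcX nry.
    have Lr : L * rho ^+ m <= a0 * rho ^+ m.-1 / 8.
      have : L * rho <= a0 / 8.
        have : L * rho <= T * rho.
          by rewrite ler_pM2r// TE ler_peMr ?(ltW L0)// ler_wpDl// ltW.
        clear - AM rh3; lra.
      rewrite -(ler_pM2r rk) mE; clear - AM; lra.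
    have m1R : 1 <= m%:R :> R by rewrite ler1n.
    have mar : a0 * rho ^+ m.-1 <= m%:R * (a0 * rho ^+ m.-1).
      by rewrite ler_peMl//; pos.
    have ar0 : 0 < a0 * rho ^+ m.-1 by pos.
    have nl : m%:R * a0 * rho ^+ m.-1 / 2 <= normc l.
      have := normcB l (l - m%:R * A * (rho%:C * y) ^+ m.-1).
      rewrite opprB addrC subrK nl1; clear - AM l1 Lr mar ar0; flra.
    have nl0 : 0 < normc l by apply: lt_le_trans nl; clear - AM ARp mR rk; pos.
    have l0 : l != 0 by rewrite -normc_gt0.
    have kr0 : 0 < kap * rho by pos.
    have near p : disc z1 (kap * rho) p -> normc (q1C p - l) <= normc l / 2.
      move=> hp; pose s := p - z1; have sk : normc s < kap * rho by [].
      have -> : p = x0%:C + (rho%:C * y + s) by rewrite /s /z1; ring.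
      have B := wB _ sk; have B0 : 0 < 2 * rho by pos.
      have h1 := hL1 _ (le_trans B hr2).
      have h2 : normc (rho%:C * y + s) ^+ m <= (2 * rho) ^+ m.
        by rewrite lerXn2r ?nnegrE ?normc_ge0// ltW.
      have h3 : L * normc (rho%:C * y + s) ^+ m <= L * (2 ^+ m * rho ^+ m).
        by rewrite -exprMn ler_pM2l.
      have yB : normc (rho%:C * y) <= 2 * rho by rewrite nry; clear - AM rho0; lra.
      have h4 := expr_diff_le m.-1 B yB.
      rewrite addrAC subrr add0r in h4.
      set X := normc (_ ^+ m.-1 - _) in h4; have X_E : X = normc ((rho%:C * y + s) ^+ m.-1 - (rho%:C * y) ^+ m.-1) by [].
      clearbody X.
      have h5 : X <= m%:R * kap * (2 ^+ m * rho ^+ m.-1).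
        rewrite -(ler_pM2l B0); apply: (le_trans h4).
        have -> : 2 * rho * (m%:R * kap * (2 ^+ m * rho ^+ m.-1)) =
          m%:R * (kap * rho) * (2 * 2 ^+ m * rho ^+ m.-1) by ring.
        apply: ler_pM; [clear - AM rho0 kap0; pos|clear - AM rho0 kap0; pos| |].
          apply: ler_pM; [by []|exact: normc_ge0| |exact: ltW].
          by rewrite ler_nat leq_pred.
        rewrite exprMn; apply: ler_wpM2r; first by pos.
        have : 2 ^+ m.-1 <= 2 ^+ m :> R by rewrite ler_weXn2l ?leq_pred// ler1n.
        have := pow2 m; clear - AM; lra.
      have h6 : m%:R * kap * 2 ^+ m <= 8^-1.
        have kp : 0 < 8 * m%:R * 2 ^+ m :> R by clear - AM mR; pos.
        have := ler_wpM2r (ltW kp) kap3; rewrite mulVf ?gt_eqF//; clear - AM; flra.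
      have h7 : X <= 8^-1 * rho ^+ m.-1.
        apply: (le_trans h5); rewrite mulrA; apply: ler_wpM2r => //; exact: ltW.
      have E : q1C (x0%:C + (rho%:C * y + s)) - l =
        (q1C (x0%:C + (rho%:C * y + s)) - m%:R * A * (rho%:C * y + s) ^+ m.-1) +
        m%:R * A * ((rho%:C * y + s) ^+ m.-1 - (rho%:C * y) ^+ m.-1) -
        (l - m%:R * A * (rho%:C * y) ^+ m.-1) by ring.
      rewrite E; apply: (le_trans (normc_lin _ _ _)); rewrite normcN.
      have -> : normc (m%:R * A * ((rho%:C * y + s) ^+ m.-1 - (rho%:C * y) ^+ m.-1)) = m%:R * a0 * X.
        by rewrite X_E !normcM normc_nat nA.
      have h8 : m%:R * a0 * X <= m%:R * a0 * (8^-1 * rho ^+ m.-1).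
        by apply: ler_wpM2l => //; pos.
      have h9 : L * (2 ^+ m * rho ^+ m) + L * rho ^+ m <= a0 * rho ^+ m.-1 / 8.
        have : (rho * (8 * T)) * rho ^+ m.-1 <= a0 * rho ^+ m.-1 by rewrite ler_pM2r.
        by rewrite TE mE; clear - AM; lra.
      clear - AM h1 h3 h8 h9 l1 nl ar0 mar; flra.
    have hz : normc (qC z1 - v%:C) < normc l * (kap * rho) / 4.
      have := hL (rho%:C * y); rewrite nry => /(_ (le_trans (_ : rho <= 2 * rho) hr2)).
      rewrite -/z1 exprMn y1 mulr1 => H.
      have -> : qC z1 - v%:C = qC z1 - c%:C - A * rho%:C ^+ m.
        rewrite vE [X in _ * X ^+ _]/real_complex_def AE rmorphD rmorphM rmorphXn/=; ring.
      apply: (le_lt_trans (H _)); first by clear - AM rho0; lra.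
      have : m%:R * a0 * rho ^+ m.-1 / 2 * (kap * rho) <= normc l * (kap * rho) by rewrite ler_pM2r.
      have : (rho * (16 * L)) * rho ^+ m <= a0 * kap * rho ^+ m by rewrite ler_pM2r.
      have : (a0 * rho ^+ m.-1) * (kap * rho) <= m%:R * (a0 * rho ^+ m.-1) * (kap * rho) by rewrite ler_pM2r.
      have : 0 < rho * L * rho ^+ m by pos.
      rewrite exprS mE; clear - AM mar; flra.
    have [p hp pv] := newton_root l0 kr0 (fun w hw => dCP AM_hol (inG w hw)) near hz.
    exists p; split => //; apply: (@closure_D p v) => //; first exact: inG.
    apply: contraTneq (near _ hp) => ->; rewrite sub0r normcN -ltNge; clear - AM nl0; flra.
  have [p [hp Dp pv]] := sol u u1; have [p' [hp' Dp' pv']] := sol 1 (expr1n _ _).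
  have [_ inj _] := AM_bij AM.
  have pp : p = p' by apply: inj; rewrite ?inE// pv pv'.
  (* The centres are [rho * du] apart, yet both discs contain the common point; [kap <= du / 4]
     excludes this. *)
  have : rho * du < 2 * (kap * rho).
    have -> : rho * du = normc ((p' - (x0%:C + rho%:C * 1)) - (p - (x0%:C + rho%:C * u))).
      have -> : (p' - (x0%:C + rho%:C * 1)) - (p - (x0%:C + rho%:C * u)) = rho%:C * (u - 1).
        by rewrite pp; ring.
      by rewrite normcM normcr gtr0_norm// duE.
    by apply: (le_lt_trans (normcB _ _)); clear - AM hp hp'; rewrite /disc/= in hp hp'; lra.
  have : kap * rho <= du / 4 * rho by rewrite ler_pM2r.
  have : 0 < du * rho by pos.
  clear - AM; lra.
split => //; rewrite -AE Am m1.
have := hasps0 r'0 hq1'; by rewrite /psdiff mul1r.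
Qed.

End Crossing.

(** * Differential inequalities and the invariant cone *)

Section Gronwall.
Variable R : realType.
Implicit Types (a b k : R).

Lemma is_derive_expR_comp (g : R -> R) (t dg : R) : is_derive t 1 g dg ->
  is_derive t 1 (fun s => expR (g s)) (dg * expR (g t)).
Proof.
move=> hg; have H := is_derive1_comp (is_derive_expR (g t)) hg.
by apply: is_derive_eq H _; rewrite /GRing.scale /= mulrC.
Qed.

Lemma gronwall_le (f df g dg : R -> R) a b : a <= b ->
  (forall t, a <= t <= b -> is_derive t 1 f (df t)) ->
  (forall t, a <= t <= b -> is_derive t 1 g (dg t)) ->
  (forall t, a <= t <= b -> df t <= dg t * f t) ->
  f b <= f a * expR (g b - g a).
Proof.
move=> ab hf hg h; have := @mean_value_le R (fun t => f t * expR (- g t))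
  (fun t => f t * (- dg t * expR (- g t)) + expR (- g t) * df t) a b 0 ab.
rewrite mul0r subr_le0 => /(_ _ _)/= H.
have {}H : f b * expR (- g b) <= f a * expR (- g a).
  apply: H.
    move=> t tab; have h1 := hf _ tab; have h2 := hg _ tab.
    have h3 : is_derive t 1 (fun s => expR (- g s)) (- dg t * expR (- g t)).
      by apply: is_derive_expR_comp; apply: is_deriveN.
    exact: is_deriveM.
  move=> t tab; have := h _ tab; have := expR_gt0 (- g t) => e0 h1.
  have -> : f t * (- dg t * expR (- g t)) + expR (- g t) * df t =
    expR (- g t) * (df t - dg t * f t) by ring.
  by rewrite pmulr_rle0// subr_le0.
have E : expR (g b) * expR (- g b) = 1 by rewrite -expRD subrr expR0.
rewrite expRD -(ler_pM2r (expR_gt0 (- g b))).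
have -> : f a * (expR (g b) * expR (- g a)) * expR (- g b) =
  f a * expR (- g a) * (expR (g b) * expR (- g b)) by ring.
by rewrite E mulr1.
Qed.

Lemma rD_normsq (u : R -> R[i]) t du : rD u t du ->
  is_derive t 1 (fun s => normc (u s) ^+ 2) (2 * Re ((u t)^* * du)).
Proof.
move=> h; have h1 := rD_re h; have h2 := rD_im h.
have -> : (fun s => normc (u s) ^+ 2) = (fun s => Re (u s) * Re (u s) + Im (u s) * Im (u s)).
  by apply/funext => s; rewrite sqr_normcE !expr2.
have := is_deriveD (is_deriveM h1 h1) (is_deriveM h2 h2).
move=> H; apply: is_derive_eq H _; rewrite !ReImE /GRing.scale /=; ring.
Qed.

(* Each of [N], [M], [Y] decays or is forced weakly by [U], which grows at rate
   [k c]: the cone of the triples small with respect to [U] is invariant. *)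
Lemma cone_invariant (U N M Y dU dN dM dY : R -> R[i]) (k c b m0 e th : R) :
  0 < k -> 0 < c -> 0 <= th -> 4 * th <= c -> 0 < b -> 0 < m0 -> 0 < e ->
  (forall s, 0 <= s <= 1 -> [/\ rD U s (dU s), rD N s (dN s), rD M s (dM s) & rD Y s (dY s)]) ->
  (forall s, 0 <= s <= 1 -> k * (c * normc (U s) ^+ 2 - th * normc (U s) * (normc (N s) / b))
    <= Re ((U s)^* * dU s)) ->
  (forall s, 0 <= s <= 1 -> Re ((N s)^* * dN s) <= k * b ^+ 2 * ((normc (N s) / b) *
     (th * normc (U s) + th * (normc (Y s) / e) - c * (normc (N s) / b)))) ->
  (forall s, 0 <= s <= 1 -> Re ((M s)^* * dM s) <= k * m0 ^+ 2 * (th * (normc (M s) / m0) *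
     (normc (Y s) / e + normc (N s) / b + normc (U s)))) ->
  (forall s, 0 <= s <= 1 -> Re ((Y s)^* * dY s) <= k * e ^+ 2 * (th * (normc (Y s) / e) *
     (normc (M s) / m0 + normc (U s)))) ->
  U 0 != 0 -> N 0 = 0 -> M 0 = 0 -> Y 0 = 0 ->
  [/\ normc (N 1) <= b * normc (U 1), normc (M 1) <= m0 * normc (U 1),
     normc (Y 1) <= e * normc (U 1) & U 1 != 0].
Proof.
move=> k0 c0 th0 th4 b0 m00 e0 hD hU hN hM hY U0 N0 M0 Y0.
(* The cone is [L < 0]. This holds at 0, where only [U] is nonzero, and [dL <= k * c * L] preserves
   it by Gronwall's inequality. *)
pose L s := normc (N s) ^+ 2 / b ^+ 2 + normc (M s) ^+ 2 / m0 ^+ 2 + normc (Y s) ^+ 2 / e ^+ 2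
  - normc (U s) ^+ 2.
pose dL s := 2 * Re ((N s)^* * dN s) / b ^+ 2 + 2 * Re ((M s)^* * dM s) / m0 ^+ 2
  + 2 * Re ((Y s)^* * dY s) / e ^+ 2 - 2 * Re ((U s)^* * dU s).
have h01 : 0 <= (0 : R) <= 1 by rewrite lexx ler01.
have : L 1 <= L 0 * expR (k * c * 1 - k * c * 0).
  apply: (@gronwall_le L dL (fun s => k * c * s) (fun=> k * c) 0 1 ler01).
  - move=> s /hD[h1 h2 h3 h4].
    have s1 := rD_normsq h1; have s2 := rD_normsq h2; have s3 := rD_normsq h3; have s4 := rD_normsq h4.
    have sc (f : R -> R) (df x : R) : is_derive s 1 f df -> is_derive s 1 (fun y => f y / x) (df / x).
      move=> hf; have := is_deriveM hf (is_derive_cst x^-1 s 1).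
      by move=> H; apply: is_derive_eq H _; rewrite /GRing.scale /= mulr0 add0r mulrC.
    exact: (is_deriveB (is_deriveD (is_deriveD (sc _ _ _ s2) (sc _ _ _ s3)) (sc _ _ _ s4)) s1).
  - move=> s _; have := is_deriveM (is_derive_cst (k * c) s 1) (is_derive_id s 1).
    by move=> H; apply: is_derive_eq H _; rewrite /GRing.scale /= mulr0 addr0 mulr1.
  - move=> s s01; have := hU _ s01; have := hN _ s01; have := hM _ s01; have := hY _ s01.
    rewrite /dL /L; set a1 := Re _; set a2 := Re _; set a3 := Re _; set a4 := Re _.
    set u := normc (U s); set n := normc (N s) / b; set m := normc (M s) / m0; set y := normc (Y s) / e.
    have -> : normc (N s) ^+ 2 / b ^+ 2 = n ^+ 2 by rewrite /n expr_div_n.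
    have -> : normc (M s) ^+ 2 / m0 ^+ 2 = m ^+ 2 by rewrite /m expr_div_n.
    have -> : normc (Y s) ^+ 2 / e ^+ 2 = y ^+ 2 by rewrite /y expr_div_n.
    have div (x z w : R) : 0 < z -> x <= k * z ^+ 2 * w -> 2 * x / z ^+ 2 <= 2 * (k * w).
      move=> z0 hx; rewrite ler_pdivrMr ?exprn_gt0//.
      have -> : 2 * (k * w) * z ^+ 2 = 2 * (k * z ^+ 2 * w) by ring.
      by rewrite ler_pM2l.
    move=> /(div _ _ _ e0) h1 /(div _ _ _ m00) h2 /(div _ _ _ b0) h3 h4.
    apply: (@le_trans _ _ (2 * (k * (n * (th * u + th * y - c * n))) + 2 * (k * (th * m * (y + n + u)))
       + 2 * (k * (th * y * (m + u))) - 2 * (k * (c * u ^+ 2 - th * u * n)))).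
      by rewrite lerB ?lerD// ler_pM2l.
    clear h1 h2 h3 h4; clearbody u n m y.
    rewrite -subr_ge0.
    (* All cross terms are completed to squares; [4 * th <= c] makes the remaining coefficient
       nonnegative. *)
    have -> : k * c * (n ^+ 2 + m ^+ 2 + y ^+ 2 - u ^+ 2) -
      (2 * (k * (n * (th * u + th * y - c * n))) + 2 * (k * (th * m * (y + n + u))) +
      2 * (k * (th * y * (m + u))) - 2 * (k * (c * u ^+ 2 - th * u * n))) =
      k * ((c - 4 * th) * (u ^+ 2 + n ^+ 2 + m ^+ 2 + y ^+ 2) + 2 * c * n ^+ 2 +
        th * (2 * (u - n) ^+ 2 + (n - y) ^+ 2 + 2 * (m - y) ^+ 2 + (m - n) ^+ 2 + (m - u) ^+ 2 + (y - u) ^+ 2)).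
      by ring.
    apply: mulr_ge0; first exact: ltW.
    have c4 : 0 <= c - 4 * th by flra.
    pos.
rewrite {2}/L N0 M0 Y0 normc0 expr0n/= !mul0r !add0r => H.
have uu : 0 < normc (U 0) ^+ 2 by rewrite exprn_gt0// normc_gt0.
have L1 : L 1 < 0 by apply: (le_lt_trans H); rewrite pmulr_llt0 ?expR_gt0//; flra.
have n0 : 0 <= normc (N 1) ^+ 2 / b ^+ 2 by pos.
have m0' : 0 <= normc (M 1) ^+ 2 / m0 ^+ 2 by pos.
have y0 : 0 <= normc (Y 1) ^+ 2 / e ^+ 2 by pos.
have final (x z : R) : 0 < z -> 0 <= x -> x ^+ 2 / z ^+ 2 <= normc (U 1) ^+ 2 -> x <= z * normc (U 1).
  move=> z0 x0; rewrite ler_pdivrMr ?exprn_gt0// -exprMn mulrC.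
  by rewrite ler_sqr// ?nnegrE// mulr_ge0 ?normc_ge0// ltW.
rewrite /L in L1; split.
- by apply: final => //; [exact: normc_ge0|flra].
- by apply: final => //; [exact: normc_ge0|flra].
- by apply: final => //; [exact: normc_ge0|flra].
- by apply: contraTneq L1 => ->; rewrite normc0 expr0n /= subr0 -leNgt; pos.
Qed.

End Gronwall.

Section Segments.
Variable R : realType.
Implicit Types (z d v : R[i]).

(** Lets all smallness conditions on [h], and then those on [eps], be listed in one place. *)
Lemma small_ex (s : seq R) : all (fun x => 0 < x) s -> exists2 h : R, 0 < h & all (fun x => h <= x) s.
Proof.
elim: s => [|x s ih] /=; first by exists 1.
move=> /andP[x0 /ih[h h0 hs]]; exists (Num.min x h); first by rewrite lt_min x0.
rewrite ge_min lexx /=; apply: sub_all hs => y; apply: le_trans.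
by rewrite ge_min lexx orbT.
Qed.

Lemma Re_conj_le z d v : Re (z^* * (d * v)) <= normc z * (normc d * normc v).
Proof. by apply: (le_trans (Re_mul_le _ _)); rewrite normc_conj normcM. Qed.

Lemma normc_i : normc ('i : R[i]) = 1 :> R.
Proof. by rewrite /normc expr0n expr1n add0r sqrtr1. Qed.

Lemma Re_conjM z v : Re (z^* * (v * z)) = Re v * normc z ^+ 2.
Proof. by rewrite sqr_normcE; case: z v => a b [c d]; rewrite !ReImE /=; ring. Qed.

(* The bounds at the end of a segment of direction [d], for a solution starting
   on the dominant branch. *)
Lemma cone_segment (U U1 Y Y1 Q Q2 : R[i] -> R[i]) (zs x0c d lam : R[i])
    (alpha eps h sd p1 b m0 th E B2 : R) :
  0 < h -> 0 < eps -> 0 < sd -> 0 < p1 -> 0 < b -> 0 < m0 -> 0 <= E -> 0 <= B2 ->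
  normc d <= 2 * h -> Im d = h ->
  (forall s : R, 0 <= s <= 1 -> normc (zs + s%:C * d - x0c) <= h) ->
  let pt z := 'i * sd%:C + p1%:C * (z - x0c) in
  let p0 := 'i * sd%:C in
  (forall s : R, 0 <= s <= 1 -> let z := zs + s%:C * d in
    [/\ cD U z (U1 z), cD U1 z ((eps%:C)^-2 * (('i * (Q z - lam) + (eps ^+ 2 * alpha ^+ 2)%:C) * U z - 'i * Q2 z * Y z)),
     cD Y z (Y1 z) & cD Y1 z (U z + (alpha ^+ 2)%:C * Y z)]) ->
  (forall s : R, 0 <= s <= 1 -> let z := zs + s%:C * d in
    normc ('i * (Q z - lam) - pt z ^+ 2) <= E * h ^+ 2 /\ normc (Q2 z) <= B2) ->
  4 * p1 * h <= sd -> 8 * th = sd ->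
  2 * b <= th -> 2 * (E * h ^+ 2 + eps * (eps * alpha ^+ 2 + p1)) <= th * b -> 2 * B2 * eps <= th * b ->
  2 * eps * alpha ^+ 2 * eps <= th * m0 -> 2 * eps * b <= th * m0 * sd -> 2 * eps * p1 * h <= th * m0 * sd ->
  2 * m0 <= th -> 2 * eps <= th * sd ->
  U zs != 0 -> eps%:C * U1 zs + pt zs * U zs = 0 -> Y1 zs + eps%:C / p0 * U zs = 0 -> Y zs = 0 ->
  let z := zs + d in
  [/\ normc (eps%:C * U1 z + pt z * U z) <= b * normc (U z),
      normc (Y1 z + eps%:C / p0 * U z) <= m0 * normc (U z),
      normc (Y z) <= eps * normc (U z) & U z != 0].
Proof.
move=> h0 e0 sd0 p10 b0 m00 E0 B20 nd imd near pt p0 hD hQ c1 thE k1 k2 k3 k4 k5 k6 k7 k8 Uz Nz Mz Yz z.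
have i2 : ('i : R[i]) * 'i = -1 by rewrite -expr2 sqr_i.
have i0 : ('i : R[i]) != 0 by rewrite -normc_gt0 normc_i.
have sdC : sd%:C != 0 :> R[i] by rewrite eq_complex /= gt_eqF.
have p00 : p0 != 0 by rewrite mulf_neq0.
have np0 : normc p0 = sd by rewrite /p0 normcM normc_i mul1r normcr gtr0_norm.
have eC : eps%:C != 0 :> R[i] by rewrite eq_complex /= gt_eqF.
have nept : normc (eps%:C : R[i]) = eps by rewrite normcr gtr0_norm.
(* [N] measures the deviation from the dominant WKB branch [eps U' = - pt U], and [M] that of [Y']
   from [- (eps / p0) U], the leading term of an antiderivative of [U] on this branch. *)
pose N w := eps%:C * U1 w + pt w * U w.
pose M w := Y1 w + eps%:C / p0 * U w.
pose zz (s : R) := zs + s%:C * d.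
have zz1 : zz 1 = z by rewrite /zz mul1r.
have zz0 : zz 0 = zs by rewrite /zz mul0r addr0.
pose dU s := d * (eps%:C^-1 * N (zz s) - eps%:C^-1 * pt (zz s) * U (zz s)).
pose dN s := d * (eps%:C^-1 * pt (zz s) * N (zz s)) + d * (eps%:C^-1 * (('i * (Q (zz s) - lam) - pt (zz s) ^+ 2) * U (zz s)
   + (eps * (eps * alpha ^+ 2 + p1))%:C * U (zz s) - 'i * Q2 (zz s) * Y (zz s))).
pose dM s := d * ((alpha ^+ 2)%:C * Y (zz s) + p0^-1 * N (zz s) + (p0 - pt (zz s)) / p0 * U (zz s)).
pose dY s := d * (M (zz s) - eps%:C / p0 * U (zz s)).
have H01 : 0 <= (1 : R) <= 1 by rewrite lexx ler01.
have th0 : 0 < th by clear - thE sd0; lra.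
have rdline s : rD zz s d by exact: rD_line.
have npt s : 0 <= s <= 1 -> normc (p0 - pt (zz s)) <= p1 * h.
  move=> s01; have -> : p0 - pt (zz s) = - (p1%:C * (zz s - x0c)) by rewrite /p0 /pt; ring.
  by rewrite normcN normcM normcr gtr0_norm// ler_pM2l// near.
(* Going up by [Im d = h] gives [- d * p0] the real part [h * sd], and by [4 * p1 * h <= sd] the
   linear term of [pt] takes away at most half of it. The same number is the growth rate of [U] and
   the damping rate of [N]. *)
have grow s : 0 <= s <= 1 -> h * (sd / 2) <= Re (- (d * pt (zz s))).
  move=> s01; have -> : - (d * pt (zz s)) = - (d * p0) - d * (pt (zz s) - p0) by ring.
  rewrite ReB; have : Re (d * (pt (zz s) - p0)) <= 2 * h * (p1 * h).
    apply: (le_trans (Re_mul_le _ _)); apply: ler_pM; [pos|pos|exact: nd|].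
    by rewrite normcBC npt.
  have -> : Re (- (d * p0)) = h * sd.
    by rewrite /p0 !ReImE /= imd; ring.
  have := ler_wpM2l (ltW h0) c1; clear; lra.
have mz (X : R[i] -> R[i]) s l : cD X (zz s) l -> rD (fun t => X (zz t)) s (d * l).
  by move=> hX; rewrite mulrC; apply: hasD_comp (rdline s) hX.
have hk : 0 < h / eps by pos.
have hc : 0 < sd / 2 by rewrite divr_gt0.
have th0' : 0 <= th by exact: ltW.
have h4 : 4 * th <= sd / 2 by clear - thE; lra.
have H : [/\ normc (N (zz 1)) <= b * normc (U (zz 1)), normc (M (zz 1)) <= m0 * normc (U (zz 1)),
     normc (Y (zz 1)) <= eps * normc (U (zz 1)) & U (zz 1) != 0].
  apply: (@cone_invariant R (fun s => U (zz s)) (fun s => N (zz s)) (fun s => M (zz s)) (fun s => Y (zz s))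
    dU dN dM dY (h / eps) (sd / 2) b m0 eps th hk hc th0' h4 b0 m00 e0).
  - move=> s s01; have [D1 D2 D3 D4] := hD _ s01; rewrite -/(zz s) in D1 D2 D3 D4.
    have Dpt : cD pt (zz s) p1%:C.
      have := hasDD (hasD_cst id p0 (zz s)) (hasDZ p1%:C (hasDB (cD_id (zz s)) (hasD_cst id x0c (zz s)))).
      by move=> HH; apply: hasD_eq HH _; rewrite subr0 mulr1 add0r.
    split.
    + apply: hasD_eq (mz U s _ D1) _; congr (_ * _); rewrite /N; field; exact: eC.
    + have := mz N s _ (hasDD (hasDZ eps%:C D2) (hasDM Dpt D1)).
      move=> HN; apply: hasD_eq HN _; rewrite /dN -mulrDr; congr (_ * _).
      have R1 : (eps ^+ 2 * alpha ^+ 2)%:C = eps%:C ^+ 2 * (alpha ^+ 2)%:C :> R[i].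
        by rewrite rmorphM (rmorphXn (real_complex R) 2 eps).
      have R2 : (eps * (eps * alpha ^+ 2 + p1))%:C = eps%:C * (eps%:C * (alpha ^+ 2)%:C + p1%:C) :> R[i].
        by rewrite rmorphM rmorphD rmorphM.
      rewrite /N R1 R2; move: (U1 _) (U _) (pt _) (Q _) (Q2 _) (Y _) (alpha ^+ 2)%:C (p1%:C) (eps%:C) eC => *.
      by field.
    + have := mz M s _ (hasDD D4 (hasDZ (eps%:C / p0) D1)).
      move=> HM; apply: hasD_eq HM _; congr (_ * _); rewrite /N.
      by move: (U1 _) (U _) (pt _) (Y _) (p0) p00 => *; field.
    + by apply: hasD_eq (mz Y s _ D3) _; congr (_ * _); rewrite /M addrK.
  - move=> s s01; set u := U (zz s); set n := N (zz s).
    have -> : dU s = (eps^-1)%:C * (- (d * pt (zz s)) * u) + (eps^-1)%:C * (d * n).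
      by rewrite /dU fmorphV -/u -/n; move: (pt _) => *; ring.
    rewrite [X in _ <= Re X]mulrDr ReD.
    have -> : Re (u^* * ((eps^-1)%:C * (- (d * pt (zz s)) * u))) = eps^-1 * (Re (- (d * pt (zz s))) * normc u ^+ 2).
      by rewrite -Re_conjM [_%:C * _]mulrC mulrA [LHS]ReM /= mulr0 subr0 mulrC.
    have h1 : - (eps^-1 * (normc u * (2 * h * normc n))) <= Re (u^* * ((eps^-1)%:C * (d * n))).
      rewrite lerNl -ReN -mulrN; apply: (le_trans (Re_mul_le _ _)).
      rewrite normc_conj normcN !normcM normcr gtr0_norm ?invr_gt0//.
      rewrite mulrCA ler_pM2l ?invr_gt0// ler_wpM2l ?normc_ge0// ler_wpM2r ?normc_ge0//.
    have h2 : eps^-1 * (h * (sd / 2) * normc u ^+ 2) <= eps^-1 * (Re (- (d * pt (zz s))) * normc u ^+ 2).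
      by rewrite ler_pM2l ?invr_gt0// ler_wpM2r ?sqr_ge0// grow.
    apply: (le_trans _ (lerD h2 h1)).
    have -> : h / eps * (sd / 2 * normc u ^+ 2 - th * normc u * (normc n / b)) =
      eps^-1 * (h * (sd / 2) * normc u ^+ 2) - eps^-1 * (normc u * (h * (th / b) * normc n)) by ring.
    rewrite lerD2l lerN2 ler_pM2l ?invr_gt0// ler_wpM2l ?normc_ge0// ler_wpM2r ?normc_ge0//.
    by rewrite mulrC ler_pM2l// ler_pdivlMr.
  - move=> s s01; set u := U (zz s); set n := N (zz s); set y := Y (zz s).
    rewrite /dN -/u -/n -/y mulrDr ReD.
    have [q1 q2] := hQ _ s01; rewrite -/(zz s) in q1 q2.
    have -> : Re (n^* * (d * (eps%:C^-1 * pt (zz s) * n))) = - (eps^-1 * (Re (- (d * pt (zz s))) * normc n ^+ 2)).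
      rewrite -Re_conjM -fmorphV; have -> : n^* * (d * ((eps^-1)%:C * pt (zz s) * n)) =
        - ((eps^-1)%:C * (n^* * (- (d * pt (zz s)) * n))) by move: (pt _) => *; ring.
      by rewrite ReN [in LHS]ReM /= mul0r subr0.
    have h2 : eps^-1 * (h * (sd / 2) * normc n ^+ 2) <= eps^-1 * (Re (- (d * pt (zz s))) * normc n ^+ 2).
      by rewrite ler_pM2l ?invr_gt0// ler_wpM2r ?sqr_ge0// grow.
    have h1 := Re_conj_le n d (eps%:C^-1 * (('i * (Q (zz s) - lam) - pt (zz s) ^+ 2) * u +
      (eps * (eps * alpha ^+ 2 + p1))%:C * u - 'i * Q2 (zz s) * y)).
    have h3 : normc (eps%:C^-1 * (('i * (Q (zz s) - lam) - pt (zz s) ^+ 2) * u +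
      (eps * (eps * alpha ^+ 2 + p1))%:C * u - 'i * Q2 (zz s) * y)) <=
      eps^-1 * ((E * h ^+ 2 + eps * (eps * alpha ^+ 2 + p1)) * normc u + B2 * normc y).
      rewrite normcM normcV nept ler_pM2l ?invr_gt0//; apply: (le_trans (normc_lin _ _ _)).
      rewrite normcN !normcM normc_i mul1r mulrDl; apply: lerD; last by rewrite ler_wpM2r ?normc_ge0.
      rewrite normcr ger0_norm; last by pos.
      by rewrite lerD2r ler_wpM2r ?normc_ge0.
    apply: (le_trans (lerD (_ : _ <= - (eps^-1 * (h * (sd / 2) * normc n ^+ 2)))
      (le_trans h1 (_ : _ <= normc n * (2 * h * (eps^-1 * ((E * h ^+ 2 + eps * (eps * alpha ^+ 2 + p1)) * normc u + B2 * normc y))))))).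
      by rewrite lerN2.
      rewrite ler_wpM2l ?normc_ge0//; apply: ler_pM => //; exact: normc_ge0.
    have -> : h / eps * b ^+ 2 * (normc n / b * (th * normc u + th * (normc y / eps) - sd / 2 * (normc n / b))) =
      - (eps^-1 * (h * (sd / 2) * normc n ^+ 2)) +
      normc n * (h * (eps^-1 * ((th * b) * normc u + (th * b) * (normc y / eps)))).
      by field; rewrite !gt_eqF.
    rewrite lerD2l ler_wpM2l ?normc_ge0//.
    have -> : 2 * h * (eps^-1 * ((E * h ^+ 2 + eps * (eps * alpha ^+ 2 + p1)) * normc u + B2 * normc y)) =
      h * (eps^-1 * ((2 * (E * h ^+ 2 + eps * (eps * alpha ^+ 2 + p1))) * normc u + (2 * B2 * eps) * (normc y / eps))).
      by field; rewrite !gt_eqF.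
    rewrite ler_pM2l// ler_pM2l ?invr_gt0//; apply: lerD; apply: ler_wpM2r => //; pos.
  - move=> s s01; set u := U (zz s); set n := N (zz s); set y := Y (zz s); set m := M (zz s).
    rewrite /dM -/u -/n -/y; apply: (le_trans (Re_conj_le _ _ _)).
    have h3 : normc ((alpha ^+ 2)%:C * y + p0^-1 * n + (p0 - pt (zz s)) / p0 * u) <=
       alpha ^+ 2 * normc y + normc n / sd + p1 * h / sd * normc u.
      apply: (le_trans (normc_lin _ _ _)); rewrite !normcM normcr !normcV np0 ger0_norm ?sqr_ge0//.
      rewrite [sd^-1 * _]mulrC lerD2l ler_wpM2r ?normc_ge0// ler_wpM2r ?invr_ge0 ?(ltW sd0)// npt//.
    apply: (@le_trans _ _ (normc m * (2 * h * (alpha ^+ 2 * normc y + normc n / sd + p1 * h / sd * normc u)))).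
      rewrite ler_wpM2l ?normc_ge0//; apply: ler_pM => //; exact: normc_ge0.
    have -> : h / eps * m0 ^+ 2 * (th * (normc m / m0) * (normc y / eps + normc n / b + normc u)) =
      normc m * (h * ((th * m0) / eps * (normc y / eps + normc n / b + normc u))).
      by field; rewrite !gt_eqF.
    rewrite ler_wpM2l ?normc_ge0//.
    have -> : 2 * h * (alpha ^+ 2 * normc y + normc n / sd + p1 * h / sd * normc u) =
      h * ((2 * eps * alpha ^+ 2 * eps) / eps * (normc y / eps) + (2 * eps * b) / sd / eps * (normc n / b) +
         (2 * eps * p1 * h) / sd / eps * normc u) by field; rewrite !gt_eqF.
    rewrite ler_pM2l// [leRHS]mulrDr [X in _ <= X + _]mulrDr.
    have ie : 0 <= eps^-1 by pos.
    apply: lerD; first apply: lerD; apply: ler_wpM2r; try pos; rewrite ler_wpM2r// ler_pdivrMr//.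
  - move=> s s01; set u := U (zz s); set y := Y (zz s); set m := M (zz s).
    rewrite /dY -/u -/m; apply: (le_trans (Re_conj_le _ _ _)).
    have h3 : normc (m - eps%:C / p0 * u) <= normc m + eps / sd * normc u.
      by apply: (le_trans (normcB _ _)); rewrite !normcM normcV np0 nept.
    apply: (@le_trans _ _ (normc y * (2 * h * (normc m + eps / sd * normc u)))).
      rewrite ler_wpM2l ?normc_ge0//; apply: ler_pM => //; exact: normc_ge0.
    have -> : h / eps * eps ^+ 2 * (th * (normc y / eps) * (normc m / m0 + normc u)) =
      normc y * (h * (th * (normc m / m0) + th * normc u)).
      by field; rewrite !gt_eqF.
    rewrite ler_wpM2l ?normc_ge0//.
    have -> : 2 * h * (normc m + eps / sd * normc u) =
      h * (2 * m0 * (normc m / m0) + (2 * eps) / sd * normc u) by field; rewrite !gt_eqF.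
    rewrite ler_pM2l//; apply: lerD.
      by apply: ler_wpM2r => //; pos.
    by apply: ler_wpM2r; [pos|rewrite ler_pdivrMr].
  - by rewrite zz0.
  - by rewrite /N zz0.
  - by rewrite /M zz0.
  - by rewrite zz0.
by rewrite zz1 in H.
Qed.

End Segments.

(** * The solution on the real axis near a crossing point *)

Section RealLine.
Variable R : realType.

Lemma real_complexV (x : R) : (x^-1)%:C = (x%:C)^-1 :> R[i].
Proof. by rewrite fmorphV. Qed.

(** The term ['i * sd] only rotates [U], so that the logarithmic derivative of [normc U] is
    [- p1 * (x - x0) / eps] up to [b / eps]. At distance at least [h / 2] the Gaussian exponent
    [p1 * h ^+ 2 / 8] exceeds [b * h <= p1 * h ^+ 2 / 16] by the stated amount. On the interval of
    length [eps * h] the crude bound on [U1] costs a factor that does not depend on [eps]. *)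
Lemma real_decay (U U1 : R -> R[i]) (x0 h eps b p1 sd : R) :
  0 < h -> 0 < eps -> 0 <= b -> 0 < p1 -> 0 < sd -> 16 * b <= p1 * h -> eps < 1 ->
  (forall x, `|x - x0| <= h -> rD U x (U1 x)) ->
  (forall x, `|x - x0| <= h ->
     normc (eps%:C * U1 x + ('i * sd%:C + p1%:C * (x - x0)%:C) * U x) <= b * normc (U x)) ->
  (forall x, h / 2 <= `|x - x0| <= h -> normc (U x) <= normc (U x0) * expR (- (p1 * h ^+ 2 / 16) / eps)) /\
  (forall x, x0 <= x <= x0 + eps * h -> normc (U x0) * expR (- ((b + sd + p1 * h) * h)) <= normc (U x)).
Proof.
move=> h0 e0 b0 p10 sd0 bp e1 hD hN.
have Re_le x : `|x - x0| <= h -> forall sg : R, `|sg| <= 1 ->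
   sg * Re ((U x)^* * U1 x) <= eps^-1 * (b - sg * (p1 * (x - x0))) * normc (U x) ^+ 2.
  move=> hx sg sg1; set N := eps%:C * U1 x + ('i * sd%:C + p1%:C * (x - x0)%:C) * U x.
  have E : U1 x = (eps^-1)%:C * (N - ('i * sd%:C + p1%:C * (x - x0)%:C) * U x).
    rewrite real_complexV /N; have : eps%:C != 0 :> R[i] by rewrite eq_complex /= gt_eqF.
    by move: (eps%:C) ('i * _ + _) => *; field.
  have -> : Re ((U x)^* * U1 x) = eps^-1 * (Re ((U x)^* * N) - p1 * (x - x0) * normc (U x) ^+ 2).
    rewrite E sqr_normcE; move: (U x) (N) (eps^-1) (x - x0) => [u1 u2] [n1 n2] e t.
    by rewrite /= ?(mul0r, mulr0, mul1r, subr0, addr0, add0r, oppr0); ring.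
  have h1 : sg * Re ((U x)^* * N) <= b * normc (U x) ^+ 2.
    apply: (le_trans (ler_norm _)); rewrite normrM.
    apply: (@le_trans _ _ (1 * normc ((U x)^* * N))).
      by apply: ler_pM; rewrite ?normr_ge0// normc_Re.
    rewrite mul1r normcM normc_conj expr2 mulrCA ler_wpM2l ?normc_ge0//.
    exact: hN.
  have -> : sg * (eps^-1 * (Re ((U x)^* * N) - p1 * (x - x0) * normc (U x) ^+ 2)) =
    eps^-1 * (sg * Re ((U x)^* * N) - sg * (p1 * (x - x0)) * normc (U x) ^+ 2) by ring.
  have -> : eps^-1 * (b - sg * (p1 * (x - x0))) * normc (U x) ^+ 2 =
    eps^-1 * (b * normc (U x) ^+ 2 - sg * (p1 * (x - x0)) * normc (U x) ^+ 2) by ring.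
  by rewrite ler_pM2l ?invr_gt0// lerD2r.
have sqle (x y : R) : 0 <= x -> 0 <= y -> x ^+ 2 <= y ^+ 2 -> x <= y.
  by move=> ? ?; rewrite ler_sqr.
have dg (t : R) : is_derive t 1 (fun s => 2 / eps * (b * s - p1 / 2 * s ^+ 2)) (2 / eps * (b - p1 * t)).
  have h1 := @is_derive_id R R t 1.
  have h2 := is_deriveM h1 h1.
  have H := is_deriveM (is_derive_cst (2 / eps) t 1) (is_deriveB (is_deriveM (is_derive_cst b t 1) h1)
     (is_deriveM (is_derive_cst (p1 / 2) t 1) h2)).
  by apply: is_derive_eq H _; rewrite /GRing.scale /=; field; rewrite gt_eqF.
(* Stated for a curve starting at [x0], to be used for both directions, [x0 + t] and [x0 - t]. *)
have decay (V : R -> R[i]) (dV : R -> R[i]) : V 0 = U x0 ->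
   (forall t, 0 <= t <= h -> rD V t (dV t)) ->
   (forall t, 0 <= t <= h -> Re ((V t)^* * dV t) <= eps^-1 * (b - p1 * t) * normc (V t) ^+ 2) ->
   forall t, h / 2 <= t <= h -> normc (V t) <= normc (U x0) * expR (- (p1 * h ^+ 2 / 16) / eps).
  move=> V0 hV hV' t /andP[t1 t2]; have t0 : 0 <= t by flra.
  have H := @gronwall_le R (fun s => normc (V s) ^+ 2) (fun s => 2 * Re ((V s)^* * dV s))
     (fun s => 2 / eps * (b * s - p1 / 2 * s ^+ 2)) (fun s => 2 / eps * (b - p1 * s)) 0 t t0.
  apply: sqle; [exact: normc_ge0|by apply: mulr_ge0; [exact: normc_ge0|exact: expR_ge0]|].
  apply: (le_trans (H _ (fun s _ => dg s) _)).
  - by move=> s /andP[s0 st]; apply: rD_normsq; apply: hV; rewrite s0 (le_trans st).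
  - move=> s /andP[s0 st]; have := hV' s; rewrite s0 (le_trans st t2) => /(_ isT).
    by rewrite -(ler_pM2l (_ : 0 < 2))// => /le_trans; apply; rewrite le_eqVlt; apply/orP; left; apply/eqP; ring.
  - rewrite V0 exprMn ler_wpM2l ?sqr_ge0// -expRM_natl ler_expR.
    have -> : 2 / eps * (b * t - p1 / 2 * t ^+ 2) - 2 / eps * (b * 0 - p1 / 2 * 0 ^+ 2) =
      2 / eps * (b * t - p1 / 2 * t ^+ 2) by rewrite expr0n /=; ring.
    have -> : 2 * (- (p1 * h ^+ 2 / 16) / eps) = 2 / eps * (- (p1 * h ^+ 2 / 16)) by ring.
    rewrite ler_pM2l; last by pos.
    have a1 : b * t <= b * h by rewrite ler_wpM2l.
    have a2 : p1 * (h / 2) ^+ 2 <= p1 * t ^+ 2 by rewrite ler_pM2l// lerXn2r// nnegrE; flra.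
    have a3 : 16 * b * h <= p1 * h * h by rewrite ler_pM2r.
    rewrite expr_div_n in a2; nra.
split.
  move=> x /andP[x1 x2]; have [xx|xx] := leP x0 x.
    rewrite ger0_norm ?subr_ge0// in x1 x2.
    have := @decay (fun t => U (x0 + t * 1)) (fun t => U1 (x0 + t * 1) * (1 : R)%:C).
    rewrite mul0r addr0 => /(_ erefl) H; have xE : x0 + (x - x0) * 1 = x by ring.
    rewrite -{1}xE; apply: H; last by rewrite x1.
    - move=> t /andP[t0 th]; apply: rD_affine; apply: hD.
      by rewrite mulr1 addrAC subrr add0r ger0_norm.
    - move=> t /andP[t0 th]; rewrite !mulr1.
      have tx : x0 + t - x0 = t by ring.
      have := Re_le (x0 + t); rewrite tx ger0_norm// => /(_ th 1); rewrite normr1 lexx => /(_ isT).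
      by rewrite !mul1r.
  rewrite ltr0_norm ?subr_lt0// opprB in x1 x2.
  have := @decay (fun t => U (x0 + t * -1)) (fun t => U1 (x0 + t * -1) * (-1 : R)%:C).
  rewrite mul0r addr0 => /(_ erefl) H; have xE : x0 + (x0 - x) * -1 = x by ring.
  rewrite -{1}xE; apply: H; last by rewrite x1.
  - move=> t /andP[t0 th]; apply: rD_affine; apply: hD.
    by rewrite mulrN1 addrAC subrr add0r normrN ger0_norm.
  - move=> t /andP[t0 th]; rewrite mulrN1.
    have tx : x0 - t - x0 = - t by ring.
    have := Re_le (x0 - t); rewrite tx normrN ger0_norm// => /(_ th (-1)); rewrite normrN1 lexx => /(_ isT).
    by rewrite !mulN1r mulrN opprK rmorphN rmorph1 mulrN1 mulrN ReN.
move=> x /andP[x1 x2].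
pose Cu := b + sd + p1 * h; have Cu0 : 0 < Cu by rewrite /Cu; pos.
have inh s : x0 <= s <= x -> `|s - x0| <= h.
  move=> /andP[s1 s2]; rewrite ger0_norm ?subr_ge0//.
  have : eps * h <= 1 * h by rewrite ler_pM2r// ltW.
  flra.
have H := @gronwall_le R (fun s => - normc (U s) ^+ 2) (fun s => - (2 * Re ((U s)^* * U1 s)))
     (fun s => (- (2 * Cu / eps)) * s) (fun s => - (2 * Cu / eps)) x0 x x1.
have {}H : - normc (U x) ^+ 2 <= - normc (U x0) ^+ 2 * expR (- (2 * Cu / eps) * x - - (2 * Cu / eps) * x0).
  apply: H.
  - by move=> s /inh/hD/rD_normsq h1; apply: is_deriveN.
  - move=> s _; have := is_deriveM (is_derive_cst (- (2 * Cu / eps)) s 1) (@is_derive_id R R s 1).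
    by move=> H; apply: is_derive_eq H _; rewrite /GRing.scale /= mulr0 addr0 mulr1.
  - move=> s /inh hs; have := hN _ hs; set w := _ + _ * U s => hw.
    have E : U1 s = (eps^-1)%:C * (w - ('i * sd%:C + p1%:C * (s - x0)%:C) * U s).
      rewrite real_complexV /w; have : eps%:C != 0 :> R[i] by rewrite eq_complex /= gt_eqF.
      by move: (eps%:C) ('i * _ + _) => *; field.
    have n1 : normc (U1 s) <= eps^-1 * (Cu * normc (U s)).
      rewrite E normcM normcr gtr0_norm ?invr_gt0// ler_pM2l ?invr_gt0//.
      apply: (le_trans (normcB _ _)); rewrite /Cu -addrA [leRHS]mulrDl; apply: lerD => //.
      rewrite normcM ler_wpM2r ?normc_ge0//; apply: (le_trans (le_normcD _ _)).
      rewrite !normcM !normcr normc_i mul1r (gtr0_norm sd0) (gtr0_norm p10) lerD2l.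
      by rewrite ler_pM2l.
    have -> : - (2 * Cu / eps) * - normc (U s) ^+ 2 = 2 * (normc (U s) * (eps^-1 * (Cu * normc (U s)))).
      by rewrite expr2; ring.
    rewrite -mulrN ler_pM2l// -ReN -mulrN; apply: (le_trans (Re_mul_le _ _)).
    by rewrite normc_conj normcN ler_wpM2l ?normc_ge0.
apply: sqle; [by apply: mulr_ge0; [exact: normc_ge0|exact: expR_ge0]|exact: normc_ge0|].
rewrite mulNr lerN2 in H; apply: le_trans H.
rewrite exprMn ler_wpM2l ?sqr_ge0// -expRM_natl ler_expR.
have -> : - (2 * Cu / eps) * x - - (2 * Cu / eps) * x0 = - (2 * Cu * ((x - x0) / eps)) by ring.
have -> : 2 * - ((b + sd + p1 * h) * h) = - (2 * Cu * h) by rewrite /Cu; ring.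
rewrite lerN2 ler_pM2l; last by pos.
by rewrite ler_pdivrMr// mulrC; flra.
Qed.

End RealLine.

Section LocalSolution.
Variables (R : realType) (q : R -> R) (G : set R[i]^o) (qC : R[i]^o -> R[i]^o).
Hypothesis AM : AM_continuation q G qC.
Local Notation q2C := (q2C qC).

(** [A] stands for the square of alpha. The square of the linear function [pt] differs from
    ['i * (qC z - lam)] by at most [E * h ^+ 2], and the cone keeps the solution within
    [b = K * h ^+ 2] of the branch. For small [h] this is beaten by the Gaussian slope [p1 * h],
    whatever [lam] within [h ^+ 2] of [lam0]. The solution is normalized so that [Y2 - A Y] is 1 at
    [x0]. *)
Lemma local_solution (A : R) (lam0 : R[i]) : 0 <= A -> Pi_of q lam0 ->
  exists x0 h kap C e1 : R, [/\ 0 < h, -1 < x0 - h, x0 + h < 1, 0 < kap & 0 < C] /\ 0 < e1 /\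
  forall (lam : R[i]) (eps : R), normc (lam - lam0) <= h ^+ 2 -> 0 < eps -> eps < e1 ->
  eps < 2^-1 /\ exists Y Y1 Y2 Y3 Y4 : R -> R[i],
  [/\ forall x, `|x - x0| <= h -> [/\ rD Y x (Y1 x), rD Y1 x (Y2 x), rD Y2 x (Y3 x), rD Y3 x (Y4 x) &
       'i * (eps ^+ 2)%:C * ((Y4 x - A%:C * Y2 x) - A%:C * (Y2 x - A%:C * Y x))
       + ((q x)%:C - lam) * (Y2 x - A%:C * Y x) - q2C x%:C * Y x = 0],
     forall x, h / 2 <= `|x - x0| <= h ->
       [/\ normc (Y x) <= C / eps * expR (- kap / eps), normc (Y1 x) <= C / eps * expR (- kap / eps),
           normc (Y2 x) <= C / eps * expR (- kap / eps) & normc (Y3 x) <= C / eps * expR (- kap / eps)] &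
     forall x, x0 <= x <= x0 + eps * h -> eps <= C * normc (Y1 x)].
Proof.
move=> A0 [hc del0]; set c := Re lam0 in hc.
have [x0 [dq [x0i qx0 dq0 q1x0]]] := simple_crossing AM hc.
have x0i' : -1 <= x0 <= 1 by case/andP: x0i => /ltW -> /ltW ->.
have [R0 R00 hR0] := AM_oG AM (itv_G AM x0i').
pose sd := Num.sqrt (- Im lam0); have sd0 : 0 < sd by rewrite sqrtr_gt0 oppr_gt0.
have sd2 : sd ^+ 2 = - Im lam0 by rewrite sqr_sqrtr// oppr_ge0 ltW.
(* Matches the linear terms of the square of ['i * sd + p1 * (z - x0)] and of ['i * (qC z - lam0)];
   the constant terms are both [- sd ^+ 2 = Im lam0]. *)
pose p1 := dq / (2 * sd); have p10 : 0 < p1 by rewrite /p1; pos.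
have R02 : 0 < R0 / 2 by rewrite divr_gt0.
have R021 : R0 / 2 < R0 by clear - AM R00; lra.
have [cc [M [M0 hM hq hq1]]] := hol_ps (AM_hol AM) hR0 R02 R021.
have [cc' [M' [M'0 hM' hq2 _]]] := hol_ps (q2C_hol AM) hR0 R02 R021.
pose L1 := 2 * M * 2 ^+ 2 / (R0 / 2) ^+ 2; have L10 : 0 <= L1 by rewrite /L1; pos.
have qtail w : normc w <= R0 / 4 -> normc (qC (x0%:C + w) - c%:C - dq%:C * w) <= L1 * normc w ^+ 2.
  move=> hw; have wr : normc w <= R0 / 2 / 2 by clear - AM hw; lra.
  have := ps_tail 2 R02 hM hq wr; rewrite !big_ord_recr big_ord0 /= add0r expr0 mulr1 expr1.
  have -> : cc 0%N = c%:C by rewrite -(hasps0 R02 hq) (qCE AM)// qx0.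
  have -> : cc 1%N = dq%:C.
    by rewrite -q1x0 /q1C (hasps0 R02 hq1) /psdiff mul1r.
  by rewrite opprD addrA.
pose B2 := 2 * M' * 2 ^+ 0 / (R0 / 2) ^+ 0; have B20 : 0 <= B2 by rewrite /B2 !expr0; pos.
have q2bd w : normc w <= R0 / 4 -> normc (q2C (x0%:C + w)) <= B2.
  move=> hw; have wr : normc w <= R0 / 2 / 2 by clear - AM hw; lra.
  by have := ps_tail 0 R02 hM' hq2 wr; rewrite big_ord0 subr0 [normc w ^+ 0]expr0 mulr1.
(* The three summands account for the Taylor remainder of [q], the square of the linear term of the
   root, and the displacement of [lam] by at most [h ^+ 2]. *)
pose E := L1 + p1 ^+ 2 + 1; have E0 : 0 < E by rewrite /E; pos.
pose th := sd / 8; have th0 : 0 < th by rewrite /th; pos.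
(* [K] and [K2] are read off the hypotheses of [cone_segment], with opening [b = K * h ^+ 2] for [N]
   and [K2 * h * eps] for [M]. Half of [th * b = 4 * E * h ^+ 2] pays for the error of the root, the
   other half for the terms with [eps]. *)
pose K := 4 * E / th; have K0 : 0 < K by rewrite /K; pos.
pose K2 := 2 * p1 / (th * sd); have K20 : 0 < K2 by rewrite /K2; pos.
have KE : th * K = 4 * E by rewrite /K; field; rewrite gt_eqF.
have K2E : th * K2 * sd = 2 * p1 by rewrite /K2; field; rewrite !gt_eqF.
have th8 : 8 * th = sd by rewrite /th; field.
have [h h0 hs] : exists2 h : R, 0 < h & all (fun x => h <= x) [:: 1; sd / (4 * p1); th / (2 * K);
    p1 / (16 * K); th / (2 * K2); (2 * K2 * sd)^-1; R0 / 24; (1 - x0) / 2; (x0 + 1) / 2].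
  apply: small_ex; case/andP: x0i => i1 i2; rewrite /= andbT.
  clear - AM K0 K20 p10 th0 sd0 R00 i1 i2; clearbody K K2 p1 th sd.
  by repeat (apply/andP; split); try pos; flra.
move: hs => /= /and5P[h1 h2 h3 h4 /and5P[h5 h6 h7 h8 /andP[h9 _]]].
rewrite ler_pdivlMr in h2; last by pos.
rewrite ler_pdivlMr in h3; last by pos.
rewrite ler_pdivlMr in h4; last by pos.
rewrite ler_pdivlMr in h5; last by pos.
have {}h6 : h * (2 * K2 * sd) <= 1 by rewrite -ler_pdivlMr ?mul1r//; pos.
pose b := K * h ^+ 2; have b0 : 0 < b by rewrite /b; pos.
have [e1 e10 es] : exists2 e : R, 0 < e & all (fun x => e <= x) [:: 2^-1; E * h ^+ 2 / (A + p1);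
    th * b / (2 * B2 + 1); th * K2 * h / (2 * A + 1); th * sd / 2].
  apply: small_ex; rewrite /= andbT; clear - AM E0 A0 p10 th0 b0 B20 K20 h0 sd0.
  clearbody E p1 th b B2 K2 sd; by repeat (apply/andP; split); pos.
move: es => /= /and5P[l1 l2 l3 l4 /andP[l5 _]].
have Ap : 0 < A + p1 by pos.
rewrite ler_pdivlMr in l2; last by pos.
rewrite ler_pdivlMr in l3; last by pos.
rewrite ler_pdivlMr in l4; last by pos.
pose kap := p1 * h ^+ 2 / 16; have kap0 : 0 < kap by rewrite /kap; pos.
pose Cu := b + sd + p1 * h; have Cu0 : 0 < Cu by rewrite /Cu; pos.
pose C1 := th + sd^-1; have C10 : 0 < C1 by rewrite /C1; pos.
(* The first bracket bounds the solution and its derivatives through [U]; the last summand serves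
   the lower bound for [Y1]. *)
pose C := (Cu + A * C1 + C1 + 1 + A) + 2 * sd * expR (Cu * h).
have C0 : 0 < C by rewrite /C; pos.
exists x0, h, kap, C, e1; split; first by clear - AM x0i h0 h8 h9 kap0 C0; case/andP: x0i => *; split => //; flra.
split => // lam eps hlam eps0 epse.
have ee1 : eps < 1 by clear - AM l1 epse; lra.
have dqE0 : dq = 2 * sd * p1 by rewrite /p1; field; rewrite gt_eqF.
have [EE bE CuE C1E CE] : [/\ E = L1 + p1 ^+ 2 + 1, b = K * h ^+ 2, Cu = b + sd + p1 * h, C1 = th + sd^-1 &
  C = (Cu + A * C1 + C1 + 1 + A) + 2 * sd * expR (Cu * h)] by [].
have kapE : kap = p1 * h ^+ 2 / 16 by [].
have x0h x : `|x - x0| <= h -> -1 <= x <= 1.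
  clear - AM h0 h8 h9 x0i; rewrite ler_norml => /andP[? ?]; case/andP: x0i => ? ?.
  by apply/andP; split; flra.
have x0h' x : x0 <= x <= x0 + eps * h -> `|x - x0| <= h.
  clear - AM h0 ee1; case/andP=> ? ?; rewrite ger0_norm ?subr_ge0//.
  have : eps * h <= 1 * h by rewrite ler_pM2r// ltW.
  flra.
clearbody C kap Cu C1 b K K2 th E p1 sd L1 B2.
clear - Ap AM A0 x0i R00 hR0 sd0 sd2 p10 qtail q2bd E0 th0 K0 K20 KE K2E th8 h0 h1 h2 h3 h4 h5 h6 h7 b0 e10 l1 l2 l3 l4 l5 kap0 Cu0 C10 C0 hlam eps0 epse ee1 EE bE CuE C1E CE kapE dqE0 x0h x0h' B20 L10.
split; first by clear - AM l1 epse; lra.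
pose zs : R[i] := x0%:C - 'i * h%:C.
pose pt (z : R[i]) := 'i * sd%:C + p1%:C * (z - x0%:C).
pose p0 : R[i] := 'i * sd%:C.
(* The segments from [zs] to the real points within [h] of [x0] have length at most [2 * h]. The
   solution lives on radius [3 * h], the expansions of the coefficients on [4 * h], their holomorphy
   on [5 * h]. *)
have disczs w : disc zs (5 * h) w -> (G : set R[i]) w.
  move=> hw; apply: hR0; rewrite /disc /= in hw *.
  have -> : w - x0%:C = (w - zs) - 'i * h%:C by rewrite /zs; ring.
  apply: (le_lt_trans (normcB _ _)); rewrite normcM normc_i mul1r normcr gtr0_norm//; clear - AM hw h0 h7; lra.
pose ie : R[i] := ((eps ^+ 2)^-1)%:C.
(* The equation solved for the fourth derivative, [Y4 = fa * Y2 + fb * Y]. *)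
pose fa (z : R[i]) := ('i * ie) * qC z + (2 * A%:C - 'i * ie * lam).
pose fb (z : R[i]) := ((- A%:C * ('i * ie)) * qC z + (A%:C * ('i * ie * lam) - A%:C ^+ 2)) + ((- 'i * ie) * q2C z + 0).
have hfa : hol (G : set R[i]) fa by exact: hol_lin (AM_hol AM).
have hfb : hol (G : set R[i]) fb by apply: hol_add; apply: hol_lin; [exact: (AM_hol AM)|exact: (q2C_hol AM)].
have r4 : 0 < 4 * h by clear - AM h0; lra.
have r45 : 4 * h < 5 * h by clear - AM h0; lra.
have [ca [Ma [hMa hca]]] := cauchy_ps r4 r45 (fun w hw => hfa w (disczs w hw)).
have [cb [Mb [hMb hcb]]] := cauchy_ps r4 r45 (fun w hw => hfb w (disczs w hw)).
have hMa' : psbound ca (Num.max Ma Mb) (4 * h) by move=> k; rewrite (le_trans (hMa k))// le_max lexx.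
have hMb' : psbound cb (Num.max Ma Mb) (4 * h) by move=> k; rewrite (le_trans (hMb k))// le_max lexx orbT.
have r3 : 0 < 3 * h by clear - AM h0; lra.
have r34 : 3 * h < 4 * h by clear - AM h0; lra.
have eC : eps%:C != 0 :> R[i] by rewrite eq_complex /= gt_eqF.
have sdC : sd%:C != 0 :> R[i] by rewrite eq_complex /= gt_eqF.
have i0 : ('i : R[i]) != 0 by rewrite -normc_gt0 normc_i.
have p00 : p0 != 0 by rewrite mulf_neq0.
(* The initial values put the solution exactly on the dominant branch at [zs]: [U = 1], [Y = 0], and
   both deviations [N] and [M] of [cone_segment] vanish. *)
have [Y [Y1 [Y2 [Y3 [Y4 [[y0 y1 y2 y3] hY]]]]]] :=
  ode_solution 0 (- (eps%:C / p0)) 1 (- (pt zs / eps%:C) + A%:C * - (eps%:C / p0)) r3 r34 hMa' hMb' hca hcb.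
pose U z := Y2 z - A%:C * Y z; pose U1 z := Y3 z - A%:C * Y1 z.
have ieE : ie = eps%:C ^- 2 by rewrite /ie real_complexV (rmorphXn (real_complex R) 2 eps).
have m00 : 0 < K2 * h * eps by pos.
have x0r x : x%:C = zs + ((x - x0)%:C + 'i * h%:C) by rewrite /zs rmorphB; ring.
have nd x : `|x - x0| <= h -> normc ((x - x0)%:C + 'i * h%:C) <= 2 * h.
  move=> hx; apply: (le_trans (le_normcD _ _)); rewrite normcM normc_i mul1r !normcr (gtr0_norm h0); clear - AM hx; lra.
have cone x : `|x - x0| <= h -> [/\ normc (eps%:C * U1 x%:C + pt x%:C * U x%:C) <= b * normc (U x%:C),
      normc (Y1 x%:C + eps%:C / p0 * U x%:C) <= K2 * h * eps * normc (U x%:C),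
      normc (Y x%:C) <= eps * normc (U x%:C) & U x%:C != 0].
  move=> hx; set d := (x - x0)%:C + 'i * h%:C.
  have near s : 0 <= s <= 1 -> normc (zs + s%:C * d - x0%:C) <= h.
    move=> /andP[s0 s1].
    have -> : zs + s%:C * d - x0%:C = s%:C * (x - x0)%:C - (1 - s)%:C * ('i * h%:C).
      by rewrite /zs /d (rmorphB _ 1 s) rmorph1; ring.
    apply: (le_trans (normcB _ _)); rewrite !normcM normc_i mul1r !normcr (gtr0_norm h0) (ger0_norm s0).
    rewrite (@ger0_norm _ (1 - s)) ?subr_ge0//; have sh : s * `|x - x0| <= s * h by rewrite ler_wpM2l.
    clear - AM sh; lra.
  have sd3 s : 0 <= s <= 1 -> normc (s%:C * d) < 3 * h.
    move=> /andP[s0 s1]; rewrite normcM normcr ger0_norm//.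
    have sn : s * normc d <= 1 * (2 * h) by apply: ler_pM => //; [exact: normc_ge0|exact: nd].
    clear - AM sn h0; lra.
  rewrite (x0r x) -/d.
  apply: (@cone_segment R U U1 Y Y1 qC q2C zs x0%:C d lam (Num.sqrt A) eps h sd p1 b (K2 * h * eps) th E B2) => //; rewrite ?sqr_sqrtr//.
  - exact: ltW.
  - exact: nd.
  - by rewrite /d !ReImE /=; ring.
  - move=> s s01; have [D0 D1 D2 D3 D4] := hY _ (sd3 _ s01).
    split => //.
    + exact: hasDB D2 (hasDZ _ D0).
    + have HH := hasDB D3 (hasDZ A%:C D1); apply: hasD_eq HH _.
      rewrite D4 /fa /fb /U ieE (rmorphM (real_complex R)) (rmorphXn (real_complex R) 2 eps) /=.
      by move: (qC _) (q2C _) (Y2 _) (Y _) (eps%:C) eC => *; field.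
    + by rewrite /U subrK.
  - move=> s s01; have ns := near _ s01; set z := zs + s%:C * d; rewrite -/z in ns.
    have zE : z = x0%:C + (z - x0%:C) by ring.
    have nR : normc (z - x0%:C) <= R0 / 4 by clear - AM ns h0 h7; lra.
    have h2' : normc (z - x0%:C) ^+ 2 <= h ^+ 2 by rewrite lerXn2r ?nnegrE ?normc_ge0// ltW.
    split; last by rewrite zE; exact: q2bd.
    set w := z - x0%:C in zE nR h2'.
    have -> : 'i * (qC z - lam) - ('i * sd%:C + p1%:C * w) ^+ 2 =
      'i * (qC (x0%:C + w) - c%:C - dq%:C * w) - 'i * (lam - lam0) + (- (p1%:C ^+ 2 * w ^+ 2)).
      have dqE : dq%:C = 2 * sd%:C * p1%:C :> R[i].
        by rewrite -[2 : R[i]](rmorph_nat (real_complex R) 2) -!rmorphM /=; congr (_%:C).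
      have lE : 'i * (c%:C - lam0) = - (sd%:C ^+ 2).
        rewrite -(rmorphXn (real_complex R) 2 sd)/= sd2 /c; case: (lam0) => l1' l2'.
        by apply: complexP; rewrite !ReImE /=; ring.
      rewrite -zE dqE; have -> : ('i * sd%:C + p1%:C * w) ^+ 2 = ('i * 'i) * sd%:C ^+ 2 + 2 * 'i * sd%:C * p1%:C * w + p1%:C ^+ 2 * w ^+ 2 by ring.
      have -> : ('i : R[i]) * 'i = -1 by rewrite -expr2 sqr_i.
      have -> : -1 * sd%:C ^+ 2 = 'i * (c%:C - lam0) by rewrite lE mulN1r.
      by ring.
    apply: (le_trans (normc_lin _ _ _)); rewrite !normcN (normcM (p1%:C ^+ 2)) !(normcM 'i) normc_i !mul1r !normcX normcr (gtr0_norm p10).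
    have q1' := qtail _ nR.
    have j1 : L1 * normc w ^+ 2 <= L1 * h ^+ 2 by rewrite ler_wpM2l.
    have j2 : p1 ^+ 2 * normc w ^+ 2 <= p1 ^+ 2 * h ^+ 2 by rewrite ler_wpM2l// sqr_ge0.
    rewrite EE; clear - AM q1' j1 j2 hlam; lra.
  - by rewrite mulrC.
  - have j1 : K * h ^+ 2 <= K * (h * 1) by rewrite ler_pM2l// expr2 ler_pM2l.
    rewrite bE; clear - AM j1 h3; lra.
  - have -> : th * b = 4 * E * h ^+ 2 by rewrite bE mulrA KE.
    have j1 : eps * (eps * A + p1) <= eps * (A + p1) by rewrite ler_pM2l// lerD2r ler_piMl// ltW.
    have j2 : eps * (A + p1) <= e1 * (A + p1) by rewrite ler_pM2r// ltW.
    have j3 : 0 < E * h ^+ 2 by rewrite mulr_gt0// exprn_gt0.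
    clear - AM j1 j2 j3 l2; lra.
  - have j1 : eps * (2 * B2 + 1) <= e1 * (2 * B2 + 1).
      by apply: ler_wpM2r; [clear - AM B20; pos|exact: ltW].
    clear - AM j1 l3 eps0; lra.
  - have l6 : eps * (2 * A + 1) <= e1 * (2 * A + 1).
      by apply: ler_wpM2r; [clear - AM A0; pos|exact: ltW].
    have eA : 0 <= eps * A by rewrite mulr_ge0// ltW.
    have -> : th * (K2 * h * eps) = (th * K2 * h) * eps by ring.
    by rewrite ler_pM2r//; clear - AM l6 l4 eA eps0; lra.
  - have -> : th * (K2 * h * eps) * sd = (th * K2 * sd) * (h * eps) by ring.
    have -> : 2 * eps * b = (K * h) * (2 * (h * eps)) by rewrite bE; ring.
    have he0 : 0 < h * eps by pos.
    have -> : th * K2 * sd * (h * eps) = p1 * (2 * (h * eps)) by rewrite K2E; ring.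
    rewrite ler_pM2r; last by pos.
    have j1 : 0 < K * h by rewrite mulr_gt0.
    clear - AM j1 h4; lra.
  - have -> : th * (K2 * h * eps) * sd = (th * K2 * sd) * (h * eps) by ring.
    have -> : 2 * eps * p1 * h = (2 * p1) * (h * eps) by ring.
    by rewrite K2E.
  - have j1 : (K2 * h) * eps <= (K2 * h) * 1 by rewrite ler_pM2l ?ltW// mulr_gt0.
    clear - AM j1 h5; lra.
  - clear - AM epse l5; lra.
  - by rewrite /U y2 y0 mulr0 subr0 oner_eq0.
  - rewrite -/(pt zs) /U1 /U y3 y2 y1 y0; move: (pt zs) (p0) p00 (eps%:C) eC (A%:C) => X1 X2 X3 X4 X5 X6.
    by field; rewrite X3.
  - by rewrite y1 /U y2 y0; ring.
have [_ _ _ U00] : [/\ True, True, True & U x0%:C != 0] by have [] := cone x0; rewrite ?subrr ?normr0 ?(ltW h0).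
have rcomp (X X' : R[i] -> R[i]) x : cD X x%:C (X' x%:C) -> rD (fun t => X t%:C) x (X' x%:C).
  by move=> hX; have := hasD_comp (rD_id x) hX; rewrite mulr1.
have hYr x : `|x - x0| <= h -> [/\ cD Y x%:C (Y1 x%:C), cD Y1 x%:C (Y2 x%:C), cD Y2 x%:C (Y3 x%:C), cD Y3 x%:C (Y4 x%:C)
   & Y4 x%:C = fa x%:C * Y2 x%:C + fb x%:C * Y x%:C].
  by move=> hx; rewrite (x0r x); apply: hY; apply: le_lt_trans (nd _ hx) _; clear - AM h0; lra.
have [|||||||||dec low] := @real_decay R (fun x => U x%:C) (fun x => U1 x%:C) x0 h eps b p1 sd => //.
- exact: ltW.
- by rewrite bE; have j1 := ler_wpM2r (ltW h0) h4; clear - AM j1; lra.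
- move=> x hx; have [D0 D1 D2 D3 D4] := hYr _ hx.
  by apply: rcomp; exact: hasDB D2 (hasDZ _ D0).
- by move=> x hx; have [] := cone _ hx; rewrite /pt -rmorphB.
set V := U x0%:C in U00 dec low.
have V0 : 0 < normc V by rewrite normc_gt0.
exists (fun x => V^-1 * Y x%:C), (fun x => V^-1 * Y1 x%:C), (fun x => V^-1 * Y2 x%:C),
  (fun x => V^-1 * Y3 x%:C), (fun x => V^-1 * Y4 x%:C); split.
- move=> x hx; have [D0 D1 D2 D3 D4] := hYr _ hx.
  split; try by apply: hasDZ; apply: rcomp.
  have xi := x0h _ hx.
  rewrite D4 /fa /fb ieE -(qCE AM xi) (rmorphXn (real_complex R) 2 eps).
  have ii : ('i : R[i]) ^+ 2 = -1 by rewrite sqr_i.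
  have -> : forall a0 b0 : R[i], 'i * eps%:C ^+ 2 * (V^-1 * (('i * eps%:C ^- 2 * qC x%:C + (2 * A%:C - 'i * eps%:C ^- 2 * lam)) * a0 +
     (- A%:C * ('i * eps%:C ^- 2) * qC x%:C + (A%:C * ('i * eps%:C ^- 2 * lam) - A%:C ^+ 2) + (- 'i * eps%:C ^- 2 * q2C x%:C + 0)) * b0)
     - A%:C * (V^-1 * a0) - A%:C * (V^-1 * a0 - A%:C * (V^-1 * b0))) + (qC x%:C - lam) * (V^-1 * a0 - A%:C * (V^-1 * b0)) - q2C x%:C * (V^-1 * b0)
     = ('i ^+ 2 + 1) * V^-1 * ((qC x%:C - lam) * (a0 - A%:C * b0) - q2C x%:C * b0).
    by move=> a0' b0'; move: (qC _) (q2C _) (eps%:C) eC (V^-1) => *; field.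
  by rewrite ii addNr !mul0r.
- move=> x hx; have hx' : `|x - x0| <= h by case/andP: hx.
  have [k1 k2 k3 _] := cone _ hx'.
  have dx := dec _ hx; rewrite -kapE in dx; set ex := expR _ in dx *.
  have ex0 : 0 < ex by exact: expR_gt0.
  set u := normc (U x%:C) in k1 k2 k3 dx.
  have u0 : 0 <= u by exact: normc_ge0.
  have uV : (normc V)^-1 * u <= ex by rewrite ler_pdivrMl.
  have fin (W : R[i]) (D : R) : 0 <= D -> D <= C -> normc W <= D / eps * u -> normc (V^-1 * W) <= C / eps * ex.
    move=> D0 DC hW; rewrite normcM normcV.
    apply: (@le_trans _ _ ((normc V)^-1 * (D / eps * u))); first by rewrite ler_wpM2l// invr_ge0 normc_ge0.
    rewrite mulrCA; apply: ler_pM; [by pos| |by rewrite ler_pM2r ?invr_gt0|exact: uV].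
    by apply: mulr_ge0; [rewrite invr_ge0 normc_ge0|].
  have ie1 : 1 <= eps^-1 by rewrite invf_ge1// ltW.
  have up (D : R) : 0 <= D -> D * u <= D / eps * u.
    by move=> D0; rewrite ler_wpM2r// ler_peMr.
  have e2 : 0 < 2 * sd * expR (Cu * h) by rewrite mulr_gt0 ?expR_gt0// mulr_gt0.
  have AC1 : 0 <= A * C1 by rewrite mulr_ge0// ltW.
  have Y0b : normc (Y x%:C) <= 1 * u by apply: (le_trans k3); rewrite ler_wpM2r// ltW.
  have nep0 : normc (eps%:C / p0) = eps / sd.
    by rewrite normcM normcV /p0 normcM normc_i mul1r !normcr !gtr0_norm.
  have Y1b : normc (Y1 x%:C) <= C1 * u.
    have -> : Y1 x%:C = (Y1 x%:C + eps%:C / p0 * U x%:C) - eps%:C / p0 * U x%:C by ring.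
    apply: (le_trans (normcB _ _)); rewrite normcM nep0 -/u.
    have i1 : K2 * h * eps * u <= th * u.
      apply: ler_wpM2r => //; have j1 : (K2 * h) * eps <= (K2 * h) * 1 by rewrite ler_pM2l ?ltW// mulr_gt0.
      clear - AM j1 h5 th0; lra.
    have i2 : eps / sd * u <= sd^-1 * u by rewrite ler_wpM2r// ler_piMl ?invr_ge0 ?(ltW sd0)// ltW.
    by rewrite C1E mulrDl lerD// ?(le_trans k2).
  have Y2b : normc (Y2 x%:C) <= (1 + A) * u.
    have -> : Y2 x%:C = U x%:C + A%:C * Y x%:C by rewrite /U subrK.
    apply: (le_trans (le_normcD _ _)); rewrite normcM normcr ger0_norm// -/u.
    by rewrite mulrDl mul1r lerD2l ler_wpM2l// (le_trans Y0b)// mul1r.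
  have Y3b : normc (Y3 x%:C) <= (Cu + A * C1) / eps * u.
    have -> : (Cu + A * C1) / eps * u = Cu / eps * u + A * C1 / eps * u by ring.
    have -> : Y3 x%:C = eps%:C^-1 * ((eps%:C * U1 x%:C + pt x%:C * U x%:C) - pt x%:C * U x%:C) + A%:C * Y1 x%:C.
      by rewrite addrK mulrA mulVf// mul1r /U1 subrK.
    apply: (le_trans (le_normcD _ _)); apply: lerD; last first.
      rewrite normcM normcr ger0_norm//; apply: (le_trans (ler_wpM2l A0 Y1b)).
      by rewrite mulrA; apply: up.
    rewrite normcM normcV normcr gtr0_norm// [Cu / eps]mulrC -mulrA ler_pM2l ?invr_gt0//.
    apply: (le_trans (normcB _ _)); rewrite CuE -addrA [leRHS]mulrDl; apply: lerD => //.
    rewrite normcM -/u ler_wpM2r//; apply: (le_trans (le_normcD _ _)).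
    rewrite !normcM -rmorphB !normcr normc_i mul1r (gtr0_norm sd0) (gtr0_norm p10) lerD2l.
    by rewrite ler_pM2l.
  have A1 : 0 <= 1 + A by rewrite addr_ge0.
  have [CD1 CD2 CD3 CD4] : [/\ 1 <= C, C1 <= C, 1 + A <= C & Cu + A * C1 <= C].
    by rewrite CE; clear - AM e2 AC1 A0 C10 Cu0; split; flra.
  split.
  + by apply: (fin _ 1) => //; apply: (le_trans Y0b); exact: up.
  + by apply: (fin _ C1) => //; [exact: ltW|apply: (le_trans Y1b); apply: up; exact: ltW].
  + by apply: (fin _ (1 + A)) => //; apply: (le_trans Y2b); exact: up.
  + by apply: (fin _ (Cu + A * C1)) => //; apply: addr_ge0 => //; exact: ltW.
- move=> x hx; have hx' := x0h' _ hx.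
  have [_ k2 _ _] := cone _ hx'.
  have lo := low _ hx; rewrite -CuE in lo; set u := normc (U x%:C) in k2 lo.
  have nep0 : normc (eps%:C / p0) = eps / sd.
    by rewrite normcM normcV /p0 normcM normc_i mul1r !normcr !gtr0_norm.
  (* By [h * (2 * K2 * sd) <= 1] the deviation of [Y1] from [- (eps / p0) * U] is at most half of
     the latter. *)
  have h1' : eps / sd * u / 2 <= normc (Y1 x%:C).
    have := normcB (Y1 x%:C + eps%:C / p0 * U x%:C) (Y1 x%:C).
    have -> : Y1 x%:C + eps%:C / p0 * U x%:C - Y1 x%:C = eps%:C / p0 * U x%:C by ring.
    rewrite normcM nep0 -/u => j1.
    have u0 : 0 <= u by exact: normc_ge0.
    have j2 : K2 * h * eps * u <= eps / sd / 2 * u.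
      apply: ler_wpM2r => //; rewrite -(ler_pM2r sd0).
      have -> : eps / sd / 2 * sd = eps / 2 by field; rewrite gt_eqF.
      have j3 : h * (2 * K2 * sd) * eps <= 1 * eps by rewrite ler_pM2r.
      clear - AM j3; lra.
    clear - AM j1 j2 k2; lra.
  rewrite normcM normcV.
  have lo' : expR (- (Cu * h)) <= (normc V)^-1 * u by rewrite ler_pdivlMl.
  have ee : expR (Cu * h) * expR (- (Cu * h)) = 1 by rewrite -expRD subrr expR0.
  apply: (@le_trans _ _ (2 * sd * expR (Cu * h) * ((normc V)^-1 * normc (Y1 x%:C)))); last first.
    apply: ler_wpM2r; first by apply: mulr_ge0; rewrite ?invr_ge0 normc_ge0.
    by rewrite CE ler_wpDl//; clear - AM Cu0 A0 C10; pos.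
  apply: (@le_trans _ _ (2 * sd * expR (Cu * h) * ((normc V)^-1 * (eps / sd * u / 2)))).
    have -> : 2 * sd * expR (Cu * h) * ((normc V)^-1 * (eps / sd * u / 2)) =
      expR (Cu * h) * ((normc V)^-1 * u) * eps by field; rewrite !gt_eqF.
    rewrite -{1}[eps]mul1r ler_pM2r// -ee ler_pM2l ?expR_gt0//.
  by apply: ler_wpM2l; [pos|rewrite ler_wpM2l// invr_ge0 normc_ge0].
Qed.

End LocalSolution.

(** * Complex integrals, square integrable functions and the Sobolev space *)

Section ComplexIntegral.
Variable R : realType.
Local Notation mu := (@lebesgue_measure R).
Local Notation meas A := (measurable (A : set (measurableTypeR R))).
Implicit Types (A : set R) (f g : R -> R[i]).

Definition rint A (f : R -> R) := mu.-integrable A (EFin \o f).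
Definition Cint A f := rint A (fun x => Re (f x)) /\ rint A (fun x => Im (f x)).

Lemma eq_rint A (f g : R -> R) : meas A -> {in A, f =1 g} -> rint A f -> rint A g.
Proof. by move=> mA fg; apply: eq_integrable => // x xA; rewrite /= fg. Qed.

Lemma rintD A (f g : R -> R) : meas A -> rint A f -> rint A g -> rint A (fun x => f x + g x).
Proof. by move=> mA hf hg; have := integrableD mA hf hg; apply: eq_integrable. Qed.

Lemma rintZ A (c : R) (f : R -> R) : meas A -> rint A f -> rint A (fun x => c * f x).
Proof. by move=> mA hf; have := integrableZl mA c hf; apply: eq_integrable. Qed.

Lemma rintB A (f g : R -> R) : meas A -> rint A f -> rint A g -> rint A (fun x => f x - g x).
Proof. by move=> mA hf hg; have := integrableB mA hf hg; apply: eq_integrable. Qed.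

Lemma CintD A f g : meas A -> Cint A f -> Cint A g -> Cint A (fun x => f x + g x).
Proof.
move=> mA [f1 f2] [g1 g2]; split.
  by apply: eq_rint (rintD mA f1 g1) => // x _; rewrite ReD.
by apply: eq_rint (rintD mA f2 g2) => // x _; rewrite ImD.
Qed.

Lemma CintZ A c f : meas A -> Cint A f -> Cint A (fun x => c * f x).
Proof.
move=> mA [f1 f2]; split.
  by apply: eq_rint (rintB mA (rintZ (Re c) mA f1) (rintZ (Im c) mA f2)) => // x _; rewrite ReImE.
by apply: eq_rint (rintD mA (rintZ (Re c) mA f2) (rintZ (Im c) mA f1)) => // x _; rewrite ReImE.
Qed.

Lemma cintegralD A f g : meas A -> Cint A f -> Cint A g ->
  cintegral A (fun x => f x + g x) = cintegral A f + cintegral A g.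
Proof.
move=> mA [f1 f2] [g1 g2]; apply: complexP; rewrite ?ReD ?ImD /=.
  by rewrite -RintegralD//; apply: eq_Rintegral => x _; rewrite ReD.
by rewrite -RintegralD//; apply: eq_Rintegral => x _; rewrite ImD.
Qed.

Lemma cintegralZ A c f : meas A -> Cint A f ->
  cintegral A (fun x => c * f x) = c * cintegral A f.
Proof.
move=> mA [f1 f2]; apply: complexP; rewrite !ReImE /=.
  rewrite -!RintegralZl// -RintegralB//; try exact: rintZ.
  by apply: eq_Rintegral => x _; rewrite ReImE.
rewrite -!RintegralZl// -RintegralD//; try exact: rintZ.
by apply: eq_Rintegral => x _; rewrite ReImE.
Qed.

Lemma eq_cintegral A f g : {in A, f =1 g} -> cintegral A f = cintegral A g.
Proof.
by move=> fg; apply: complexP => /=; apply: eq_Rintegral => x xA; rewrite fg.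
Qed.

Lemma eq_Cint A f g : meas A -> {in A, f =1 g} -> Cint A f -> Cint A g.
Proof.
by move=> mA fg [h1 h2]; split; [apply: eq_rint h1|apply: eq_rint h2] => // x xA; rewrite fg.
Qed.

Lemma ae_imp (P Q : R -> Prop) : (forall x, P x -> Q x) ->
  {ae mu, forall x, P x} -> {ae mu, forall x, Q x}.
Proof. by move=> PQ; apply: filterS => //; exact: (ae_filter_ringOfSetsType mu). Qed.

Lemma Rint_ae A (f g : R -> R) : meas A -> rint A f -> rint A g ->
  {ae mu, forall x, A x -> f x = g x} -> \int[mu]_(x in A) f x = \int[mu]_(x in A) g x.
Proof.
move=> mA hf hg fg; rewrite /Rintegral; congr fine; apply: ae_eq_integral => //.
- by have /integrableP[] := hf.
- by have /integrableP[] := hg.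
- by apply: ae_imp fg => x /= h /h ->.
Qed.

Lemma cintegral_ae A f g : meas A -> Cint A f -> Cint A g ->
  {ae mu, forall x, A x -> f x = g x} -> cintegral A f = cintegral A g.
Proof.
move=> mA [f1 f2] [g1 g2] fg; apply: complexP => /=; apply: Rint_ae => //.
  by apply: ae_imp fg => x /= h /h ->.
by apply: ae_imp fg => x /= h /h ->.
Qed.

Lemma cintegral_conj A f : Cint A f -> meas A ->
  cintegral A (fun x => (f x)^*) = (cintegral A f)^*.
Proof.
move=> [f1 f2] mA; apply: complexP; rewrite ReImE /=.
  by apply: eq_Rintegral => x _; rewrite ReImE.
rewrite -mulN1r -RintegralZl//; apply: eq_Rintegral => x _; rewrite ReImE mulN1r//.
Qed.

Lemma Cint_conj A f : meas A -> Cint A f -> Cint A (fun x => (f x)^*).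
Proof.
move=> mA [f1 f2]; split; first by apply: eq_rint f1 => // x _; rewrite ReImE.
by apply: eq_rint (rintZ (-1) mA f2) => // x _; rewrite ReImE mulN1r.
Qed.

(** Multiplication by the conjugate of the integral turns its squared modulus into the real part of
    an integral. *)
Lemma normc_cintegral A f (g : R -> R) : meas A -> Cint A f -> rint A g ->
  (forall x, A x -> normc (f x) <= g x) -> normc (cintegral A f) <= \int[mu]_(x in A) g x.
Proof.
move=> mA hf hg fg; set c := cintegral A f.
have [->|c0] := eqVneq c 0.
  rewrite normc0; apply: Rintegral_ge0 => x /fg; exact: le_trans (normc_ge0 _).
have nc : 0 < normc c by rewrite normc_gt0.
have cE : normc c * normc c = Re (cintegral A (fun x => c^* * f x)).
  by rewrite cintegralZ// -/c [_^* * _]mulrC mulc_conj /= expr2.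
rewrite -(ler_pM2l nc) cE -RintegralZl//=.
apply: le_Rintegral => //; [exact: (CintZ _ mA hf).1|exact: rintZ|] => x Ax.
apply: (le_trans (Re_mul_le _ _)); rewrite normc_conj ler_pM2l//; exact: fg.
Qed.

Lemma rint_sub A B (f : R -> R) : meas A -> meas B -> B `<=` A -> rint A f -> rint B f.
Proof. by move=> mA mB BA; apply: integrableS. Qed.

Lemma Cint_sub A B f : meas A -> meas B -> B `<=` A -> Cint A f -> Cint B f.
Proof. by move=> mA mB BA [h1 h2]; split; apply: rint_sub BA _. Qed.

Lemma Rint_split (f : R -> R) a b c : a <= b -> b <= c -> rint `[a, c] f ->
  \int[mu]_(x in `[a, c]) f x = \int[mu]_(x in `[a, b]) f x + \int[mu]_(x in `[b, c]) f x.
Proof.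
move=> ab bc hf; have := @Rintegral_itvB R f (BLeft a) (BRight c) b hf.
rewrite !bnd_simp => /(_ ab bc); rewrite Rintegral_itv_obnd_cbnd => [<-|].
  by rewrite addrC subrK.
apply: rint_sub hf => //; apply: subset_itvr; rewrite bnd_simp//.
Qed.

Lemma cintegral_split f a b c : a <= b -> b <= c -> Cint `[a, c] f ->
  cintegral `[a, c] f = cintegral `[a, b] f + cintegral `[b, c] f.
Proof.
move=> ab bc [f1 f2]; apply: complexP; rewrite ?ReD ?ImD /=; exact: Rint_split.
Qed.

Lemma rint_cont (f : R -> R) a b : {within `[a, b], continuous f} -> rint `[a, b] f.
Proof. by move=> cf; apply: continuous_compact_integrable => //; exact: segment_compact. Qed.

End ComplexIntegral.

Section L2Theory.
Variable R : realType.
Local Notation mu := (@lebesgue_measure R).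
Local Notation meas A := (measurable (A : set (measurableTypeR R))).
Local Notation J := ([set` `[(-1 : R), 1]]).
Implicit Types (f g h : R -> R[i]).

Lemma measJ : meas J. Proof. exact: measurable_itv. Qed.
Hint Resolve measJ : core.

Definition sqN f := \int[mu]_(x in J) (normc (f x) ^+ 2).

Lemma measurable_sq f : measurable_fun J (fun x => Re (f x)) -> measurable_fun J (fun x => Im (f x)) ->
  measurable_fun J (fun x => Re (f x) ^+ 2 + Im (f x) ^+ 2).
Proof.
by move=> h1 h2; apply: measurable_funD; apply: measurable_funX.
Qed.

Lemma L2P f : L2 f <-> [/\ measurable_fun J (fun x => Re (f x)), measurable_fun J (fun x => Im (f x)) &
  rint J (fun x => normc (f x) ^+ 2)].
Proof.
have E x : normc (f x) ^+ 2 = Re (f x) ^+ 2 + Im (f x) ^+ 2 by rewrite sqr_normcE.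
split=> [[h1 h2 h3]|[h1 h2 h3]]; split => //.
  apply/integrableP; split.
    apply/measurable_EFinP; rewrite (_ : (fun x => _) = (fun x => Re (f x) ^+ 2 + Im (f x) ^+ 2)).
      exact: measurable_sq.
    by apply/funext => x; rewrite E.
  rewrite (_ : (fun x => _) = (fun x => (Re (f x) ^+ 2 + Im (f x) ^+ 2)%:E)) //.
  by apply/funext => x /=; rewrite E ger0_norm// addr_ge0// sqr_ge0.
have /integrableP[_] := h3.
rewrite (_ : (fun x => _) = (fun x => (Re (f x) ^+ 2 + Im (f x) ^+ 2)%:E)) //.
by apply/funext => x /=; rewrite E ger0_norm// addr_ge0// sqr_ge0.
Qed.

Lemma rint_le (A : set R) (f g : R -> R) : meas A -> measurable_fun A f -> rint A g ->
  (forall x, A x -> `|f x| <= g x) -> rint A f.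
Proof.
move=> mA mf ig fg; apply: (le_integrable mA _ _ ig); first exact/measurable_EFinP.
by move=> x Ax /=; rewrite lee_fin (le_trans (fg _ Ax))// ler_norm.
Qed.

Lemma L2D f g : L2 f -> L2 g -> L2 (fun x => f x + g x).
Proof.
move=> /L2P[f1 f2 f3] /L2P[g1 g2 g3]; have m1 : measurable_fun J (fun x => Re (f x + g x)).
  by rewrite (_ : (fun x => _) = (fun x => Re (f x) + Re (g x))); [exact: measurable_funD|apply/funext => x; rewrite ReD].
have m2 : measurable_fun J (fun x => Im (f x + g x)).
  by rewrite (_ : (fun x => _) = (fun x => Im (f x) + Im (g x))); [exact: measurable_funD|apply/funext => x; rewrite ImD].
apply/L2P; split => //; apply: (@rint_le _ _ (fun x => 2 * (normc (f x) ^+ 2 + normc (g x) ^+ 2))) => //.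
- rewrite (_ : (fun x => _) = (fun x => Re (f x + g x) ^+ 2 + Im (f x + g x) ^+ 2)); first exact: measurable_sq.
  by apply/funext => x; rewrite sqr_normcE.
- by apply: rintZ => //; exact: rintD.
- move=> x _; rewrite ger0_norm ?sqr_ge0//.
  have := le_normcD (f x) (g x); have := normc_ge0 (f x); have := normc_ge0 (g x).
  have := normc_ge0 (f x + g x); move: (normc (f x)) (normc (g x)) (normc (f x + g x)) => a b c b0 a0 c0 h.
  have : c ^+ 2 <= (a + b) ^+ 2 by rewrite lerXn2r ?nnegrE// addr_ge0.
  have := sqr_ge0 (a - b); nra.
Qed.

Lemma L2_prod_int f g : L2 f -> L2 g -> Cint J (fun x => f x * g x).
Proof.
move=> /L2P[f1 f2 f3] /L2P[g1 g2 g3].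
have b x : normc (f x * g x) <= normc (f x) ^+ 2 + normc (g x) ^+ 2.
  rewrite normcM; have := normc_ge0 (f x); have := normc_ge0 (g x).
  move: (normc _) (normc _) => a b a0 b0; have := sqr_ge0 (a - b); nra.
split; apply: (rint_le _ _ (rintD measJ f3 g3)) => //.
- rewrite (_ : (fun x => _) = (fun x => Re (f x) * Re (g x) - Im (f x) * Im (g x))).
    by apply: measurable_funB; apply: measurable_funM.
  by apply/funext => x; rewrite ReM.
- by move=> x _; apply: le_trans (normc_Re _) (b x).
- rewrite (_ : (fun x => _) = (fun x => Re (f x) * Im (g x) + Im (f x) * Re (g x))).
    by apply: measurable_funD; apply: measurable_funM.
  by apply/funext => x; rewrite ImM.
- by move=> x _; apply: le_trans (normc_Im _) (b x).
Qed.

Lemma L2_conj f : L2 f -> L2 (fun x => (f x)^*).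
Proof.
move=> /L2P[f1 f2 f3]; apply/L2P; split.
- by rewrite (_ : (fun x => _) = (fun x => Re (f x))) //; apply/funext => x; rewrite ReJ.
- by rewrite (_ : (fun x => _) = (fun x => - Im (f x))); [exact: measurable_funN|apply/funext => x; rewrite ImJ].
- by apply: eq_rint f3 => // x _; rewrite normc_conj.
Qed.

Lemma L2Z c f : L2 f -> L2 (fun x => c * f x).
Proof.
move=> /L2P[f1 f2 f3]; apply/L2P; split.
- rewrite (_ : (fun x => _) = (fun x => Re c * Re (f x) - Im c * Im (f x))); last by apply/funext => x; rewrite ReM.
  by apply: measurable_funB; apply: measurable_funM.
- rewrite (_ : (fun x => _) = (fun x => Re c * Im (f x) + Im c * Re (f x))); last by apply/funext => x; rewrite ImM.
  by apply: measurable_funD; apply: measurable_funM.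
- by apply: eq_rint (rintZ (normc c ^+ 2) measJ f3) => // x _; rewrite normcM exprMn.
Qed.

Lemma L2_bounded f (M : R) : measurable_fun J (fun x => Re (f x)) -> measurable_fun J (fun x => Im (f x)) ->
  (forall x, J x -> normc (f x) <= M) -> L2 f.
Proof.
move=> f1 f2 fM; apply/L2P; split => //.
apply: (@rint_le _ _ (fun=> M ^+ 2)) => //.
- rewrite (_ : (fun x => _) = (fun x => Re (f x) ^+ 2 + Im (f x) ^+ 2)); first exact: measurable_sq.
  by apply/funext => x; rewrite sqr_normcE.
- by apply: rint_cont; apply: continuous_subspaceT => x; exact: cst_continuous.
- move=> x Jx; rewrite ger0_norm ?sqr_ge0// lerXn2r ?nnegrE ?normc_ge0 ?fM//.
  exact: le_trans (normc_ge0 _) (fM _ Jx).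
Qed.

Lemma L2_cst c : L2 (fun=> c : R[i]).
Proof. by apply: (@L2_bounded _ (normc c)) => //; exact: measurable_cst. Qed.

Lemma L2_int f : L2 f -> Cint J f.
Proof.
move=> hf; have := L2_prod_int hf (L2_cst 1); apply: eq_Cint => // x _; exact: mulr1.
Qed.

Lemma sqNE f : L2 f -> sqN f = Re (cintegral J (fun x => f x * (f x)^*)).
Proof.
by move=> hf; rewrite /sqN /=; apply: eq_Rintegral => x _; rewrite mulc_conj.
Qed.

Lemma sqN_ge0 f : 0 <= sqN f.
Proof. by apply: Rintegral_ge0 => x _; exact: sqr_ge0. Qed.

(** Cauchy-Schwarz in the abstract: with [a], [b] the squared norms of f and g and [c] the squared
    modulus of their product p, the quadratic in [s] is the squared norm of f - s p g. *)
Lemma discr_le (a b c : R) : 0 <= a -> 0 <= b -> 0 <= c ->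
  (forall s, 0 <= a - 2 * s * c + s ^+ 2 * c * b) -> c <= a * b.
Proof.
move=> a0 b0 c0 h; have [b1|b1] := eqVneq b 0.
  have [->|c1] := eqVneq c 0; first by rewrite mulr_ge0.
  have cp : 0 < c by rewrite lt_def c1.
  have := h ((a + 1) / c); rewrite b1 mulr0 addr0.
  have -> : 2 * ((a + 1) / c) * c = 2 * (a + 1) by field.
  lra.
have bp : 0 < b by rewrite lt_def b1.
have := h b^-1; have -> : a - 2 * b^-1 * c + b^-1 ^+ 2 * c * b = (a * b - c) / b by field.
by rewrite pmulr_lge0 ?invr_gt0// subr_ge0.
Qed.

Lemma sqN_expand f g c : L2 f -> L2 g ->
  sqN (fun x => f x + c * g x) =
  sqN f + 2 * Re (c^* * cintegral J (fun x => f x * (g x)^*)) + normc c ^+ 2 * sqN g.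
Proof.
move=> hf hg; have hg' := L2Z c hg; rewrite !sqNE//; last exact: L2D.
have i1 := L2_prod_int hf (L2_conj hf); have i2 := L2_prod_int hg (L2_conj hg).
have i3 := L2_prod_int hf (L2_conj hg).
have i4 := Cint_conj measJ i3.
rewrite (@eq_cintegral _ _ _ (fun x => (f x * (f x)^* + c^* * (f x * (g x)^*)) +
   (c * (f x * (g x)^*)^* + c * c^* * (g x * (g x)^*)))); last first.
  move=> x _; apply: complexP; case: (f x) (g x) (c) => [a a'] [b b'] [k k'] /=; ring.
have z1 := CintZ c^* measJ i3; have z2 := CintZ c measJ i4; have z3 := CintZ (c * c^*) measJ i2.
rewrite !cintegralD//; try exact: CintD.
rewrite !cintegralZ// cintegral_conj// mulc_conj.
move: (cintegral _ _) (cintegral _ _) (cintegral _ _) => X Y Z.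
by rewrite !ReImE /=; ring.
Qed.

Lemma cauchy_schwarz f g : L2 f -> L2 g ->
  normc (cintegral J (fun x => f x * (g x)^*)) ^+ 2 <= sqN f * sqN g.
Proof.
move=> hf hg; set c := cintegral _ _.
apply: discr_le; rewrite ?sqN_ge0 ?sqr_ge0// => s.
have := sqN_ge0 (fun x => f x + (- s%:C * c) * g x); rewrite sqN_expand// -/c => /le_trans; apply.
rewrite le_eqVlt; apply/orP; left; apply/eqP; rewrite normcM normcN normcr exprMn real_normK ?num_real//.
congr (_ + _ + _).
by rewrite sqr_normcE; case: (c) => c1 c2; rewrite !ReImE /=; ring.
Qed.

End L2Theory.
#[global] Hint Resolve measJ : core.

Section W1Theory.
Variable R : realType.
Local Notation mu := (@lebesgue_measure R).
Local Notation meas A := (measurable (A : set (measurableTypeR R))).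
Local Notation J := ([set` `[(-1 : R), 1]]).
Implicit Types (f g h : R -> R[i]).

Lemma le_m11 : (-1 : R) <= 1. Proof. lra. Qed.

Lemma J_m1 : (-1 : R) <= (-1 : R) <= (1 : R). Proof. by rewrite lexx le_m11. Qed.
Lemma J_1 : (-1 : R) <= (1 : R) <= (1 : R). Proof. by rewrite lexx le_m11. Qed.

Lemma JP (x : R) : J x <-> -1 <= x <= 1. Proof. by rewrite /= in_itv. Qed.

Lemma subJ (a b : R) : -1 <= a -> b <= 1 -> [set` `[a, b]] `<=` J.
Proof.
move=> a1 b1 x /=; rewrite !in_itv/= => /andP[h1 h2].
by rewrite (le_trans a1 h1) (le_trans h2 b1).
Qed.

(** Lebesgue's differentiation theorem for the extension of [d] by zero, whose integrals over all
    left half-lines vanish. *)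
Lemma rint_zero_ae (d : R -> R) : rint J d ->
  (forall x, -1 <= x <= 1 -> \int[mu]_(t in `[-1, x]) d t = 0) ->
  {ae mu, forall x, J x -> d x = 0}.
Proof.
move=> id hd; pose f := d \_ J.
have intf (A : set R) : meas A -> rint A f.
  move=> mA; apply: (@rint_sub _ setT A) => //.
  have /(integrable_mkcond _ (@measJ R)) := id.
  by rewrite restrict_EFin.
have F0 x : \int[mu]_(t in [set` `]-oo, x]]) f t = 0.
  rewrite -Rintegral_mkcondr.
  have [x1|x1] := ltP x (-1).
    rewrite (_ : _ `&` _ = set0) ?Rintegral_set0//; apply/seteqP; split => // t /=.
    by rewrite !in_itv/= => -[h1 /andP[h2 _]]; lra.
  have [x2|x2] := leP x 1.
    rewrite (_ : _ `&` _ = [set` `[-1, x]]) ?hd ?x1//; apply/seteqP; split => t /=; rewrite !in_itv/=.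
      by move=> [-> /andP[->]].
    by move=> /andP[h1 h2]; rewrite h1 h2 (le_trans h2 x2).
  rewrite (_ : _ `&` _ = [set` `[(-1 : R), (1 : R)]]) ?hd ?J_1//; apply/seteqP; split => t /=; rewrite !in_itv/=.
    by case.
  by move=> /andP[h1 h2]; rewrite h1 h2 (le_trans h2 (ltW x2)).
have := @FTC1Ny R f (fun y => intf _ (measurable_itv _)) (integrable_locally (@measJ R) id).
apply: ae_imp => x H /JP xJ.
have [_ h2] := H.
have E : f x = d x by rewrite /f patchE mem_set//; exact/JP.
rewrite -E -h2 (_ : (fun y : R => _) = (fun=> 0)); first by rewrite derive1_cst.
by apply/funext => y; exact: F0.
Qed.

Lemma Rintegral_point (x : R) (d : R -> R) : \int[mu]_(t in `[x, x]) d t = 0.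
Proof. by rewrite set_itv1 Rintegral_set1. Qed.

Lemma cintegral_point (x : R) f : cintegral `[x, x] f = 0.
Proof. by apply: complexP; rewrite /= Rintegral_point. Qed.

Lemma Cint_subJ (a b : R) f : -1 <= a -> b <= 1 -> Cint J f -> Cint `[a, b] f.
Proof. by move=> a1 b1; apply: Cint_sub; [exact: measurable_itv|exact: measurable_itv|exact: subJ]. Qed.

(** This allows the representative chosen by [deriv_L2] to be exchanged under integrals for any
    explicit derivative. *)
Lemma hd_ae f g1 g2 : has_deriv f g1 -> has_deriv f g2 -> {ae mu, forall x, J x -> g1 x = g2 x}.
Proof.
move=> [l1 h1] [l2 h2]; have i1 := L2_int l1; have i2 := L2_int l2.
have E x : -1 <= x <= 1 -> cintegral `[-1, x] g1 = cintegral `[-1, x] g2.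
  by move=> xJ; have := h1 _ xJ; rewrite (h2 _ xJ) => /addrI ->.
have a1 := @rint_zero_ae (fun x => Re (g1 x) - Re (g2 x)) (rintB (@measJ R) i1.1 i2.1).
have a2 := @rint_zero_ae (fun x => Im (g1 x) - Im (g2 x)) (rintB (@measJ R) i1.2 i2.2).
have {}a1 : {ae mu, forall x, J x -> Re (g1 x) - Re (g2 x) = 0}.
  apply: a1 => x xJ; case/andP: (xJ) => x1 x2.
  have [j1 _] := @Cint_subJ (-1) x _ (lexx _) x2 i1.
  have [j2 _] := @Cint_subJ (-1) x _ (lexx _) x2 i2.
  rewrite RintegralB//.
  by have /(congr1 (@Re R)) /= -> := E _ xJ; rewrite subrr.
have {}a2 : {ae mu, forall x, J x -> Im (g1 x) - Im (g2 x) = 0}.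
  apply: a2 => x xJ; case/andP: (xJ) => x1 x2.
  have [_ j1] := @Cint_subJ (-1) x _ (lexx _) x2 i1.
  have [_ j2] := @Cint_subJ (-1) x _ (lexx _) x2 i2.
  rewrite RintegralB//.
  by have /(congr1 (@Im R)) /= -> := E _ xJ; rewrite subrr.
have : {ae mu, forall x, (J x -> Re (g1 x) - Re (g2 x) = 0) /\ (J x -> Im (g1 x) - Im (g2 x) = 0)}.
  by have := @filterI _ _ (ae_filter_ringOfSetsType mu) _ _ a1 a2.
apply: ae_imp => x [k1 k2] Jx; apply: complexP; apply/eqP; rewrite -subr_eq0; apply/eqP; [exact: k1|exact: k2].
Qed.

Lemma hd_dL2 f g : has_deriv f g -> has_deriv f (deriv_L2 f).
Proof.
by move=> h; rewrite /deriv_L2; case: xgetP => [g' _ //|/(_ g)]; move=> /(_ h).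
Qed.

Lemma Re_re f g : has_deriv f g -> forall x, -1 <= x <= 1 ->
  Re (f x) = Re (f (-1)) + \int[mu]_(t in `[-1, x]) Re (g t).
Proof. by move=> [_ h] x xJ; rewrite (h _ xJ) ReD. Qed.

Lemma Im_im f g : has_deriv f g -> forall x, -1 <= x <= 1 ->
  Im (f x) = Im (f (-1)) + \int[mu]_(t in `[-1, x]) Im (g t).
Proof. by move=> [_ h] x xJ; rewrite (h _ xJ) ImD. Qed.

Lemma cont_prim (f d : R -> R) : rint J d ->
  (forall x, -1 <= x <= 1 -> f x = f (-1) + \int[mu]_(t in `[-1, x]) d t) -> {within J, continuous f}.
Proof.
move=> id hf.
have C := @parameterized_integral_continuous R (-1) 1 d le_m11 id.
have C2 : {within J, continuous (fun x : R => f (-1) + parameterized_integral mu (-1) x d)}.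
  by apply: within_continuousD => //; apply: continuous_subspaceT => x; exact: cst_continuous.
apply: subspace_eq_continuous C2 => x /set_mem/JP xJ.
by rewrite /parameterized_integral; symmetry; exact: hf.
Qed.

Lemma meas_within (f : R -> R) : {within J, continuous f} -> measurable_fun J f.
Proof. by move=> cf; apply: subspace_continuous_measurable_fun => //; exact: measurable_itv. Qed.

Lemma hd_cont f g : has_deriv f g ->
  {within J, continuous (fun x => Re (f x))} /\ {within J, continuous (fun x => Im (f x))}.
Proof.
move=> h; have [h1 _] := h; have [i1 i2] := L2_int h1.
by split; [apply: cont_prim i1 _ => x /(Re_re h)|apply: cont_prim i2 _ => x /(Im_im h)].
Qed.

Lemma cont_bounded (f : R -> R) : {within J, continuous f} -> exists M : R, forall x, J x -> `|f x| <= M.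
Proof.
move=> cf; have [c1 _ h1] := @EVT_max R f _ _ le_m11 cf.
have [c2 _ h2] := @EVT_min R f _ _ le_m11 cf.
exists (`|f c1| + `|f c2|) => x xJ; rewrite ler_norml.
have := h1 x xJ; have := h2 x xJ; have := ler_norm (f c1); have := ler_norm (- f c2).
have := normr_ge0 (f c1); have := normr_ge0 (f c2); rewrite normrN.
by move=> ? ? ? ? ? ?; apply/andP; split; flra.
Qed.

Lemma L2_cont f : {within J, continuous (fun x => Re (f x))} ->
  {within J, continuous (fun x => Im (f x))} -> L2 f.
Proof.
move=> c1 c2; have [M1 h1] := cont_bounded c1; have [M2 h2] := cont_bounded c2.
apply: (@L2_bounded _ f (M1 + M2)); [exact: meas_within|exact: meas_within|] => x Jx.
by apply: (le_trans (normc_leReIm _)); apply: lerD; [exact: h1|exact: h2].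
Qed.

Lemma hd_L2 f g : has_deriv f g -> L2 f.
Proof. by move=> /hd_cont[]; exact: L2_cont. Qed.

Lemma eq_L2 f g : eq_itv f g -> L2 f -> L2 g.
Proof.
move=> fg /L2P[h1 h2 h3]; apply/L2P.
have E x : x \in J -> f x = g x by move=> /set_mem/JP/fg.
split.
- by apply: eq_measurable_fun h1 => x xJ; rewrite E.
- by apply: eq_measurable_fun h2 => x xJ; rewrite E.
- by apply: eq_rint h3 => // x xJ; rewrite E.
Qed.

Lemma hd_eq f f' g g' : eq_itv f f' -> eq_itv g g' -> has_deriv f g -> has_deriv f' g'.
Proof.
move=> ff gg [l h]; split; first exact: eq_L2 l.
move=> x xJ; rewrite -(ff _ xJ) -(ff _ J_m1) (h _ xJ); congr (_ + _); apply: eq_cintegral => t /set_mem/=.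
rewrite in_itv/= => /andP[t1 t2]; apply: gg; rewrite t1/=; case/andP: xJ => _; exact: le_trans.
Qed.

Lemma hdD f f' g g' : has_deriv f g -> has_deriv f' g' -> has_deriv (fun x => f x + f' x) (fun x => g x + g' x).
Proof.
move=> [l h] [l' h']; split; first exact: L2D.
move=> x xJ; case/andP: (xJ) => x1 x2.
rewrite cintegralD; [|exact: measurable_itv|exact: Cint_subJ (L2_int l)|exact: Cint_subJ (L2_int l')].
by rewrite h// h'//; ring.
Qed.

Lemma hdZ c f g : has_deriv f g -> has_deriv (fun x => c * f x) (fun x => c * g x).
Proof.
move=> [l h]; split; first exact: L2Z.
move=> x xJ; case/andP: (xJ) => x1 x2.
rewrite cintegralZ; [|exact: measurable_itv|exact: Cint_subJ (L2_int l)].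
by rewrite h//; ring.
Qed.

Lemma hd_conj f g : has_deriv f g -> has_deriv (fun x => (f x)^*) (fun x => (g x)^*).
Proof.
move=> [l h]; split; first exact: L2_conj.
move=> x xJ; case/andP: (xJ) => x1 x2.
rewrite cintegral_conj; [|exact: Cint_subJ (L2_int l)|exact: measurable_itv].
by rewrite h// rmorphD.
Qed.

Lemma hd0 : has_deriv (fun=> 0 : R[i]) (fun=> 0).
Proof.
split; first exact: L2_cst.
move=> x /andP[_ x2]; rewrite add0r; symmetry; rewrite (@eq_cintegral _ _ _ (fun t => 0 * 0)) => [|t _]; last by rewrite mul0r.
rewrite cintegralZ; [by rewrite mul0r|exact: measurable_itv|].
by apply: (@Cint_subJ (-1) x) => //; exact: L2_int (L2_cst 0).
Qed.

Lemma cint_dL2 f f1 h : has_deriv f f1 -> L2 h ->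
  cintegral J (fun x => deriv_L2 f x * h x) = cintegral J (fun x => f1 x * h x).
Proof.
move=> hf hh; have hf' := hd_dL2 hf; apply: cintegral_ae; [exact: measurable_itv| | |].
- by apply: L2_prod_int => //; case: hf'.
- by apply: L2_prod_int => //; case: hf.
- by apply: ae_imp (hd_ae hf' hf) => x E Jx; rewrite E.
Qed.

Lemma W1_innerE f f1 g g1 : has_deriv f f1 -> has_deriv g g1 ->
  W1_inner f g = cintegral J (fun x => f1 x * (g1 x)^*) + cintegral J (fun x => f x * (g x)^*).
Proof.
move=> hf hg; rewrite /W1_inner; congr (_ + _).
have lg := L2_conj (hd_dL2 hg).1.
rewrite (cint_dL2 hf lg); apply: cintegral_ae; [exact: measurable_itv| | |].
- by apply: L2_prod_int => //; case: hf.
- by apply: L2_prod_int => //; [case: hf|apply: L2_conj; case: hg].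
- by apply: ae_imp (hd_ae (hd_dL2 hg) hg) => x E Jx; rewrite E.
Qed.

Lemma helmholtzE alpha f f1 g g1 : has_deriv f f1 -> has_deriv g g1 ->
  helmholtz alpha f g = - cintegral J (fun x => f1 x * g1 x) - (alpha ^+ 2)%:C * cintegral J (fun x => f x * g x).
Proof.
move=> hf hg; rewrite /helmholtz; congr (- _ - _).
rewrite (cint_dL2 hf (hd_dL2 hg).1); apply: cintegral_ae; [exact: measurable_itv| | |].
- by apply: L2_prod_int; [case: hf|case: (hd_dL2 hg)].
- by apply: L2_prod_int; [case: hf|case: hg].
- by apply: ae_imp (hd_ae (hd_dL2 hg) hg) => x E Jx; rewrite E.
Qed.

Lemma W1_norm2 f f1 : has_deriv f f1 -> W1_norm f ^+ 2 = sqN f1 + sqN f.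
Proof.
move=> hf; rewrite /W1_norm (W1_innerE hf hf) ReD -!sqNE ?sqr_sqrtr ?addr_ge0 ?sqN_ge0//.
  exact: hd_L2 hf.
by case: hf.
Qed.

Lemma W1_norm_ge0 f : 0 <= W1_norm f. Proof. exact: sqrtr_ge0. Qed.

(* Sum over the partition into n equal pieces and let n tend to infinity. *)
Lemma increment_const (H : R -> R[i]) (G : R -> R) (C : R) : 0 <= C ->
  (forall x y, -1 <= x -> x <= y -> y <= 1 -> normc (H y - H x) <= C * (y - x) * (G y - G x)) -> H 1 = H (-1).
Proof.
move=> C0 hH; apply/eqP; rewrite -subr_eq0 -normc_eq0 eq_le normc_ge0 andbT.
pose t n k : R := -1 + 2 * k%:R / n.+1%:R.
have t0 n : t n 0%N = -1 by rewrite /t mulr0 mul0r addr0.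
have tn n : t n n.+1 = 1 by rewrite /t mulfK ?pnatr_eq0//; lra.
have ts n k : t n k.+1 - t n k = 2 / n.+1%:R.
  have kE : k.+1%:R = k%:R + 1 :> R by rewrite natr1.
  rewrite /t kE; have : (n.+1%:R : R) != 0 by rewrite pnatr_eq0.
  by move: (n.+1%:R) => N N0; field.
have step n k : (k <= n.+1)%N -> normc (H (t n k) - H (-1)) <= C * (2 / n.+1%:R) * (G (t n k) - G (-1)).
  elim: k => [|k IH] kn; first by rewrite t0 !subrr normc0 mulr0.
  have p2 : 0 < (2 : R) / n.+1%:R by rewrite divr_gt0// ltr0n.
  have E : H (t n k.+1) - H (-1) = (H (t n k.+1) - H (t n k)) + (H (t n k) - H (-1)) by ring.
  rewrite E; apply: (le_trans (le_normcD _ _)); have {}IH := IH (ltnW kn).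
  have := hH (t n k) (t n k.+1); rewrite ts => h.
  have l1 : -1 <= t n k by rewrite /t lerDl; pos.
  have l2 : t n k <= t n k.+1 by rewrite -subr_ge0 ts ltW.
  have l3 : t n k.+1 <= 1.
    have : 2 * (k.+1%:R / n.+1%:R) <= (2 : R) * 1 by rewrite ler_pM2l// ler_pdivrMr ?ltr0n// mul1r ler_nat.
    by rewrite mulrA /t; move: (_ / n.+1%:R) => N; flra.
  have E2 : C * (2 / n.+1%:R) * (G (t n k.+1) - G (-1)) =
    C * (2 / n.+1%:R) * (G (t n k.+1) - G (t n k)) + C * (2 / n.+1%:R) * (G (t n k) - G (-1)) by ring.
  by rewrite E2; apply: lerD; first exact: h.
apply: (@le0_geom _ _ (C * 2 * (G 1 - G (-1))) 2^-1); first by apply/andP; split; lra.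
move=> m; have := step (2 ^ m).-1 (2 ^ m)%N.
have pE : (2 ^ m).-1.+1 = (2 ^ m)%N by rewrite prednK// expn_gt0.
have := tn (2 ^ m).-1; rewrite pE => -> /(_ (leqnn _)) /le_trans; apply.
by rewrite natrX exprVn le_eqVlt; apply/orP; left; apply/eqP; ring.
Qed.

Lemma normc_int f : L2 f -> rint J (fun x => normc (f x)).
Proof.
move=> hf; have [m1 m2 i2] := (L2P f).1 hf.
apply: (@rint_le _ _ _ (fun x => 1 + normc (f x) ^+ 2)) => //.
- rewrite (_ : (fun x => _) = (fun x => Num.sqrt (Re (f x) ^+ 2 + Im (f x) ^+ 2))); last first.
    by apply/funext => x; case: (f x).
  by apply: (measurableT_comp (continuous_measurable_fun (@sqrt_continuous R))); exact: measurable_sq.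
- apply: rintD => //; apply: rint_cont; apply: continuous_subspaceT => x; exact: cst_continuous.
- by move=> x _; rewrite ger0_norm ?normc_ge0//; have := sqr_ge0 (normc (f x) - 1); have := normc_ge0 (f x); nra.
Qed.

Lemma hd_incr f g x y : has_deriv f g -> -1 <= x -> x <= y -> y <= 1 ->
  f y - f x = cintegral `[x, y] g.
Proof.
move=> [l h] x1 xy y1; have yJ : -1 <= y <= 1 by rewrite (le_trans x1 xy).
have xJ : -1 <= x <= 1 by rewrite x1 (le_trans xy y1).
rewrite (h _ yJ) (h _ xJ) (@cintegral_split R g (-1) x y)//; first by ring.
exact: Cint_subJ (L2_int l).
Qed.

Lemma measI (a b : R) : meas [set` `[a, b]]. Proof. exact: measurable_itv. Qed.

Lemma lebesgue_len (x y : R) : x <= y -> fine (mu [set` `[x, y]]) = y - x.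
Proof.
move=> xy; rewrite lebesgue_measure_itv /= lte_fin; case: ltP => h; first by [].
by apply/eqP; rewrite eq_sym subr_eq0 eq_le xy h.
Qed.

Lemma hd_lip h h1 (M : R) x y : has_deriv h h1 -> (forall t, J t -> normc (h1 t) <= M) ->
  -1 <= x -> x <= y -> y <= 1 -> normc (h y - h x) <= M * (y - x).
Proof.
move=> hh hM x1 xy y1; rewrite (hd_incr hh)//.
rewrite -(lebesgue_len xy) -Rintegral_cst; last exact: measI.
apply: normc_cintegral; [exact: measI|apply: Cint_subJ x1 y1 (L2_int hh.1)| |].
  by apply: rint_cont; apply: continuous_subspaceT => t; exact: cst_continuous.
by move=> t /(subJ x1 y1); exact: hM.
Qed.

(** The function [H], integral minus product, has increments of at most [2 * M * (y - x)] times the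
    integral of [normc (g t)] over [[x, y]], because [h] is Lipschitz with constant [M]. Such
    increments sum to zero by [increment_const]. *)
Lemma ibp f g h h1 (M : R) : has_deriv f g -> has_deriv h h1 -> (forall x, J x -> normc (h1 x) <= M) ->
  cintegral J (fun x => g x * h x) = f 1 * h 1 - f (-1) * h (-1) - cintegral J (fun x => f x * h1 x).
Proof.
move=> hf hh hM; have [lg _] := hf; have [lh1 _] := hh.
have lf := hd_L2 hf; have lh := hd_L2 hh.
have M0 : 0 <= M by apply: le_trans (normc_ge0 _) (hM (-1) _); apply/JP; exact: J_m1.
have i1 := L2_prod_int lg lh; have i2 := L2_prod_int lf lh1.
pose H x := cintegral `[-1, x] (fun t => g t * h t + f t * h1 t) - f x * h x.
pose G x := \int[mu]_(t in `[-1, x]) normc (g t).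
have ng := normc_int lg.
have HE : H 1 = H (-1).
  apply: (@increment_const H G (2 * M)); first by pos.
  move=> x y x1 xy y1.
  have yJ : -1 <= y <= 1 by rewrite (le_trans x1 xy).
  have xJ : -1 <= x <= 1 by rewrite x1 (le_trans xy y1).
  have GE : G y - G x = \int[mu]_(t in `[x, y]) normc (g t).
    rewrite /G (@Rint_split _ _ (-1) x y)//; first by rewrite addrAC subrr add0r.
    by apply: rint_sub ng; [exact: measI|exact: measI|exact: subJ].
  have ngxy : rint `[x, y] (fun t => normc (g t)).
    by apply: rint_sub ng; [exact: measI|exact: measI|exact: subJ].
  have c1 := Cint_subJ x1 y1 (L2_int lg); have c2 := Cint_subJ x1 y1 (L2_int lh1).
  have c3 := Cint_subJ x1 y1 i1; have c4 := Cint_subJ x1 y1 i2.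
  have mxy := measI x y.
  have HH : H y - H x = cintegral `[x, y] (fun t => g t * h t + - h y * g t) +
      cintegral `[x, y] (fun t => f t * h1 t + - f x * h1 t).
    rewrite !cintegralD//; try exact: CintZ.
    rewrite !cintegralZ// -(hd_incr hf)// -(hd_incr hh)//.
    rewrite /H (@cintegral_split _ _ (-1) x y)//; last first.
      by apply: Cint_subJ => //; exact: CintD.
    rewrite (@cintegralD _ `[x, y])//; ring.
  have gnn t : 0 <= normc (g t) by exact: normc_ge0.
  have G0 : 0 <= \int[mu]_(t in `[x, y]) normc (g t) by apply: Rintegral_ge0.
  rewrite HH GE; apply: (le_trans (le_normcD _ _)).
  have -> : 2 * M * (y - x) * (\int[mu]_(t in `[x, y]) normc (g t)) =
     M * (y - x) * (\int[mu]_(t in `[x, y]) normc (g t)) + (\int[mu]_(t in `[x, y]) normc (g t)) * M * (y - x) by ring.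
  apply: lerD.
    rewrite -RintegralZl//; apply: normc_cintegral => //; [by apply: CintD => //; exact: CintZ|exact: rintZ|].
    move=> t; rewrite /= in_itv/= => /andP[t1 t2].
    have -> : g t * h t + - h y * g t = - (g t * (h y - h t)) by ring.
    rewrite normcN normcM mulrC ler_wpM2r//.
    apply: (le_trans (hd_lip hh hM (le_trans x1 t1) t2 y1)); by rewrite ler_wpM2l// lerD2l lerN2.
  rewrite -(lebesgue_len xy) -Rintegral_cst//; apply: normc_cintegral => //.
  - by apply: CintD => //; exact: CintZ.
  - by apply: rint_cont; apply: continuous_subspaceT => t; exact: cst_continuous.
  - move=> t txy; have tJ := subJ x1 y1 txy; move: txy; rewrite /= in_itv/= => /andP[t1 t2].
    have -> : f t * h1 t + - f x * h1 t = (f t - f x) * h1 t by ring.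
    rewrite normcM; apply: ler_pM; rewrite ?normc_ge0//; last exact: hM.
    rewrite (hd_incr hf) ?(le_trans t2)//.
    apply: (@le_trans _ _ (\int[mu]_(s in `[x, t]) normc (g s))).
      apply: normc_cintegral => //; [apply: Cint_subJ (L2_int lg) => //; exact: le_trans y1|].
      by apply: rint_sub ngxy; [exact: measI|exact: measI|move=> s /=; rewrite !in_itv/= => /andP[-> s2]; exact: le_trans t2].
    rewrite (@Rint_split _ _ x t y)// lerDl; apply: Rintegral_ge0 => s _; exact: normc_ge0.
move: HE; rewrite /H cintegral_point cintegralD//.
set X := cintegral _ _; set Y := cintegral _ _ => E.
have -> : X = (X + Y - f 1 * h 1) + f 1 * h 1 - Y by ring.
by rewrite E; ring.
Qed.

End W1Theory.

(** * A cut-off function of class C^4 and truncated products *)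

Section Cutoff.
Variable R : realType.
Implicit Types (f g : R -> R).

Fixpoint Ck (n : nat) f : Prop :=
  if n is n'.+1 then exists2 f1, forall x : R, is_derive x 1 f (f1 x) & Ck n' f1 else continuous f.

Lemma Ck_cont n f : Ck n f -> continuous f.
Proof. by case: n => [//|n] [f1 h _] x; exact: is_derive_cont (h x). Qed.

Lemma Ck_weak n f : Ck n.+1 f -> Ck n f.
Proof.
elim: n f => [|n IH] f; first by move=> /Ck_cont.
by move=> [f1 h /IH h1]; exists f1.
Qed.

Lemma Ck_ext n f g : f =1 g -> Ck n f -> Ck n g.
Proof. by move=> /funext ->. Qed.

Lemma CkD n f g : Ck n f -> Ck n g -> Ck n (fun x => f x + g x).
Proof.
elim: n f g => [|n IH] f g; first by move=> cf cg x; apply: continuousD; [exact: cf|exact: cg].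
move=> [f1 hf cf] [g1 hg cg]; exists (fun x => f1 x + g1 x); last exact: IH.
by move=> x; exact: is_deriveD.
Qed.

Lemma CkM n f g : Ck n f -> Ck n g -> Ck n (fun x => f x * g x).
Proof.
elim: n f g => [|n IH] f g; first by move=> cf cg x; apply: continuousM; [exact: cf|exact: cg].
move=> Cf Cg; have [f1 hf cf] := Cf; have [g1 hg cg] := Cg.
exists (fun x => f x * g1 x + g x * f1 x); last first.
  by apply: CkD; apply: IH => //; exact: Ck_weak.
by move=> x; have := is_deriveM (hf x) (hg x).
Qed.

Lemma Ck_cst n (c : R) : Ck n (fun=> c).
Proof.
elim: n c => [|n IH] c; first by move=> x; exact: cst_continuous.
by exists (fun=> 0); [move=> x; exact: is_derive_cst|exact: IH].
Qed.

Lemma Ck_id n : Ck n (fun x => x).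
Proof.
case: n => [|n]; first by move=> x.
by exists (fun=> 1); [move=> x; exact: is_derive_id|exact: Ck_cst].
Qed.

Definition pp (m : nat) (t : R) := Num.max 0 t ^+ m.

Lemma pp2_derive (t : R) : is_derive t 1 (pp 2) (2 * Num.max 0 t).
Proof.
have H : rD (fun x => (pp 2 x)%:C) t (2 * Num.max 0 t)%:C.
  move=> e e0; exists e => // s; rewrite normcr => hs.
  rewrite -!rmorphM -!rmorphB !normcr.
  have : `|pp 2 (t + s) - pp 2 t - 2 * Num.max 0 t * s| <= s ^+ 2.
    rewrite /pp ler_norml; case: (leP 0 t) => t0; case: (leP 0 (t + s)) => ts; apply/andP; split; nra.
  move=> /le_trans; apply; rewrite -(real_normK (num_real s)) expr2.
  by rewrite ler_wpM2r// ltW.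
by have /= := rD_re H.
Qed.

Lemma ppS m t : pp m.+2 t = t * pp m.+1 t.
Proof.
rewrite /pp; case: (leP 0 t) => t0; first by rewrite exprS.
by rewrite !expr0n/= mulr0.
Qed.

Lemma pp_derive (m : nat) (t : R) : is_derive t 1 (pp m.+2) (m.+2%:R * pp m.+1 t).
Proof.
elim: m => [|m IH]; first by rewrite /pp expr1; exact: pp2_derive.
rewrite (_ : pp m.+3 = (fun t => t * pp m.+2 t)); last by apply/funext => s; exact: ppS.
have H := is_deriveM (@is_derive_id R R t 1) IH.
by apply: is_derive_eq H _; rewrite /GRing.scale /= ppS -(natr1 m.+2); ring.
Qed.

Lemma Ck_pp n g : Ck n g -> Ck n (fun x => pp n.+1 (g x)).
Proof.
elim: n g => [|n IH] g Cg.
  have cg := Ck_cont Cg.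
  rewrite (_ : (fun x => _) = (fun y => (g y + `|g y|) * 2^-1)); last first.
    apply/funext => y; rewrite /pp expr1; case: (leP 0 (g y)) => gy; [rewrite ger0_norm//|rewrite ltr0_norm//]; lra.
  apply: (@CkM 0 (fun y => g y + `|g y|) (fun=> 2^-1)); last exact: Ck_cst.
  apply: (@CkD 0 g (fun y => `|g y|)) => //= x.
  by apply: continuous_comp; [exact: cg|exact: norm_continuous].
have [g1 hg cg1] := Cg.
exists (fun x => n.+2%:R * pp n.+1 (g x) * g1 x).
  by move=> x; exact: (is_derive1_comp (pp_derive n (g x)) (hg x)).
by apply: CkM => //; apply: CkM; [exact: Ck_cst|apply: IH; exact: Ck_weak].
Qed.

Lemma locally_cst_derive f (x l c d : R) : 0 < d -> (forall y, `|y - x| < d -> f y = c) ->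
  is_derive x 1 f l -> l = 0.
Proof.
move=> d0 h hf; have : is_derive x 1 (fun=> c : R) l.
  apply: near_eq_is_derive hf; exists d => //= y; rewrite /ball_/= distrC => /h ->//.
by move=> [_ <-]; rewrite derive_cst.
Qed.

(** [pp 5], the fifth power of the positive part, is of class C^4. The quadratic [s] is at most 0
    for [|x - x0| <= h / 2] and at least 1 from [4 * h / 5] on, so that [X 0] is 1 on the inner
    interval and 0 beyond [4 * h / 5]. The margin up to [h] lets the derivatives vanish there by
    local constancy. *)
Lemma cutoff (x0 h : R) : 0 < h -> exists X : nat -> R -> R,
  [/\ forall i (x : R), (i < 4)%N -> is_derive x 1 (X i) (X i.+1 x), forall i, (i <= 4)%N -> continuous (X i),
   forall i x, (i <= 4)%N -> h <= `|x - x0| -> X i x = 0,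
   forall x, `|x - x0| < h / 2 -> X 0%N x = 1 &
   forall i x, (0 < i <= 4)%N -> `|x - x0| < h / 2 -> X i x = 0].
Proof.
move=> h0; pose s (x : R) := 4 * (((x - x0) / h) * ((x - x0) / h)) - 1.
pose X0 x := pp 5 (1 - pp 5 (s x)).
have Cs n : Ck n s.
  apply: CkD; last exact: Ck_cst.
  apply: CkM; first exact: Ck_cst.
  have C1 : Ck n (fun x => (x - x0) / h).
    by apply: CkM; [apply: CkD; [exact: Ck_id|exact: Ck_cst]|exact: Ck_cst].
  exact: CkM.
have : Ck 4 X0.
  apply: Ck_pp; apply: CkD; first exact: Ck_cst.
  by apply: Ck_ext (CkM (Ck_cst 4 (-1)) (Ck_pp (Cs 4%N))) => x; rewrite mulN1r.
move=> [X1 d0 [X2 d1 [X3 d2 [X4 d3 c4]]]].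
pose X i := nth X4 [:: X0; X1; X2; X3] i.
have d i (x : R) : (i < 4)%N -> is_derive x 1 (X i) (X i.+1 x) by move: i => [|[|[|[|]]]].
have sqE (x : R) : (x - x0) / h * ((x - x0) / h) = (`|x - x0| / h) ^+ 2.
  by rewrite -expr2 !expr_div_n real_normK ?num_real.
have out (x : R) : 4 * h / 5 <= `|x - x0| -> X 0%N x = 0.
  move=> hx; rewrite /X /= /X0 /pp.
  have h1 : 4 / 5 <= `|x - x0| / h by rewrite ler_pdivlMr//; lra.
  have h2 : (4 / 5) ^+ 2 <= (`|x - x0| / h) ^+ 2 by rewrite lerXn2r ?nnegrE//; flra.
  have s1 : 1 <= Num.max 0 (s x).
    by rewrite le_max; apply/orP; right; rewrite /s sqE; rewrite expr_div_n in h2; flra.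
  by have := exprn_ege1 5 s1 => s2; rewrite max_l ?expr0n//; flra.
have inn (x : R) : `|x - x0| < h / 2 -> X 0%N x = 1.
  move=> hx; rewrite /X /= /X0 /pp.
  have h1 : `|x - x0| / h <= 1 / 2 by rewrite ler_pdivrMr//; lra.
  have h2 : (`|x - x0| / h) ^+ 2 <= (1 / 2) ^+ 2 by rewrite lerXn2r ?nnegrE//; flra || pos.
  have s1 : s x <= 0 by rewrite /s sqE; rewrite expr_div_n in h2; flra.
  by rewrite (max_l s1) expr0n /= subr0 max_r// expr1n.
have lip (x y r : R) : `|y - x| < r -> `| `|y - x0| - `|x - x0| | < r.
  move=> hr; apply: le_lt_trans hr; have := lerB_dist (y - x0) (x - x0); have := lerB_dist (x - x0) (y - x0).
  have -> : x - x0 - (y - x0) = - (y - x) by ring.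
  have -> : y - x0 - (x - x0) = y - x by ring.
  by rewrite normrN ler_norml => ? ?; apply/andP; split; flra.
exists X; split => //.
- move=> i i4 x; have [i3|i3] := ltnP i 4; first exact: is_derive_cont (d _ x i3).
  by have -> : i = 4%N by [apply/eqP; rewrite eqn_leq i4|exact: c4].
- have H i : (i <= 4)%N -> forall x : R, 4 * h / 5 < `|x - x0| -> X i x = 0.
    elim: i => [|i IH] i4 x hx; first by apply: out; exact: ltW.
    apply: (@locally_cst_derive (X i) x _ 0 (`|x - x0| - 4 * h / 5)); [flra| |exact: d].
    by move=> y /lip; rewrite ltr_norml => /andP[y1 y2]; apply: IH; [exact: ltnW|flra].
  by move=> i x i4 hx; apply: H => //; flra.
- have H i : (i < 4)%N -> forall x : R, `|x - x0| < h / 2 -> X i.+1 x = 0.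
    elim: i => [|i IH] i4 x hx.
      apply: (@locally_cst_derive (X 0%N) x _ 1 (h / 2 - `|x - x0|) _ _ (d 0%N x isT)); first by flra.
      by move=> y /lip; rewrite ltr_norml => /andP[y1 y2]; apply: inn; flra.
    apply: (@locally_cst_derive (X i.+1) x _ 0 (h / 2 - `|x - x0|)); [flra| |exact: d].
    by move=> y /lip; rewrite ltr_norml => /andP[y1 y2]; apply: IH; [exact: ltnW|flra].
  by move=> [|i] x //= i4; exact: H.
Qed.

End Cutoff.

Section Cut.
Variables (R : realType) (x0 h : R).
Implicit Types (P : R -> R) (Y : R -> R[i]).

(** The local solution obeys its equation only for [|x - x0| <= h]; elsewhere the product is
    replaced by 0, whatever [Y] is there. *)
Definition cut P Y (x : R) : R[i] := if `|x - x0| <= h then (P x)%:C * Y x else 0.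

Lemma normc_cut P Y x : normc (cut P Y x) <= normc ((P x)%:C * Y x).
Proof. by rewrite /cut; case: ifP => _ //; rewrite normc0 normc_ge0. Qed.

Lemma cut_rD P P1 Y Y1 x :
  (forall x : R, is_derive x 1 P (P1 x)) -> (forall x, h <= `|x - x0| -> P x = 0) ->
  (forall x, h <= `|x - x0| -> P1 x = 0) ->
  (forall x, `|x - x0| <= h -> rD Y x (Y1 x)) -> rD (cut P Y) x (cut P1 Y x + cut P Y1 x).
Proof.
move=> dP P0 P10 dY.
have rP t : rD (fun s => (P s)%:C) t (P1 t)%:C.
  have := rD_pair (dP t) (@is_derive_cst R _ R 0 t 1); exact.
have lip (y z r : R) : `|y - z| < r -> `| `|y - x0| - `|z - x0| | < r.
  move=> hr; apply: le_lt_trans hr; have := lerB_dist (y - x0) (z - x0); have := lerB_dist (z - x0) (y - x0).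
  have -> : z - x0 - (y - x0) = - (y - z) by ring.
  have -> : y - x0 - (z - x0) = y - z by ring.
  by rewrite normrN ler_norml => ? ?; apply/andP; split; flra.
have [x1|x1] := ltP `|x - x0| h.
  have H := hasDM (rP x) (dY x (ltW x1)).
  apply: hasD_eq; first apply: (@hasD_near _ _ _ (fun s => (P s)%:C * Y s) _ x _ (h - `|x - x0|)) H.
  - by rewrite subr_gt0.
  - by rewrite /cut ltW.
  - move=> w; rewrite normcr => hw; have := lip (x + w) x _; rewrite addrAC subrr add0r => /(_ _ hw).
    by rewrite ltr_norml /cut => /andP[_ h2]; rewrite ifT//; flra.
  - by rewrite /cut ltW.
have [x2|x2] := leP `|x - x0| h; last first.
  have -> : cut P1 Y x + cut P Y1 x = 0 by rewrite /cut leNgt x2/= addr0.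
  apply: (@hasD_near _ _ _ (fun=> 0) _ x _ (`|x - x0| - h)); last exact: hasD_cst.
  - by rewrite subr_gt0.
  - by rewrite /cut leNgt x2.
  - move=> w; rewrite normcr => hw; have := lip (x + w) x _; rewrite addrAC subrr add0r => /(_ _ hw).
    by rewrite ltr_norml /cut => /andP[h1 _]; rewrite ifF//; apply/negbTE; rewrite -ltNge; flra.
(* At [|x - x0| = h] the truncated function is dominated by the product, whose value and derivative
   both vanish. *)
have H := hasDM (rP x) (dY x x2).
have E0 f : cut P f x = 0 by rewrite /cut P0// mul0r if_same.
have E1 f : cut P1 f x = 0 by rewrite /cut P10// mul0r if_same.
rewrite E0 E1 addr0; rewrite P0// P10// !mul0r addr0 in H.
move=> e /H[d d0 hd]; exists d => // w /hd.
have z : (P x)%:C = 0 by rewrite P0.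
by rewrite E0 z !mul0r !subr0; exact: le_trans (normc_cut _ _ _).
Qed.

Definition rcont_at Y (x : R) := forall e : R, 0 < e ->
  exists2 d : R, 0 < d & forall s : R, `|s| < d -> normc (Y (x + s) - Y x) < e.

Lemma rcont_atM (Y Z : R -> R[i]) x : rcont_at Y x -> rcont_at Z x -> rcont_at (fun x => Y x * Z x) x.
Proof.
move=> cY cZ e e0.
pose M := normc (Y x) + normc (Z x) + 1; have M0 : 0 < M by rewrite /M; have := normc_ge0 (Y x); have := normc_ge0 (Z x); lra.
pose e1 := Num.min 1 (e / (2 * M)).
have e10 : 0 < e1 by rewrite lt_min ltr01 divr_gt0// mulr_gt0.
have [d1 d10 h1] := cY _ e10; have [d2 d20 h2] := cZ _ e10.
exists (Num.min d1 d2); first by rewrite lt_min d10.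
move=> s; rewrite lt_min => /andP[/h1 s1 /h2 s2].
have -> : Y (x + s) * Z (x + s) - Y x * Z x =
  (Y (x + s) - Y x) * (Z (x + s) - Z x) + (Y (x + s) - Y x) * Z x + Y x * (Z (x + s) - Z x) by ring.
apply: (le_lt_trans (le_normcD _ _)); apply: (@le_lt_trans _ _ (normc (Y (x + s) - Y x) * normc (Z (x + s) - Z x) + normc (Y (x + s) - Y x) * normc (Z x) + normc (Y x) * normc (Z (x + s) - Z x))).
  by rewrite -!normcM lerD2r le_normcD.
move: s1 s2; rewrite !lt_min ltr_pdivlMr ?mulr_gt0// => /andP[a1 a2]; rewrite ltr_pdivlMr ?mulr_gt0// => /andP[b1 b2].
move: a1 a2 b1 b2; rewrite /M; have := normc_ge0 (Y x); have := normc_ge0 (Z x).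
have := normc_ge0 (Y (x + s) - Y x); have := normc_ge0 (Z (x + s) - Z x).
move: (normc _) (normc _) (normc _) (normc _) => a b c d *; nra.
Qed.

Lemma rcont_atD (Y Z : R -> R[i]) x : rcont_at Y x -> rcont_at Z x -> rcont_at (fun x => Y x + Z x) x.
Proof.
move=> cY cZ e e0; have e20 : 0 < e / 2 by lra.
have [d1 d10 h1] := cY _ e20; have [d2 d20 h2] := cZ _ e20.
exists (Num.min d1 d2); first by rewrite lt_min d10.
move=> s; rewrite lt_min => /andP[/h1 s1 /h2 s2].
have -> : Y (x + s) + Z (x + s) - (Y x + Z x) = (Y (x + s) - Y x) + (Z (x + s) - Z x) by ring.
by apply: (le_lt_trans (le_normcD _ _)); lra.
Qed.

Lemma rcont_at_cst (c : R[i]) x : rcont_at (fun=> c) x.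
Proof. by move=> e e0; exists 1 => // s _; rewrite subrr normc0. Qed.

Lemma rcont_at_rD Y l x : rD Y x l -> rcont_at Y x.
Proof. by move=> hY e e0; have [d d0 hd] := hasD_cont hY e0; exists d => // s sd; apply: hd; rewrite normcr. Qed.

Lemma cut_rcont P Y : continuous P -> (forall x, h <= `|x - x0| -> P x = 0) ->
  (forall x, `|x - x0| <= h -> rcont_at Y x) -> rcont (cut P Y).
Proof.
move=> cP P0 cY x.
have rP t : rcont_at (fun s => (P s)%:C) t.
  move=> e e0; have /cvgrPdist_lt/(_ _ e0)[d /= d0 hd] := cP t.
  exists d => // s sd; have := hd (t + s); rewrite /ball_/= opprD addrA subrr add0r normrN => /(_ sd).
  by rewrite -rmorphB normcr distrC.
have lip (y z r : R) : `|y - z| < r -> `| `|y - x0| - `|z - x0| | < r.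
  move=> hr; apply: le_lt_trans hr; have := lerB_dist (y - x0) (z - x0); have := lerB_dist (z - x0) (y - x0).
  have -> : z - x0 - (y - x0) = - (y - z) by ring.
  have -> : y - x0 - (z - x0) = y - z by ring.
  by rewrite normrN ler_norml => ? ?; apply/andP; split; lra.
have [x2|x2] := leP `|x - x0| h; last first.
  move=> e e0; exists (`|x - x0| - h); first by lra.
  move=> w hw; have := lip (x + w) x _; rewrite addrAC subrr add0r => /(_ _ hw).
  rewrite ltr_norml /cut => /andP[h1 _]; rewrite !ifF ?subrr ?normc0//; apply/negbTE; rewrite -ltNge//; flra.
have H := rcont_atM (rP x) (cY x x2).
move=> e e0; have [d d0 hd] := H e e0.
have [x1|x1] := ltP `|x - x0| h.
  exists (Num.min d (h - `|x - x0|)); first by rewrite lt_min d0; flra.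
  move=> w; rewrite lt_min => /andP[/hd w1 hw]; have := lip (x + w) x _; rewrite addrAC subrr add0r => /(_ _ hw).
  by rewrite ltr_norml /cut => /andP[_ h2]; rewrite !ifT//; flra.
exists d => // w /hd.
have -> : cut P Y x = 0 by rewrite /cut P0// mul0r if_same.
have z : (P x)%:C = 0 by rewrite P0.
by rewrite z mul0r !subr0; exact: le_lt_trans (normc_cut _ _ _).
Qed.

End Cut.

(** * From classical to weak derivatives, and the Dirichlet problem *)

Section Smooth.
Variable R : realType.
Local Notation mu := (@lebesgue_measure R).
Local Notation J := ([set` `[(-1 : R), 1]]).
Implicit Types (f g : R -> R[i]).

Lemma rcont_at_within f : (forall x, J x -> rcont_at f x) ->
  {within J, continuous (fun x => Re (f x))} /\ {within J, continuous (fun x => Im (f x))}.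
Proof.
have key (p : R[i] -> R) : (forall z, `|p z| <= normc z) -> (forall z w, p (z - w) = p z - p w) ->
    (forall x, J x -> rcont_at f x) -> {within J, continuous (fun x => p (f x))}.
  move=> hp pB h; apply: continuous_in_subspaceT => x /set_mem /h hx.
  apply/cvgrPdist_lt => e e0; have [d d0 hd] := hx e e0.
  exists d => //= y; rewrite /ball_/= distrC => yd.
  rewrite distrC -pB; apply: (le_lt_trans (hp _)).
  by have := hd (y - x) yd; rewrite (addrC x) subrK.
by move=> h; split; apply: key => //; [exact: normc_Re|exact: ReB|exact: normc_Im|exact: ImB].
Qed.

Lemma FTC2 (F f : R -> R) x : -1 <= x <= 1 -> (forall t, J t -> is_derive t 1 F (f t)) ->
  {within J, continuous f} -> F x = F (-1) + \int[mu]_(t in `[-1, x]) f t.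
Proof.
move=> xJ dF cf; case/andP: (xJ); rewrite le_eqVlt => /orP[/eqP <-|x1] x2.
  by rewrite Rintegral_point addr0.
have sub : [set` `[-1, x]] `<=` J by apply: subJ.
have := @continuous_FTC2 R f F (-1) x x1 (continuous_subspaceW sub cf) _ _.
move=> H; rewrite /Rintegral H /=; first by rewrite [RHS]addrC subrK.
  split.
  - move=> t; rewrite in_itv/= => /andP[t1 t2]; have Jt : J t by apply/JP; rewrite (ltW t1) (le_trans (ltW t2)).
    by have [h _] := dF t Jt.
  - apply: cvg_at_right_filter; apply: is_derive_cont (dF _ _); apply/JP; exact: J_m1.
  - by apply: cvg_at_left_filter; apply: is_derive_cont (dF _ _); apply/JP.
move=> t; rewrite in_itv/= => /andP[t1 t2]; rewrite derive1E.
have Jt : J t by apply/JP; rewrite (ltW t1) (le_trans (ltW t2)).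
by have [_ h] := dF t Jt.
Qed.

Lemma rD_hd f g : (forall x, J x -> rD f x (g x)) -> (forall x, J x -> rcont_at g x) -> has_deriv f g.
Proof.
move=> hD /rcont_at_within[c1 c2]; split; first exact: L2_cont.
move=> x xJ; apply: complexP; rewrite ?ReD ?ImD /=.
  by apply: (@FTC2 (fun x => Re (f x)) (fun x => Re (g x))) => // t /hD/rD_re.
by apply: (@FTC2 (fun x => Im (f x)) (fun x => Im (g x))) => // t /hD/rD_im.
Qed.

Lemma sqN_le f (M : R) : L2 f -> (forall x, J x -> normc (f x) <= M) -> sqN f <= 2 * M ^+ 2.
Proof.
move=> /L2P[_ _ hf] fM.
have -> : 2 * M ^+ 2 = M ^+ 2 * fine (mu J) by rewrite lebesgue_len ?le_m11//; ring.
rewrite -Rintegral_cst//; apply: le_Rintegral => //.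
  by apply: rint_cont; apply: continuous_subspaceT => t; exact: cst_continuous.
move=> x Jx; rewrite lerXn2r ?nnegrE ?normc_ge0 ?fM//.
exact: le_trans (normc_ge0 _) (fM _ Jx).
Qed.

Lemma sqN_ge f (a b M : R) : L2 f -> -1 <= a -> a <= b -> b <= 1 -> 0 <= M ->
  (forall x, a <= x <= b -> M <= normc (f x)) -> (b - a) * M ^+ 2 <= sqN f.
Proof.
move=> /L2P[_ _ hf] a1 ab b1 M0 fM.
have sub := subJ a1 b1.
have hab : rint `[a, b] (fun x => normc (f x) ^+ 2) by apply: rint_sub hf; [exact: measJ|exact: measI|].
apply: (@le_trans _ _ (\int[mu]_(x in `[a, b]) (normc (f x) ^+ 2))).
  rewrite mulrC -(lebesgue_len ab) -Rintegral_cst; last exact: measI.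
  apply: le_Rintegral => //.
    by apply: rint_cont; apply: continuous_subspaceT => t; exact: cst_continuous.
  move=> x; rewrite /= in_itv/= => xab; rewrite lerXn2r ?nnegrE ?normc_ge0 ?fM//.
have h0 (c d : R) : 0 <= \int[mu]_(x in `[c, d]) (normc (f x) ^+ 2) by apply: Rintegral_ge0 => x _; exact: sqr_ge0.
rewrite /sqN (@Rint_split _ _ (-1) a 1)//; last exact: le_trans b1.
rewrite (@Rint_split _ _ a b 1)//; last by apply: rint_sub hf; [exact: measJ|exact: measI|exact: subJ].
have := h0 (-1) a; have := h0 b 1; move: (\int[mu]_(x in `[-1, a]) _) (\int[mu]_(x in `[b, 1]) _) => u v u0 v0.
by rewrite addrCA lerDl addr_ge0.
Qed.

(** With a bounded second derivative the functional is integration against a function, so that the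
    weak equation in [OS_graph] can be checked pointwise. *)
Lemma helm_C2 (alpha : R) (w w1 w2 phi : R -> R[i]) (M : R) : has_deriv w w1 -> has_deriv w1 w2 ->
  (forall x, J x -> normc (w2 x) <= M) -> H10 phi ->
  helmholtz alpha w phi = cintegral J (fun x => (w2 x - (alpha ^+ 2)%:C * w x) * phi x).
Proof.
move=> h1 h2 hM [[p1 hp] pm p_1].
have L := hd_L2 hp; have Lw := hd_L2 h1.
rewrite (helmholtzE _ h1 hp).
have := ibp hp h2 hM; rewrite pm p_1 !mul0r subr0 sub0r.
rewrite (@eq_cintegral _ _ _ (fun x => w1 x * p1 x)) => [->|x _]; last by rewrite mulrC.
rewrite opprK; have i1 := L2_prod_int L h2.1; have i2 := L2_prod_int Lw L.
rewrite -mulNr -cintegralZ// -cintegralD//; last exact: CintZ.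
by apply: eq_cintegral => x _; ring.
Qed.

Lemma rD_expR (a b t : R) : rD (fun s => (expR (a * s + b))%:C) t (a * expR (a * t + b))%:C.
Proof.
have d1 : is_derive t 1 (fun s : R => a * s + b) a.
  have H := is_deriveD (is_deriveM (is_derive_cst a t 1) (@is_derive_id R R t 1)) (is_derive_cst b t 1).
  by apply: is_derive_eq H _; rewrite /GRing.scale /=; ring.
have d2 : is_derive t 1 (fun s : R => expR (a * s + b)) (a * expR (a * t + b)).
  have H := @is_derive1_comp R expR (fun s => a * s + b) t _ _ (is_derive_expR (a * t + b)) d1.
  by apply: is_derive_eq H _; rewrite mulrC.
by have := rD_pair d2 (@is_derive_cst R _ R 0 t 1).
Qed.

(** Variation of constants with the two exponentials gives a solution that vanishes at -1. A
    multiple of [sh], that is of sinh(a(x+1)), which is nonzero at 1, corrects the value there. The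
    residual of a quasimode is inverted in this way. *)
Lemma green (a : R) : a != 0 -> exists2 Ca : R, 0 < Ca & forall (g : R -> R[i]) (M : R), rcont g ->
  (forall x, J x -> normc (g x) <= M) ->
  exists f f1 : R -> R[i], [/\ forall x, J x -> rD f x (f1 x),
    forall x, J x -> rD f1 x ((a ^+ 2)%:C * f x + g x), f (-1) = 0, f 1 = 0 &
    forall x, J x -> normc (f x) <= Ca * M /\ normc (f1 x) <= Ca * M].
Proof.
move=> a0; pose Ea := expR `|a|; have Ea0 : 0 < Ea by exact: expR_gt0.
have na : 0 < `|a| by rewrite normr_gt0.
pose D := expR (2 * a) - expR (- (2 * a)).
have D0 : D != 0.
  rewrite subr_eq0; apply/eqP => /expR_inj E; have : a = 0 by lra.
  by move/eqP; rewrite (negbTE a0).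
have nD : 0 < `|D| by rewrite normr_gt0.
pose K0 := 2 * Ea ^+ 2 / `|a|; have K00 : 0 < K0 by rewrite /K0; pos.
pose K1 := 2 * Ea ^+ 2; have K10 : 0 < K1 by rewrite /K1; pos.
exists (K0 + K0 / `|D| * K1 + (K1 + K0 / `|D| * (`|a| * K1))); first by pos.
move=> g M cg gM.
have M0 : 0 <= M by apply: le_trans (normc_ge0 _) (gM (-1) _); apply/JP; exact: J_m1.
pose ep (x : R) : R[i] := (expR (a * x + 0))%:C; pose em (x : R) : R[i] := (expR (- a * x + 0))%:C.
have dep t : rD ep t (a%:C * ep t) by have := rD_expR a 0 t; rewrite rmorphM.
have dem t : rD em t (- a%:C * em t) by have := rD_expR (- a) 0 t; rewrite rmorphM rmorphN.
have cgm : rcont (fun x => em x * g x) by move=> t; apply: rcont_atM; [exact: rcont_at_rD (dem t)|exact: cg].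
have cgp : rcont (fun x => ep x * g x) by move=> t; apply: rcont_atM; [exact: rcont_at_rD (dep t)|exact: cg].
have [P1 hP1] := curve_primitive (-1) 1 cgm; have [P2 hP2] := curve_primitive (-1) 1 cgp.
pose F1 x := P1 x - P1 (-1); pose F2 x := P2 x - P2 (-1).
have dF1 x : J x -> rD F1 x (em x * g x).
  by move=> /JP/hP1 h; have := hasDB h (hasD_cst (real_complex R) (P1 (-1)) x); rewrite subr0.
have dF2 x : J x -> rD F2 x (ep x * g x).
  by move=> /JP/hP2 h; have := hasDB h (hasD_cst (real_complex R) (P2 (-1)) x); rewrite subr0.
have epm x : ep x * em x = 1.
  rewrite /ep /em -rmorphM -expRD; have -> : a * x + 0 + (- a * x + 0) = 0 by ring.
  by rewrite expR0.
have aC : a%:C != 0 :> R[i] by rewrite eq_complex /= negb_and a0.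
pose fp x := (2 * a%:C)^-1 * (ep x * F1 x - em x * F2 x).
pose fp1 x := 2^-1 * (ep x * F1 x + em x * F2 x).
have dfp x : J x -> rD fp x (fp1 x).
  move=> Jx; have h1 := hasDM (dep x) (dF1 x Jx); have h2 := hasDM (dem x) (dF2 x Jx).
  apply: hasD_eq (hasDZ _ (hasDB h1 h2)) _; rewrite /fp1.
  have -> : ep x * (em x * g x) = g x by rewrite mulrA epm mul1r.
  have -> : em x * (ep x * g x) = g x by rewrite mulrA [em x * _]mulrC epm mul1r.
  by move: (ep x) (em x) (F1 x) (F2 x) (g x) (a%:C) aC => *; field.
have dfp1 x : J x -> rD fp1 x ((a ^+ 2)%:C * fp x + g x).
  move=> Jx; have h1 := hasDM (dep x) (dF1 x Jx); have h2 := hasDM (dem x) (dF2 x Jx).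
  apply: hasD_eq (hasDZ _ (hasDD h1 h2)) _; rewrite /fp (rmorphXn (real_complex R) 2 a) /=.
  have -> : ep x * (em x * g x) = g x by rewrite mulrA epm mul1r.
  have -> : em x * (ep x * g x) = g x by rewrite mulrA [em x * _]mulrC epm mul1r.
  by move: (ep x) (em x) (F1 x) (F2 x) (g x) (a%:C) aC => *; field.
pose c := - fp 1 / D%:C.
pose sh (x : R) : R[i] := (expR (a * x + a))%:C - (expR (- a * x + - a))%:C.
pose ch (x : R) : R[i] := (expR (a * x + a))%:C + (expR (- a * x + - a))%:C.
have dsh x : rD sh x (a%:C * ch x).
  by apply: hasD_eq (hasDB (rD_expR a a x) (rD_expR (- a) (- a) x)) _; rewrite !rmorphM rmorphN /ch /=; ring.
have dch x : rD ch x (a%:C * sh x).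
  by apply: hasD_eq (hasDD (rD_expR a a x) (rD_expR (- a) (- a) x)) _; rewrite !rmorphM rmorphN /sh /=; ring.
have ab x : J x -> `|a * x| <= `|a|.
  by move=> /JP xJ; rewrite normrM ler_piMr// ler_norml.
have nE x y : `|x| <= y -> expR x <= expR y by move=> h; rewrite ler_expR (le_trans (ler_norm _)).
have nep x : J x -> normc (ep x) <= Ea.
  by move=> /ab Jx; rewrite /ep normcr gtr0_norm ?expR_gt0//; apply: nE; rewrite addr0.
have nem x : J x -> normc (em x) <= Ea.
  by move=> /ab Jx; rewrite /em normcr gtr0_norm ?expR_gt0//; apply: nE; rewrite addr0 mulNr normrN.
have nF (p : R -> R[i]) (F P : R -> R[i]) : (forall x, J x -> normc (p x) <= Ea) ->
   (forall x, F x = P x - P (-1)) ->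
   (forall t, -1 <= t <= 1 -> rD P t (p t * g t)) -> forall x, J x -> normc (F x) <= 2 * Ea * M.
  move=> hp FE hP x /JP/andP[x1 x2]; rewrite FE.
  apply: (@le_trans _ _ (Ea * M * (x - -1))).
    apply: (rD_mean_value x1 (dg := fun t => p t * g t)).
      by move=> t /andP[t1 t2]; apply: hP; rewrite t1 (le_trans t2).
    move=> t /andP[t1 t2]; have Jt : J t by apply/JP; rewrite t1 (le_trans t2).
    by rewrite normcM; apply: ler_pM; [exact: normc_ge0|exact: normc_ge0|exact: hp|exact: gM].
  rewrite mulrC -mulrA; apply: ler_wpM2r; [by pos|flra].
have nF1 := nF em F1 P1 nem (fun=> erefl) hP1; have nF2 := nF ep F2 P2 nep (fun=> erefl) hP2.
have nsum x : J x -> normc (ep x * F1 x) + normc (em x * F2 x) <= 2 * K1 * M.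
  move=> Jx; rewrite !normcM; have -> : 2 * K1 * M = Ea * (2 * Ea * M) + Ea * (2 * Ea * M) by rewrite /K1; ring.
  apply: lerD; apply: ler_pM; rewrite ?normc_ge0//; [exact: nep|exact: nF1|exact: nem|exact: nF2].
have nfp x : J x -> normc (fp x) <= K0 * M.
  move=> Jx; rewrite /fp normcM normcV normcM normcr.
  have -> : normc (2 : R[i]) = 2 by rewrite (normc_nat R 2).
  rewrite ler_pdivrMl; last by pos.
  apply: (le_trans (normcB _ _)); apply: (le_trans (nsum x Jx)).
  by rewrite le_eqVlt; apply/orP; left; apply/eqP; rewrite /K0 /K1; field; rewrite gt_eqF.
have nfp1 x : J x -> normc (fp1 x) <= K1 * M.
  move=> Jx; rewrite /fp1 normcM normcV.
  have -> : normc (2 : R[i]) = 2 by rewrite (normc_nat R 2).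
  rewrite ler_pdivrMl//; apply: (le_trans (le_normcD _ _)); apply: (le_trans (nsum x Jx)).
  by rewrite -[2 * K1 * M]mulrA.
have nc : normc c <= K0 / `|D| * M.
  rewrite /c normcM normcN normcV normcr mulrAC ler_wpM2r ?invr_ge0//.
  by apply: nfp; apply/JP; exact: J_1.
have nx2 x : J x -> expR (a * x + a) <= Ea ^+ 2 /\ expR (- a * x + - a) <= Ea ^+ 2.
  move=> /ab Jx; rewrite /Ea -expRM_natl; have h : `|a * x + a| <= 2 * `|a|.
    by apply: (le_trans (ler_normD _ _)); flra.
  split; apply: nE => //.
  have -> : - a * x + - a = - (a * x + a) by ring.
  by rewrite normrN; exact: h.
have nshch x : J x -> normc (sh x) <= K1 /\ normc (ch x) <= K1.
  move=> /nx2[h1 h2]; have h3 := expR_ge0 (a * x + a); have h4 := expR_ge0 (- a * x + - a).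
  by split; [apply: (le_trans (normcB _ _))|apply: (le_trans (le_normcD _ _))];
    rewrite !normcr !ger0_norm// /K1; flra.
exists (fun x => fp x + c * sh x), (fun x => fp1 x + c * (a%:C * ch x)); split.
- by move=> x Jx; exact: hasDD (dfp x Jx) (hasDZ c (dsh x)).
- move=> x Jx; apply: hasD_eq (hasDD (dfp1 x Jx) (hasDZ c (hasDZ a%:C (dch x)))) _.
  by rewrite (rmorphXn (real_complex R) 2 a) /=; ring.
- rewrite /fp /F1 /F2 !subrr !mulr0 subrr mulr0 add0r /sh.
  have -> : a * -1 + a = 0 by ring.
  have -> : - a * -1 + - a = 0 by ring.
  by rewrite subrr mulr0.
- have -> : sh 1 = D%:C.
    by rewrite /sh /D rmorphB; congr (_ - _); congr ((expR _)%:C); ring.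
  have DC : D%:C != 0 :> R[i] by rewrite eq_complex /= negb_and D0.
  by rewrite /c mulfVK// subrr.
- move=> x Jx; have [s1 s2] := nshch x Jx.
  have k1 := nfp x Jx; have k2 := nfp1 x Jx.
  have e1 : normc (c * sh x) <= K0 / `|D| * M * K1 by rewrite normcM; apply: ler_pM; [exact: normc_ge0|exact: normc_ge0|exact: nc|].
  have e2 : normc (c * (a%:C * ch x)) <= K0 / `|D| * M * (`|a| * K1).
    rewrite normcM; apply: ler_pM; [exact: normc_ge0|exact: normc_ge0|exact: nc|].
    by rewrite normcM normcr ler_wpM2l.
  have p1 : 0 <= K0 * M by pos.
  have p2 : 0 <= K1 * M by pos.
  have p3 : 0 <= K0 / `|D| * M * K1 by pos.
  have p4 : 0 <= K0 / `|D| * M * (`|a| * K1) by pos.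
  have -> : (K0 + K0 / `|D| * K1 + (K1 + K0 / `|D| * (`|a| * K1))) * M =
    K0 * M + K0 / `|D| * M * K1 + (K1 * M + K0 / `|D| * M * (`|a| * K1)) by ring.
  split; apply: (le_trans (le_normcD _ _)).
    by apply: (le_trans (lerD k1 e1)); rewrite lerDl addr_ge0.
  by apply: (le_trans (lerD k2 e2)); rewrite lerDr addr_ge0.
Qed.

End Smooth.

(** * Construction of quasimodes *)

Section Quasimode.
Variables (R : realType) (q : R -> R) (G : set R[i]^o) (qC : R[i]^o -> R[i]^o).
Hypothesis AM : AM_continuation q G qC.
Local Notation J := ([set` `[(-1 : R), 1]]).
Local Notation q1C := (q1C qC).
Local Notation q2C := (q2C qC).

Lemma near_itv (x : R) : -1 < x < 1 -> \forall y \near x, -1 < y < 1.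
Proof.
move=> /andP[x1 x2]; exists (Num.min (x + 1) (1 - x)); first by rewrite /= lt_min; apply/andP; split; lra.
move=> y /=; rewrite lt_min => /andP[]; rewrite !ltr_norml => /andP[? ?] /andP[? ?]; apply/andP; split; flra.
Qed.

Lemma J_oo (x : R) : -1 < x < 1 -> -1 <= x <= 1.
Proof. by move=> /andP[/ltW-> /ltW->]. Qed.

Lemma hol_line f : hol (G : set R[i]) f -> forall x : R, -1 <= x <= 1 -> rD (fun t => f t%:C) x (dC f x%:C).
Proof.
by move=> hf x xJ; have := hasD_comp (rD_id x) (dCP hf (itv_G AM xJ)); rewrite mulr1.
Qed.

Lemma q_derive (x : R) : -1 < x < 1 -> is_derive x 1 q (Re (q1C x%:C)) /\ Im (q1C x%:C) = 0.
Proof.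
move=> xJ; have H := hol_line (AM_hol AM) (J_oo xJ); split.
  apply: near_eq_is_derive (rD_re H); near=> y; rewrite (qCE AM)//; apply: J_oo.
  by near: y; exact: near_itv.
have H' : is_derive x 1 (fun=> 0 : R) (Im (q1C x%:C)).
  apply: near_eq_is_derive (rD_im H); near=> y; rewrite (qCE AM)//; apply: J_oo.
  by near: y; exact: near_itv.
by have [_ <-] := H'; rewrite derive_cst.
Unshelve. all: by end_near. Qed.

(** Links the real second derivative in [OS_graph] to the holomorphic one. Endpoints are excluded,
    since the values of [q] outside the interval are arbitrary. *)
Lemma q_derive2 (x : R) : -1 < x < 1 -> (derive1n 2 q x)%:C = q2C x%:C.
Proof.
move=> xJ; have H := hol_line (q1C_hol AM) (J_oo xJ).
have e1 (y : R) : -1 < y < 1 -> (q^`())%classic y = Re (q1C y%:C).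
  by move=> /q_derive[[_ h] _]; rewrite derive1E.
have d1 : is_derive x 1 (q^`())%classic (Re (q2C x%:C)).
  apply: near_eq_is_derive (rD_re H); near=> y; symmetry; apply: e1.
  by near: y; exact: near_itv.
have d2 : is_derive x 1 (fun=> 0 : R) (Im (q2C x%:C)).
  apply: near_eq_is_derive (rD_im H); near=> y.
  suff /q_derive[] : -1 < y < 1 by [].
  by near: y; exact: near_itv.
have -> : derive1n 2 q x = Re (q2C x%:C).
  by rewrite /derive1n /=; have [_ h] := d1; rewrite derive1E.
have : Im (q2C x%:C) = 0 by have [_ <-] := d2; rewrite derive_cst.
by case: (q2C x%:C) => a b /= ->.
Unshelve. all: by end_near. Qed.

Lemma q_rcont_at (x : R) : -1 <= x <= 1 -> rcont_at (fun t => qC t%:C) x.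
Proof. by move=> xJ; exact: rcont_at_rD (hol_line (AM_hol AM) xJ). Qed.

Lemma bounded_J (f : R -> R[i]) : (forall x, J x -> rcont_at f x) -> exists2 M : R, 0 < M & forall x, J x -> normc (f x) <= M.
Proof.
move=> /rcont_at_within[/cont_bounded[M1 h1] /cont_bounded[M2 h2]].
exists (`|M1| + `|M2| + 1); first by pos.
move=> x Jx; apply: (le_trans (normc_leReIm _)); have := h1 x Jx; have := h2 x Jx.
by have := ler_norm M1; have := ler_norm M2; lra.
Qed.

(** The cut-off spoils the equation only where its derivatives live, for [h / 2 <= |x - x0| <= h],
    and there [m] bounds the solution up to its third derivative. [green] turns the residual into
    the function [f] with (S - lam) y = f. *)
Lemma quasi_step (alpha x0 h La : R) : alpha != 0 -> 0 < h -> -1 < x0 - h -> x0 + h < 1 ->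
  exists2 Cst : R, 0 < Cst & forall (eps m : R) (lam : R[i]) (Y Y1 Y2 Y3 Y4 : R -> R[i]),
  0 < eps -> eps < 1 -> 0 <= m -> normc lam <= La ->
  (forall x, `|x - x0| <= h -> [/\ rD Y x (Y1 x), rD Y1 x (Y2 x), rD Y2 x (Y3 x), rD Y3 x (Y4 x) &
     'i * (eps ^+ 2)%:C * ((Y4 x - (alpha ^+ 2)%:C * Y2 x) - (alpha ^+ 2)%:C * (Y2 x - (alpha ^+ 2)%:C * Y x))
       + ((q x)%:C - lam) * (Y2 x - (alpha ^+ 2)%:C * Y x) - q2C x%:C * Y x = 0]) ->
  (forall x, h / 2 <= `|x - x0| <= h ->
     [/\ normc (Y x) <= m, normc (Y1 x) <= m, normc (Y2 x) <= m & normc (Y3 x) <= m]) ->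
  exists y y1 f : R -> R[i], [/\ OS_shift q alpha eps lam y f, has_deriv y y1, W1_norm f <= Cst * m &
    forall x, `|x - x0| < h / 2 -> y1 x = Y1 x].
Proof.
move=> a0 h0 xm xp; pose A := alpha ^+ 2.
have A0 : 0 <= A by exact: sqr_ge0.
have [X [dX cX X0 X1 Xin]] := cutoff x0 h0.
have xJ x : `|x - x0| <= h -> -1 < x < 1.
  by rewrite ler_norml => /andP[? ?]; apply/andP; split; flra.
have [Ca Ca0 hCa] := green a0.
have [Qb Qb0 hQb] := bounded_J (fun x (Jx : J x) => q_rcont_at ((JP x).1 Jx)).
have XB i : (i <= 4)%N -> exists2 B : R, 0 <= B & forall x, `|x - x0| <= h -> `|X i x| <= B.
  move=> i4; have [B hB] := cont_bounded (continuous_subspaceT (cX i i4)).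
  exists `|B|; first exact: normr_ge0.
  by move=> x /xJ/J_oo/JP/hB h1; apply: (le_trans h1); exact: ler_norm.
have [B1 B10 hB1] := XB 1%N isT; have [B2 B20 hB2] := XB 2%N isT.
have [B3 B30 hB3] := XB 3%N isT; have [B4 B40 hB4] := XB 4%N isT.
pose Bg := B4 + 4 * B3 + 6 * B2 + 4 * B1 + 2 * A * (B2 + 2 * B1) + (Qb + `|La|) * (B2 + 2 * B1) + 1.
have Bg0 : 0 < Bg by rewrite /Bg; pos.
exists (2 * (Ca * Bg)); first by pos.
move=> eps m lam Y Y1 Y2 Y3 Y4 eps0 eps1 m0 hlam hY hm.
have eC : (eps ^+ 2)%:C != 0 :> R[i] by rewrite eq_complex /= negb_and expf_neq0// gt_eqF.
have i0 : ('i : R[i]) != 0 by rewrite -normc_gt0 normc_i.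
have ii : ('i : R[i]) * 'i = -1 by rewrite -expr2 sqr_i.
pose qY Z (x : R) := (qC x%:C + - lam) * Z x.
(* The fourth derivative expressed through the equation: equal to [Y4] for [|x - x0| <= h], and
   built from functions known to be continuous. *)
pose Z4 x := (2 * A%:C * Y2 x + - A%:C ^+ 2 * Y x) +
    (- 'i / (eps ^+ 2)%:C) * (q2C x%:C * Y x + -1 * qY (fun x => Y2 x + - A%:C * Y x) x).
have [D0 D1 D2 Z4E ODE] : [/\ forall x, `|x - x0| <= h -> rD Y x (Y1 x), forall x, `|x - x0| <= h -> rD Y1 x (Y2 x),
   forall x, `|x - x0| <= h -> rD Y2 x (Y3 x), forall x, `|x - x0| <= h -> Z4 x = Y4 x &
   forall x, `|x - x0| <= h -> 'i * (eps ^+ 2)%:C * ((Z4 x - A%:C * Y2 x) - A%:C * (Y2 x - A%:C * Y x))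
       + (qC x%:C - lam) * (Y2 x - A%:C * Y x) - q2C x%:C * Y x = 0].
  have Z4E x : `|x - x0| <= h -> Z4 x = Y4 x.
    move=> hx; have [_ _ _ _] := hY x hx; rewrite -(qCE AM (J_oo (xJ _ hx))) -/A => E.
    have E2 : q2C x%:C * Y x = 'i * (eps ^+ 2)%:C * ((Y4 x - A%:C * Y2 x) - A%:C * (Y2 x - A%:C * Y x))
       + (qC x%:C - lam) * (Y2 x - A%:C * Y x).
      by apply/eqP; rewrite -subr_eq0 -oppr_eq0 opprB; apply/eqP; rewrite -[RHS]E; move: (A%:C) (qC _) => *; ring.
    rewrite /Z4 /qY E2.
    have -> : - 'i / (eps ^+ 2)%:C = ('i * (eps ^+ 2)%:C)^-1.
      by rewrite invfM; congr (_ * _); apply: (mulfI i0); rewrite mulfV// mulrN ii opprK.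
    by move: (eps ^+ 2)%:C eC (A%:C) (Y4 x) (Y2 x) (Y x) (qC _) => e e0 *; field; rewrite i0 e0.
  split => // x hx; have [d0 d1 d2 _ E] := hY x hx => //.
  by rewrite Z4E// (qCE AM (J_oo (xJ _ hx))).
have D3 x : `|x - x0| <= h -> rD Y3 x (Z4 x) by move=> hx; rewrite Z4E//; case: (hY x hx).
have ra Z Z' : (forall x, `|x - x0| <= h -> rD Z x (Z' x)) -> forall x, `|x - x0| <= h -> rcont_at Z x.
  by move=> H x hx; exact: rcont_at_rD (H x hx).
have rq x : `|x - x0| <= h -> rcont_at (fun x => qC x%:C) x by move=> /xJ/J_oo/q_rcont_at.
have rqY Z : (forall x, `|x - x0| <= h -> rcont_at Z x) -> forall x, `|x - x0| <= h -> rcont_at (qY Z) x.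
  move=> hZ x hx; apply: rcont_atM; last exact: hZ.
  by apply: rcont_atD; [exact: rq|exact: rcont_at_cst].
have rZ4 x : `|x - x0| <= h -> rcont_at Z4 x.
  have r20 (k : R[i]) t : `|t - x0| <= h -> rcont_at (fun x => Y2 x + k * Y x) t.
    by move=> ht; apply: rcont_atD; [exact: ra D2 _ ht|apply: rcont_atM; [exact: rcont_at_cst|exact: ra D0 _ ht]].
  move=> hx; apply: rcont_atD.
    by apply: rcont_atD; apply: rcont_atM; [exact: rcont_at_cst|exact: ra D2 _ hx|exact: rcont_at_cst|exact: ra D0 _ hx].
  apply: rcont_atM; first exact: rcont_at_cst.
  apply: rcont_atD; apply: rcont_atM; [|exact: ra D0 _ hx|exact: rcont_at_cst|by apply: rqY => // t ht; exact: r20].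
  by apply: (rcont_at_rD (hol_line (q2C_hol AM) _)); exact/J_oo/xJ.
pose c i (Z : R -> R[i]) := cut x0 h (X i) Z.
have dc i Z Z1 x : (i < 4)%N -> (forall x, `|x - x0| <= h -> rD Z x (Z1 x)) -> rD (c i Z) x (c i.+1 Z x + c i Z1 x).
  move=> i4 hZ; apply: cut_rD => //.
  - by move=> t; exact: dX.
  - by move=> t; apply: X0; exact: ltnW.
  - by move=> t; apply: X0.
have cc i Z : (i <= 4)%N -> (forall x, `|x - x0| <= h -> rcont_at Z x) -> rcont (c i Z).
  by move=> i4 hZ; apply: cut_rcont => //; [exact: cX|move=> x; exact: X0].
pose y := c 0%N Y.
pose y1 x := c 1%N Y x + c 0%N Y1 x.
pose y2 x := c 2%N Y x + 2 * c 1%N Y1 x + c 0%N Y2 x.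
pose y3 x := c 3%N Y x + 3 * c 2%N Y1 x + 3 * c 1%N Y2 x + c 0%N Y3 x.
pose y4 x := c 4%N Y x + 4 * c 3%N Y1 x + 6 * c 2%N Y2 x + 4 * c 1%N Y3 x + c 0%N Z4 x.
have dy x : rD y x (y1 x) by exact: dc.
have dy1 x : rD y1 x (y2 x).
  by apply: hasD_eq (hasDD (dc 1%N Y Y1 x isT D0) (dc 0%N Y1 Y2 x isT D1)) _; rewrite /y2; ring.
have dy2 x : rD y2 x (y3 x).
  apply: hasD_eq (hasDD (hasDD (dc 2%N Y Y1 x isT D0) (hasDZ 2 (dc 1%N Y1 Y2 x isT D1))) (dc 0%N Y2 Y3 x isT D2)) _.
  by rewrite /y3; ring.
have dy3 x : rD y3 x (y4 x).
  apply: hasD_eq (hasDD (hasDD (hasDD (dc 3%N Y Y1 x isT D0) (hasDZ 3 (dc 2%N Y1 Y2 x isT D1)))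
     (hasDZ 3 (dc 1%N Y2 Y3 x isT D2))) (dc 0%N Y3 Z4 x isT D3)) _.
  by rewrite /y4; ring.
have rc0 := ra _ _ D0; have rc1 := ra _ _ D1; have rc2 := ra _ _ D2; have rc3 := ra _ _ D3.
(* What Leibniz' rule leaves of the operator applied to the truncated solution: the terms without a
   derivative on the cut-off cancel by [ODE]. *)
pose g x := 'i * (eps ^+ 2)%:C * ((c 4%N Y x + 4 * c 3%N Y1 x + 6 * c 2%N Y2 x + 4 * c 1%N Y3 x) +
     - (2 * A%:C) * (c 2%N Y x + 2 * c 1%N Y1 x)) + (c 2%N (qY Y) x + 2 * c 1%N (qY Y1) x).
have cg : forall t, rcont_at g t.
  move=> t; have k := rcont_at_cst; have M := @rcont_atM; have D := @rcont_atD.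
  apply: rcont_atD.
    apply: rcont_atM; first exact: k.
    apply: rcont_atD; last first.
      apply: rcont_atM; first exact: k.
      by apply: rcont_atD; [exact: cc|apply: rcont_atM; [exact: k|exact: cc]].
    apply: rcont_atD; last by apply: rcont_atM; [exact: k|exact: cc].
    apply: rcont_atD; last by apply: rcont_atM; [exact: k|exact: cc].
    by apply: rcont_atD; [exact: cc|apply: rcont_atM; [exact: k|exact: cc]].
  by apply: rcont_atD; [apply: cc => //; exact: rqY|apply: rcont_atM; [exact: k|apply: cc => //; exact: rqY]].
have res x : J x -> 'i * (eps ^+ 2)%:C * ((y4 x - A%:C * y2 x) - A%:C * (y2 x - A%:C * y x))
       + ((q x)%:C - lam) * (y2 x - A%:C * y x) - (derive1n 2 q x)%:C * y x = g x.
  move=> /JP Jx; rewrite /g /y4 /y2 /y /c /cut; case: ifPn => hx; last by move: (A%:C) => *; ring.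
  rewrite (q_derive2 (xJ _ hx)) -(qCE AM Jx) /qY.
  apply/eqP; rewrite -subr_eq0; apply/eqP.
  rewrite -[RHS](mulr0 (X 0%N x)%:C) -[in RHS](ODE x hx).
  move: (Z4 x) (A%:C) (X 0%N x)%:C (X 1%N x)%:C (X 2%N x)%:C (X 3%N x)%:C (X 4%N x)%:C (eps ^+ 2)%:C (qC _) (q2C _).
  move: (Y x) (Y1 x) (Y2 x) (Y3 x) => *; ring.
have ncB i Z (B mm : R) : (0 < i <= 4)%N -> 0 <= B -> 0 <= mm -> (forall x, `|x - x0| <= h -> `|X i x| <= B) ->
   (forall x, h / 2 <= `|x - x0| <= h -> normc (Z x) <= mm) -> forall x, normc (c i Z x) <= B * mm.
  move=> i4 B0 mm0 hB hZ x; rewrite /c /cut; case: ifPn => hx; last by rewrite normc0 mulr_ge0.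
  have [x1|x1] := ltP `|x - x0| (h / 2); first by rewrite Xin// mul0r normc0 mulr_ge0.
  rewrite normcM normcr; apply: ler_pM; [exact: normr_ge0|exact: normc_ge0|exact: hB|].
  by apply: hZ; rewrite x1 hx.
have nqY Z : (forall x, h / 2 <= `|x - x0| <= h -> normc (Z x) <= m) ->
    forall x, h / 2 <= `|x - x0| <= h -> normc (qY Z x) <= (Qb + `|La|) * m.
  move=> hZ x hx; rewrite /qY normcM; apply: ler_pM; [exact: normc_ge0|exact: normc_ge0| |exact: hZ].
  apply: (le_trans (le_normcD _ _)); apply: lerD; last by rewrite normcN (le_trans hlam)// ler_norm.
  by apply: hQb; apply/JP/J_oo/xJ; case/andP: hx.
have [m0' m1' m2' m3'] : [/\ forall x, h / 2 <= `|x - x0| <= h -> normc (Y x) <= m,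
   forall x, h / 2 <= `|x - x0| <= h -> normc (Y1 x) <= m, forall x, h / 2 <= `|x - x0| <= h -> normc (Y2 x) <= m &
   forall x, h / 2 <= `|x - x0| <= h -> normc (Y3 x) <= m] by split=> x /hm[].
have QL0 : 0 <= (Qb + `|La|) * m by pos.
have gB x : J x -> normc (g x) <= Bg * m.
  move=> _; have n4 := ncB 4%N Y B4 m isT B40 m0 hB4 m0' x.
  have n3 := ncB 3%N Y1 B3 m isT B30 m0 hB3 m1' x.
  have n2 := ncB 2%N Y2 B2 m isT B20 m0 hB2 m2' x.
  have n1 := ncB 1%N Y3 B1 m isT B10 m0 hB1 m3' x.
  have n20 := ncB 2%N Y B2 m isT B20 m0 hB2 m0' x.
  have n11 := ncB 1%N Y1 B1 m isT B10 m0 hB1 m1' x.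
  have p2 := ncB 2%N _ B2 _ isT B20 QL0 hB2 (nqY _ m0') x.
  have p1 := ncB 1%N _ B1 _ isT B10 QL0 hB1 (nqY _ m1') x.
  have nn k : normc (k%:R : R[i]) = k%:R by exact: normc_nat.
  rewrite /g; apply: (@le_trans _ _ ((B4 * m + 4 * (B3 * m) + 6 * (B2 * m) + 4 * (B1 * m) + 2 * A * (B2 * m + 2 * (B1 * m))) +
     (B2 * ((Qb + `|La|) * m) + 2 * (B1 * ((Qb + `|La|) * m))))); last first.
    have -> : Bg * m = (B4 * m + 4 * (B3 * m) + 6 * (B2 * m) + 4 * (B1 * m) + 2 * A * (B2 * m + 2 * (B1 * m))) +
     (B2 * ((Qb + `|La|) * m) + 2 * (B1 * ((Qb + `|La|) * m))) + m by rewrite /Bg; ring.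
    by rewrite lerDl.
  apply: (le_trans (le_normcD _ _)); apply: lerD; last first.
    apply: (le_trans (le_normcD _ _)); apply: lerD => //.
    by rewrite normcM nn ler_wpM2l.
  rewrite normcM; apply: (@le_trans _ _ (1 * (B4 * m + 4 * (B3 * m) + 6 * (B2 * m) + 4 * (B1 * m) + 2 * A * (B2 * m + 2 * (B1 * m))))); last by rewrite mul1r.
  apply: ler_pM; [exact: normc_ge0|exact: normc_ge0| |].
    by rewrite normcM normc_i mul1r normcr ger0_norm ?sqr_ge0// expr_le1// ltW.
  apply: (le_trans (le_normcD _ _)); apply: lerD.
    apply: (le_trans (le_normcD _ _)); apply: lerD; last by rewrite normcM nn ler_wpM2l.
    apply: (le_trans (le_normcD _ _)); apply: lerD; last by rewrite normcM nn ler_wpM2l.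
    apply: (le_trans (le_normcD _ _)); apply: lerD => //; by rewrite normcM nn ler_wpM2l.
  rewrite normcM normcN normcM nn normcr (ger0_norm A0); apply: ler_wpM2l; first by pos.
  by apply: (le_trans (le_normcD _ _)); apply: lerD => //; rewrite normcM nn ler_wpM2l.
have [f [f1 [df df1 fm fp fB]]] := hCa g _ cg gB.
have hf : has_deriv f f1 by apply: rD_hd => // x Jx; exact: rcont_at_rD (df1 x Jx).
have hy : has_deriv y y1 by apply: rD_hd => // x Jx; exact: rcont_at_rD (dy1 x).
have hy1 : has_deriv y1 y2 by apply: rD_hd => // x Jx; exact: rcont_at_rD (dy2 x).
have hy2 : has_deriv y2 y3 by apply: rD_hd => // x Jx; exact: rcont_at_rD (dy3 x).
have cy4 : forall t, rcont_at y4 t.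
  have k := rcont_at_cst; move=> t; apply: rcont_atD; last exact: cc.
  apply: rcont_atD; last by apply: rcont_atM; [exact: k|exact: cc].
  apply: rcont_atD; last by apply: rcont_atM; [exact: k|exact: cc].
  by apply: rcont_atD; [exact: cc|apply: rcont_atM; [exact: k|exact: cc]].
have hy3 : has_deriv y3 y4 by apply: rD_hd => // x Jx; exact: cy4.
pose f2 x := A%:C * f x + g x.
have rf2 x : J x -> rcont_at f2 x.
  move=> Jx; apply: rcont_atD; last exact: cg.
  by apply: rcont_atM; [exact: rcont_at_cst|exact: rcont_at_rD (df x Jx)].
have hf1 : has_deriv f1 f2 by apply: rD_hd.
have out (x : R) : `|x| = 1 -> `|x - x0| <= h = false.
  move=> x1; apply/negbTE; rewrite -ltNge; have := ler_norm x0; have := ler_norm (- x0); rewrite normrN.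
  have := lerB_dist x x0; rewrite x1 => k1 k2 k3.
  have : `|x0| < 1 - h by rewrite ltr_norml; apply/andP; split; flra.
  flra.
have out1 : `|(1 : R) - x0| <= h = false by apply: out; rewrite normr1.
have outm1 : `|-1 - x0| <= h = false by apply: out; rewrite normrN1.
exists y, y1, f; split => //.
- exists (fun x => f x + lam * y x); last by move=> x Jx; rewrite addrK.
  exists y1, y2; split; first by split => //; exists y3.
  split; first by split; rewrite /y /y1 /c /cut ?out1 ?outm1 ?addr0.
  have hw := hdD hf (hdZ lam hy).
  split.
    split; first by exists (fun x => f1 x + lam * y1 x).
      by rewrite fm /y /c /cut outm1 mulr0 addr0.
    by rewrite fp /y /c /cut out1 mulr0 addr0.
  move=> phi hphi.
  have hw1 := hdD hf1 (hdZ lam hy1).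
  have rw2 x : J x -> rcont_at (fun x => f2 x + lam * y2 x) x.
    move=> Jx; apply: rcont_atD; first exact: rf2.
    by apply: rcont_atM; [exact: rcont_at_cst|exact: rcont_at_rD (dy2 x)].
  have [Mw _ hMw] := bounded_J rw2.
  have hu : has_deriv (fun x => y2 x - A%:C * y x) (fun x => y3 x - A%:C * y1 x).
    by apply: hd_eq (hdD hy2 (hdZ (- A%:C) hy)) => x _; rewrite mulNr.
  have hu1 : has_deriv (fun x => y3 x - A%:C * y1 x) (fun x => y4 x - A%:C * y2 x).
    by apply: hd_eq (hdD hy3 (hdZ (- A%:C) hy1)) => x _; rewrite mulNr.
  have ru2 x : J x -> rcont_at (fun x => y4 x + - A%:C * y2 x) x.
    move=> Jx; apply: rcont_atD; first exact: cy4.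
    by apply: rcont_atM; [exact: rcont_at_cst|exact: rcont_at_rD (dy2 x)].
  have [Mu _ hMu] := bounded_J ru2.
  rewrite (helm_C2 alpha hw hw1 hMw hphi).
  have hMu' x : J x -> normc (y4 x - A%:C * y2 x) <= Mu by move=> /hMu; rewrite mulNr.
  rewrite (helm_C2 alpha hu hu1 hMu' hphi).
  have [hph _ _] := hphi; have [p1 hp] := hph; have Lp := hd_L2 hp.
  have Lw := L2_prod_int (hd_L2 hw) Lp.
  have Lu2 : L2 (fun x => y4 x - A%:C * y2 x) by case: hu1.
  have i1 := L2_prod_int (L2D Lu2 (L2Z (- A%:C) (hd_L2 hu))) Lp.
  rewrite -cintegralZ//; last by apply: eq_Cint i1 => // x _; rewrite mulNr.
  have i2 : Cint J (fun x => (f2 x + lam * y2 x + - A%:C * (f x + lam * y x)) * phi x).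
    exact: L2_prod_int (L2D hw1.1 (L2Z _ (hd_L2 hw))) Lp.
  pose I1 x := ('i * (eps ^+ 2)%:C) * ((y4 x - A%:C * y2 x + - A%:C * (y2 x - A%:C * y x)) * phi x).
  have j1 : Cint J I1 by exact: CintZ.
  have hI x : J x -> (f2 x + lam * y2 x + - A%:C * (f x + lam * y x)) * phi x + -1 * I1 x =
     ((q x)%:C * (y2 x - A%:C * y x) - (derive1n 2 q x)%:C * y x) * phi x.
    by move=> Jx; rewrite /I1 /f2 -(res x Jx); move: (phi x) (f x) (y x) (y2 x) (y4 x) => *; ring.
  pose I2 x := (f2 x + lam * y2 x + - A%:C * (f x + lam * y x)) * phi x.
  have -> : cintegral J (fun x => ((q x)%:C * (y2 x - A%:C * y x) - (derive1n 2 q x)%:C * y x) * phi x) =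
      cintegral J I2 + -1 * cintegral J I1.
    rewrite -cintegralZ// -cintegralD//; last exact: CintZ.
    by apply: eq_cintegral => x /set_mem Jx; rewrite -(hI x Jx).
  have -> : cintegral J (fun x => iC R * (eps ^+ 2)%:C * ((y4 x - A%:C * y2 x - (alpha ^+ 2)%:C * (y2 x - A%:C * y x)) * phi x)) =
      cintegral J I1 by apply: eq_cintegral => x _; rewrite /I1 mulNr.
  by rewrite mulN1r addrCA subrr addr0; apply: eq_cintegral => x _; rewrite /I2 mulNr.
- have CB0 : 0 <= Ca * (Bg * m) by pos.
  rewrite -(@ler_pXn2r _ 2)// ?nnegrE ?W1_norm_ge0//; last by pos.
  rewrite (W1_norm2 hf).
  have k1 := sqN_le hf.1 (fun x Jx => (fB x Jx).2); have k2 := sqN_le (hd_L2 hf) (fun x Jx => (fB x Jx).1).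
  apply: (le_trans (lerD k1 k2)); rewrite le_eqVlt; apply/orP; left; apply/eqP; ring.
- move=> x hx; have hx' : `|x - x0| <= h by flra.
  rewrite /y1 /c /cut hx'.
  by rewrite Xin// X1// mul0r mul1r add0r.
Qed.

(** The exponential is at least the power [n.+1] of [kap / (n.+1%:R * eps)], one power of [1 / eps]
    more than is needed. *)
Lemma poly_exp (c kap : R) (n : nat) : 0 < c -> 0 < kap -> exists2 e0 : R, 0 < e0 &
  forall eps, 0 < eps -> eps < e0 -> 1 <= c * eps ^+ n * expR (kap / eps).
Proof.
move=> c0 k0; pose N : R := n.+1%:R; have N0 : 0 < N by rewrite ltr0n.
exists (c * (kap / N) ^+ n.+1); first by pos.
move=> eps e0 he.
have h1 : (kap / N / eps) ^+ n.+1 <= expR (kap / eps).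
  have -> : kap / eps = N * (kap / N / eps) by field; rewrite !gt_eqF.
  rewrite expRM_natl lerXn2r ?nnegrE ?expR_ge0//; first by pos.
  by apply: le_trans (expR_ge1Dx _); rewrite lerDr.
apply: (@le_trans _ _ (c * eps ^+ n * (kap / N / eps) ^+ n.+1)); last first.
  by apply: ler_wpM2l => //; pos.
have -> : c * eps ^+ n * (kap / N / eps) ^+ n.+1 = c * (kap / N) ^+ n.+1 / eps.
  rewrite [(kap / N / eps) ^+ _]expr_div_n [eps ^+ n.+1]exprS.
  have : eps ^+ n != 0 by rewrite expf_neq0// gt_eqF.
  by move: (eps ^+ n) ((kap / N) ^+ _) => u v u0; field; rewrite u0 gt_eqF.
by rewrite ler_pdivlMr// mul1r ltW.
Qed.

Lemma quasimode (alpha : R) (lam0 : R[i]) : alpha != 0 -> Pi_of q lam0 ->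
  exists rho tau e0 : R, [/\ 0 < rho, 0 < tau & 0 < e0] /\
  forall (eps : R) (lam : R[i]), 0 < eps -> eps < e0 -> normc (lam - lam0) <= rho ->
  exists y f : R -> R[i], [/\ OS_shift q alpha eps lam y f, W1_norm f <= 1 & expR (tau / eps) <= W1_norm y].
Proof.
move=> a0 hPi.
have [x0 [h [kap [C [e1 [[h0 xm xp kap0 C0] [e10 hloc]]]]]]] := local_solution AM (sqr_ge0 alpha) hPi.
have [Cst Cst0 step] := quasi_step (normc lam0 + h ^+ 2) a0 h0 xm xp.
pose m := Cst^-1; have m0 : 0 < m by rewrite /m; pos.
(* On an interval of length [eps * h] the derivative of the scaled solution is at least
   [s * (eps / C)], which makes its squared L2 norm at least [c * eps ^+ 5 * expR (kap / eps) ^+ 2].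
   One exponential absorbs the constants and the powers of [eps]; the square root of the other gives
   the exponent [kap / 2]. *)
pose c := h * m ^+ 2 / C ^+ 4; have c0 : 0 < c by rewrite /c; pos.
have [e2 e20 hexp] := poly_exp 5 c0 kap0.
exists (h ^+ 2), (kap / 2), (Num.min e1 e2); split; first by rewrite lt_min e10 e20; split => //; pos.
move=> eps lam eps0; rewrite lt_min => /andP[epse1 epse2] hlam.
have [epsh [Y [Y1 [Y2 [Y3 [Y4 [hY hdec hlow]]]]]]] := hloc lam eps hlam eps0 epse1.
(* The scaling raises the exponentially small bound on the cut-off region exactly to [m], hence
   [W1_norm f] to at most 1. *)
pose s := m * eps * expR (kap / eps) / C; have s0 : 0 < s by rewrite /s; pos.
have sE : s * (C / eps * expR (- kap / eps)) = m.
  rewrite /s mulNr expRN; have := expR_gt0 (kap / eps); move: (expR _) => e ee.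
  by field; rewrite !gt_eqF.
have La : normc lam <= normc lam0 + h ^+ 2.
  have -> : lam = lam0 + (lam - lam0) by ring.
  by apply: (le_trans (le_normcD _ _)); rewrite lerD2l.
have eps1 : eps < 1 by clear - AM epsh; lra.
have [||y [y1 [f [hS hy hf hy1]]]] := step eps m lam (fun x => s%:C * Y x) (fun x => s%:C * Y1 x)
  (fun x => s%:C * Y2 x) (fun x => s%:C * Y3 x) (fun x => s%:C * Y4 x) eps0 eps1 (ltW m0) La.
- move=> x /hY[d0 d1 d2 d3 E]; split; try exact: hasDZ.
  rewrite -[RHS](mulr0 s%:C) -[in RHS]E.
  by move: (alpha ^+ 2)%:C (eps ^+ 2)%:C (q x)%:C => *; ring.
- move=> x /hdec[k0 k1 k2 k3]; have nb Z : normc Z <= C / eps * expR (- kap / eps) -> normc (s%:C * Z) <= m.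
    by move=> hZ; rewrite normcM normcr gtr0_norm// -sE ler_pM2l.
  by split; exact: nb.
exists y, f; split => //; first by apply: (le_trans hf); rewrite /m mulfV// gt_eqF.
rewrite -(@ler_pXn2r _ 2)// ?nnegrE ?W1_norm_ge0 ?expR_ge0//.
rewrite (W1_norm2 hy).
have eh : eps * h < h / 2.
  have eh1 : eps * h < 2^-1 * h by rewrite ltr_pM2r.
  clear - AM eh1; lra.
have eh0 : 0 < eps * h by pos.
have low : (x0 + eps * h - x0) * (s * (eps / C)) ^+ 2 <= sqN y1.
  apply: sqN_ge; [by case: hy|..|by pos|]; try by clear - AM xm xp h0 eh eh0; flra.
  move=> x /andP[xa xb]; rewrite hy1; last by rewrite ger0_norm; clear - AM xa xb eh; lra.
  rewrite normcM normcr gtr0_norm// ler_pM2l// ler_pdivrMr// mulrC; apply: hlow.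
  by rewrite xa xb.
apply: (@le_trans _ _ (sqN y1)); last by rewrite lerDl sqN_ge0.
apply: le_trans low.
have -> : expR (kap / 2 / eps) ^+ 2 = expR (kap / eps).
  by rewrite -expRM_natl; congr expR; field; rewrite gt_eqF.
have -> : (x0 + eps * h - x0) * (s * (eps / C)) ^+ 2 = (c * eps ^+ 5 * expR (kap / eps)) * expR (kap / eps).
  by rewrite /s /c; move: (expR _) => e; field; rewrite gt_eqF.
by rewrite ler_peMl ?expR_ge0// hexp.
Qed.

End Quasimode.

(** * The domain inside the semistrip, and the growth of the resolvent *)

Section Domain.
Variables (R : realType) (q : R -> R) (G : set R[i]^o) (qC : R[i]^o -> R[i]^o).
Implicit Types z v : R[i]^o.

Lemma Omega_boundary_sub z : q (-1) < q 1 -> Omega_boundary q G qC z ->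
  Pi_of q z \/ Im z = 0 /\ q (-1) <= Re z <= q 1.
Proof.
move=> q11; have arc s e : (Im e = 0 /\ q (-1) <= Re e <= q 1) -> gamma_arc q G qC s e z ->
    Pi_of q z \/ Im z = 0 /\ q (-1) <= Re z <= q 1.
  move=> he [g [[_ _ _ g1 hg] [t /andP[t0]]]]; rewrite le_eqVlt => /orP[/eqP -> ->|t1 ->].
    by rewrite g1; right.
  by left; have [] := hg t (introT andP (conj t0 t1)).
have la : q (-1) <= q 1 by exact: ltW.
move=> [[/arc|/arc]|[x hx <-]]; last by right.
  by apply; split => //=; rewrite la lexx.
by apply; split => //=; rewrite la lexx.
Qed.

Lemma unbounded_ray (B : set R[i]^o) z v : normc v = 1 -> bounded_set B ->
  (forall t : R, 0 <= t -> B (z + t%:C * v)) -> False.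
Proof.
move=> v1 [M [Mr HM]] hB.
have [m mE] : exists m : R, M <= m%:C.
  exists (Re M); move: Mr; case: (M) => a b; rewrite realE !lecE /= => /orP[/andP[/eqP -> _]|/andP[/eqP b0 _]];
    by rewrite ?b0 eqxx lexx.
pose t := `|m| + normc z + 2.
have t0 : 0 <= t by rewrite /t; have := normc_ge0 z; have := normr_ge0 m; lra.
have : M < (`|m| + 1)%:C.
  by apply: (le_lt_trans mE); rewrite ltcR; have := ler_norm m; flra.
move=> /HM/(_ _ (hB t t0)) /=; rewrite normc_normr lecR.
have := normcB (z + t%:C * v) z; have -> : z + t%:C * v - z = t%:C * v by ring.
rewrite normcM v1 mulr1 normcr ger0_norm// /t; flra.
Qed.

(** From a point outside the semistrip and off the boundary set, a ray upwards, to the left or to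
    the right never meets the boundary curves, which lie in the semistrip and on the segment; its
    component is therefore unbounded. *)
Lemma Omega_sub : q (-1) < q 1 -> Omega q G qC `<=` Pi_of q.
Proof.
move=> q11 z [nz bz]; apply: contrapT => nPi.
have ray v : normc v = 1 -> (forall t : R, 0 < t -> ~ Omega_boundary q G qC (z + t%:C * v)) -> False.
  move=> v1 hv; apply: (unbounded_ray v1 bz (z := z)) => t t0.
  pose f (s : R) : R[i]^o := z + s%:C * v.
  have cf : continuous f.
    apply: continuous_complex_pair => s e e0; exists e => // w we.
    rewrite /f; have -> : z + (s + w)%:C * v - (z + s%:C * v) = w%:C * v by rewrite rmorphD; ring.
    by rewrite normcM v1 mulr1 normcr.
  have conn : connected (f @` [set s | 0 <= s]).
    apply: connected_continuous_connected; last exact: continuous_subspaceT.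
    by apply/connected_intervalP => x y /= x0 y0 w /andP[xw _]; exact: le_trans xw.
  apply: (connected_component_max _ _ conn); [by exists 0 => //=; rewrite /f mul0r addr0| |by exists t].
  move=> w [s /= s0 <-]; move: s0; rewrite le_eqVlt => /orP[/eqP <-|s0]; last exact: hv.
  by rewrite /f mul0r addr0.
case: (leP 0 (Im z)) => iz.
  apply: (ray 'i); first exact: normc_i.
  move=> t t0 /(Omega_boundary_sub q11)[[_]|[+ _]]; rewrite !ReImE /=; flra.
case: (leP (Re z) (q (-1))) => rz.
  apply: (ray (-1)); first by rewrite normcN normc1.
  by move=> t t0 /(Omega_boundary_sub q11)[[/andP[+ _] _]|[_ /andP[+ _]]]; rewrite !ReImE /=; flra.
case: (leP (q 1) (Re z)) => rz1.
  apply: (ray 1); first by rewrite normc1.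
  by move=> t t0 /(Omega_boundary_sub q11)[[/andP[_ +] _]|[_ /andP[_ +]]]; rewrite !ReImE /=; flra.
by apply: nPi; split => //; rewrite rz rz1.
Qed.

Hypothesis AM : AM_continuation q G qC.

Lemma resolvent_norm_ge (alpha eps : R) (lam : R[i]^o) (y f : R -> R[i]^o) (M : R) :
  OS_shift q alpha eps lam y f -> W1_norm f <= 1 -> M <= W1_norm y ->
  (M%:E <= OS_resolvent_norm q alpha eps lam)%E.
Proof.
move=> hS hf hy; rewrite /OS_resolvent_norm; case: ifP => _; last exact: leey.
apply: (@le_trans _ _ (W1_norm y)%:E); first by rewrite lee_fin.
by apply: ereal_sup_ubound; exists f, y.
Qed.

(** The quasimodes of one point serve a whole disc around it, and compactness makes the constants
    uniform. A single number [e] plays both the exponent and the bound on [eps]: decreasing it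
    weakens both requirements. *)
Lemma resolvent_growth (alpha : R) (K : set R[i]^o) : alpha != 0 -> compact K -> K `<=` Pi_of q ->
  exists2 e : R, 0 < e & forall eps lam, 0 < eps -> eps < e -> K lam ->
    ((expR (e / eps))%:E <= OS_resolvent_norm q alpha eps lam)%E.
Proof.
move=> a0 /compact_near_coveringP cK KPi.
pose P (e : R) (lam : R[i]^o) := forall eps, 0 < eps -> eps < e ->
  ((expR (e / eps))%:E <= OS_resolvent_norm q alpha eps lam)%E.
have hK : \forall e \near (0 : R)^'+, K `<=` P e.
  apply: cK => lam0 Klam0.
  have [rho [tau [e0 [[rho0 tau0 e00] hq]]]] := quasimode AM a0 (KPi _ Klam0).
  exists ([set lam : R[i]^o | disc lam0 rho lam], [set e : R | 0 < e < Num.min tau e0]).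
    split => /=; first by apply/nbhs_disc; exists rho.
    exists (Num.min tau e0); rewrite /= ?lt_min ?tau0// => e; rewrite /ball_/= sub0r normrN => h1 h2.
    by move: h1; rewrite h2 gtr0_norm.
  move=> [lam e] /= [hlam /andP[ep]]; rewrite lt_min => /andP[et ee0] eps eps0 epse.
  have [y [f [hS hf hy]]] := hq eps lam eps0 (lt_trans epse ee0) (ltW hlam).
  apply: resolvent_norm_ge hS hf _; apply: le_trans hy.
  by rewrite ler_expR ler_pM2r ?invr_gt0// ltW.
have : \forall e \near (0 : R)^'+, 0 < e /\ K `<=` P e.
  by near=> e; split; near: e => //; exact: nbhs_right_gt.
move=> /filter_ex[e [e0 he]]; exists e => // eps lam eps0 epse Kl; exact: he.
Unshelve. all: by end_near. Qed.

End Domain.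

(** * Inner product calculus in the Sobolev space and energy estimates *)

Section W1Algebra.
Variable R : realType.
Local Notation mu := (@lebesgue_measure R).
Local Notation J := ([set` `[(-1 : R), 1]]).
Implicit Types (f g h : R -> R[i]).

Lemma W1_inner_addl f g h c : W1 f -> W1 g -> W1 h ->
  W1_inner (fun x => f x + c * g x) h = W1_inner f h + c * W1_inner g h.
Proof.
move=> [f1 hf] [g1 hg] [h1 hh].
rewrite (W1_innerE (hdD hf (hdZ c hg)) hh) (W1_innerE hf hh) (W1_innerE hg hh).
have key a b k : L2 a -> L2 b -> L2 k -> cintegral J (fun x => (a x + c * b x) * (k x)^*) =
   cintegral J (fun x => a x * (k x)^*) + c * cintegral J (fun x => b x * (k x)^*).
  move=> la lb lk; have i1 := L2_prod_int la (L2_conj lk); have i2 := L2_prod_int lb (L2_conj lk).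
  rewrite -cintegralZ// -cintegralD//; last exact: CintZ.
  by apply: eq_cintegral => x _; ring.
rewrite !key; [by ring|exact: hd_L2 hf|exact: hd_L2 hg|exact: hd_L2 hh|by case: hf|by case: hg|by case: hh].
Qed.

Lemma W1_inner_conj f g : W1 f -> W1 g -> W1_inner g f = (W1_inner f g)^*.
Proof.
move=> [f1 hf] [g1 hg]; rewrite (W1_innerE hf hg) (W1_innerE hg hf) rmorphD /=.
have key a b : L2 a -> L2 b -> cintegral J (fun x => b x * (a x)^*) = (cintegral J (fun x => a x * (b x)^*))^*.
  move=> la lb; rewrite -cintegral_conj//; last by apply: L2_prod_int => //; exact: L2_conj.
  by apply: eq_cintegral => x _; apply: complexP; rewrite !ReImE; ring.
by congr (_ + _); apply: key; [by case: hf|by case: hg|exact: hd_L2 hf|exact: hd_L2 hg].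
Qed.

Lemma W1_inner_self f : W1 f -> W1_inner f f = (W1_norm f ^+ 2)%:C.
Proof.
move=> [f1 hf]; have E := W1_norm2 hf; rewrite (W1_innerE hf hf) E.
have key a : L2 a -> cintegral J (fun x => a x * (a x)^*) = (sqN a)%:C.
  move=> la; apply: complexP; rewrite /= ?sqNE//.
  transitivity (\int[mu]_(x in J) (0 : R)); last by rewrite Rintegral_cst// mul0r.
  by apply: eq_Rintegral => x _; case: (a x) => u v /=; ring.
by rewrite !key ?rmorphD//; [exact: hd_L2 hf|case: hf].
Qed.

Lemma W1D f g : W1 f -> W1 g -> W1 (fun x => f x + g x).
Proof. by move=> [f1 hf] [g1 hg]; exists (fun x => f1 x + g1 x); exact: hdD. Qed.

Lemma W1Z c f : W1 f -> W1 (fun x => c * f x).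
Proof. by move=> [f1 hf]; exists (fun x => c * f1 x); exact: hdZ. Qed.

Lemma W1_0 : W1 (fun=> 0 : R[i]). Proof. by exists (fun=> 0); exact: hd0. Qed.

Lemma eq_W1 f g : eq_itv f g -> W1 f -> W1 g.
Proof. by move=> fg [f1 hf]; exists f1; apply: hd_eq hf. Qed.

Lemma W1_expand f g c : W1 f -> W1 g ->
  W1_norm (fun x => f x + c * g x) ^+ 2 = W1_norm f ^+ 2 + 2 * Re (c^* * W1_inner f g) + normc c ^+ 2 * W1_norm g ^+ 2.
Proof.
move=> wf wg; have [f1 hf] := wf; have [g1 hg] := wg.
rewrite (W1_norm2 (hdD hf (hdZ c hg))) (W1_norm2 hf) (W1_norm2 hg) (W1_innerE hf hg).
rewrite !sqN_expand; [|exact: hd_L2 hf|exact: hd_L2 hg|by case: hf|by case: hg].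
by rewrite mulrDr ReD; ring.
Qed.

Lemma W1_CS f g : W1 f -> W1 g -> normc (W1_inner f g) <= W1_norm f * W1_norm g.
Proof.
move=> wf wg; rewrite -(@ler_pXn2r _ 2)// ?nnegrE ?normc_ge0 ?mulr_ge0 ?W1_norm_ge0// exprMn.
apply: discr_le; rewrite ?sqr_ge0// => s; set c := W1_inner f g.
have := sqr_ge0 (W1_norm (fun x => f x + (- s%:C * c) * g x)); rewrite W1_expand// -/c => /le_trans; apply.
rewrite le_eqVlt; apply/orP; left; apply/eqP; rewrite normcM normcN normcr exprMn real_normK ?num_real//.
congr (_ + _ + _).
by rewrite sqr_normcE; case: (c) => c1 c2; rewrite !ReImE /=; ring.
Qed.

Lemma W1_normD f g c : W1 f -> W1 g -> W1_norm (fun x => f x + c * g x) <= W1_norm f + normc c * W1_norm g.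
Proof.
move=> wf wg; rewrite -(@ler_pXn2r _ 2)// ?nnegrE ?W1_norm_ge0//; last first.
  by rewrite addr_ge0 ?mulr_ge0 ?W1_norm_ge0 ?normc_ge0.
rewrite W1_expand//; have -> : (W1_norm f + normc c * W1_norm g) ^+ 2 =
  W1_norm f ^+ 2 + 2 * (normc c * (W1_norm f * W1_norm g)) + normc c ^+ 2 * W1_norm g ^+ 2 by ring.
rewrite lerD2r lerD2l ler_pM2l//; apply: (le_trans (Re_mul_le _ _)).
by rewrite normc_conj ler_wpM2l ?normc_ge0 ?W1_CS.
Qed.

Lemma eq_W1_norm f g : eq_itv f g -> W1 f -> W1_norm f = W1_norm g.
Proof.
move=> fg [f1 hf]; have hg : has_deriv g f1 by apply: hd_eq hf.
have : W1_norm f ^+ 2 = W1_norm g ^+ 2.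
  rewrite (W1_norm2 hf) (W1_norm2 hg); congr (_ + _); apply: eq_Rintegral => x /set_mem/JP/fg ->//.
by move/eqP; rewrite eqrXn2 ?W1_norm_ge0// => /eqP.
Qed.

Lemma W1_norm_sub f g c : W1 f -> W1 g -> W1_norm f <= W1_norm (fun x => f x + c * g x) + normc c * W1_norm g.
Proof.
move=> wf wg; rewrite (@eq_W1_norm f (fun x => (f x + c * g x) + - c * g x))//; last by move=> x _; ring.
by rewrite -[normc c]normcN; apply: W1_normD => //; apply: W1D => //; exact: W1Z.
Qed.

Lemma W1_norm0 : W1_norm (fun=> 0 : R[i]) = 0.
Proof.
have h : W1_inner (fun=> 0 : R[i]) (fun=> 0) = 0.
  rewrite (W1_innerE (@hd0 R) (@hd0 R)).
  have -> : cintegral J (fun=> 0 * 0^*) = 0 :> R[i].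
    have := @cintegralZ R J 0 (fun=> 0) (@measJ R) (L2_int (@L2_cst R 0)).
    rewrite [RHS in _ = RHS -> _]mul0r => E; rewrite -[RHS]E.
    by apply: eq_cintegral => x _; rewrite !mul0r.
  by rewrite addr0.
by rewrite /W1_norm h /= sqrtr0.
Qed.

Lemma L1_le_L2 f : L2 f -> (\int[mu]_(x in J) normc (f x)) ^+ 2 <= 2 * sqN f.
Proof.
move=> lf; have i1 := normc_int lf.
have [_ _ m3] := (L2P f).1 lf; have /integrableP[/measurable_EFinP m _] := i1.
have lg : L2 (fun x => (normc (f x))%:C).
  by apply/L2P; split => //; apply: eq_rint m3 => // x _; rewrite normcr ger0_norm ?normc_ge0.
have := cauchy_schwarz lg (@L2_cst R 1).
have -> : sqN (fun x => (normc (f x))%:C) = sqN f.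
  by apply: eq_Rintegral => x _; rewrite normcr ger0_norm ?normc_ge0.
have -> : sqN (fun=> 1 : R[i]) = 2.
  by rewrite /sqN Rintegral_cst// lebesgue_len ?le_m11// normc1 expr1n; ring.
have -> : cintegral J (fun x => (normc (f x))%:C * 1^*) = (\int[mu]_(x in J) normc (f x))%:C.
  apply: complexP => /=; first by apply: eq_Rintegral => x _; move: (normc _) => N /=; ring.
  rewrite (@eq_Rintegral _ _ _ _ _ (fun=> 0)); first by rewrite Rintegral_cst// mul0r.
  by move=> x _; move: (normc _) => N /=; ring.
rewrite normcr real_normK ?num_real//; flra.
Qed.

Lemma Rint_sum n (f : nat -> R -> R) : (forall k, rint J (f k)) ->
  rint J (fun x => \sum_(k < n) f k x) /\
  \int[mu]_(x in J) (\sum_(k < n) f k x) = \sum_(k < n) \int[mu]_(x in J) f k x.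
Proof.
move=> hf; elim: n => [|n [i1 IH]].
  have E : (fun x : R => \sum_(k < 0) f k x) = (fun=> 0) by apply/funext => x; rewrite big_ord0.
  rewrite E big_ord0 Rintegral_cst// mul0r; split => //.
  by apply: rint_cont; apply: continuous_subspaceT => x; exact: cst_continuous.
have E : (fun x : R => \sum_(k < n.+1) f k x) = (fun x => \sum_(k < n) f k x + f n x).
  by apply/funext => x; rewrite big_ord_recr.
rewrite E big_ord_recr /= -IH; split; first exact: rintD.
by rewrite RintegralD//; exact: hf.
Qed.

End W1Algebra.

Section Energy.
Variables (R : realType) (q : R -> R) (G : set R[i]^o) (qC : R[i]^o -> R[i]^o).
Hypothesis AM : AM_continuation q G qC.
Local Notation mu := (@lebesgue_measure R).
Local Notation J := ([set` `[(-1 : R), 1]]).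
Local Notation q2C := (q2C qC).
Implicit Types (f g : R -> R[i]).

Lemma L2_bmul (k f : R -> R[i]) (B : R) : (forall x, J x -> rcont_at k x) -> (forall x, J x -> normc (k x) <= B) ->
  L2 f -> L2 (fun x => k x * f x) /\ sqN (fun x => k x * f x) <= B ^+ 2 * sqN f.
Proof.
move=> /rcont_at_within[c1 c2] hB /L2P[m1 m2 m3].
have k1 := meas_within c1; have k2 := meas_within c2.
have mR : measurable_fun J (fun x => Re (k x * f x)).
  rewrite (_ : (fun x => _) = (fun x => Re (k x) * Re (f x) - Im (k x) * Im (f x))); last by apply/funext => x; rewrite ReM.
  by apply: measurable_funB; apply: measurable_funM.
have mI : measurable_fun J (fun x => Im (k x * f x)).
  rewrite (_ : (fun x => _) = (fun x => Re (k x) * Im (f x) + Im (k x) * Re (f x))); last by apply/funext => x; rewrite ImM.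
  by apply: measurable_funD; apply: measurable_funM.
have le x : J x -> normc (k x * f x) ^+ 2 <= B ^+ 2 * normc (f x) ^+ 2.
  move=> Jx; rewrite normcM exprMn ler_wpM2r ?sqr_ge0// lerXn2r ?nnegrE ?normc_ge0 ?hB//.
  exact: le_trans (normc_ge0 _) (hB _ Jx).
have iB : rint J (fun x => B ^+ 2 * normc (f x) ^+ 2) by exact: rintZ.
have i2 : rint J (fun x => normc (k x * f x) ^+ 2).
  apply: (rint_le _ _ iB) => //.
    rewrite (_ : (fun x => _) = (fun x => Re (k x * f x) ^+ 2 + Im (k x * f x) ^+ 2)); first exact: measurable_sq.
    by apply/funext => x; rewrite sqr_normcE.
  by move=> x /le; rewrite [X in _ -> X <= _]ger0_norm ?sqr_ge0.
split; first by apply/L2P.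
by rewrite /sqN -RintegralZl//; apply: le_Rintegral.
Qed.

(* The weak form of [S y = w], with all derivatives explicit: [u1] is the derivative of
   [(D^2 - alpha^2) y].  It uses [q2C] in place of [q''], as [y] vanishes at the endpoints. *)
Definition OSw (alpha eps : R) (y y1 y2 u1 w w1 : R -> R[i]) : Prop :=
  let u x := y2 x - (alpha ^+ 2)%:C * y x in
  [/\ [/\ has_deriv y y1, has_deriv y1 y2, has_deriv u u1 & has_deriv w w1],
   [/\ y (-1) = 0, y 1 = 0, y1 (-1) = 0 & y1 1 = 0] &
   forall phi phi1, has_deriv phi phi1 -> phi (-1) = 0 -> phi 1 = 0 ->
    - cintegral J (fun x => w1 x * phi1 x) - (alpha ^+ 2)%:C * cintegral J (fun x => w x * phi x) =
    'i * (eps ^+ 2)%:C * (- cintegral J (fun x => u1 x * phi1 x) - (alpha ^+ 2)%:C * cintegral J (fun x => u x * phi x))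
     + cintegral J (fun x => (qC x%:C * u x - q2C x%:C * y x) * phi x)].

Lemma OS_graphW (alpha eps : R) (y w : R -> R[i]) : OS_graph q alpha eps y w ->
  exists y1 y2 u1 w1, OSw alpha eps y y1 y2 u1 w w1.
Proof.
move=> [y1 [y2 [[hy hy1 [y3 hy2]] [[b1 b2 b3 b4] [[[w1 hw] wm wp] H]]]]].
pose u1 x := y3 x + - (alpha ^+ 2)%:C * y1 x.
have hu : has_deriv (fun x => y2 x - (alpha ^+ 2)%:C * y x) u1.
  by apply: hd_eq (hdD hy2 (hdZ (- (alpha ^+ 2)%:C) hy)) => x _ //; rewrite mulNr.
exists y1, y2, u1, w1; split => // phi phi1 hphi pm pp.
have := H phi; rewrite (helmholtzE _ hw hphi) (helmholtzE _ hu hphi) => -> //; last by split => //; exists phi1.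
congr (_ + _); apply: eq_cintegral => x /set_mem/JP xJ.
rewrite (qCE AM xJ); case/andP: (xJ); rewrite le_eqVlt => /orP[/eqP <-|x1]; first by rewrite b1 !mulr0.
rewrite le_eqVlt => /orP[/eqP ->|x2]; first by rewrite b2 !mulr0.
by rewrite (q_derive2 AM)// x1.
Qed.

Lemma qC_rcont x : J x -> rcont_at (fun t => qC t%:C) x.
Proof. by move=> /JP/(q_rcont_at AM). Qed.

Lemma q2C_rcont x : J x -> rcont_at (fun t => q2C t%:C) x.
Proof. by move=> /JP xJ; exact: rcont_at_rD (hol_line AM (q2C_hol AM) xJ). Qed.

Lemma OSw_lin (alpha eps : R) c y y1 y2 u1 w w1 y' y1' y2' u1' w' w1' :
  OSw alpha eps y y1 y2 u1 w w1 -> OSw alpha eps y' y1' y2' u1' w' w1' ->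
  OSw alpha eps (fun x => y x + c * y' x) (fun x => y1 x + c * y1' x) (fun x => y2 x + c * y2' x)
    (fun x => u1 x + c * u1' x) (fun x => w x + c * w' x) (fun x => w1 x + c * w1' x).
Proof.
move=> [[hy hy1 hu hw] [b1 b2 b3 b4] H] [[hy' hy1' hu' hw'] [b1' b2' b3' b4'] H'].
set u := fun x => y2 x - _ in hu H; set u' := fun x => y2' x - _ in hu' H'.
have huu : has_deriv (fun x => y2 x + c * y2' x - (alpha ^+ 2)%:C * (y x + c * y' x)) (fun x => u1 x + c * u1' x).
  by apply: hd_eq (hdD hu (hdZ c hu')) => x _ //; rewrite /u /u'; ring.
split; first by split; [exact: hdD hy (hdZ c hy')|exact: hdD hy1 (hdZ c hy1')|exact: huu|exact: hdD hw (hdZ c hw')].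
  by rewrite b1 b2 b3 b4 b1' b2' b3' b4' !mulr0 !addr0.
move=> phi phi1 hphi pm pp; have {}H := H _ _ hphi pm pp; have {}H' := H' _ _ hphi pm pp.
have [Q0 _ hQ0] := bounded_J qC_rcont; have [Q2 _ hQ2] := bounded_J q2C_rcont.
have lp := hd_L2 hphi; have lp1 := hphi.1.
have key a b k : L2 a -> L2 b -> L2 k -> cintegral J (fun x => (a x + c * b x) * k x) =
   cintegral J (fun x => a x * k x) + c * cintegral J (fun x => b x * k x).
  move=> la lb lk; have i1 := L2_prod_int la lk; have i2 := L2_prod_int lb lk.
  rewrite -cintegralZ// -cintegralD//; last exact: CintZ.
  by apply: eq_cintegral => x _; ring.
have Lq v z : L2 v -> L2 z -> L2 (fun x => qC x%:C * v x - q2C x%:C * z x).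
  move=> lv lz; have [l1 _] := L2_bmul qC_rcont hQ0 lv; have [l2 _] := L2_bmul q2C_rcont hQ2 lz.
  by apply: eq_L2 (L2D l1 (L2Z (-1) l2)) => x _; rewrite mulN1r.
have Ly := hd_L2 hy; have Ly' := hd_L2 hy'; have Lu := hd_L2 hu; have Lu' := hd_L2 hu'.
rewrite (key w1 w1' phi1 hw.1 hw'.1 lp1) (key w w' phi (hd_L2 hw) (hd_L2 hw') lp) (key u1 u1' phi1 hu.1 hu'.1 lp1).
have -> : cintegral J (fun x => (y2 x + c * y2' x - (alpha ^+ 2)%:C * (y x + c * y' x)) * phi x) =
   cintegral J (fun x => u x * phi x) + c * cintegral J (fun x => u' x * phi x).
  by rewrite -key//; apply: eq_cintegral => x _; rewrite /u /u'; ring.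
have -> : cintegral J (fun x => (qC x%:C * (y2 x + c * y2' x - (alpha ^+ 2)%:C * (y x + c * y' x)) - q2C x%:C * (y x + c * y' x)) * phi x) =
   cintegral J (fun x => (qC x%:C * u x - q2C x%:C * y x) * phi x) + c * cintegral J (fun x => (qC x%:C * u' x - q2C x%:C * y' x) * phi x).
  rewrite -(key _ _ phi (Lq _ _ Lu Ly) (Lq _ _ Lu' Ly') lp).
  by apply: eq_cintegral => x _; rewrite /u /u'; ring.
move: H H'; set X1 := cintegral _ _; set X2 := cintegral _ _; set X3 := cintegral _ _; set X4 := cintegral _ _.
set X5 := cintegral _ _; move=> E; set Z1 := cintegral _ _; set Z2 := cintegral _ _; set Z3 := cintegral _ _.
set Z4 := cintegral _ _; set Z5 := cintegral _ _ => E'.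
transitivity ((- X1 - (alpha ^+ 2)%:C * X2) + c * (- Z1 - (alpha ^+ 2)%:C * Z2)); first by ring.
by rewrite E E'; ring.
Qed.

Lemma OSw_0 (alpha eps : R) : OSw alpha eps (fun=> 0) (fun=> 0) (fun=> 0) (fun=> 0) (fun=> 0) (fun=> 0).
Proof.
have h0 := @hd0 R.
have hu : has_deriv (fun x : R => 0 - (alpha ^+ 2)%:C * 0) (fun=> 0 : R[i]).
  by apply: hd_eq h0 => x _; rewrite ?mulr0 ?subr0.
split => // phi phi1 hphi pm pp.
have Z f : (forall x, f x = 0) -> cintegral J f = 0.
  move=> f0; have := @cintegralZ R J 0 (fun=> 0) (@measJ R) (L2_int (@L2_cst R 0)).
  by rewrite [RHS in _ = RHS -> _]mul0r => E; rewrite -[RHS]E; apply: eq_cintegral => x _; rewrite f0 mul0r.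
by rewrite !Z => *; rewrite !(oppr0, mulr0, subr0, addr0, mul0r).
Qed.

(** The weak form tested with the conjugate of [y]. Integration by parts has no boundary terms
    because [y1] vanishes at both endpoints, and the viscous term becomes the purely imaginary
    multiple of [sqN u]. *)
Lemma energy (alpha eps : R) y y1 y2 u1 w w1 : OSw alpha eps y y1 y2 u1 w w1 ->
  let u x := y2 x - (alpha ^+ 2)%:C * y x in
  - cintegral J (fun x => w1 x * (y1 x)^*) - (alpha ^+ 2)%:C * cintegral J (fun x => w x * (y x)^*) =
  'i * (eps ^+ 2 * sqN u)%:C + cintegral J (fun x => (qC x%:C * u x - q2C x%:C * y x) * (y x)^*).
Proof.
move=> [[hy hy1 hu hw] [b1 b2 b3 b4] H] u.
rewrite (H _ _ (hd_conj hy)) ?b1 ?b2 ?rmorph0//; congr (_ + _).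
rewrite (rmorphM (real_complex R) (eps ^+ 2)) mulrA; congr (_ * _).
have hy1c := hd_conj hy1.
have [M hM] : exists M : R, forall x, J x -> normc (y2 x)^* <= M.
  have [c1 c2] := hd_cont hu; have [d1 d2] := hd_cont hy.
  have [B1 h1] := cont_bounded c1; have [B2 h2] := cont_bounded c2; have [B3 h3] := cont_bounded d1; have [B4 h4] := cont_bounded d2.
  exists (B1 + B2 + alpha ^+ 2 * (B3 + B4)) => x Jx; rewrite normc_conj.
  have -> : y2 x = u x + (alpha ^+ 2)%:C * y x by rewrite /u; ring.
  apply: (le_trans (le_normcD _ _)); rewrite normcM normcr ger0_norm ?sqr_ge0//; apply: lerD.
    by apply: (le_trans (normc_leReIm _)); apply: lerD; [exact: h1|exact: h2].
  rewrite ler_wpM2l ?sqr_ge0//.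
  by apply: (le_trans (normc_leReIm _)); apply: lerD; [exact: h3|exact: h4].
rewrite (ibp hu hy1c hM) b3 b4 rmorph0 !mulr0 subrr sub0r opprK.
have Lu := hd_L2 hu; have i1 := L2_prod_int Lu hy1c.1; have i2 := L2_prod_int Lu (L2_conj (hd_L2 hy)).
rewrite -mulNr -cintegralZ// -cintegralD//; last exact: CintZ.
transitivity (cintegral J (fun x => u x * (u x)^*)); last first.
  apply: complexP; rewrite /= ?sqNE//; transitivity (\int[mu]_(x in J) (0 : R)); last by rewrite Rintegral_cst// mul0r.
  by apply: eq_Rintegral => x _; case: (u x) => a b /=; ring.
apply: eq_cintegral => x _.
by rewrite /u; case: (y2 x) (y x) => [a b] [c d]; move: (alpha ^+ 2) => e; apply: complexP; rewrite /=; ring.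
Qed.

(* [n], [W], [U] stand for the norms of [y], [w] and [(D^2 - alpha^2) y]. *)
Lemma weighted_young_bound (eps Q0 Q2 A n W U : R) : 0 < eps -> eps < 1 -> 0 <= Q0 -> 0 <= Q2 -> 0 <= A ->
  0 <= n -> 0 <= W -> 0 <= U -> eps ^+ 2 * U ^+ 2 <= Q0 * (U * n) + Q2 * n ^+ 2 + (1 + A) * (W * n) ->
  eps ^+ 4 * U ^+ 2 <= (Q0 ^+ 2 + 2 * Q2 + (1 + A)) * (n ^+ 2 + W ^+ 2).
Proof.
move=> e0 e1 q0 q2 a0 n0 w0 u0 H.
have h1 : eps ^+ 2 * (Q0 * (U * n)) <= (eps ^+ 4 * U ^+ 2 + Q0 ^+ 2 * n ^+ 2) / 2.
  have := sqr_ge0 (eps ^+ 2 * U - Q0 * n); rewrite ler_pdivlMr//.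
  have -> : (eps ^+ 2 * U - Q0 * n) ^+ 2 = eps ^+ 4 * U ^+ 2 + Q0 ^+ 2 * n ^+ 2 - eps ^+ 2 * (Q0 * (U * n)) * 2 by ring.
  by rewrite subr_ge0.
have e2 : eps ^+ 2 <= 1 by rewrite expr_le1// ltW.
have wn : W * n <= (n ^+ 2 + W ^+ 2) / 2 by have := sqr_ge0 (W - n); rewrite sqrrB; flra.
have h2 : eps ^+ 2 * (Q2 * n ^+ 2) <= Q2 * n ^+ 2 by rewrite ler_piMl//; pos.
have h2' : eps ^+ 2 * ((1 + A) * (W * n)) <= (1 + A) * (W * n) by rewrite ler_piMl//; pos.
have h3 : eps ^+ 4 * U ^+ 2 <= eps ^+ 2 * (Q0 * (U * n)) + eps ^+ 2 * (Q2 * n ^+ 2) + eps ^+ 2 * ((1 + A) * (W * n)).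
  have -> : eps ^+ 4 * U ^+ 2 = eps ^+ 2 * (eps ^+ 2 * U ^+ 2) by ring.
  by rewrite -!mulrDr ler_wpM2l// sqr_ge0.
have h4 : (1 + A) * (W * n) <= (1 + A) * ((n ^+ 2 + W ^+ 2) / 2) by rewrite ler_wpM2l//; pos.
have p1 : 0 <= Q0 ^+ 2 * W ^+ 2 by pos.
have p2 : 0 <= Q2 * W ^+ 2 by pos.
have -> : (Q0 ^+ 2 + 2 * Q2 + (1 + A)) * (n ^+ 2 + W ^+ 2) = Q0 ^+ 2 * n ^+ 2 + Q0 ^+ 2 * W ^+ 2 + 2 * (Q2 * n ^+ 2) + 2 * (Q2 * W ^+ 2) + 2 * ((1 + A) * ((n ^+ 2 + W ^+ 2) / 2)) by field.
flra.
Qed.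

Lemma sqrt_sqr_le (x y z : R) : 0 <= x -> 0 <= y -> 0 <= z -> x ^+ 2 <= y * z -> x <= Num.sqrt y * Num.sqrt z.
Proof.
move=> x0 y0 z0 h; rewrite -(@ler_pXn2r _ 2)// ?nnegrE ?mulr_ge0 ?sqrtr_ge0//.
by rewrite exprMn !sqr_sqrtr.
Qed.

Lemma CS_sqrt f g : L2 f -> L2 g -> normc (cintegral J (fun x => f x * (g x)^*)) <= Num.sqrt (sqN f) * Num.sqrt (sqN g).
Proof. by move=> lf lg; apply: sqrt_sqr_le; rewrite ?normc_ge0 ?sqN_ge0// cauchy_schwarz. Qed.

Lemma sqrt_sqN_W1 f f1 : has_deriv f f1 -> Num.sqrt (sqN f) <= W1_norm f /\ Num.sqrt (sqN f1) <= W1_norm f.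
Proof.
move=> hf; have E := W1_norm2 hf.
by split; rewrite -(@ler_pXn2r _ 2)// ?nnegrE ?sqrtr_ge0 ?W1_norm_ge0// sqr_sqrtr ?sqN_ge0// E ?lerDl ?lerDr sqN_ge0.
Qed.

Lemma energy_terms (alpha eps Q0 Q2 : R) y y1 y2 u1 w w1 : 0 <= Q0 -> 0 <= Q2 ->
  (forall x, J x -> normc (qC x%:C) <= Q0) -> (forall x, J x -> normc (q2C x%:C) <= Q2) ->
  OSw alpha eps y y1 y2 u1 w w1 -> let u x := y2 x - (alpha ^+ 2)%:C * y x in
  normc (cintegral J (fun x => w1 x * (y1 x)^*) + (alpha ^+ 2)%:C * cintegral J (fun x => w x * (y x)^*)) <=
    (1 + alpha ^+ 2) * (W1_norm w * W1_norm y) /\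
  normc (cintegral J (fun x => (qC x%:C * u x - q2C x%:C * y x) * (y x)^*)) <=
    Q0 * (Num.sqrt (sqN u) * W1_norm y) + Q2 * W1_norm y ^+ 2.
Proof.
move=> q0 q2 hq0 hq2 [[hy hy1 hu hw] _ _] u.
have [y0' y1'] := sqrt_sqN_W1 hy; have [w0' w1'] := sqrt_sqN_W1 hw.
have Ly := hd_L2 hy; have Lw := hd_L2 hw; have Lu : L2 u := hd_L2 hu.
have s0 (a : R) := sqrtr_ge0 a.
split.
  apply: (le_trans (le_normcD _ _)); rewrite mulrDl mul1r; apply: lerD.
    by apply: (le_trans (CS_sqrt hw.1 hy.1)); apply: ler_pM.
  rewrite normcM normcr ger0_norm ?sqr_ge0// ler_wpM2l ?sqr_ge0//.
  by apply: (le_trans (CS_sqrt Lw Ly)); apply: ler_pM.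
have [l1 b1] := L2_bmul qC_rcont hq0 Lu; have [l2 b2] := L2_bmul q2C_rcont hq2 Ly.
have -> : cintegral J (fun x => (qC x%:C * u x - q2C x%:C * y x) * (y x)^*) =
   cintegral J (fun x => (qC x%:C * u x) * (y x)^*) + -1 * cintegral J (fun x => (q2C x%:C * y x) * (y x)^*).
  have i1 := L2_prod_int l1 (L2_conj Ly); have i2 := L2_prod_int l2 (L2_conj Ly).
  rewrite -cintegralZ// -cintegralD//; last exact: CintZ.
  by apply: eq_cintegral => x _; ring.
have sb (B : R) a b : 0 <= B -> 0 <= a -> 0 <= b -> a <= B ^+ 2 * b -> Num.sqrt a <= B * Num.sqrt b.
  move=> B0 aa bb h; apply: (le_trans (ler_wsqrtr h)); rewrite sqrtrM ?sqr_ge0// sqrtr_sqr ger0_norm//.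
apply: (le_trans (le_normcD _ _)); apply: lerD.
  apply: (le_trans (CS_sqrt l1 Ly)); rewrite mulrA; apply: ler_pM => //.
  by apply: sb; rewrite ?sqN_ge0.
rewrite normcM normcN normc1 mul1r; apply: (le_trans (CS_sqrt l2 Ly)); rewrite expr2 mulrA; apply: ler_pM => //.
apply: (@le_trans _ _ (Q2 * Num.sqrt (sqN y))); first by apply: sb; rewrite ?sqN_ge0.
by rewrite ler_wpM2l.
Qed.

Lemma OSw_helmholtz_bound (alpha : R) : exists2 C : R, 0 < C & forall eps y y1 y2 u1 w w1, 0 < eps -> eps < 1 ->
  OSw alpha eps y y1 y2 u1 w w1 ->
  eps ^+ 4 * sqN (fun x => y2 x - (alpha ^+ 2)%:C * y x) <= C * (W1_norm y ^+ 2 + W1_norm w ^+ 2).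
Proof.
have [Q0 Q00 hQ0] := bounded_J qC_rcont; have [Q2 Q20 hQ2] := bounded_J q2C_rcont.
exists (Q0 ^+ 2 + 2 * Q2 + (1 + alpha ^+ 2)); first by have := sqr_ge0 alpha => ?; pos.
move=> eps y y1 y2 u1 w w1 e0 e1 H.
pose u x := y2 x - (alpha ^+ 2)%:C * y x.
have [t1 _] := energy_terms (ltW Q00) (ltW Q20) hQ0 hQ2 H.
have t2 : normc (cintegral J (fun x => (qC x%:C * u x - q2C x%:C * y x) * (y x)^*)) <=
  Q0 * (Num.sqrt (sqN u) * W1_norm y) + Q2 * W1_norm y ^+ 2 := (energy_terms (ltW Q00) (ltW Q20) hQ0 hQ2 H).2.
have E : - cintegral J (fun x => w1 x * (y1 x)^*) - (alpha ^+ 2)%:C * cintegral J (fun x => w x * (y x)^*) =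
  'i * (eps ^+ 2 * sqN u)%:C + cintegral J (fun x => (qC x%:C * u x - q2C x%:C * y x) * (y x)^*) := energy H.
rewrite -[X in eps ^+ 4 * X]/(sqN u) -[sqN u]sqr_sqrtr ?sqN_ge0//; apply: weighted_young_bound => //; try (by rewrite ?W1_norm_ge0 ?sqrtr_ge0 ?sqr_ge0); try exact: ltW.
rewrite sqr_sqrtr ?sqN_ge0//.
have -> : eps ^+ 2 * sqN u = normc ('i * (eps ^+ 2 * sqN u)%:C).
  by rewrite normcM normc_i mul1r normcr ger0_norm// mulr_ge0 ?sqr_ge0 ?sqN_ge0.
have -> : 'i * (eps ^+ 2 * sqN u)%:C = - (cintegral J (fun x => w1 x * (y1 x)^*) + (alpha ^+ 2)%:C * cintegral J (fun x => w x * (y x)^*))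
   - cintegral J (fun x => (qC x%:C * u x - q2C x%:C * y x) * (y x)^*).
  by rewrite opprD E; ring.
apply: (le_trans (normcB _ _)); rewrite normcN addrC; exact: lerD.
Qed.

(** Far up the imaginary axis, at ['i * N], the imaginary part of the energy identity is coercive.
    [N] depends on [eps], but the constant [1 + A] does not. *)
Lemma OSw_far_resolvent (alpha : R) : alpha != 0 -> exists2 C : R, 0 < C & forall eps, 0 < eps -> exists2 N : R, 0 < N &
  forall y y1 y2 u1 w w1, OSw alpha eps y y1 y2 u1 w w1 ->
  W1_norm y <= C * W1_norm (fun x => w x + - ('i * N%:C) * y x).
Proof.
move=> a0; have [Q0 Q00 hQ0] := bounded_J qC_rcont; have [Q2 Q20 hQ2] := bounded_J q2C_rcont.
pose A := alpha ^+ 2; have A0 : 0 < A by rewrite /A exprn_even_gt0.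
exists (1 + A); first by pos.
move=> eps e0; pose a := Num.min 1 A; have a00 : 0 < a by rewrite lt_min ltr01.
(* The first summand absorbs the mixed term with [q] by Young's inequality against
   [eps ^+ 2 * sqN u], the second the term with q''; the remaining 1 gives the estimate. *)
exists ((Q0 ^+ 2 / (4 * eps ^+ 2) + Q2 + 1) / a); first by pos.
set N := _ / a => y y1 y2 u1 w w1 H; set mu1 := 'i * N%:C; pose g x := w x + - mu1 * y x.
have Na : N * a = Q0 ^+ 2 / (4 * eps ^+ 2) + Q2 + 1 by rewrite /N divfK// gt_eqF.
have N0 : 0 <= N by rewrite /N; pos.
have H' : OSw alpha eps y y1 y2 u1 w w1 by [].
pose u x := y2 x - (alpha ^+ 2)%:C * y x.
have [t1 _] := energy_terms (ltW Q00) (ltW Q20) hQ0 hQ2 H.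
have t2 : normc (cintegral J (fun x => (qC x%:C * u x - q2C x%:C * y x) * (y x)^*)) <=
  Q0 * (Num.sqrt (sqN u) * W1_norm y) + Q2 * W1_norm y ^+ 2 := (energy_terms (ltW Q00) (ltW Q20) hQ0 hQ2 H).2.
have E : - cintegral J (fun x => w1 x * (y1 x)^*) - (alpha ^+ 2)%:C * cintegral J (fun x => w x * (y x)^*) =
  'i * (eps ^+ 2 * sqN u)%:C + cintegral J (fun x => (qC x%:C * u x - q2C x%:C * y x) * (y x)^*) := energy H.
have [[hy hy1 hu hw] _ _] := H.
have hg : has_deriv g (fun x => w1 x + - mu1 * y1 x) by exact: hdD hw (hdZ _ hy).
have Ly := hd_L2 hy; have Lg := hd_L2 hg.
pose Ig := cintegral J (fun x => (w1 x + - mu1 * y1 x) * (y1 x)^*) + A%:C * cintegral J (fun x => g x * (y x)^*).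
have sE a' : L2 a' -> cintegral J (fun x => a' x * (a' x)^*) = (sqN a')%:C.
  move=> la; apply: complexP; rewrite /= ?sqNE//; transitivity (\int[mu]_(x in J) (0 : R)); last by rewrite Rintegral_cst// mul0r.
  by apply: eq_Rintegral => x _; case: (a' x) => a1 b1 /=; ring.
have IgE : cintegral J (fun x => w1 x * (y1 x)^*) + A%:C * cintegral J (fun x => w x * (y x)^*) =
   Ig + mu1 * (sqN y1 + A * sqN y)%:C.
  have -> : (sqN y1 + A * sqN y)%:C = cintegral J (fun x => y1 x * (y1 x)^*) + A%:C * cintegral J (fun x => y x * (y x)^*).
    by rewrite !sE//; [apply: complexP; rewrite !ReImE /=; ring|case: hy].
  have key b c d : L2 b -> L2 c -> cintegral J (fun x => b x * (c x)^*) =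
     cintegral J (fun x => (b x + - d * c x) * (c x)^*) + d * cintegral J (fun x => c x * (c x)^*).
    move=> lb lc; have lbc := L2D lb (L2Z (- d) lc).
    have i1 := L2_prod_int lbc (L2_conj lc); have i2 := L2_prod_int lc (L2_conj lc).
    by rewrite -cintegralZ// -cintegralD//; [apply: eq_cintegral => x _; ring|exact: CintZ].
  by rewrite (key w1 y1 mu1 hw.1 hy.1) (key w y mu1 (hd_L2 hw) Ly) /Ig; ring.
have nIg : normc Ig <= (1 + A) * (W1_norm g * W1_norm y).
  have [y0' y1'] := sqrt_sqN_W1 hy; have [w0' w1'] := sqrt_sqN_W1 hg.
  apply: (le_trans (le_normcD _ _)); rewrite mulrDl mul1r; apply: lerD.
    by apply: (le_trans (CS_sqrt hg.1 hy.1)); apply: ler_pM; rewrite ?sqrtr_ge0.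
  rewrite normcM normcr gtr0_norm// ler_pM2l//.
  by apply: (le_trans (CS_sqrt Lg Ly)); apply: ler_pM; rewrite ?sqrtr_ge0.
have ImE : N * (sqN y1 + A * sqN y) + eps ^+ 2 * sqN u = - Im Ig - Im (cintegral J (fun x => (qC x%:C * u x - q2C x%:C * y x) * (y x)^*)).
  move/(congr1 (@Im R)): E; rewrite -/A -opprD IgE.
  move: (Ig) (cintegral _ _) (sqN y1 + A * sqN y) (eps ^+ 2 * sqN u) => I1 I2 s1 s2.
  rewrite /mu1 !ReImE /=; flra.
have nn : a * W1_norm y ^+ 2 <= sqN y1 + A * sqN y.
  rewrite (W1_norm2 hy) mulrDr; apply: lerD.
    by rewrite ler_piMl ?sqN_ge0// ge_min lexx.
  by rewrite ler_wpM2r ?sqN_ge0// ge_min lexx orbT.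
have Im1 := normc_Im Ig; have Im2 := normc_Im (cintegral J (fun x => (qC x%:C * u x - q2C x%:C * y x) * (y x)^*)).
rewrite -/A in t2.
have U0 := sqrtr_ge0 (sqN u); have UE : sqN u = Num.sqrt (sqN u) ^+ 2 by rewrite sqr_sqrtr ?sqN_ge0.
have am : Q0 * (Num.sqrt (sqN u) * W1_norm y) <= eps ^+ 2 * sqN u + Q0 ^+ 2 / (4 * eps ^+ 2) * W1_norm y ^+ 2.
  rewrite UE sqrtr_sqr ger0_norm//; move: (Num.sqrt _) (W1_norm y) => U n.
  have := sqr_ge0 (eps * U - Q0 * n / (2 * eps)).
  have -> : (eps * U - Q0 * n / (2 * eps)) ^+ 2 = eps ^+ 2 * U ^+ 2 + Q0 ^+ 2 / (4 * eps ^+ 2) * n ^+ 2 - Q0 * (U * n).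
    by field; rewrite gt_eqF.
  by rewrite subr_ge0.
have fin : W1_norm y ^+ 2 <= (1 + A) * (W1_norm g * W1_norm y).
  have k1 : N * (a * W1_norm y ^+ 2) <= N * (sqN y1 + A * sqN y) by rewrite ler_wpM2l.
  rewrite mulrA Na in k1.
  have l1 := ler_norm (- Im Ig); rewrite normrN in l1.
  set Q := cintegral _ _ in ImE Im2 t2; have l2 := ler_norm (- Im Q); rewrite normrN in l2.
  have e1 : (Q0 ^+ 2 / (4 * eps ^+ 2) + Q2 + 1) * W1_norm y ^+ 2 = Q0 ^+ 2 / (4 * eps ^+ 2) * W1_norm y ^+ 2 + Q2 * W1_norm y ^+ 2 + W1_norm y ^+ 2 by ring.
  rewrite e1 in k1.
  move: (le_trans l1 (le_trans Im1 nIg)) (le_trans l2 (le_trans Im2 t2)) k1 ImE am => p1 p2 k1 ImE am.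
  move: (Q0 ^+ 2 / _ * _) (N * _) (eps ^+ 2 * _) (Q0 * (_ * _)) (Q2 * _) p1 p2 k1 ImE am => c1 c2 c3 c4 c5 p1 p2 k1 ImE am.
  clear - AM p1 p2 k1 ImE am.
  by lra.
have [n0|n0] := eqVneq (W1_norm y) 0; first by rewrite n0 mulr_ge0 ?W1_norm_ge0//; pos.
have np : 0 < W1_norm y by rewrite lt_def n0 W1_norm_ge0.
by move: fin; rewrite expr2 mulrA ler_pM2r.
Qed.

(** [y] and [y1] vanish at -1, so that their values are integrals of their derivatives; the second
    derivative is controlled by [OSw_helmholtz_bound]. Since [OSw] is linear, the bounds hold for
    all finite combinations of eigenfunctions. *)
Lemma OSw_point (alpha : R) : exists2 C : R, 0 < C & forall eps y y1 y2 u1 w w1, 0 < eps -> eps < 1 ->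
  OSw alpha eps y y1 y2 u1 w w1 -> forall x, J x ->
  eps ^+ 4 * (normc (y x) ^+ 2) <= C * (W1_norm y ^+ 2 + W1_norm w ^+ 2) /\
  eps ^+ 4 * (normc (y1 x) ^+ 2) <= C * (W1_norm y ^+ 2 + W1_norm w ^+ 2).
Proof.
have [C C0 hC] := OSw_helmholtz_bound alpha; pose A := alpha ^+ 2; have A0 : 0 <= A by exact: sqr_ge0.
exists (2 + 4 * C + 4 * A ^+ 2); first by pos.
move=> eps y y1 y2 u1 w w1 e0 e1 H x Jx.
have [[hy hy1 hu hw] [ym _ y1m _] _] := H.
have hb f f1 : has_deriv f f1 -> f (-1) = 0 -> normc (f x) ^+ 2 <= 2 * sqN f1.
  move=> hf fm; have lf := hf.1; apply: (le_trans _ (L1_le_L2 lf)).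
  rewrite lerXn2r ?nnegrE ?normc_ge0//; first by apply: Rintegral_ge0 => t _; exact: normc_ge0.
  have := (JP x).1 Jx => /andP[x1 x2].
  have -> : f x = f x - f (-1) by rewrite fm subr0.
  rewrite (hd_incr hf)//.
  apply: (@le_trans _ _ (\int[mu]_(t in `[-1, x]) normc (f1 t))).
    apply: normc_cintegral => //; first by apply: Cint_subJ => //; exact: L2_int.
    by apply: rint_sub (normc_int lf); [exact: measJ|exact: measI|exact: subJ].
  rewrite (@Rint_split _ _ (-1) x 1)//; last exact: normc_int.
  by rewrite lerDl; apply: Rintegral_ge0 => t _; exact: normc_ge0.
have k1 := hb _ _ hy ym; have k2 := hb _ _ hy1 y1m.
pose u x := y2 x - (alpha ^+ 2)%:C * y x.
have k3 : eps ^+ 4 * sqN u <= C * (W1_norm y ^+ 2 + W1_norm w ^+ 2) := hC _ _ _ _ _ _ _ e0 e1 H.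
have Lu : L2 u := hd_L2 hu; have Ly := hd_L2 hy.
have k4 : sqN y2 <= 2 * (sqN u + A ^+ 2 * sqN y).
  have -> : sqN y2 = sqN (fun x => u x + A%:C * y x).
    by apply: eq_Rintegral => t _; congr (normc _ ^+ 2); rewrite /u /A; ring.
  rewrite sqN_expand// normcr ger0_norm//; have := CS_sqrt Lu Ly; set I1 := cintegral _ _ => h1.
  have h2 : Re (A%:C^* * I1) <= A * (Num.sqrt (sqN u) * Num.sqrt (sqN y)).
    apply: (le_trans (Re_mul_le _ _)); rewrite normc_conj normcr ger0_norm// ler_wpM2l//.
  have := sqr_ge0 (Num.sqrt (sqN u) - A * Num.sqrt (sqN y)); rewrite sqrrB exprMn !sqr_sqrtr ?sqN_ge0//.
  move: (sqN u) (sqN y) (Num.sqrt _) (Num.sqrt _) h2 => a b c d h2.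
  have -> : d * (A * c) *+ 2 = 2 * (A * (d * c)) by rewrite mulr2n; ring.
  by flra.
have ny := W1_norm2 hy; have s1 := sqN_ge0 y1; have s2 := sqN_ge0 y.
have e4 : 0 <= eps ^+ 4 by pos.
have e41 : eps ^+ 4 <= 1 by rewrite expr_le1// ltW.
have W0 := sqr_ge0 (W1_norm w); have n0 := sqr_ge0 (W1_norm y).
pose T := W1_norm y ^+ 2 + W1_norm w ^+ 2; have T0 : 0 <= T by exact: addr_ge0.
have TE : (2 + 4 * C + 4 * A ^+ 2) * T = 2 * T + 4 * (C * T) + 4 * (A ^+ 2 * T) by ring.
have CT : 0 <= C * T by pos.
have AT : 0 <= A ^+ 2 * T by pos.
rewrite -/T in k3 *; rewrite TE.
split.
  apply: (@le_trans _ _ (1 * (2 * sqN y1))); last by rewrite /T in T0 CT AT *; flra.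
  by apply: ler_pM; rewrite ?sqr_ge0.
apply: (@le_trans _ _ (eps ^+ 4 * (2 * (2 * (sqN u + A ^+ 2 * sqN y))))).
  by rewrite ler_wpM2l//; flra.
have h5 : eps ^+ 4 * (A ^+ 2 * sqN y) <= 1 * (A ^+ 2 * T).
  apply: ler_pM => //; first by rewrite mulr_ge0// sqr_ge0.
  by rewrite ler_wpM2l ?sqr_ge0// /T; flra.
have -> : eps ^+ 4 * (2 * (2 * (sqN u + A ^+ 2 * sqN y))) = 4 * (eps ^+ 4 * sqN u) + 4 * (eps ^+ 4 * (A ^+ 2 * sqN y)) by ring.
flra.
Qed.

End Energy.

(** * Frame bounds from the norms of the Gram operator and of its inverse *)

Section Gram.
Variable R : realType.
Implicit Types (c d : nat -> R[i]) (n N : nat).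

Definition nsq n c : R := \sum_(k < n) sqmod (c k).

Lemma sqmod_ge0 (z : R[i]) : 0 <= sqmod z. Proof. by rewrite sqmod_normc sqr_ge0. Qed.

Lemma nsq_ge0 n c : 0 <= nsq n c. Proof. by apply: sumr_ge0 => k _; exact: sqmod_ge0. Qed.

Lemma real_CS n (x y : nat -> R) :
  (\sum_(k < n) x k * y k) ^+ 2 <= (\sum_(k < n) x k ^+ 2) * (\sum_(k < n) y k ^+ 2).
Proof.
set P := \sum_(k < n) x k * y k.
apply: discr_le; rewrite ?sqr_ge0//; try by apply: sumr_ge0 => k _; exact: sqr_ge0.
move=> s; have : 0 <= \sum_(k < n) (x k - s * P * y k) ^+ 2 by apply: sumr_ge0 => k _; exact: sqr_ge0.
move=> /le_trans; apply; rewrite le_eqVlt; apply/orP; left; apply/eqP.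
have -> : s ^+ 2 * P ^+ 2 * (\sum_(k < n) y k ^+ 2) = \sum_(k < n) (s * P) ^+ 2 * y k ^+ 2 by rewrite mulr_sumr exprMn.
have -> : 2 * s * P ^+ 2 = \sum_(k < n) (2 * (s * P)) * (x k * y k) by rewrite -mulr_sumr -/P; ring.
rewrite -sumrB -big_split /=; apply: eq_bigr => k _; ring.
Qed.

Lemma cplx_CS n c d : normc (\sum_(k < n) c k * d k) ^+ 2 <= nsq n c * nsq n d.
Proof.
have h : normc (\sum_(k < n) c k * d k) <= \sum_(k < n) normc (c k) * normc (d k).
  by apply: (le_trans (@normc_sum R n (fun k => c k * d k))); apply: ler_sum => k _; rewrite normcM.
apply: (@le_trans _ _ ((\sum_(k < n) normc (c k) * normc (d k)) ^+ 2)).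
  by rewrite lerXn2r ?nnegrE ?normc_ge0//; exact: le_trans (normc_ge0 _) h.
apply: (le_trans (real_CS n (fun k => normc (c k)) (fun k => normc (d k)))).
by rewrite /nsq; under eq_bigr do rewrite -sqmod_normc; under [X in _ * X]eq_bigr do rewrite -sqmod_normc.
Qed.

Lemma l2_le d (S : R) : (forall N, nsq N d <= S) -> l2 d /\ l2_norm d ^+ 2 <= S.
Proof.
move=> h.
have le : (l2_sqnorm d <= S%:E)%E.
  apply: lime_le; first by apply: is_cvg_nneseries => k _ _; rewrite lee_fin sqmod_ge0.
  by apply: nearW => N; rewrite sumEFin lee_fin big_mkord; exact: h.
have l : l2 d by apply: le_lt_trans le _; exact: ltry.
split => //; rewrite /l2_norm.
have ge0 : (0 <= l2_sqnorm d)%E by apply: nneseries_ge0 => k _ _; rewrite lee_fin sqmod_ge0.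
rewrite sqr_sqrtr ?fine_ge0// -lee_fin fineK//.
by rewrite ge0_fin_numE.
Qed.

Lemma l2_ge d N : l2 d -> nsq N d <= l2_norm d ^+ 2.
Proof.
move=> l; have ge0 : (0 <= l2_sqnorm d)%E by apply: nneseries_ge0 => k _ _; rewrite lee_fin sqmod_ge0.
rewrite /l2_norm sqr_sqrtr ?fine_ge0// -lee_fin fineK ?ge0_fin_numE//.
have := @nneseries_lim_ge R (fun k => (sqmod (d k))%:E) xpredT 0%N N.
by rewrite sumEFin big_mkord; apply => k _; rewrite lee_fin sqmod_ge0.
Qed.

Lemma l2_norm_ge0 d : 0 <= l2_norm d. Proof. exact: sqrtr_ge0. Qed.

Variable Y : nat -> R -> R[i].
Hypothesis YW : forall k, W1 (Y k).

Lemma lin_comb_recr n c : lin_comb Y n.+1 c = (fun x => lin_comb Y n c x + c n * Y n x).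
Proof. by apply/funext => x; rewrite /lin_comb big_ord_recr. Qed.

Lemma lin_comb0 c : lin_comb Y 0 c = (fun=> 0).
Proof. by apply/funext => x; rewrite /lin_comb big_ord0. Qed.

Lemma lin_comb_W1 n c : W1 (lin_comb Y n c).
Proof.
elim: n => [|n IH]; first by rewrite lin_comb0; exact: W1_0.
by rewrite lin_comb_recr; apply: W1D => //; exact: W1Z.
Qed.

Lemma lin_comb_inner n c h : W1 h -> W1_inner (lin_comb Y n c) h = \sum_(k < n) c k * W1_inner (Y k) h.
Proof.
move=> wh; elim: n => [|n IH]; last by rewrite lin_comb_recr W1_inner_addl// ?IH ?big_ord_recr//; exact: lin_comb_W1.
rewrite lin_comb0 big_ord0; have := @W1_inner_addl R (fun=> 0) (fun=> 0) h 1 (@W1_0 R) (@W1_0 R) wh.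
have E0 : (fun x : R => (0 : R[i]) + 1 * 0) = (fun=> 0) by apply/funext => x; rewrite mulr0 addr0.
rewrite E0 [1 * _]mul1r.
by move/eqP; rewrite -subr_eq subrr eq_sym => /eqP.
Qed.

Lemma inner_lin_comb n c h : W1 h -> W1_inner h (lin_comb Y n c) = \sum_(k < n) (c k)^* * W1_inner h (Y k).
Proof.
move=> wh; rewrite (W1_inner_conj (lin_comb_W1 n c) wh) lin_comb_inner// rmorph_sum /=.
by apply: eq_bigr => k _; rewrite (W1_inner_conj (YW k) wh); apply: complexP; rewrite !ReImE; ring.
Qed.

(** The dual of the upper frame bound: [v] is tested against the combination whose coefficients are
    the conjugates of the inner products. *)
Lemma bessel (M0 : R) v N : 0 <= M0 -> W1 v -> (forall n c, W1_norm (lin_comb Y n c) ^+ 2 <= M0 * nsq n c) ->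
  nsq N (fun k => W1_inner (Y k) v) <= M0 * W1_norm v ^+ 2.
Proof.
move=> M00 wv hM; set d := fun k => _; have [D0|D0] := eqVneq (nsq N d) 0; first by rewrite D0 mulr_ge0// sqr_ge0.
have Dp : 0 < nsq N d by rewrite lt_def D0 nsq_ge0.
have E : W1_inner (lin_comb Y N (fun k => (d k)^*)) v = (nsq N d)%:C.
  rewrite lin_comb_inner// /nsq rmorph_sum /=; apply: eq_bigr => k _.
  by rewrite mulrC -/(d k) mulc_conj sqmod_normc.
have nE : nsq N (fun k => (d k)^*) = nsq N d by apply: eq_bigr => k _; rewrite !sqmod_normc normc_conj.
have := W1_CS (lin_comb_W1 N (fun k => (d k)^*)) wv.
rewrite E normcr gtr0_norm// => h.
have {}h : nsq N d ^+ 2 <= M0 * nsq N d * W1_norm v ^+ 2.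
  rewrite -{2}nE; apply: (@le_trans _ _ ((W1_norm (lin_comb Y N (fun k => (d k)^*)) * W1_norm v) ^+ 2)).
    by rewrite lerXn2r ?nnegrE// ?mulr_ge0 ?W1_norm_ge0// ltW.
  by rewrite exprMn ler_wpM2r ?sqr_ge0.
by move: h; rewrite expr2 mulrAC ler_pM2r.
Qed.

Definition fin n c k : R[i] := if (k < n)%N then c k else 0.

Lemma nsq_fin n c : nsq n (fin n c) = nsq n c.
Proof. by apply: eq_bigr => k _; rewrite /fin ltn_ord. Qed.

Lemma sqmod0 : sqmod (0 : R[i]) = 0. Proof. by rewrite sqmod_normc normc0 expr0n. Qed.

Lemma nsq_fin_le n c N : nsq N (fin n c) <= nsq n c.
Proof.
rewrite /nsq -!(big_mkord xpredT (fun k => sqmod (_ k))).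
have [nN|nN] := leqP N n.
  rewrite (big_cat_nat (leq0n N) nN) /=.
  have -> : \sum_(0 <= k < N) sqmod (fin n c k) = \sum_(0 <= k < N) sqmod (c k).
    by apply: eq_big_nat => k /andP[_ kN]; rewrite /fin (leq_trans kN nN).
  by rewrite lerDl; apply: sumr_ge0 => k _; exact: sqmod_ge0.
rewrite (big_cat_nat (leq0n n) (ltnW nN)) /=.
have -> : \sum_(n <= k < N) sqmod (fin n c k) = 0.
  by rewrite big_nat big1// => k /andP[nk _]; rewrite /fin ltnNge nk sqmod0.
by rewrite addr0 le_eqVlt; apply/orP; left; apply/eqP; apply: eq_big_nat => k /andP[_ kn]; rewrite /fin kn.
Qed.

Variable M0 : R.
Hypothesis M00 : 0 <= M0.
Hypothesis hM : forall n c, W1_norm (lin_comb Y n c) ^+ 2 <= M0 * nsq n c.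

(** The k-th coordinate of the Gram operator applied to the first [n] entries of [c]. The inner
    product is antilinear in its second argument, hence the conjugates. *)
Definition gcoef n c k : R[i] := W1_inner (Y k) (lin_comb Y n (fun j => (c j)^*)).

Lemma gcoefE n c k : gcoef n c k = \sum_(j < n) W1_inner (Y k) (Y j) * c j.
Proof.
by rewrite /gcoef inner_lin_comb//; apply: eq_bigr => j _; rewrite mulrC; congr (_ * _); apply: complexP; rewrite !ReImE ?opprK.
Qed.

Lemma gram_fin n c (s : R) : gram_graph Y (fun k => s%:C * fin n c k) (fun k => s%:C * gcoef n c k).
Proof.
have sc (a : nat -> R[i]) N : nsq N (fun k => s%:C * a k) = s ^+ 2 * nsq N a.
  by rewrite /nsq mulr_sumr; apply: eq_bigr => k _; rewrite !sqmod_normc normcM normcr exprMn real_normK ?num_real.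
split.
- apply: (@l2_le _ (s ^+ 2 * nsq n c) _).1 => N; rewrite sc.
  by rewrite ler_wpM2l ?sqr_ge0// nsq_fin_le.
- apply: (@l2_le _ (s ^+ 2 * (M0 * W1_norm (lin_comb Y n (fun j => (c j)^*)) ^+ 2)) _).1 => N; rewrite sc.
  by rewrite ler_wpM2l ?sqr_ge0//; apply: bessel => //; exact: lin_comb_W1.
- move=> k; apply: cvg_near_cst; exists n => // N /= nN.
  rewrite /series /= (big_cat_nat (leq0n n) nN) /= [X in _ + X]big_nat [X in _ + X]big1 ?addr0; last first.
    by move=> j /andP[nj _]; rewrite /fin ltnNge nj !mulr0.
  rewrite big_mkord gcoefE mulr_sumr; apply: eq_bigr => j _; rewrite /fin ltn_ord; ring.
Qed.

Local Notation opT := (gram_graph Y).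
Local Notation opV := (fun d c : nat -> R[i]^o => gram_graph Y c d).

Lemma graph_norm_ub (T : (nat -> R[i]^o) -> (nat -> R[i]^o) -> Prop) (A : R) a b :
  graph_norm (@l2_norm R) (@l2_norm R) T = A%:E -> T a b -> l2_norm a <= 1 -> l2_norm b <= A.
Proof.
by move=> TA Tab a1; rewrite -lee_fin -TA; apply: ereal_sup_ubound; exists a, b.
Qed.

Lemma nsqZ (a : nat -> R[i]) N (s : R) : nsq N (fun k => s%:C * a k) = s ^+ 2 * nsq N a.
Proof.
by rewrite /nsq mulr_sumr; apply: eq_bigr => k _; rewrite !sqmod_normc normcM normcr exprMn real_normK ?num_real.
Qed.

Lemma nsq0_eq n (c : nat -> R[i]) : nsq n c = 0 -> forall k, (k < n)%N -> c k = 0.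
Proof.
move=> /eqP; rewrite psumr_eq0; last by move=> k _; exact: sqmod_ge0.
move=> /allP h k kn; have := h (Ordinal kn) (mem_index_enum _); rewrite /= sqmod_normc expf_eq0 /= => /eqP.
by move/eqP; rewrite normc_eq0 => /eqP.
Qed.

(** [graph_norm] sees only vectors of norm at most 1, hence the rescaling by [s]; the zero vector is
    treated apart. *)
Lemma gcoef_le (A : R) n c : graph_norm (@l2_norm R) (@l2_norm R) opT = A%:E ->
  forall N, nsq N (gcoef n c) <= A ^+ 2 * nsq n c.
Proof.
move=> TA N; have [S0|S0] := eqVneq (nsq n c) 0.
  rewrite S0 mulr0 /nsq big1// => k _; rewrite gcoefE big1 ?sqmod0// => j _.
  by rewrite (nsq0_eq S0)// mulr0.
have Sp : 0 < nsq n c by rewrite lt_def S0 nsq_ge0.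
pose s := (Num.sqrt (nsq n c))^-1; have s2 : s ^+ 2 * nsq n c = 1 by rewrite exprVn sqr_sqrtr ?mulVf ?ltW.
have H := gram_fin n c s.
have [lc ld _] := H.
have c1 : l2_norm (fun k => s%:C * fin n c k) <= 1.
  rewrite -(@ler_pXn2r _ 2)// ?nnegrE ?l2_norm_ge0// expr1n.
  by apply: (@l2_le _ 1 _).2 => N'; rewrite nsqZ -s2 ler_wpM2l ?sqr_ge0// nsq_fin_le.
have d1 := graph_norm_ub TA H c1.
have := l2_ge N ld; rewrite nsqZ => h.
have : s ^+ 2 * nsq N (gcoef n c) <= A ^+ 2.
  by apply: (le_trans h); rewrite lerXn2r ?nnegrE ?l2_norm_ge0// (le_trans _ d1)// l2_norm_ge0.
rewrite -(ler_pM2r Sp) => h2.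
by have -> : nsq N (gcoef n c) = s ^+ 2 * nsq N (gcoef n c) * nsq n c by rewrite mulrAC s2 mul1r.
Qed.

Lemma norm_gcoef n c : (W1_norm (lin_comb Y n (fun j => (c j)^*)) ^+ 2)%:C = \sum_(k < n) (c k)^* * gcoef n c k.
Proof.
have W := lin_comb_W1 n (fun j => (c j)^*).
by rewrite -(W1_inner_self W) lin_comb_inner.
Qed.

Lemma nsq_conj n (c : nat -> R[i]) : nsq n (fun k => (c k)^*) = nsq n c.
Proof. by apply: eq_bigr => k _; rewrite !sqmod_normc normc_conj. Qed.

Lemma lin_comb_conj n c : lin_comb Y n c = lin_comb Y n (fun j => ((c j)^*)^*).
Proof.
by apply/funext => x; apply: eq_bigr => k _; congr (_ * _); apply: complexP; rewrite !ReImE ?opprK.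
Qed.

Lemma frame_up (A : R) n c : 0 <= A -> graph_norm (@l2_norm R) (@l2_norm R) opT = A%:E ->
  W1_norm (lin_comb Y n c) ^+ 2 <= A * nsq n c.
Proof.
move=> A0 TA; suff key b : W1_norm (lin_comb Y n (fun j => (b j)^*)) ^+ 2 <= A * nsq n b.
  by have := key (fun j => (c j)^*); rewrite nsq_conj -lin_comb_conj.
rewrite -(@ler_pXn2r _ 2)// ?nnegrE ?mulr_ge0 ?nsq_ge0 ?sqr_ge0 ?W1_norm_ge0//.
have := cplx_CS n (fun k => (b k)^*) (gcoef n b); rewrite -norm_gcoef normcr ger0_norm ?sqr_ge0// nsq_conj => h.
apply: (le_trans h); have h2 := gcoef_le n b TA n.
have -> : (A * nsq n b) ^+ 2 = nsq n b * (A ^+ 2 * nsq n b) by ring.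
by rewrite ler_wpM2l ?nsq_ge0.
Qed.

(** The coefficients are recovered by the inverse operator, of norm [B], from their Gram image,
    whose squared norm is at most [A] times that of the combination by [bessel]; this explains the
    factor [B ^+ 2 * A]. The qualitative bound [m] settles the case of a vanishing combination. *)
Lemma frame_low (A B m : R) n c : 0 <= A -> 0 <= B -> 0 < m ->
  (forall n c, m * nsq n c <= W1_norm (lin_comb Y n c) ^+ 2) ->
  graph_norm (@l2_norm R) (@l2_norm R) opT = A%:E -> graph_norm (@l2_norm R) (@l2_norm R) opV = B%:E ->
  nsq n c <= B ^+ 2 * A * W1_norm (lin_comb Y n c) ^+ 2.
Proof.
move=> A0 B0 m0 hm TA TB.
suff key b : nsq n b <= B ^+ 2 * A * W1_norm (lin_comb Y n (fun j => (b j)^*)) ^+ 2.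
  by have := key (fun j => (c j)^*); rewrite nsq_conj -lin_comb_conj.
pose v := lin_comb Y n (fun j => (b j)^*); pose V := W1_norm v ^+ 2.
have V0 : 0 <= V by exact: sqr_ge0.
have dV N : nsq N (gcoef n b) <= A * V.
  apply: bessel => //; [exact: lin_comb_W1|move=> n' c'; exact: frame_up].
have [S0|S0] := eqVneq (A * V) 0.
  have d0 k : (k < n)%N -> gcoef n b k = 0.
    by apply: nsq0_eq; apply/eqP; rewrite eq_le nsq_ge0 andbT -S0.
  have v0 : V = 0.
    have := norm_gcoef n b; rewrite big1 => [|k _]; last by rewrite d0 ?mulr0.
    by move=> /(congr1 (@Re R)).
  have := hm n (fun j => (b j)^*); rewrite -/v -/V v0 nsq_conj => h.
  by rewrite -/v -/V ?v0 mulr0 -(ler_pM2l m0) mulr0.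
have Sp : 0 < A * V by rewrite lt_def S0 mulr_ge0.
pose s := (Num.sqrt (A * V))^-1; have s2 : s ^+ 2 * (A * V) = 1 by rewrite exprVn sqr_sqrtr ?mulVf ?ltW.
have H := gram_fin n b s.
have [lc ld _] := H.
have d1 : l2_norm (fun k => s%:C * gcoef n b k) <= 1.
  rewrite -(@ler_pXn2r _ 2)// ?nnegrE ?l2_norm_ge0// expr1n.
  by apply: (@l2_le _ 1 _).2 => N'; rewrite nsqZ -s2 ler_wpM2l ?sqr_ge0.
have c1 := graph_norm_ub TB H d1.
have := l2_ge n lc; rewrite nsqZ nsq_fin => h.
have : s ^+ 2 * nsq n b <= B ^+ 2.
  by apply: (le_trans h); rewrite lerXn2r ?nnegrE ?l2_norm_ge0// (le_trans _ c1)// l2_norm_ge0.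
rewrite -(ler_pM2r Sp) => h2; rewrite -/v -/V -mulrA.
by have -> : nsq n b = s ^+ 2 * nsq n b * (A * V) by rewrite mulrAC s2 mul1r.
Qed.

End Gram.

(** * Eigenvalues close to quasimodes, and their number *)

Section Eigenfunctions.
Variables (R : realType) (q : R -> R) (G : set R[i]^o) (qC : R[i]^o -> R[i]^o).
Hypothesis AM : AM_continuation q G qC.
Local Notation mu := (@lebesgue_measure R).
Local Notation J := ([set` `[(-1 : R), 1]]).
Local Notation OSw := (OSw qC).

Lemma OS_graph_eq (alpha eps : R) (y w w' : R -> R[i]^o) : OS_graph q alpha eps y w -> eq_itv w w' -> OS_graph q alpha eps y w'.
Proof.
move=> [y1 [y2 [h1 [h2 [[[w1 hw] wm wp] H]]]]] ww.
have hw' : has_deriv w' w1 by apply: hd_eq hw.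
exists y1, y2; split => //; split => //; split.
  by split; [exists w1|rewrite -ww ?J_m1|rewrite -ww ?J_1].
move=> phi hphi; rewrite -H//; have [[p1 hp] _ _] := hphi.
rewrite (helmholtzE _ hw hp) (helmholtzE _ hw' hp); congr (_ - _ * _).
by apply: eq_cintegral => x /set_mem/JP/ww ->.
Qed.

Variables (alpha eps : R).
Variables (Y : nat -> R -> R[i]^o).

Lemma eigen_data : normed_eigenfunctions q alpha eps Y -> exists (lam : nat -> R[i]) (Y1 Y2 U1 V1 : nat -> R -> R[i]),
  forall k, OSw alpha eps (Y k) (Y1 k) (Y2 k) (U1 k) (fun x => lam k * Y k x) (V1 k).
Proof.
move=> nY.
have /choice[F hF] : forall k, exists p : R[i] * (R -> R[i]) * (R -> R[i]) * (R -> R[i]) * (R -> R[i]),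
    OSw alpha eps (Y k) p.1.1.1.2 p.1.1.2 p.1.2 (fun x => p.1.1.1.1 * Y k x) p.2.
  move=> k; have [[lam [[w hw ww] _]] _] := nY k.
  have E : eq_itv w (fun x => lam * Y k x).
    by move=> x /ww /eqP; rewrite eq_sym subr_eq0 => /eqP.
  have [y1 [y2 [u1 [v1 h]]]] := OS_graphW AM (OS_graph_eq hw E).
  by exists (lam, y1, y2, u1, v1).
by exists (fun k => (F k).1.1.1.1), (fun k => (F k).1.1.1.2), (fun k => (F k).1.1.2), (fun k => (F k).1.2), (fun k => (F k).2).
Qed.

Variables (lam : nat -> R[i]) (Y1 Y2 U1 V1 : nat -> R -> R[i]).
Hypothesis hY : forall k, OSw alpha eps (Y k) (Y1 k) (Y2 k) (U1 k) (fun x => lam k * Y k x) (V1 k).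
Hypothesis Y_1 : forall k, W1_norm (Y k) = 1.

Lemma YW k : W1 (Y k).
Proof. by have [[h _ _ _] _ _] := hY k; exists (Y1 k). Qed.

Lemma lin_comb_lam n b : lin_comb (fun k x => lam k * Y k x) n b = lin_comb Y n (fun k => b k * lam k).
Proof. by apply/funext => x; apply: eq_bigr => k _; rewrite mulrA. Qed.

Lemma OSw_sum n b : OSw alpha eps (lin_comb Y n b) (lin_comb Y1 n b) (lin_comb Y2 n b) (lin_comb U1 n b)
  (lin_comb Y n (fun k => b k * lam k)) (lin_comb V1 n b).
Proof.
rewrite -lin_comb_lam; elim: n => [|n IH]; first by rewrite !lin_comb0; exact: OSw_0.
by rewrite !lin_comb_recr; apply: (OSw_lin AM).
Qed.

Variables (A D : R).
Hypotheses (A0 : 0 < A) (D0 : 0 < D).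
Hypothesis hup : forall n c, W1_norm (lin_comb Y n c) ^+ 2 <= A * nsq n c.
Hypothesis hlow : forall n c, nsq n c <= D * W1_norm (lin_comb Y n c) ^+ 2.

Lemma nsqM_le n (b l : nat -> R[i]) (L : R) : 0 <= L -> (forall k, (k < n)%N -> b k != 0 -> normc (l k) <= L) ->
  nsq n (fun k => b k * l k) <= L ^+ 2 * nsq n b.
Proof.
move=> L0 h; rewrite /nsq mulr_sumr; apply: ler_sum => k _; rewrite !sqmod_normc normcM exprMn mulrC.
have [->|b0] := eqVneq (b k) 0; first by rewrite normc0 expr0n /= !mulr0.
by rewrite ler_wpM2r ?sqr_ge0// lerXn2r ?nnegrE ?normc_ge0// h.
Qed.

Lemma nsqM_ge n (b l : nat -> R[i]) (L : R) : 0 <= L -> (forall k, L <= normc (l k)) ->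
  L ^+ 2 * nsq n b <= nsq n (fun k => b k * l k).
Proof.
move=> L0 h; rewrite /nsq mulr_sumr; apply: ler_sum => k _; rewrite !sqmod_normc normcM exprMn [leRHS]mulrC.
by rewrite ler_wpM2r ?sqr_ge0// lerXn2r ?nnegrE ?normc_ge0// h.
Qed.

(** Density is applied to [g], that is to (S - m) y with [m = 'i * N], and the far resolvent turns
    it into an approximation of [y] by a combination [z] for which (S - lam0) z is close to [f]. If
    all eigenvalues were at distance [delta] from [lam0], the frame bounds would give
    [delta ^+ 2 * nsq n b <= 4 * D] together with [X ^+ 2 / 4 <= A * nsq n b]. *)
Lemma near_eigenvalue (lam0 : R[i]) (y f : R -> R[i]^o) (X delta : R) : alpha != 0 -> 0 < eps ->
  (forall f, H10 f -> forall e : R, 0 < e -> exists n c, W1_norm (fun x => f x - lin_comb Y n c x) < e) ->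
  OS_shift q alpha eps lam0 y f -> W1_norm f <= 1 -> 0 < X -> X <= W1_norm y -> 0 < delta ->
  16 * (A * D) < delta ^+ 2 * X ^+ 2 -> exists k, normc (lam k - lam0) < delta.
Proof.
move=> a0 e0 dense [w hw fE] f1 X0 yX d0 hX; apply: contrapT => nk.
have {nk}hd k : delta <= normc (lam k - lam0) by rewrite leNgt; apply/negP => h; apply: nk; exists k.
have [y1 [y2 [u1 [w1 H]]]] := OS_graphW AM hw.
have [C2 C20 /(_ eps e0)[N N0 hE2]] := OSw_far_resolvent AM a0.
set m := 'i * N%:C in hE2; pose g (x : R) := w x + - m * y x.
have [[hy _ _ hww] [ym yp _ _] _] := H.
have Wy : W1 y by exists y1.
have Ww : W1 w by exists w1.
have [y1' [y2' [_ [_ [[_ wm wp] _]]]]] := hw.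
have Hg : H10 g.
  by split; [apply: W1D => //; exact: W1Z|rewrite /g ym wm mulr0 addr0|rewrite /g yp wp mulr0 addr0].
pose K := 1 + (N + normc lam0) * C2; have K0 : 0 < K by have := normc_ge0 lam0 => ?; rewrite /K; pos.
(* The accuracy of the expansion: [K * e <= 1] will keep [W1_norm h] below 2, and [C2 * e <= X / 2]
   will keep [W1_norm z] above [X / 2]. *)
pose e := Num.min K^-1 (X / (2 * C2)); have ep : 0 < e by rewrite lt_min; apply/andP; split; pos.
have eK : K * e <= 1 by rewrite -(mulfV (lt0r_neq0 K0)) ler_pM2l// ge_min lexx.
have eX : C2 * e <= X / 2.
  have : e <= X / (2 * C2) by rewrite ge_min lexx orbT.
  rewrite -(ler_pM2l C20) => /le_trans; apply; rewrite le_eqVlt; apply/orP; left; apply/eqP.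
  by field; rewrite gt_eqF.
have [n [c hc]] := dense g Hg e ep.
(* For an eigenvalue equal to [m] the far resolvent bound would read [1 <= 0]. *)
have lm k : lam k - m != 0.
  apply/eqP => E; have := hE2 _ _ _ _ _ _ (hY k); rewrite Y_1.
  have -> : (fun x : R => lam k * Y k x + - m * Y k x) = (fun=> 0).
    by apply/funext => x; rewrite -mulrDl E mul0r.
  by rewrite W1_norm0 mulr0 ler10.
(* [z] is the image of the expansion of [g] under the resolvent at [m], so that [y - z] is the image
   of the expansion error. *)
pose b k := c k / (lam k - m); pose z := lin_comb Y n b.
have Wz : W1 z by exact: lin_comb_W1 YW n b.
have Wc := lin_comb_W1 YW n c.
have gE x : (w x + -1 * lin_comb Y n (fun k => b k * lam k) x) + - m * (y x + -1 * z x) = g x - lin_comb Y n c x.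
  have -> : lin_comb Y n c x = lin_comb Y n (fun k => b k * lam k) x - m * z x.
    rewrite /z /lin_comb mulr_sumr -sumrB; apply: eq_bigr => k _; rewrite /b.
    transitivity (c k * Y k x * ((lam k - m) / (lam k - m))); first by rewrite divff ?mulr1.
    by move: (lam k - m)^-1 => i; ring.
  by rewrite /g; ring.
have yz : W1_norm (fun x => y x + -1 * z x) <= C2 * e.
  have := hE2 _ _ _ _ _ _ (OSw_lin AM (-1) H (OSw_sum n b)).
  rewrite (_ : (fun x : R => _ + - m * _) = (fun x => g x - lin_comb Y n c x)); last by apply/funext => x; exact: gE.
  by move=> /le_trans; apply; rewrite ler_pM2l// ltW.
have Wyz : W1 (fun x => y x + -1 * z x) by apply: W1D => //; exact: W1Z.
pose h := lin_comb Y n (fun k => b k * (lam k - lam0)).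
have Wh : W1 h by exact: lin_comb_W1 YW n _.
have Wg : W1 g by case: Hg.
have Wgc : W1 (fun x => g x - lin_comb Y n c x).
  by apply: eq_W1 (W1D Wg (W1Z (-1) Wc)) => x _; rewrite mulN1r.
have Wf : W1 f.
  by apply: eq_W1 (W1D Ww (W1Z (- lam0) Wy)) => x xJ; rewrite fE// mulNr.
have hE x : -1 <= x <= 1 -> f x = (h x + 1 * (g x - lin_comb Y n c x)) + (m - lam0) * (y x + -1 * z x).
  move=> xJ; rewrite fE//.
  have -> : h x = lin_comb Y n (fun k => b k * lam k) x - lam0 * z x.
    by rewrite /h /z /lin_comb mulr_sumr -sumrB; apply: eq_bigr => k _; ring.
  by rewrite -gE; ring.
have nm : normc (m - lam0) <= N + normc lam0.
  by apply: (le_trans (normcB _ _)); rewrite /m normcM normc_i mul1r normcr gtr0_norm.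
have nh : W1_norm h <= 2.
  have s1 := W1_norm_sub 1 Wh Wgc; rewrite normc1 mul1r in s1.
  have Wh1 : W1 (fun x => h x + 1 * (g x - lin_comb Y n c x)) by apply: W1D => //; exact: W1Z.
  have s2 := W1_norm_sub (m - lam0) Wh1 Wyz.
  rewrite -(eq_W1_norm hE Wf) in s2.
  have s3 : normc (m - lam0) * W1_norm (fun x => y x + -1 * z x) <= (N + normc lam0) * (C2 * e).
    by apply: ler_pM; rewrite ?normc_ge0 ?W1_norm_ge0.
  have KE : K * e = e + (N + normc lam0) * (C2 * e) by rewrite /K; ring.
  apply: (le_trans s1); apply: (le_trans (lerD s2 (ltW hc))); rewrite -addrA -[2]/(1 + 1).
  by apply: (lerD f1); rewrite (le_trans _ eK)// KE addrC lerD2l.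
have nz : X / 2 <= W1_norm z.
  have s1 := W1_norm_sub (-1) Wy Wz; rewrite normcN normc1 mul1r in s1.
  rewrite -(lerD2l (X / 2)) -splitr.
  exact: le_trans yX (le_trans s1 (lerD (le_trans yz eX) (lexx _))).
have k1 := hlow n (fun k => b k * (lam k - lam0)).
have k2 := nsqM_ge n b (ltW d0) hd.
have k3 := hup n b; rewrite -/z in k3; rewrite -/h in k1.
have z2 : (X / 2) ^+ 2 <= W1_norm z ^+ 2 by rewrite lerXn2r ?nnegrE ?W1_norm_ge0//; pos.
have h2 : W1_norm h ^+ 2 <= 2 ^+ 2 by rewrite lerXn2r ?nnegrE ?W1_norm_ge0.
have : delta ^+ 2 * X ^+ 2 <= 16 * (A * D); last by rewrite leNgt hX.
have j1 : delta ^+ 2 * nsq n b <= D * 2 ^+ 2.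
  by apply: (le_trans k2); apply: (le_trans k1); rewrite ler_pM2l.
have j2 : (X / 2) ^+ 2 <= A * nsq n b by exact: le_trans k3.
have j3 : delta ^+ 2 * (X / 2) ^+ 2 <= delta ^+ 2 * (A * nsq n b) by rewrite ler_wpM2l// sqr_ge0.
have j4 : A * (delta ^+ 2 * nsq n b) <= A * (D * 2 ^+ 2) by rewrite ler_pM2l.
have -> : delta ^+ 2 * X ^+ 2 = 4 * (delta ^+ 2 * (X / 2) ^+ 2) by field.
have E1' : delta ^+ 2 * (A * nsq n b) = A * (delta ^+ 2 * nsq n b) by ring.
have E2' : A * (D * 2 ^+ 2) = 4 * (A * D) by ring.
rewrite E1' in j3; rewrite E2' in j4.
have -> : 16 * (A * D) = 4 * (4 * (A * D)) by ring.
by rewrite ler_pM2l//; exact: le_trans j3 j4.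
Qed.

(** At each point [x] the evaluation bound is tested with the conjugates of the values [Y k x], [k]
    in [K], which bounds the sum of their squared moduli; likewise for the derivatives. Integrating
    over the interval of length 2 and adding both, each normed eigenfunction contributes exactly
    1. *)
Lemma eigen_count (C L : R) (K : pred nat) n : 0 < eps -> eps < 1 -> 0 < C -> 0 <= L ->
  (forall y y1 y2 u1 w w1, OSw alpha eps y y1 y2 u1 w w1 -> forall x, J x ->
    eps ^+ 4 * (normc (y x) ^+ 2) <= C * (W1_norm y ^+ 2 + W1_norm w ^+ 2) /\
    eps ^+ 4 * (normc (y1 x) ^+ 2) <= C * (W1_norm y ^+ 2 + W1_norm w ^+ 2)) ->
  (forall k, (k < n)%N -> K k -> normc (lam k) <= L) ->
  eps ^+ 4 * (\sum_(k < n) (K k)%:R) <= 4 * C * (1 + L ^+ 2) * A.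
Proof.
move=> e0 e1 C0 L0 hC hK; have e4 : 0 < eps ^+ 4 by exact: exprn_gt0.
pose B := C * (1 + L ^+ 2) * A; have B0 : 0 <= B by rewrite /B; pos.
pose cc (a : nat -> R[i]) k : R[i] := (K k)%:R * (a k)^*.
have nsqcc a : nsq n (cc a) = \sum_(k < n) (K k)%:R * normc (a k) ^+ 2.
  by apply: eq_bigr => k _; rewrite sqmod_normc /cc; case: (K k); rewrite ?mul0r ?mul1r ?normc0 ?expr0n// normc_conj.
have point (a : nat -> R[i]) :
    (forall b : nat -> R[i], eps ^+ 4 * (normc (\sum_(k < n) b k * a k) ^+ 2) <=
       C * (W1_norm (lin_comb Y n b) ^+ 2 + W1_norm (lin_comb Y n (fun k => b k * lam k)) ^+ 2)) ->
    eps ^+ 4 * (\sum_(k < n) (K k)%:R * normc (a k) ^+ 2) <= B.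
  move=> h; rewrite -nsqcc; set s := nsq n (cc a).
  have [->|s0] := eqVneq s 0; first by rewrite mulr0.
  have sp : 0 < s by rewrite lt_def s0 nsq_ge0.
  have := h (cc a).
  have -> : \sum_(k < n) cc a k * a k = s%:C.
    rewrite /s nsqcc rmorph_sum /=; apply: eq_bigr => k _; rewrite /cc.
    by case: (K k); rewrite ?mul0r ?mul1r// mulrC mulc_conj.
  rewrite normcr gtr0_norm// => h1.
  have h2 := hup n (cc a); have h3 := hup n (fun k => cc a k * lam k).
  have h4 : nsq n (fun k => cc a k * lam k) <= L ^+ 2 * s.
    apply: nsqM_le => // k kn; rewrite /cc; case: (boolP (K k)) => [Kk _|_]; first exact: hK.
    by rewrite mul0r eqxx.
  rewrite -(ler_pM2r sp).
  have -> : eps ^+ 4 * s * s = eps ^+ 4 * s ^+ 2 by ring.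
  apply: (le_trans h1); have -> : B * s = C * (A * s + A * (L ^+ 2 * s)) by rewrite /B; ring.
  rewrite ler_pM2l//; apply: lerD => //; apply: (le_trans h3); by rewrite ler_pM2l.
have p0 x : J x -> eps ^+ 4 * (\sum_(k < n) (K k)%:R * normc (Y k x) ^+ 2) <= B.
  by move=> Jx; apply: (point (fun k => Y k x)) => b; exact: (hC _ _ _ _ _ _ (OSw_sum n b) x Jx).1.
have p1 x : J x -> eps ^+ 4 * (\sum_(k < n) (K k)%:R * normc (Y1 k x) ^+ 2) <= B.
  by move=> Jx; apply: (point (fun k => Y1 k x)) => b; exact: (hC _ _ _ _ _ _ (OSw_sum n b) x Jx).2.
have intg (Z : nat -> R -> R[i]) : (forall k, L2 (Z k)) ->
    (forall x, J x -> eps ^+ 4 * (\sum_(k < n) (K k)%:R * normc (Z k x) ^+ 2) <= B) ->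
    eps ^+ 4 * (\sum_(k < n) (K k)%:R * sqN (Z k)) <= 2 * B.
  move=> LZ hZ; have iZ k : rint J (fun x => normc (Z k x) ^+ 2) by have [] := (L2P (Z k)).1 (LZ k).
  have iK k : rint J (fun x => (K k)%:R * normc (Z k x) ^+ 2) by exact: rintZ.
  have [i1 E] := @Rint_sum R n (fun k x => (K k)%:R * normc (Z k x) ^+ 2) iK.
  have -> : \sum_(k < n) (K k)%:R * sqN (Z k) = \int[mu]_(x in J) (\sum_(k < n) (K k)%:R * normc (Z k x) ^+ 2).
    by rewrite E; apply: eq_bigr => k _; rewrite -RintegralZl//; exact: iZ.
  rewrite -RintegralZl//; have -> : 2 * B = B * fine (mu J) by rewrite lebesgue_len ?le_m11//; ring.
  rewrite -Rintegral_cst//; apply: le_Rintegral => //; first exact: rintZ.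
  by apply: rint_cont; apply: continuous_subspaceT => t; exact: cst_continuous.
have L2Y k : L2 (Y k) by have [[h _ _ _] _ _] := hY k; exact: hd_L2 h.
have L2Y1 k : L2 (Y1 k) by have [[h _ _ _] _ _] := hY k; case: h.
have := lerD (intg _ L2Y p0) (intg _ L2Y1 p1).
rewrite -mulrDr -big_split /=.
have -> : \sum_(i < n) ((K i)%:R * sqN (Y i) + (K i)%:R * sqN (Y1 i)) = \sum_(k < n) (K k)%:R :> R.
  apply: eq_bigr => k _; rewrite -mulrDr; have [[h _ _ _] _ _] := hY k.
  by have := W1_norm2 h; rewrite Y_1 expr1n addrC => <-; rewrite mulr1.
by move=> /le_trans; apply; rewrite /B; flra.
Qed.

End Eigenfunctions.

(** * Exponential growth of the Riesz constant *)

Section Main.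
Variables (R : realType) (q : R -> R) (G : set R[i]^o) (qC : R[i]^o -> R[i]^o).
Hypothesis AM : AM_continuation q G qC.

Lemma count_mem_ge (s : seq nat) n : uniq s -> (forall k, k \in s -> (k < n)%N) ->
  (size s)%:R <= \sum_(k < n) (nat_of_ord k \in s)%:R :> R.
Proof.
move=> us sn; have -> : \sum_(k < n) (nat_of_ord k \in s)%:R = (size [seq k <- iota 0 n | k \in s])%:R :> R.
  rewrite -natr_sum; congr (_%:R).
  by rewrite -(big_mkord xpredT (fun k => nat_of_bool (k \in s))) size_filter /index_iota subn0 -sum1_count [RHS]big_mkcond.
rewrite ler_nat; apply: uniq_leq_size => // k ks.
by rewrite mem_filter ks mem_iota add0n sn.
Qed.

(** Tested on the first unit vector, whose image has first coordinate 1, and for the inverse on a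
    multiple of this image. It excludes a product of zero and infinity in [Riesz_constant]. *)
Lemma gram_norms (Y : nat -> R -> R[i]^o) : (forall k, W1 (Y k)) -> (forall k, W1_norm (Y k) = 1) -> Riesz_basis Y ->
  (1 <= graph_norm (@l2_norm R) (@l2_norm R) (gram_graph Y))%E /\
  (0 < graph_norm (@l2_norm R) (@l2_norm R) (fun d c => gram_graph Y c d))%E.
Proof.
move=> YW Y_1 [_ _ [m [M [m0 hM]]]].
have hup n c : W1_norm (lin_comb Y n c) ^+ 2 <= M * nsq n c by case/andP: (hM n c).
have M0 : 0 <= M.
  have := hup 1%N (fun=> 1); rewrite /nsq big_ord1 sqmod_normc normc1 expr1n mulr1.
  exact: le_trans (sqr_ge0 _).
have H s := gram_fin YW M0 hup 1%N (fun=> 1) s.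
set c := fin 1 (fun=> 1) in H; set d := gcoef Y 1 (fun=> 1) in H.
have c0 : c 0%N = 1 by [].
have d0 : d 0%N = 1.
  by rewrite /d gcoefE// big_ord1 mulr1 W1_inner_self// Y_1 expr1n.
have id (a : nat -> R[i]) : (fun k => (1 : R)%:C * a k) = a by apply/funext => k; rewrite mul1r.
have H1 := H 1; rewrite !id in H1; have [lc ld _] := H1.
have c1 : l2_norm c <= 1.
  rewrite -(@ler_pXn2r _ 2)// ?nnegrE ?l2_norm_ge0// expr1n.
  apply: (@l2_le _ c 1 _).2 => N; apply: (le_trans (nsq_fin_le _ _ _)).
  by rewrite /nsq big_ord1 sqmod_normc normc1 expr1n.
have d1 : 1 <= l2_norm d.
  rewrite -(@ler_pXn2r _ 2)// ?nnegrE ?l2_norm_ge0//; apply: le_trans (l2_ge 1%N ld).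
  by rewrite /nsq big_ord1 d0 sqmod_normc normc1 expr1n.
have dp : 0 < l2_norm d by apply: lt_le_trans d1.
split.
  apply: (@le_trans _ _ (l2_norm d)%:E); first by rewrite lee_fin.
  by apply: ereal_sup_ubound; exists c, d.
pose s := (l2_norm d)^-1; have s0 : 0 < s by rewrite invr_gt0.
have Hs := H s; have [lsc lsd _] := Hs.
have sd1 : l2_norm (fun k => s%:C * d k) <= 1.
  rewrite -(@ler_pXn2r _ 2)// ?nnegrE ?l2_norm_ge0// expr1n.
  apply: (@l2_le _ _ 1 _).2 => N; rewrite nsqZ.
  have -> : 1 = s ^+ 2 * l2_norm d ^+ 2 by rewrite -exprMn mulVf ?expr1n// gt_eqF.
  by rewrite ler_wpM2l ?sqr_ge0// l2_ge.
clearbody c d.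
apply: (@lt_le_trans _ _ s%:E); first by rewrite lte_fin.
apply: (@le_trans _ _ (l2_norm (fun k => s%:C * c k))%:E).
  rewrite lee_fin -(@ler_pXn2r _ 2)// ?nnegrE ?l2_norm_ge0 ?(ltW s0)//; apply: le_trans (l2_ge 1%N lsc).
  by rewrite nsqZ /nsq big_ord1 c0 sqmod_normc normc1 expr1n mulr1.
by apply: ereal_sup_ubound; exists (fun k => s%:C * d k), (fun k => s%:C * c k); split.
Qed.

(* Points at mutual distance at least [2 r] have distinct [lam k] within [r]. *)
Lemma spaced_points_bound (lam : nat -> R[i]) (lam0 : R[i]) (rho r Z : R) : 0 < rho -> 0 < r -> 2 * r <= rho ->
  (forall l, normc (l - lam0) <= rho -> exists k, normc (lam k - l) < r) ->
  (forall (K : pred nat) n, (forall k, (k < n)%N -> K k -> normc (lam k) <= normc lam0 + 2 * rho) ->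
     \sum_(k < n) (K k)%:R <= Z) -> rho / (2 * r) <= Z.
Proof.
move=> rho0 r0 rr hn hc.
have x1 : 1 <= rho / (2 * r) by rewrite ler_pdivlMr ?mul1r//; pos.
pose N := Num.truncn (rho / (2 * r)).
have [N1 N2] : N%:R <= rho / (2 * r) /\ rho / (2 * r) < N.+1%:R.
  have := @Num.Theory.truncn_itv R (rho / (2 * r)); rewrite -/N => /(_ (le_trans ler01 x1)) /andP[-> ->] //.
have Np : (0 < N)%N by have := le_lt_trans x1 N2; rewrite (ltr_nat R 1).
have Nr : 0 < N%:R :> R by rewrite ltr0n.
pose p (j : nat) := lam0 + (rho * j%:R / N%:R)%:C.
have hp (j : nat) : (j < N.+1)%N -> exists k, normc (lam k - p j) < r.
  move=> jN; apply: hn; rewrite /p addrAC subrr add0r normcr ger0_norm; last by pos.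
  by rewrite ler_pdivrMr// ler_pM2l// ler_nat.
have /choice[kk hkk] : forall j, exists k, (j < N.+1)%N -> normc (lam k - p j) < r.
  by move=> j; case: (ltnP j N.+1) => [/hp[k hk]|_]; [exists k|exists 0%N].
pose s := [seq kk j | j <- iota 0 N.+1].
have us : uniq s.
  rewrite map_inj_in_uniq ?iota_uniq// => i j; rewrite !mem_iota !add0n => /andP[_ iN] /andP[_ jN] E.
  apply/eqP; apply: contraT => ij.
  have h1 := hkk _ iN; have h2 := hkk _ jN; rewrite E in h1.
  have : normc (p i - p j) < 2 * r.
    have -> : p i - p j = (lam (kk j) - p j) - (lam (kk j) - p i) by ring.
    apply: (le_lt_trans (normcB _ _)); flra.
  have -> : p i - p j = (rho / N%:R * (i%:R - j%:R))%:C.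
    by rewrite /p; apply: complexP; rewrite !ReImE /=; ring.
  rewrite normcr normrM gtr0_norm; last by pos.
  have : 1 <= `|i%:R - j%:R : R|.
    have [h|h|/eqP] := ltngtP i j; last by rewrite (negbTE ij).
      rewrite ltr0_norm ?subr_lt0 ?ltr_nat// opprB; have : i.+1%:R <= j%:R :> R by rewrite ler_nat.
      by rewrite -natr1; flra.
    rewrite gtr0_norm ?subr_gt0 ?ltr_nat//; have : j.+1%:R <= i%:R :> R by rewrite ler_nat.
    by rewrite -natr1; flra.
  have rN : 2 * r <= rho / N%:R.
    by move: N1; rewrite ler_pdivlMr ?ler_pdivlMr// 1?mulrC//; pos.
  have q0 : 0 < rho / N%:R by pos.
  move=> k1 k2; have : rho / N%:R * 1 <= rho / N%:R * `|i%:R - j%:R| by rewrite ler_pM2l.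
  flra.
have big k : k \in s -> (k < (\max_(j <- s) j).+1)%N.
  by move=> ks; rewrite ltnS; exact: (leq_bigmax_seq (F := id)).
have hK k : (k < (\max_(j <- s) j).+1)%N -> k \in s -> normc (lam k) <= normc lam0 + 2 * rho.
  move=> _ /mapP[j]; rewrite mem_iota add0n => /andP[_ jN] ->.
  have h1 := hkk _ jN; have -> : lam (kk j) = (lam (kk j) - p j) + p j by ring.
  apply: (le_trans (le_normcD _ _)); have : normc (p j) <= normc lam0 + rho.
    apply: (le_trans (le_normcD _ _)); rewrite lerD2l normcr ger0_norm; last by pos.
    by rewrite ler_pdivrMr// ler_pM2l// ler_nat.
  flra.
have := count_mem_ge us big; rewrite size_map size_iota => h1.
by apply: (le_trans (ltW N2)); apply: (le_trans h1); exact: hc hK.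
Qed.

Lemma mule_ge_fin (a b : \bar R) (P : R) : (1 <= a)%E -> (0 < b)%E ->
  (forall A B : R, 1 <= A -> 0 < B -> a = A%:E -> b = B%:E -> P <= A * B) -> (P%:E <= a * b)%E.
Proof.
move=> a1 b0 h; have a0 : (0 < a)%E by apply: lt_le_trans a1; rewrite lte_fin.
case: a a1 a0 h => [A| |] // a1 a0 h; last by rewrite gt0_mulye// leey.
case: b b0 h => [B| |] // b0 h; last by rewrite gt0_muley// leey.
by rewrite -EFinM lee_fin; apply: h; rewrite -?lee_fin -?lte_fin.
Qed.

Lemma Riesz_growth (alpha : R) : alpha != 0 -> exists eta eps1 : R, 0 < eta /\ 0 < eps1 /\
  forall eps, 0 < eps -> eps < eps1 -> forall Y : nat -> R -> R[i]^o,
    normed_eigenfunctions q alpha eps Y -> Riesz_basis Y -> ((expR (eta / eps))%:E <= Riesz_constant Y)%E.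
Proof.
move=> a0.
(* A sample point of the semistrip, at depth 1 below the midpoint of its upper edge. *)
pose lamS : R[i] := Complex ((q (-1) + q 1) / 2) (-1).
have hPi : Pi_of q lamS.
  by have := AM_lt AM => q11; rewrite /Pi_of /semistrip /=; split; [apply/andP; split|]; lra.
have [rho [tau [e0 [[rho0 tau0 e00] hq]]]] := quasimode AM a0 hPi.
have [C C0 hC] := OSw_point AM alpha.
pose L := normc lamS + 2 * rho; have L0 : 0 <= L by have := normc_ge0 lamS => ?; rewrite /L; pos.
pose C4 := 10 / rho * (4 * C * (1 + L ^+ 2) + 1).
have C40 : 0 < C4 by rewrite /C4; pos.
have tau2 : 0 < tau / 2 by pos.
have C4V : 0 < C4^-1 by pos.
have [e2 e20 hexp] := poly_exp 4 C4V tau2.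
exists (tau / 6), (Num.min 1 (Num.min e0 e2)); split; first by pos.
split; first by rewrite !lt_min ltr01 e00.
move=> eps eps0; rewrite !lt_min => /and3P[eps1 epse0 epse2] Y nY RY.
have [lam [Y1 [Y2 [U1 [V1 hY]]]]] := eigen_data AM nY.
have Y_1 k : W1_norm (Y k) = 1 by case: (nY k).
have YWk k : W1 (Y k) := YW hY k.
have [gA1 gB0] := gram_norms YWk Y_1 RY.
apply: (mule_ge_fin gA1 gB0) => A B {}gA1 {}gB0 EA EB.
have gA0 : 0 < A by apply: lt_le_trans gA1.
have [_ dense [m [M [m0 hM]]]] := RY.
have hupM n c : W1_norm (lin_comb Y n c) ^+ 2 <= M * nsq n c by case/andP: (hM n c).
have hlowm n c : m * nsq n c <= W1_norm (lin_comb Y n c) ^+ 2 by case/andP: (hM n c).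
have M0 : 0 <= M.
  have := hupM 1%N (fun=> 1); rewrite /nsq big_ord1 sqmod_normc normc1 expr1n mulr1.
  exact: le_trans (sqr_ge0 _).
have hup n c := frame_up YWk M0 hupM n c (ltW gA0) EA.
have hlow n c := frame_low YWk M0 hupM n c (ltW gA0) (ltW gB0) m0 hlowm EA EB.
pose D := B ^+ 2 * A; have D0 : 0 < D by rewrite /D; pos.
have D1 : 1 <= D.
  have := hlow 1%N (fun=> 1); rewrite /nsq big_ord1 sqmod_normc normc1 expr1n.
  have -> : lin_comb Y 1 (fun=> 1) = Y 0%N.
    by apply/funext => x; rewrite /lin_comb big_ord1 mul1r.
  by rewrite Y_1 expr1n mulr1.
pose P := A * B; have P0 : 0 < P by rewrite /P; pos.
(* Both frame constants are expressed through [P = A * B]: the product [A * D] is [P ^+ 2], and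
   [D >= 1]. *)
have PA : A <= P ^+ 2.
  have -> : P ^+ 2 = A * D by rewrite /P /D; ring.
  by rewrite ler_peMr// ltW.
pose X := expR (tau / eps); have X0 : 0 < X by exact: expR_gt0.
(* [near_eigenvalue] needs [16 * (A * D) = 16 * P ^+ 2] below [r ^+ 2 * X ^+ 2], which is
   [25 * P ^+ 2] for this radius. *)
pose r := 5 * P / X; have r0 : 0 < r by rewrite /r; pos.
have rX : 16 * (A * D) < r ^+ 2 * X ^+ 2.
  have -> : r ^+ 2 * X ^+ 2 = 25 * P ^+ 2 by rewrite /r; field; rewrite gt_eqF.
  have -> : A * D = P ^+ 2 by rewrite /P /D; ring.
  have : 0 < P ^+ 2 by pos.
  by move: (P ^+ 2) => *; flra.
have near l : normc (l - lamS) <= rho -> exists k, normc (lam k - l) < r.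
  move=> /(hq eps l eps0 epse0)[y [f [hS hf hy]]].
  exact: (near_eigenvalue AM hY Y_1 gA0 D0 hup hlow a0 eps0 dense hS hf X0 hy r0 rX).
have e4 : 0 < eps ^+ 4 by pos.
have e41 : eps ^+ 4 <= 1 by rewrite expr_le1// ltW.
have P1 : 1 <= P ^+ 2 by apply: le_trans gA1 PA.
pose C3 := 4 * C * (1 + L ^+ 2); have C30 : 0 < C3 by rewrite /C3; pos.
(* [rho / (2 * r)] well separated points each attract an eigenvalue, while [eigen_count] admits at
   most a multiple of [P ^+ 2 / eps ^+ 4] of them. If [2 * r > rho], the comparison is trivial
   because [P >= 1] and [eps < 1]. *)
have main : eps ^+ 4 * X <= C4 * P ^+ 3.
  have Z : rho / (2 * r) <= (C3 + 1) * P ^+ 2 / eps ^+ 4.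
    have [rr|rr] := leP (2 * r) rho.
      apply: (spaced_points_bound rho0 r0 rr near) => K n hK.
      have := eigen_count AM hY Y_1 gA0 hup eps0 eps1 C0 L0 (fun y y1 y2 u1 w w1 H => hC eps y y1 y2 u1 w w1 eps0 eps1 H) hK.
      rewrite -/C3 ler_pdivlMr// mulrC => h; apply: (le_trans h).
      have : C3 * A <= C3 * P ^+ 2 by rewrite ler_pM2l.
      have : 0 <= P ^+ 2 by pos.
      by move=> p2 le; rewrite mulrDl mul1r; apply: (le_trans le); rewrite lerDl.
    apply: (@le_trans _ _ 1); first by rewrite ler_pdivrMr ?mul1r ?ltW//; pos.
    rewrite ler_pdivlMr// mul1r; apply: (le_trans e41); apply: (le_trans P1).
    by rewrite mulrDl mul1r lerDr; pos.
  have E : rho / (2 * r) = rho * X / (10 * P) by rewrite /r; field; rewrite !gt_eqF.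
  rewrite E ler_pdivrMr ?mulr_gt0// in Z.
  have -> : C4 * P ^+ 3 = ((C3 + 1) * P ^+ 2 / eps ^+ 4 * (10 * P)) * (eps ^+ 4 / rho).
    by rewrite /C4 -/C3; field; rewrite !gt_eqF.
  have -> : eps ^+ 4 * X = rho * X * (eps ^+ 4 / rho) by field; rewrite gt_eqF.
  by rewrite ler_pM2r//; pos.
have k := hexp eps eps0 epse2.
pose T := expR (tau / 2 / eps); have T0 : 0 < T by exact: expR_gt0.
have XT : X = T * T by rewrite /X /T -expRD; congr expR; field; rewrite gt_eqF.
(* One factor [T] of [X = T * T] absorbs [C4] and [eps ^+ 4]; the cube root of the other leaves the
   exponent [tau / 6]. *)
have hT : T <= P ^+ 3.
  rewrite -(ler_pM2l C40); apply: le_trans main; rewrite XT mulrA ler_pM2r//.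
  by move: k; rewrite -mulrA mulrC ler_pdivlMr// mul1r.
rewrite -(@ler_pXn2r _ 3)// ?nnegrE ?expR_ge0//; last exact: ltW.
have -> : expR (tau / 6 / eps) ^+ 3 = T by rewrite /T -expRM_natl; congr expR; field; rewrite gt_eqF.
exact: hT.
Qed.

End Main.

Theorem theorem5 (R : realType) (alpha : R) (q : R -> R)
    (G : set R[i]^o) (qC : R[i]^o -> R[i]^o) :
  AM_continuation q G qC ->
  (forall K : set R[i]^o, compact K -> K `<=` Omega q G qC ->
     exists tau eps0 : R, 0 < tau /\ 0 < eps0 /\
       forall Rey eps : R, 0 < alpha * Rey ->
         eps = (alpha * Rey) `^ (- 2^-1) -> eps < eps0 ->
         forall lambda : R[i]^o, K lambda ->
           ((expR (tau / eps))%:E <= OS_resolvent_norm q alpha eps lambda)%E)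
  /\
  (exists eta eps1 : R, 0 < eta /\ 0 < eps1 /\
     forall Rey eps : R, 0 < alpha * Rey ->
       eps = (alpha * Rey) `^ (- 2^-1) -> eps < eps1 ->
       forall Y : nat -> R -> R[i]^o,
         OS_no_associated q alpha eps ->
         normed_eigenfunctions q alpha eps Y ->
         Riesz_basis Y ->
         ((expR (eta / eps))%:E <= Riesz_constant Y)%E).
Proof.
(* For [alpha = 0] no Reynolds number satisfies [0 < alpha * Rey] and both claims are vacuous;
   [green] and the far resolvent need [alpha != 0]. *)
move=> AM; have [a0|a0] := eqVneq alpha 0.
  have no (Rey : R) : ~ (0 < alpha * Rey) by rewrite a0 mul0r ltxx.
  split; first by move=> K _ _; exists 1, 1; split=> //; split=> // Rey eps /no.
  by exists 1, 1; split=> //; split=> // Rey eps /no.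
have epsP (Rey eps : R) : 0 < alpha * Rey -> eps = (alpha * Rey) `^ (- 2^-1) -> 0 < eps.
  by move=> h ->; exact: powR_gt0.
split=> [K cK KO|].
  have [e e0 he] := resolvent_growth AM a0 cK (subset_trans KO (@Omega_sub R q G qC (AM_lt AM))).
  exists e, e; split=> //; split=> // Rey eps h1 h2 h3 lambda Kl.
  exact: he (epsP _ _ h1 h2) h3 Kl.
have [eta [eps1 [eta0 [eps10 h]]]] := Riesz_growth AM a0.
exists eta, eps1; split=> //; split=> // Rey eps h1 h2 h3 Y _ nY RY.
exact: h (epsP _ _ h1 h2) h3 Y nY RY.
Qed.
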